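(* Let $(\Omega,\mu)$ be a measure space, $1<p<\infty$, and let $T\colon L^p(\Omega)\to L^p(\Omega)$ be an analytic contractively regular operator. (1) There exist an angle $\gamma\in(0,\pi/2)$ and a constant $C\ge1$ such that for every sequence $(F_n)_{n\ge1}$ of complex polynomials and every $x\in L^p(\Omega)$, $$\Big\|\Big(\sum_{n=1}^\infty|F_n(T)x|^2\Big)^{1/2}\Big\|_p\le C\|x\|_p\sup\Big\{\Big(\sum_{n=1}^\infty|F_n(z)|^2\Big)^{1/2}: z\in B_\gamma\Big\}.$$ (2) For every integer $m\ge1$ there is a constant $C_m$ such that $$\Big\|\Big(\sum_{n=0}^\infty(n+1)^{2m-1}\big|T^n(T-I)^m x\big|^2\Big)^{1/2}\Big\|_p\le C_m\|x\|_p,\qquad x\in L^p(\Omega).$$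
   Context: An operator $T$ on $L^p(\Omega)$ is regular if there is $C\ge0$ with $\|\sup_k|T(x_k)|\|_p\le C\|\sup_k|x_k|\|_p$ for all finite sequences $(x_k)$; the least such $C$ is $\|T\|_r$, and $T$ is contractively regular if $\|T\|_r\le1$. A bounded operator $T$ is analytic if $\sup_{n\ge0}\|T^n\|<\infty$ and $\sup_{n\ge1}n\|T^n-T^{n-1}\|<\infty$. For $\gamma\in(0,\pi/2)$, the Stolz domain $B_\gamma$ is the closed convex hull of the point $1$ and the disc $\{|z|<\sin\gamma\}$. *)

(* Defs.v *)
From HB Require Import structures.
From mathcomp Require Import all_boot all_order all_algebra.
From mathcomp Require Import all_classical all_reals all_analysis.
From mathcomp Require Import complex.
Import Normc.

Set Implicit Arguments.
Unset Strict Implicit.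
Unset Printing Implicit Defensive.
Import Order.TTheory GRing.Theory Num.Theory.

Local Open Scope classical_set_scope.
Local Open Scope ring_scope.

Section LpDefs.
Context {d : measure_display} {Omega : measurableType d} {R : realType}.
Variable mu : {measure set Omega -> \bar R}.

Definition cfun := Omega -> R[i].

Definition cabs (f : cfun) : Omega -> R := fun w => normc (f w).

Definition cLnorm (p : R) (f : cfun) : \bar R :=
  Lnorm mu p%:E (EFin \o cabs f).

Definition inLp (p : R) (f : cfun) : Prop :=
  measurable_fun setT (fun w => complex.Re (f w)) /\
  measurable_fun setT (fun w => complex.Im (f w)) /\
  (cLnorm p f < +oo)%E.

Definition ae_eqC (f g : cfun) : Prop := ae_eq mu setT f g.

(* T acts on representatives; it is a bounded linear operator on L^p
   (elements of L^p = a.e.-classes of functions in inLp). *)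
Definition bounded_operator_Lp (p : R) (T : cfun -> cfun) : Prop :=
  (forall x, inLp p x -> inLp p (T x)) /\
  (forall x y, inLp p x -> inLp p y -> ae_eqC x y -> ae_eqC (T x) (T y)) /\
  (forall (a : R[i]) x y, inLp p x -> inLp p y ->
      ae_eqC (T (fun w => a * x w + y w)) (fun w => a * T x w + T y w)) /\
  (exists c : R, forall x, inLp p x -> (cLnorm p (T x) <= c%:E * cLnorm p x)%E).

Definition regular_with (p : R) (T : cfun -> cfun) (C : R) : Prop :=
  forall s : seq cfun, (forall x, x \in s -> inLp p x) ->
    (Lnorm mu p%:E (fun w => (\big[Num.max/0]_(x <- s) normc (T x w))%:E)
     <= C%:E * Lnorm mu p%:E (fun w => (\big[Num.max/0]_(x <- s) normc (x w))%:E))%E.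

Definition contractively_regular (p : R) (T : cfun -> cfun) : Prop :=
  regular_with p T 1.

Definition opow (T : cfun -> cfun) (n : nat) : cfun -> cfun := iter n T.

Definition analytic_operator (p : R) (T : cfun -> cfun) : Prop :=
  bounded_operator_Lp p T /\
  (exists K : R, forall n x, inLp p x ->
      (cLnorm p (opow T n x) <= K%:E * cLnorm p x)%E) /\
  (exists K : R, forall n x, (1 <= n)%N -> inLp p x ->
      (n%:R%:E * cLnorm p (fun w => (opow T n x w - opow T n.-1 x w)%R)
        <= K%:E * cLnorm p x)%E).

Definition polyT (F : {poly R[i]}) (T : cfun -> cfun) (x : cfun) : cfun :=
  fun w => \sum_(i < size F) F`_i * opow T i x w.

End LpDefs.

Section Stolz.
Context {R : realType}.

Definition convexC (A : set R[i]) : Prop :=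
  forall a b (t : R), A a -> A b -> 0 <= t <= 1 ->
    A (((1 - t)%:C)%C * a + (t%:C)%C * b).

Definition closedC (A : set R[i]) : Prop :=
  forall z, (forall e : R, 0 < e -> exists2 y, A y & normc (z - y) < e) -> A z.

Definition closed_convex_hullC (A : set R[i]) : set R[i] :=
  [set z | forall K, A `<=` K -> convexC K -> closedC K -> K z].

Definition Stolz (gamma : R) : set R[i] :=
  closed_convex_hullC ([set 1] `|` [set z | normc z < sin gamma]).

End Stolz.

(* Main.v *)
(** Write u_k = z^(2^k), a_k = 2^-k (1 + z + ... + z^(2^k - 1)), R_k = a_k^3 (1 - u_k)^2 and
    m_k(z) = (2^k (1 - z))^6 ((1 + u_k)^10 - 1).  Telescoping 1 - (1 - u_k)^10 gives
      F = F (1 - z)^10 + sum_(k < K) R_k (F m_k) R_k + F (1 - (1 - u_K)^10).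
    For z = T the last term tends to F(1) (1 - (1 - T^(2^K))^10), because (1 - T) T^n -> 0 in norm, and
    the R_k satisfy a square function estimate and its dual.  For the shift on Z/2^K the polynomial
    a_k^2 (1 - u_k)^2 is, up to a factor and a shift, a difference of consecutive Fejer averages, which are
    translation averages of dyadic conditional expectations, so there the estimates come from Doob's inequality
    and the martingale square function.  They pass from the shift to T by discretizing T into a matrix t and weighting paths by a
    Markov chain built from an extremal vector of |t|, which transfers any L^p(l^q)-inequality for
    polynomials of the shift.
    It remains to bound the operators (F m_k)(T) jointly in k.  Transference together with the analyticity
    of T bounds differences of resolvents along lambda (1 + 2^-j |lambda - 1|); complex interpolation between
    the decaying norm bound and the growing l^1- or l^oo-valued bound makes them summable, so that
    (lambda - 1)(lambda - T)^-1 is R-bounded outside the disc, and by a Neumann series outside a Stolz-type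
    region.  A discrete Cauchy formula over zeta (1 - c |1 - zeta|), zeta^n = 1, with the Cauchy-Schwarz
    inequality and the integrability of m_k(lambda) / (1 - lambda) over this contour, then yields (1).
    Resolvents are used only as polynomials in T that invert lambda - T up to a small error.
    For (2) take F_n = (n + 1)^(m - 1/2) z^n (z - 1)^m and |1 - z| <= C (1 - |z|) on the contour. *)

Require Import Defs.
From HB Require Import structures.
From mathcomp Require Import all_boot all_order all_algebra.
From mathcomp Require Import all_classical all_reals all_analysis.
From mathcomp Require Import complex measurable_realfun ring lra zify.
Import Normc.
Import Order.TTheory GRing.Theory Num.Theory.
Import numFieldNormedType.Exports.
Local Open Scope classical_set_scope.
Local Open Scope ring_scope.

Set Implicit Arguments.
Unset Strict Implicit.
Unset Printing Implicit Defensive.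

(** * Elementary inequalities *)

(** The exponents fit together as follows. The Fejer difference a_k^2 (1 - u_k)^2 comes with a
    translation that depends on k, and l^2-valued norms are not uniformly stable under such
    translations; the third factor a_k in R_k turns the translated value into an average, which a
    Fejer mean of level k + 2 dominates. The two factors R_k around m_k, one for the square function
    and one for its dual, then contain a_k^6 and (1 - u_k)^4. The power 6 in m_k turns a_k^6 into (1
    - u_k)^6, whence 10 in total. The sum over j in the R-boundedness argument converges only
    because the interpolation parameter is below 1/2: the decay 2^-j must outweigh the growth 2^j.
    To reach L^p(l^2) with such a parameter, l^oo serves for p <= 2 and l^1 for p > 2. The measure
    space is arbitrary, so neither duality of L^p nor a modulus of T is used. A dual estimate
    consists in testing against a power of the quantity itself and absorbing it, which is harmless
    for finite sums, and regularity of T enters transference only through finite matrices. *)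

Section FiniteInequalities.
Context {R : realType}.
Implicit Types (p s a b c : R).

Lemma powR_young a b th : 0 <= a -> 0 <= b -> 0 < th < 1 ->
  a `^ th * b `^ (1 - th) <= th * a + (1 - th) * b.
Proof.
move=> a0 b0 /andP[t0 t1].
have t1' : 0 < 1 - th by rewrite subr_gt0.
have := @conjugate_powR R (a `^ th) (b `^ (1 - th)) th^-1 (1 - th)^-1
  (powR_ge0 _ _) (powR_ge0 _ _).
rewrite !invr_gt0 !invrK => /(_ t0 t1').
rewrite -!powRrM !divff ?gt_eqF// !powRr1// mulrC (mulrC b) => H.
by move: H; rewrite addrC subrK => /(_ erefl); rewrite (mulrC a).

Qed.

Lemma powR_le p a b : 0 <= p -> 0 <= a -> a <= b -> a `^ p <= b `^ p.
Proof. by move=> p0 a0 ab; apply: ge0_ler_powR => //; rewrite nnegrE// (le_trans a0 ab). Qed.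

Lemma powR_root p a b : 0 < p -> 0 <= a -> 0 <= b -> a `^ p <= b -> a <= b `^ p^-1.
Proof.
move=> p0 a0 b0 h; have := @powR_le p^-1 _ _ _ (powR_ge0 a p) h.
by rewrite -powRrM divff ?gt_eqF// powRr1// => -> //; rewrite invr_ge0 ltW.
Qed.

(** The solution A of A^(s/p) = c D^(1 - s/p): with it the two coefficients in Young's inequality
    below multiply to exactly c. *)
Definition boot_cst p s c D : R := (c * D `^ (1 - s / p)) `^ (p / s).

Lemma boot_cst_ge0 p s c D : 0 <= boot_cst p s c D.
Proof. exact: powR_ge0. Qed.

(** Absorption in place of duality. In the applications S is the quantity to be bounded, f the data,
    and H comes from a known estimate, at the exponent p / (p - s), for a power of S; the second
    hypothesis leads back to S. Young's inequality with weights s/p and 1 - s/p leaves the share 1 -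
    s/p of the sum of S^p on the right, which is moved to the left. *)
Lemma bootstrap (I : Type) (r : seq I) (S f H : I -> R) p s c D :
  0 < s < p -> 0 < c -> 0 < D ->
  (forall i, 0 <= S i) -> (forall i, 0 <= f i) -> (forall i, 0 <= H i) ->
  \sum_(i <- r) S i `^ p <= c * \sum_(i <- r) f i `^ s * H i ->
  \sum_(i <- r) H i `^ (p / (p - s)) <= D * \sum_(i <- r) S i `^ p ->
  \sum_(i <- r) S i `^ p <= boot_cst p s c D * \sum_(i <- r) f i `^ p.
Proof.
move=> /andP[s0 sp] c0 D0 S0 f0 H0 h1 h2.
have p0 : 0 < p by exact: lt_trans sp.
have ps0 : 0 < p - s by rewrite subr_gt0.
set th := s / p.
have th01 : 0 < th < 1 by rewrite divr_gt0//= ltr_pdivrMr// mul1r.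
have thE : 1 - th = (p - s) / p by rewrite /th; field; rewrite gt_eqF.
set A := boot_cst p s c D.
have key i : c * (f i `^ s * H i) <= th * (A * f i `^ p) + (1 - th) * (D^-1 * H i `^ (p / (p - s))).
  apply: le_trans (powR_young _ _ th01); last 2 first.
  - by rewrite mulr_ge0 ?boot_cst_ge0 ?powR_ge0.
  - by rewrite mulr_ge0 ?powR_ge0 ?invr_ge0 ?ltW.
  rewrite !powRM ?boot_cst_ge0 ?powR_ge0 ?invr_ge0 ?(ltW D0)//.
  rewrite /A /boot_cst -!powRrM.
  have -> : p * th = s by rewrite /th; field; rewrite gt_eqF.
  have -> : p / s * th = 1 by rewrite /th; field; rewrite !gt_eqF.
  have -> : p / (p - s) * (1 - th) = 1.
    by rewrite thE; field; rewrite !gt_eqF.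
  rewrite powRr1 ?mulr_ge0 ?powR_ge0 ?(ltW c0)// powRr1//.
  rewrite -/th -powR_inv1 ?(ltW D0)// -powRrM mulN1r powRN.
  have D' : D `^ (1 - th) != 0 by rewrite gt_eqF// powR_gt0.
  by rewrite le_eqVlt; apply/orP; left; apply/eqP; field.
have t0 : 0 < th by case/andP: th01.
have t1 : 0 < 1 - th by rewrite subr_gt0; case/andP: th01.
have : \sum_(i <- r) S i `^ p <= th * (A * \sum_(i <- r) f i `^ p) + (1 - th) * \sum_(i <- r) S i `^ p.
  apply: le_trans h1 _; rewrite mulr_sumr.
  apply: le_trans (ler_sum _ (fun i _ => key i)) _.
  rewrite big_split /= -!mulr_sumr lerD2l ler_wpM2l ?(ltW t1)//.
  by rewrite ler_pdivrMl.
rewrite -lerBlDr -{1}(mul1r (\sum_(i <- r) S i `^ p)) -mulrBl opprB addrC subrK.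
by rewrite ler_pM2l.
Qed.

(** Young's inequality for each g i against M^(p - 1), M being the mean. Total mass below 1 is
    enough, since the mass only multiplies M^p. *)
Lemma jensen_powR (I : Type) (r : seq I) (w g : I -> R) p : 1 <= p ->
  (forall i, 0 <= w i) -> (forall i, 0 <= g i) -> \sum_(i <- r) w i <= 1 ->
  (\sum_(i <- r) w i * g i) `^ p <= \sum_(i <- r) w i * g i `^ p.
Proof.
rewrite le_eqVlt => /predU1P[<-|p1] w0 g0 w1.
  rewrite powRr1; last by apply: sumr_ge0 => i _; rewrite mulr_ge0.
  by apply: ler_sum => i _; rewrite powRr1.
have p0 : 0 < p by apply: lt_trans p1.
set M := \sum_(i <- r) w i * g i.
have M0 : 0 <= M by apply: sumr_ge0 => i _; rewrite mulr_ge0.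
have th01 : 0 < p^-1 < 1 by rewrite invr_gt0 p0 invf_lt1.
have key i : w i * g i * M `^ (p - 1) <= p^-1 * (w i * g i `^ p) + (1 - p^-1) * (w i * M `^ p).
  rewrite -mulrA !(mulrCA _ (w i)) -mulrDr ler_wpM2l//.
  apply: le_trans (powR_young (powR_ge0 _ _) (powR_ge0 _ _) th01).
  rewrite -!powRrM divff ?gt_eqF// powRr1//.
  by rewrite mulrBr divff ?gt_eqF// mulr1.
have : M `^ p <= p^-1 * (\sum_(i <- r) w i * g i `^ p) + (1 - p^-1) * M `^ p.
  apply: (@le_trans _ _ (\sum_(i <- r) w i * g i * M `^ (p - 1))).
    by rewrite -mulr_suml -/M mulr_powRB1.
  apply: le_trans (ler_sum _ (fun i _ => key i)) _.
  rewrite big_split /= -!mulr_sumr lerD2l ler_wpM2l//.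
    by rewrite subr_ge0 ltW//; case/andP: th01.
  by rewrite -mulr_suml ler_piMl ?powR_ge0.
rewrite -lerBlDr -{1}(mul1r (M `^ p)) -mulrBl opprB addrC subrK.
by rewrite ler_pM2l ?invr_gt0.
Qed.

Definition enorm (I : Type) (r : seq I) (v : I -> R) : R :=
  Num.sqrt (\sum_(j <- r) v j ^+ 2).

Lemma sumsq_ge0 (I : Type) (r : seq I) (v : I -> R) : 0 <= \sum_(j <- r) v j ^+ 2.
Proof. by apply: sumr_ge0 => j _; rewrite sqr_ge0. Qed.

Lemma enorm_ge0 (I : Type) (r : seq I) (v : I -> R) : 0 <= enorm r v.
Proof. exact: sqrtr_ge0. Qed.

Lemma sqr_enorm (I : Type) (r : seq I) (v : I -> R) : enorm r v ^+ 2 = \sum_(j <- r) v j ^+ 2.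
Proof. by rewrite sqr_sqrtr// sumsq_ge0. Qed.

Lemma cauchy_schwarz (I : Type) (r : seq I) (a b : I -> R) :
  \sum_(j <- r) a j * b j <= enorm r a * enorm r b.
Proof.
set A := enorm r a; set B := enorm r b.
have A0 : 0 <= A by exact: enorm_ge0.
have B0 : 0 <= B by exact: enorm_ge0.
have [AB|AB] := eqVneq (A * B) 0; last first.
  have AB0 : 0 < A * B by rewrite lt_neqAle eq_sym AB mulr_ge0.
  have := sumsq_ge0 r (fun j => B * a j - A * b j).
  under eq_bigr do rewrite sqrrB !exprMn.
  rewrite big_split /= sumrB -!mulr_sumr -!sqr_enorm -/A -/B.
  rewrite (eq_bigr (fun i => 2 * (A * B) * (a i * b i))); last by move=> i _; ring.
  rewrite -mulr_sumr => h.
  rewrite -(ler_pM2l AB0).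
  by move: h; set X := \sum_(_ <- _) _; nra.
have hs (v : I -> R) : enorm r v = 0 -> forall w : I -> R, \sum_(j <- r) v j * w j = 0.
  move=> v0 w; have: \sum_(j <- r) v j ^+ 2 = 0 by rewrite -sqr_enorm v0 expr0n.
  elim: r {A B A0 B0 AB v0} => [|x r IH]; first by rewrite !big_nil.
  rewrite !big_cons => /eqP; rewrite paddr_eq0 ?sqr_ge0 ?sumsq_ge0//.
  by rewrite sqrf_eq0 => /andP[/eqP -> /eqP/IH ->]; rewrite mul0r addr0.
rewrite AB; move/eqP: AB; rewrite mulf_eq0 => /orP[] /eqP z.
  by rewrite (hs a).
by under eq_bigr do rewrite mulrC; rewrite (hs b).
Qed.

Lemma le_enorm (I : Type) (r : seq I) (a b : I -> R) :
  (forall j, `|a j| <= b j) -> enorm r a <= enorm r b.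
Proof.
move=> h; apply: ler_wsqrtr; apply: ler_sum => j _.
by rewrite -real_normK ?num_real// lerXn2r ?nnegrE// (le_trans _ (h j)).
Qed.

Lemma enormD (I : Type) (r : seq I) (a b : I -> R) :
  enorm r (fun j => a j + b j) <= enorm r a + enorm r b.
Proof.
rewrite -(ler_pXn2r (n := 2))// ?nnegrE ?addr_ge0 ?enorm_ge0//.
rewrite sqrrD !sqr_enorm.
under eq_bigr do rewrite sqrrD -mulr_natr.
rewrite !big_split /= -mulr_suml.
have := cauchy_schwarz r a b; lra.
Qed.

Lemma enormZ (I : Type) (r : seq I) (c : R) (a : I -> R) :
  enorm r (fun j => c * a j) = `|c| * enorm r a.
Proof.
rewrite /enorm; under eq_bigr do rewrite exprMn.
by rewrite -mulr_sumr sqrtrM ?sqr_ge0// sqrtr_sqr.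
Qed.

Lemma enorm0 (I : Type) (r : seq I) : enorm r (fun _ => 0) = 0.
Proof. by rewrite /enorm big1 ?sqrtr0// => j _; rewrite expr0n. Qed.

Lemma eq_enorm (I : Type) (r : seq I) (a b : I -> R) : a =1 b -> enorm r a = enorm r b.
Proof. by move=> h; rewrite /enorm; under eq_bigr do rewrite h. Qed.

Lemma enorm_sum (I J : Type) (r : seq I) (s : seq J) (w : J -> R) (v : J -> I -> R) :
  enorm r (fun i => \sum_(j <- s) w j * v j i) <= \sum_(j <- s) `|w j| * enorm r (v j).
Proof.
elim: s => [|x s IH].
  by rewrite big_nil (eq_enorm _ (b := fun=> 0)) ?enorm0// => i; rewrite big_nil.
rewrite big_cons (eq_enorm _ (b := fun i => w x * v x i + \sum_(j <- s) w j * v j i)).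
  by apply: le_trans (enormD _ _ _) _; rewrite enormZ lerD2l.
by move=> i; rewrite big_cons.
Qed.

End FiniteInequalities.

(** * Dyadic martingales *)

Section DyadicMartingale.
Context {R : realType}.
Implicit Types (f g h : nat -> R) (k l K s : nat).

Lemma sum_blocks (F : nat -> R) m n :
  \sum_(0 <= s < m * n) F s = \sum_(0 <= c < m) \sum_(0 <= i < n) F (c * n + i)%N.
Proof.
elim: m => [|m IH]; first by rewrite mul0n !big_geq.
rewrite big_nat_recr//= -IH mulSn addnC.
rewrite (big_cat_nat (n := m * n)) ?leq_addr//=; congr (_ + _).
by rewrite -{1}(add0n (m * n)%N) [(m * n + n)%N]addnC big_addn addnK; under eq_bigr do rewrite addnC.
Qed.

(** The conditional expectation on the dyadic blocks of length 2^k. Blocks grow with k, so the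
    filtration runs backwards: level 0 is the finest, and [block_fun k] is measurability at level
    k. *)
Definition avg k f s : R :=
  (2 ^+ k)^-1 * \sum_(0 <= i < 2 ^ k) f (s %/ 2 ^ k * 2 ^ k + i)%N.

Definition block_fun k f := forall s s', (s %/ 2 ^ k = s' %/ 2 ^ k)%N -> f s = f s'.

Lemma block_avg k f : block_fun k (avg k f).
Proof. by move=> s s' e; rewrite /avg e. Qed.

Lemma blockS k l f : (k <= l)%N -> block_fun l f -> block_fun k f.
Proof.
move=> kl h s s' e; apply: h.
by rewrite -(subnKC kl) expnD !divnMA e.
Qed.

Lemma avg0 f : avg 0 f =1 f.
Proof. by move=> s; rewrite /avg expn0 big_nat1 invr1 mul1r divn1 muln1 addn0. Qed.

Lemma avg_ge0 k f s : (forall i, 0 <= f i) -> 0 <= avg k f s.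
Proof. by move=> f0; rewrite mulr_ge0 ?invr_ge0 ?exprn_ge0// sumr_ge0. Qed.

Lemma block_index k s i : (i < 2 ^ k)%N -> ((s %/ 2 ^ k * 2 ^ k + i) %/ 2 ^ k = s %/ 2 ^ k)%N.
Proof. by move=> ik; rewrite divnMDl ?expn_gt0// (divn_small ik) addn0. Qed.

Lemma avgM k f g s : block_fun k g -> avg k (fun i => f i * g i) s = avg k f s * g s.
Proof.
move=> kg; rewrite /avg -mulrA mulr_suml; congr (_ * _).
rewrite big_nat [RHS]big_nat; apply: eq_bigr => i /andP[_ ik].
by rewrite (kg _ s)// block_index.
Qed.

Lemma sum_avg k K f : (k <= K)%N ->
  \sum_(0 <= s < 2 ^ K) avg k f s = \sum_(0 <= s < 2 ^ K) f s.
Proof.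
move=> kK; rewrite -(subnK kK) expnD !sum_blocks; apply: eq_bigr => c _.
rewrite (eq_big_nat _ _ (F2 := fun=> avg k f (c * 2 ^ k)%N)).
  rewrite big_const_nat subn0 iter_addr addr0 /avg mulnK ?expn_gt0//.
  by rewrite -[LHS]mulr_natl natrX mulrA divff ?mul1r// expf_neq0.
move=> i /andP[_ ik]; apply: block_avg.
by rewrite mulnK ?expn_gt0// divnMDl ?expn_gt0// (divn_small ik) addn0.
Qed.

Lemma avg_avg k l f s : (k <= l)%N -> avg l (avg k f) s = avg l f s.
Proof.
move=> kl; rewrite /avg; congr (_ * _).
set c := (s %/ 2 ^ l * 2 ^ l)%N.
rewrite -(sum_avg (fun i => f (c + i)%N) kl); apply: eq_bigr => i _.
congr (_ * _); apply: eq_bigr => j _; congr f.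
rewrite addnA; congr (_ + _)%N.
have -> : c = (s %/ 2 ^ l * 2 ^ (l - k) * 2 ^ k)%N by rewrite -mulnA -expnD subnK.
by rewrite divnMDl ?expn_gt0// mulnDl.
Qed.

Lemma sum_avgM k K f g : (k <= K)%N -> block_fun k g ->
  \sum_(0 <= s < 2 ^ K) avg k f s * g s = \sum_(0 <= s < 2 ^ K) f s * g s.
Proof.
move=> kK kg; rewrite -(sum_avg (fun i => f i * g i) kK).
by apply: eq_bigr => s _; rewrite avgM.
Qed.

(** Regularity of the dyadic filtration: a block is half of its parent. It allows a weight of level
    k to be replaced by a weight of the coarser level k + 1, against which martingale differences
    are orthogonal. *)
Lemma avg_doubling k f s : (forall i, 0 <= f i) -> avg k f s <= 2 * avg k.+1 f s.
Proof.
move=> f0; rewrite -(@avg_avg k k.+1)// /(avg k.+1) exprS invfM.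
rewrite mulrA mulrA divff ?mul1r ?pnatr_eq0//.
rewrite expnS sum_blocks big_nat_recr//= big_nat1.
set F := (X in _ * (X + _)); set G := (X in _ * (_ + X)).
have F0 : 0 <= F by apply: sumr_ge0 => i _; apply: avg_ge0.
have G0 : 0 <= G by apply: sumr_ge0 => i _; apply: avg_ge0.
rewrite ler_pdivlMl ?exprn_gt0//.
have cst c : \sum_(0 <= i < 2 ^ k) avg k f (s %/ (2 * 2 ^ k) * (2 * 2 ^ k) + (c * 2 ^ k + i))%N
    = 2 ^+ k * avg k f (s %/ (2 * 2 ^ k) * (2 * 2 ^ k) + c * 2 ^ k)%N.
  rewrite (eq_big_nat _ _ (F2 := fun=> avg k f (s %/ (2 * 2 ^ k) * (2 * 2 ^ k) + c * 2 ^ k)%N)).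
    by rewrite big_const_nat subn0 iter_addr addr0 -natrX mulr_natl.
  move=> i /andP[_ ik]; apply: block_avg.
  by rewrite !mulnA -!mulnDl addnA -mulnDl divnMDl ?expn_gt0// (divn_small ik) addn0 mulnK ?expn_gt0.
have e : (s %/ 2 ^ k = s %/ (2 * 2 ^ k) * 2 + (s %/ 2 ^ k) %% 2)%N.
  by rewrite [(2 * 2 ^ k)%N]mulnC divnMA -divn_eq.
have : ((s %/ 2 ^ k) %% 2 < 2)%N by rewrite ltn_mod.
case: ((s %/ 2 ^ k) %% 2)%N e => [|[|//]] e _.
- apply: (@le_trans _ _ F); last by rewrite lerDl.
  rewrite /F (cst 0%N) (_ : avg k f s = avg k f (s %/ (2 * 2 ^ k) * (2 * 2 ^ k) + 0 * 2 ^ k)%N)//.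
  by apply: block_avg; rewrite e mulnA -mulnDl mulnK ?expn_gt0.
- apply: (@le_trans _ _ G); last by rewrite lerDr.
  rewrite /G (cst 1%N) (_ : avg k f s = avg k f (s %/ (2 * 2 ^ k) * (2 * 2 ^ k) + 1 * 2 ^ k)%N)//.
  by apply: block_avg; rewrite e mulnA -mulnDl mulnK ?expn_gt0.
Qed.

(** [Hm K k] is the maximal function over the levels k, ..., K only. As these are coarser than k, it
    is constant on the blocks of level k, so the maximal functions of higher index can serve as
    predictable weights. *)
Fixpoint hmax n k h s : R :=
  if n is n'.+1 then Num.max (avg k h s) (hmax n' k.+1 h s) else avg k h s.
Definition Hm K k := hmax (K - k) k.

Lemma HmE K k h s : (k < K)%N -> Hm K k h s = Num.max (avg k h s) (Hm K k.+1 h s).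
Proof. by move=> kK; rewrite /Hm -subSS subSn. Qed.

Lemma HmK K h s : Hm K K h s = avg K h s.
Proof. by rewrite /Hm subnn. Qed.

Lemma avg_le_Hm K k h s : avg k h s <= Hm K k h s.
Proof. by rewrite /Hm; case: (K - k)%N => //= n; rewrite le_max lexx. Qed.

Lemma HmS K k h s : (k < K)%N -> Hm K k.+1 h s <= Hm K k h s.
Proof. by move=> kK; rewrite (HmE _ _ kK) le_max lexx orbT. Qed.

Lemma Hm_ge0 K k h s : (forall i, 0 <= h i) -> 0 <= Hm K k h s.
Proof. by move=> h0; rewrite (le_trans (avg_ge0 k s h0))// avg_le_Hm. Qed.

Lemma block_Hm K k h : block_fun k (Hm K k h).
Proof.
rewrite /Hm; move: (K - k)%N => n; elim: n k => [|n IH] {}k /=; first exact: block_avg.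
move=> s s' e; congr Num.max; first exact: block_avg.
exact: (blockS (leqnSn k) (IH k.+1)).
Qed.

Lemma Hm_le0 K k h s : (k <= K)%N -> Hm K k h s <= Hm K 0 h s.
Proof.
elim: k => // k IH kK; apply: le_trans (IH (ltnW kK)); exact: HmS.
Qed.

Lemma avg_le_Hm0 K k h s : (k <= K)%N -> avg k h s <= Hm K 0 h s.
Proof. by move=> kK; apply: le_trans (Hm_le0 _ _ kK); exact: avg_le_Hm. Qed.

Lemma Hm_doubling K k h s : (forall i, 0 <= h i) -> (k < K)%N ->
  Hm K k h s <= 2 * Hm K k.+1 h s.
Proof.
move=> h0 kK; rewrite HmE// ge_max; apply/andP; split.
  by rewrite (le_trans (avg_doubling _ _ h0))// ler_pM2l// avg_le_Hm.
by rewrite ler_peMl ?Hm_ge0// ler1n.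
Qed.

Definition doob_cst p : R := boot_cst p 1 (p / (p - 1)) 1.

(** A potential that is monotone along the levels gives the sum of M^p as at most q times the sum of
    h M^(p - 1), with M the maximal function and q = p / (p - 1). Since M^(p - 1) to the power q is
    M^p, [bootstrap] applies with s = 1 and D = 1. *)
Lemma doob p K h : 1 < p -> (forall i, 0 <= h i) ->
  \sum_(0 <= s < 2 ^ K) Hm K 0 h s `^ p <= doob_cst p * \sum_(0 <= s < 2 ^ K) h s `^ p.
Proof.
move=> p1 h0; have p0 : 0 < p by apply: lt_trans p1.
have pB : 0 < p - 1 by rewrite subr_gt0.
set q := p / (p - 1).
have q0 : 0 < q by rewrite divr_gt0.
have young (x y : R) : 0 <= x -> 0 <= y -> q * (x * y `^ (p - 1)) <= (q - 1) * x `^ p + y `^ p.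
  move=> x0 y0; have th : 0 < p^-1 < 1 by rewrite invr_gt0 p0 invf_lt1.
  have := powR_young (powR_ge0 x p) (powR_ge0 y p) th.
  rewrite -!powRrM divff ?gt_eqF// powRr1// mulrBr divff ?gt_eqF// mulr1.
  move=> /(ler_wpM2l (ltW q0)); rewrite mulrDr !mulrA.
  have -> : q * p^-1 = q - 1 by rewrite /q; field; rewrite !gt_eqF.
  have -> : q * (1 - p^-1) = 1 by rewrite /q; field; rewrite !gt_eqF.
  by rewrite mul1r.
(* Between the levels k + 1 and k the average may be exchanged, because [Hm K k.+1] is constant on
   the coarser blocks; where the maximum jumps to the new average, [young] pays for the jump. *)
pose Phi k := \sum_(0 <= s < 2 ^ K) (Hm K k h s `^ p - q * (avg k h s * Hm K k h s `^ (p - 1))).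
have PhiK : Phi K <= 0.
  apply: sumr_le0 => s _; rewrite HmK mulr_powRB1 ?avg_ge0//.
  rewrite -{1}(mul1r (_ `^ p)) -mulrBl mulr_le0_ge0 ?powR_ge0//.
  by rewrite subr_le0 /q ler_pdivlMr// mul1r gerBl.
have PhiS k : (k < K)%N -> Phi k <= Phi k.+1.
  move=> kK.
  have -> : Phi k.+1 = \sum_(0 <= s < 2 ^ K) (Hm K k.+1 h s `^ p - q * (avg k h s * Hm K k.+1 h s `^ (p - 1))).
    rewrite /Phi !sumrB; congr (_ - _); rewrite -!mulr_sumr; congr (_ * _).
    have bH : block_fun k.+1 (fun s => Hm K k.+1 h s `^ (p - 1)).
      by move=> s s' e; congr (_ `^ _); apply: block_Hm.
    by rewrite (sum_avgM h kK bH) (sum_avgM h (ltnW kK) (blockS (leqnSn k) bH)).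
  apply: ler_sum => s _; rewrite HmE//.
  set x := avg k h s; set y := Hm K k.+1 h s.
  have x0 : 0 <= x by exact: avg_ge0.
  have y0 : 0 <= y by exact: Hm_ge0.
  have [xy|yx] := leP x y; first by [].
  rewrite mulr_powRB1//.
  by have := young _ _ x0 y0; lra.
have Phi0 : Phi 0%N <= 0.
  have : forall k, (k <= K)%N -> Phi 0%N <= Phi k.
    by elim=> // k IH kK; rewrite (le_trans (IH (ltnW kK)))// PhiS.
  by move=> /(_ K (leqnn K)) /le_trans; apply.
apply: (@bootstrap _ _ _ (Hm K 0 h) h (fun s => Hm K 0 h s `^ (p - 1))) => //.
- by rewrite ltr01.
- by move=> i; apply: Hm_ge0.
- by move=> i; exact: powR_ge0.
- move: Phi0; rewrite /Phi sumrB subr_le0 -mulr_sumr => /le_trans; apply.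
  by rewrite ler_pM2l//; apply: ler_sum => s _; rewrite avg0 powRr1.
- rewrite mul1r le_eqVlt; apply/orP; left; apply/eqP/eq_bigr => i _.
  by rewrite -powRrM mulrC divfK// gt_eqF.
Qed.

(** * Vector-valued martingale differences and their square function *)

Section Vector.
Context {J : Type} (r : seq J).
Implicit Types (u : nat -> J -> R).

Definition vavg k u s j := avg k (u^~ j) s.
Definition vdiff k u s j := vavg k u s j - vavg k.+1 u s j.
Definition sqf K u s := enorm (index_iota 0 K) (fun k => enorm r (vdiff k u s)).

Lemma enorm_vavg k u s : enorm r (vavg k u s) <= avg k (fun i => enorm r (u i)) s.
Proof.
rewrite (eq_enorm r (b := fun j => \sum_(0 <= i < 2 ^ k) (2 ^+ k)^-1 * u (s %/ 2 ^ k * 2 ^ k + i)%N j)).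
  apply: le_trans (enorm_sum _ _ _ _) _; rewrite /avg mulr_sumr.
  by apply: ler_sum => i _; rewrite ger0_norm// invr_ge0 exprn_ge0.
by move=> j; rewrite /vavg /avg mulr_sumr.
Qed.

(** Orthogonality of a martingale difference to everything of level k + 1; a weight of that level
    does not disturb it. *)
Lemma martingale_energy K k u (W : nat -> R) : (k < K)%N -> block_fun k.+1 W ->
  \sum_(0 <= s < 2 ^ K) enorm r (vdiff k u s) ^+ 2 * W s =
  \sum_(0 <= s < 2 ^ K) enorm r (vavg k u s) ^+ 2 * W s -
  \sum_(0 <= s < 2 ^ K) enorm r (vavg k.+1 u s) ^+ 2 * W s.
Proof.
move=> kK bW.
have E (F : nat -> J -> R) : \sum_(0 <= s < 2 ^ K) enorm r (F s) ^+ 2 * W s =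
    \sum_(j <- r) \sum_(0 <= s < 2 ^ K) F s j ^+ 2 * W s.
  by rewrite exchange_big; apply: eq_bigr => s _; rewrite sqr_enorm mulr_suml.
rewrite !E -sumrB; apply: eq_bigr => j _.
set a := vavg k u; set b := vavg k.+1 u.
have bb : block_fun k.+1 (fun s => b s j * W s).
  by move=> s s' e; rewrite (bW _ _ e); congr (_ * _); apply: block_avg.
have ab : \sum_(0 <= s < 2 ^ K) a s j * (b s j * W s) = \sum_(0 <= s < 2 ^ K) b s j * (b s j * W s).
  by rewrite (sum_avgM _ kK bb) (sum_avgM _ (ltnW kK) (blockS (leqnSn k) bb)).
rewrite (eq_bigr (fun s => a s j ^+ 2 * W s + b s j ^+ 2 * W s - 2 * (a s j * (b s j * W s)))).
  rewrite sumrB big_split /= -mulr_sumr ab.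
  under [X in 2 * X]eq_bigr do rewrite mulrA -expr2.
  ring.
by move=> s _; rewrite /vdiff -/a -/b; ring.
Qed.

Lemma enorm_vavg_le_Hm K k u s : (k <= K)%N ->
  enorm r (vavg k u s) <= Hm K k (fun i => enorm r (u i)) s.
Proof. by move=> kK; apply: le_trans (enorm_vavg _ _ _) _; apply: avg_le_Hm. Qed.

Lemma vdiff_sqr_avg k u (h : nat -> R) K : (k < K)%N -> (forall i, 0 <= h i) ->
  \sum_(0 <= s < 2 ^ K) enorm r (vdiff k u s) ^+ 2 * h s <=
  2 * \sum_(0 <= s < 2 ^ K) enorm r (vdiff k u s) ^+ 2 * Hm K k.+1 h s.
Proof.
move=> kK h0.
have bd : block_fun k (fun s => enorm r (vdiff k u s) ^+ 2).
  move=> s s' e; congr (_ ^+ 2); apply: eq_enorm => j; rewrite /vdiff.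
  congr (_ - _); first exact: block_avg.
  by apply: (blockS (leqnSn k) (@block_avg k.+1 _)).
under eq_bigr do rewrite mulrC.
rewrite -(sum_avgM h (ltnW kK) bd) mulr_sumr; apply: ler_sum => s _.
rewrite [leLHS]mulrC [leRHS]mulrCA; apply: ler_wpM2l; first exact: sqr_ge0.
by rewrite (le_trans (avg_doubling _ _ h0))// ler_pM2l// avg_le_Hm.
Qed.

Lemma sqf_ge0 K u s : 0 <= sqf K u s. Proof. exact: enorm_ge0. Qed.

(** The energies telescope although the weight changes from level to level, because the weights
    [Hm K k h] increase as k decreases and therefore enter the telescoping with the right sign. *)
Lemma weighted_square K u (h : nat -> R) : (forall i, 0 <= h i) ->
  \sum_(0 <= s < 2 ^ K) sqf K u s ^+ 2 * h s <=
  2 * \sum_(0 <= s < 2 ^ K) enorm r (u s) ^+ 2 * Hm K 0 h s.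
Proof.
move=> h0.
pose Psi k := \sum_(0 <= s < 2 ^ K) enorm r (vavg k u s) ^+ 2 * Hm K k h s.
have step k : (k < K)%N ->
    \sum_(0 <= s < 2 ^ K) enorm r (vdiff k u s) ^+ 2 * h s <= 2 * (Psi k - Psi k.+1).
  move=> kK; apply: le_trans (vdiff_sqr_avg _ kK h0) _.
  rewrite ler_pM2l// (martingale_energy _ kK (@block_Hm _ _ _)) lerD2r.
  by apply: ler_sum => s _; rewrite ler_wpM2l ?sqr_ge0// HmS.
have -> : \sum_(0 <= s < 2 ^ K) sqf K u s ^+ 2 * h s =
    \sum_(0 <= k < K) \sum_(0 <= s < 2 ^ K) enorm r (vdiff k u s) ^+ 2 * h s.
  by rewrite exchange_big; apply: eq_bigr => s _; rewrite sqr_enorm mulr_suml.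
apply: (@le_trans _ _ (\sum_(0 <= k < K) 2 * (Psi k - Psi k.+1))).
  by rewrite big_nat [leRHS]big_nat; apply: ler_sum => k /andP[_]; exact: step.
rewrite -mulr_sumr ler_pM2l//.
under eq_bigr do rewrite -opprB.
rewrite sumrN telescope_sumr// opprB.
have -> : Psi 0%N = \sum_(0 <= s < 2 ^ K) enorm r (u s) ^+ 2 * Hm K 0 h s.
  by apply: eq_bigr => s _; congr (_ ^+ 2 * _); apply: eq_enorm => j; rewrite /vavg avg0.
by rewrite gerBl sumr_ge0// => s _; rewrite mulr_ge0 ?sqr_ge0 ?Hm_ge0.
Qed.

(** The price of passing from the weight m^(p - 2) to the smaller m'^(p - 2). With rho = m' / m in
    [1, 2] it reduces to rho^2 + 4 <= 5 rho^p, which follows from (rho - 1) (rho - 4) <= 0. *)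
Lemma square_scalar (m m' e p : R) : 1 < p <= 2 -> 0 <= m -> m <= m' -> m' <= 2 * m ->
  0 <= e <= m' -> e ^+ 2 * (m `^ (p - 2) - m' `^ (p - 2)) <= 4 * (m' `^ p - m `^ p).
Proof.
move=> /andP[p1 p2]; rewrite le_eqVlt => /predU1P[<-|m0] mm' m'2 /andP[e0 em].
  have -> : m' = 0 by apply/eqP; rewrite eq_le mm'; move: m'2; rewrite mulr0 => ->.
  by rewrite !subrr !mulr0.
set rho := m' / m.
have m'E : m' = rho * m by rewrite /rho divfK// gt_eqF.
have rho1 : 1 <= rho by rewrite /rho ler_pdivlMr// mul1r.
have rho2 : rho <= 2 by rewrite /rho ler_pdivrMr.
have m'0 : 0 < m' by apply: lt_le_trans mm'.
have r0 : 0 <= rho by apply: le_trans rho1.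
have hp x : 0 < x -> x ^+ 2 * x `^ (p - 2) = x `^ p.
  move=> x0; rewrite -powR_mulrn ?ltW// -powRD; last by rewrite (gt_eqF x0) implybT.
  by congr (_ `^ _); lra.
have mono : m' `^ (p - 2) <= m `^ (p - 2).
  have -> : p - 2 = - (2 - p) by ring.
  rewrite !powRN lef_pV2 ?posrE ?powR_gt0//.
  by apply: powR_le => //; [lra|exact: ltW].
apply: (@le_trans _ _ (m' ^+ 2 * (m `^ (p - 2) - m' `^ (p - 2)))).
  by rewrite ler_wpM2r ?subr_ge0// lerXn2r ?nnegrE// ltW.
rewrite mulrBr (hp m')// {1}m'E exprMn -mulrA (hp m)// {1 2}m'E powRM// ?(ltW m0)//.
rewrite -[X in _ <= _ * (_ - X)]mul1r -!mulrBl mulrA ler_wpM2r ?powR_ge0//.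
have : rho <= rho `^ p by apply: le1r_powR => //; exact: ltW.
set x := rho `^ p; nra.
Qed.

(** The weight is the negative power F^(p - 2) of the maximal function. The telescoped energies cost
    one sum of F^p, the changes of weight four more by [square_scalar]. The sixth pays for the
    points where the square function is below F; elsewhere its own power p - 2 is at most that of
    F. *)
Lemma square_small_p p K u : 1 < p <= 2 ->
  \sum_(0 <= s < 2 ^ K) sqf K u s `^ p <=
  6 * \sum_(0 <= s < 2 ^ K) Hm K 0 (fun i => enorm r (u i)) s `^ p.
Proof.
move=> p12; case/andP: (p12) => p1 p2.
have p0 : 0 < p by lra.
pose F k := Hm K k (fun i => enorm r (u i)).
have F0 k s : 0 <= F k s by apply: Hm_ge0 => i; exact: enorm_ge0.
pose Psi k := \sum_(0 <= s < 2 ^ K) enorm r (vavg k u s) ^+ 2 * F k s `^ (p - 2).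
pose Th k := \sum_(0 <= s < 2 ^ K) F k s `^ p.
have step k : (k < K)%N ->
    \sum_(0 <= s < 2 ^ K) enorm r (vdiff k u s) ^+ 2 * F k.+1 s `^ (p - 2)
    <= (Psi k - Psi k.+1) + 4 * (Th k - Th k.+1).
  move=> kK; rewrite (martingale_energy _ kK); last first.
    by move=> s s' e; congr (_ `^ _); apply: block_Hm.
  have : \sum_(0 <= s < 2 ^ K) enorm r (vavg k u s) ^+ 2 * F k.+1 s `^ (p - 2) - Psi k <= 4 * (Th k - Th k.+1); last by rewrite /Psi; lra.
  rewrite -!sumrB mulr_sumr.
  apply: ler_sum => s _; rewrite -mulrBr; apply: square_scalar => //.
  - exact: HmS.
  - by apply: Hm_doubling => // i; exact: enorm_ge0.
  - by rewrite enorm_ge0 enorm_vavg_le_Hm// ltnW.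
have psi_le k : Psi k <= Th k.
  apply: ler_sum => s _.
  have [z|nz] := eqVneq (F k s) 0.
    have [kK|kK] := leqP k K.
      have := enorm_vavg_le_Hm u s kK; rewrite -/(F k) z => h.
      have -> : enorm r (vavg k u s) = 0 by apply/eqP; rewrite eq_le h enorm_ge0.
      by rewrite expr0n/= mul0r powR_ge0.
    have : enorm r (vavg k u s) <= 0.
      by rewrite -z (le_trans (enorm_vavg _ _ _))// avg_le_Hm.
    move=> h; have -> : enorm r (vavg k u s) = 0 by apply/eqP; rewrite eq_le h enorm_ge0.
    by rewrite expr0n/= mul0r powR_ge0.
  have Fp : 0 < F k s by rewrite lt_neqAle eq_sym nz F0.
  have -> : F k s `^ p = F k s ^+ 2 * F k s `^ (p - 2).
    rewrite -powR_mulrn// -powRD; last by rewrite nz implybT.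
    by congr (_ `^ _); lra.
  rewrite ler_wpM2r ?powR_ge0// lerXn2r ?nnegrE ?enorm_ge0//.
  by rewrite (le_trans (enorm_vavg _ _ _))// avg_le_Hm.
have d3 s k : (k < K)%N -> enorm r (vdiff k u s) <= 3 * F k.+1 s.
  move=> kK; rewrite (eq_enorm r (b := fun j => vavg k u s j + -1 * vavg k.+1 u s j)).
    apply: le_trans (enormD _ _ _) _; rewrite (enormZ _ (-1)) normrN normr1 mul1r.
    have := enorm_vavg_le_Hm u s (ltnW kK); have := enorm_vavg_le_Hm u s kK.
    have := Hm_doubling s (fun i => enorm_ge0 r (u i)) kK.
    by rewrite -/(F k) -/(F k.+1); lra.
  by move=> j; rewrite /vdiff mulN1r.
(* A power with nonzero exponent is 0 at 0 for [powR], so x^(p - 2) is not antitone there; but where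
   [F k.+1] vanishes the martingale difference vanishes too, by [d3]. *)
have mono s k : (k < K)%N ->
    enorm r (vdiff k u s) ^+ 2 * F 0%N s `^ (p - 2) <= enorm r (vdiff k u s) ^+ 2 * F k.+1 s `^ (p - 2).
  move=> kK; have [z|nz] := eqVneq (F k.+1 s) 0.
    have -> : enorm r (vdiff k u s) = 0.
      by apply/eqP; rewrite eq_le enorm_ge0 andbT (le_trans (d3 s k kK))// z mulr0.
    by rewrite expr0n/= !mul0r.
  have Fp : 0 < F k.+1 s by rewrite lt_neqAle eq_sym nz F0.
  have FF : F k.+1 s <= F 0%N s by apply: Hm_le0.
  rewrite ler_wpM2l ?sqr_ge0//.
  have -> : p - 2 = - (2 - p) by ring.
  rewrite !powRN lef_pV2 ?posrE ?powR_gt0//; last exact: lt_le_trans FF.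
  by apply: powR_le => //; lra.
have sq : \sum_(0 <= s < 2 ^ K) sqf K u s ^+ 2 * F 0%N s `^ (p - 2) <= 5 * Th 0%N.
  have -> : \sum_(0 <= s < 2 ^ K) sqf K u s ^+ 2 * F 0%N s `^ (p - 2) =
      \sum_(0 <= k < K) \sum_(0 <= s < 2 ^ K) enorm r (vdiff k u s) ^+ 2 * F 0%N s `^ (p - 2).
    by rewrite exchange_big; apply: eq_bigr => s _; rewrite sqr_enorm mulr_suml.
  apply: (@le_trans _ _ (\sum_(0 <= k < K) ((Psi k - Psi k.+1) + 4 * (Th k - Th k.+1)))).
    rewrite big_nat [leRHS]big_nat; apply: ler_sum => k /andP[_ kK].
    by apply: le_trans (step k kK); apply: ler_sum => s _; exact: mono.
  rewrite big_split /= -mulr_sumr.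
  have tel (G : nat -> R) : \sum_(0 <= k < K) (G k - G k.+1) = G 0%N - G K.
    under eq_bigr do rewrite -opprB.
    by rewrite sumrN telescope_sumr// opprB.
  rewrite !tel.
  have ThK : 0 <= Th K by apply: sumr_ge0 => s _; exact: powR_ge0.
  have PsiK : 0 <= Psi K by apply: sumr_ge0 => s _; rewrite mulr_ge0 ?sqr_ge0 ?powR_ge0.
  have := psi_le 0%N; lra.
have -> : 6 * Th 0%N = 5 * Th 0%N + Th 0%N by ring.
apply: le_trans (lerD sq (lexx _)); rewrite -big_split /=; apply: ler_sum => s _.
have [SF|FS] := leP (sqf K u s) (F 0%N s).
  rewrite -[leLHS]add0r; apply: lerD.
    by apply: mulr_ge0; [exact: sqr_ge0|exact: powR_ge0].
  by apply: powR_le; [exact: ltW|exact: sqf_ge0|].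
rewrite -[leLHS]addr0; apply: lerD; last exact: powR_ge0.
have [z|nz] := eqVneq (F 0%N s) 0.
  suff -> : sqf K u s = 0 by rewrite powR0 ?gt_eqF// mulr_ge0 ?sqr_ge0 ?powR_ge0.
  rewrite /sqf {1}/enorm big_nat big1 ?sqrtr0// => k /andP[_ kK].
  suff -> : enorm r (vdiff k u s) = 0 by rewrite expr0n.
  apply/eqP; rewrite eq_le enorm_ge0 andbT (le_trans (d3 s k kK))//.
  by rewrite pmulr_rle0// -z Hm_le0.
have Fp : 0 < F 0%N s by rewrite lt_neqAle eq_sym nz F0.
have Sp : 0 < sqf K u s by apply: lt_trans FS.
have -> : sqf K u s `^ p = sqf K u s ^+ 2 * sqf K u s `^ (p - 2).
  rewrite -powR_mulrn ?ltW// -powRD; last by rewrite (gt_eqF Sp) implybT.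
  by congr (_ `^ _); lra.
rewrite ler_wpM2l ?sqr_ge0//.
have -> : p - 2 = - (2 - p) by ring.
rewrite !powRN lef_pV2 ?posrE ?powR_gt0//.
by apply: powR_le; [lra|exact: ltW|exact: ltW].
Qed.

End Vector.

Lemma doob_exists p : 1 < p -> exists2 C : R, 0 < C & forall K h, (forall i, 0 <= h i) ->
  \sum_(0 <= s < 2 ^ K) Hm K 0 h s `^ p <= C * \sum_(0 <= s < 2 ^ K) h s `^ p.
Proof.
move=> p1; exists (doob_cst p + 1).
  by rewrite ltr_pwDr// /doob_cst boot_cst_ge0.
move=> K h h0; apply: le_trans (doob K p1 h0) _; apply: ler_wpM2r.
  by apply: sumr_ge0 => s _; exact: powR_ge0.
by rewrite lerDl.
Qed.

(** Up to 2 this is [square_small_p] and Doob's inequality. Above 2 the square function raised to p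
    - 2 is taken as the weight in [weighted_square], and Doob's inequality at the exponent p / (p -
    2) closes the circle through [bootstrap]. *)
Lemma martingale_square p : 1 < p -> exists2 C : R, 0 < C &
  forall K (J : Type) (r : seq J) (u : nat -> J -> R),
  \sum_(0 <= s < 2 ^ K) sqf r K u s `^ p <= C * \sum_(0 <= s < 2 ^ K) enorm r (u s) `^ p.
Proof.
move=> p1; have p0 : 0 < p by apply: lt_trans p1.
have [p2|p2] := leP p 2.
  have [C C0 hC] := doob_exists p1.
  exists (6 * C); first by rewrite mulr_gt0.
  move=> K J r u; apply: le_trans (square_small_p r K u _) _; first by rewrite p1.
  rewrite -mulrA ler_pM2l//; apply: hC => i; exact: enorm_ge0.
have pB : 0 < p - 2 by rewrite subr_gt0.
have r1 : 1 < p / (p - 2) by rewrite ltr_pdivlMr// mul1r gtrBl.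
have [D D0 hD] := doob_exists r1.
exists (boot_cst p 2 2 D + 1); first by rewrite ltr_pwDr// boot_cst_ge0.
move=> K J r u.
have h0 s : 0 <= sqf r K u s `^ (p - 2) by exact: powR_ge0.
apply: (@le_trans _ _ (boot_cst p 2 2 D * \sum_(0 <= s < 2 ^ K) enorm r (u s) `^ p)); last first.
  apply: ler_wpM2r; last by rewrite lerDl.
  by apply: sumr_ge0 => s _; exact: powR_ge0.
apply: (@bootstrap _ _ _ (sqf r K u) (fun s => enorm r (u s)) (Hm K 0 (fun s => sqf r K u s `^ (p - 2)))) => //.
- by rewrite p2 andbT.
- by move=> s; exact: sqf_ge0.
- by move=> s; exact: enorm_ge0.
- by move=> s; exact: Hm_ge0.
- under [X in _ <= _ * X]eq_bigr => s _ do rewrite (powR_mulrn 2 (enorm_ge0 r (u s))).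
  apply: le_trans (weighted_square r K u h0); rewrite le_eqVlt; apply/orP; left; apply/eqP.
  apply: eq_bigr => s _; have [z|nz] := eqVneq (sqf r K u s) 0.
    by rewrite z powR0 ?gt_eqF// expr0n/= mul0r.
  rewrite -powR_mulrn ?sqf_ge0// -powRD; last by rewrite nz implybT.
  by congr (_ `^ _); lra.
- apply: le_trans (hD K _ h0) _; rewrite ler_pM2l// le_eqVlt; apply/orP; left; apply/eqP.
  by apply: eq_bigr => s _; rewrite -powRrM mulrC divfK// gt_eqF.
Qed.

End DyadicMartingale.

(** * Averages over translations *)

Section PeriodicAveraging.
Context {R : realType} (K : nat).
Local Notation N := (2 ^ K)%N.
Implicit Types (f g h : nat -> R) (k s t : nat).

Definition periodic (T : Type) (f : nat -> T) := forall t, f (t + N)%N = f t.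

Lemma sum_shift f a : periodic f ->
  \sum_(0 <= t < N) f (t + a)%N = \sum_(0 <= t < N) f t.
Proof.
move=> pf; elim: a => [|a IH]; first by under eq_bigr do rewrite addn0.
rewrite -IH.
have e : \sum_(0 <= t < N.+1) f (t + a)%N = \sum_(0 <= t < N) f (t + a.+1)%N + f a.
  by rewrite big_nat_recl// addrC; under eq_bigr do rewrite addSnnS.
move: e; rewrite big_nat_recr//= addnC pf => /eqP.
by rewrite -subr_eq addrK => /eqP.
Qed.

Definition shift (T : Type) (u : nat -> T) a t := u (t + a)%N.

(** Averaging over all positions of the dyadic grid: [shift u (t + (N - s))] brings the point t of u
    to the place s of the grid. A bound tied to dyadic blocks becomes a translation invariant one
    with the same constant. *)
Lemma mean_shift (T : Type) (A : (nat -> T) -> nat -> R) (B : T -> R) C (u : nat -> T) :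
  periodic u ->
  (forall w, \sum_(0 <= s < N) A w s <= C * \sum_(0 <= s < N) B (w s)) ->
  \sum_(0 <= t < N) (\sum_(0 <= s < N) N%:R^-1 * A (shift u (t + (N - s))) s)
    <= C * \sum_(0 <= t < N) B (u t).
Proof.
move=> pu hA; rewrite exchange_big_nat/=.
rewrite (eq_bigr (fun s => \sum_(0 <= t < N) N%:R^-1 * A (shift u t) s)); last first.
  move=> s _; apply: (@sum_shift (fun t => N%:R^-1 * A (shift u t) s)) => t.
  congr (_ * A _ _); apply/funext => x; rewrite /shift.
  by rewrite addnA pu.
rewrite exchange_big_nat/=.
apply: (@le_trans _ _ (\sum_(0 <= t < N) N%:R^-1 * (C * \sum_(0 <= t < N) B (u t)))).
  apply: ler_sum => t _; rewrite -mulr_sumr ler_wpM2l ?invr_ge0//.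
  apply: le_trans (hA _) _; rewrite /shift (@sum_shift (B \o u))// => x.
  by rewrite /= pu.
by rewrite big_const_nat subn0 iter_addr addr0 -[leLHS]mulr_natl mulrA divff ?mul1r// pnatr_eq0 expn_eq0.
Qed.

Lemma mean_weights : \sum_(0 <= s < N) (N%:R^-1 : R) <= 1.
Proof.
by rewrite big_const_nat subn0 iter_addr addr0 -[leLHS]mulr_natl divff// pnatr_eq0 expn_eq0.
Qed.

(** Convolution with the triangular Fejer kernel of width 2^k, written as an interval average
    followed by the reflected one; by periodicity [N - i'] stands for the negative translation. *)
Definition fejer k f t : R :=
  (4 ^+ k)^-1 * \sum_(0 <= i' < 2 ^ k) \sum_(0 <= i < 2 ^ k) f (t + (N - i') + i)%N.

(** Under translation of the grid the place of t inside its block is uniformly distributed, so the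
    mean of the block averages is the double sum over that place and over the block. *)
Lemma fejer_mean k f t : (k <= K)%N -> periodic f ->
  fejer k f t = \sum_(0 <= s < N) N%:R^-1 * avg k (shift f (t + (N - s))) s.
Proof.
move=> kK pf; have kN : (2 ^ k <= N)%N by rewrite leq_exp2l.
have E : \sum_(0 <= s < N) avg k (shift f (t + (N - s))) s =
    \sum_(0 <= s < N) (2 ^+ k)^-1 * \sum_(0 <= i < 2 ^ k) f (t + (N - s %% 2 ^ k) + i)%N.
  rewrite big_nat [RHS]big_nat; apply: eq_bigr => s /andP[_ sN]; congr (_ * _).
  apply: eq_bigr => i _; rewrite /shift; congr f.
  have := ltn_pmod s (expn_gt0 2 k); have := divn_eq s (2 ^ k); lia.
rewrite -mulr_sumr E.
have -> : \sum_(0 <= s < N) (2 ^+ k)^-1 * \sum_(0 <= i < 2 ^ k) f (t + (N - s %% 2 ^ k) + i)%N =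
    \sum_(0 <= s < 2 ^ (K - k) * 2 ^ k) (2 ^+ k)^-1 * \sum_(0 <= i < 2 ^ k) f (t + (N - s %% 2 ^ k) + i)%N.
  by rewrite -expnD subnK.
rewrite sum_blocks.
rewrite (eq_bigr (fun=> (2 ^+ k)^-1 * \sum_(0 <= i' < 2 ^ k) \sum_(0 <= i < 2 ^ k) f (t + (N - i') + i)%N)).
  rewrite big_const_nat subn0 iter_addr addr0 -[_ *+ 2 ^ (K - k)]mulr_natl !mulrA /fejer; congr (_ * _).
  have -> : (N%:R : R) = (2 ^ (K - k))%:R * 2 ^+ k by rewrite -natrX -natrM -expnD subnK.
  rewrite natrX.
  have -> : (4 : R) = 2 * 2 by rewrite -natrM.
  by rewrite exprMn; field; rewrite !expf_neq0.
move=> c _; rewrite -mulr_sumr; congr (_ * _).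
rewrite big_nat [RHS]big_nat; apply: eq_bigr => i' /andP[_ ik].
by rewrite modnMDl modn_small.
Qed.

Lemma fejer_ge0 k f t : (forall i, 0 <= f i) -> 0 <= fejer k f t.
Proof.
move=> f0; rewrite mulr_ge0 ?invr_ge0 ?exprn_ge0//.
by rewrite sumr_ge0 => // i _; rewrite sumr_ge0.
Qed.

Lemma fejer_le k f g t : (forall i, f i <= g i) -> fejer k f t <= fejer k g t.
Proof.
move=> fg; rewrite ler_wpM2l ?invr_ge0 ?exprn_ge0//.
by apply: ler_sum => i _; apply: ler_sum.
Qed.

Lemma periodic_fejer k f : periodic f -> periodic (fejer k f).
Proof.
move=> pf t; congr (_ * _); apply: eq_bigr => i' _; apply: eq_bigr => i _.
by rewrite -(pf (t + (N - i') + i)%N); congr f; lia.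
Qed.

Lemma sum_fejer k f g : (k <= K)%N -> periodic f -> periodic g ->
  \sum_(0 <= t < N) fejer k f t * g t = (4 ^+ k)^-1 *
  \sum_(0 <= i' < 2 ^ k) \sum_(0 <= i < 2 ^ k) \sum_(0 <= t < N) f (t + i)%N * g (t + i')%N.
Proof.
move=> kK pf pg; have kN : (2 ^ k <= N)%N by rewrite leq_exp2l.
rewrite (eq_bigr (fun t => (4 ^+ k)^-1 * \sum_(0 <= i' < 2 ^ k) \sum_(0 <= i < 2 ^ k) f (t + (N - i') + i)%N * g t)); last first.
  move=> t _; rewrite /fejer -mulrA mulr_suml; congr (_ * _).
  by apply: eq_bigr => i _; rewrite mulr_suml.
rewrite -mulr_sumr; congr (_ * _); rewrite exchange_big_nat/=.
rewrite big_nat [RHS]big_nat; apply: eq_bigr => i' /andP[_ ik].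
rewrite exchange_big_nat/=; apply: eq_bigr => i _.
rewrite -(@sum_shift (fun t => f (t + (N - i') + i)%N * g t) i').
  apply: eq_bigr => t _; congr (_ * _).
  by rewrite -(pf (t + i)%N); congr f; lia.
move=> t; rewrite pg; congr (_ * _).
by rewrite -(pf (t + (N - i') + i)%N); congr f; lia.
Qed.

Lemma fejer_adjoint k f g : (k <= K)%N -> periodic f -> periodic g ->
  \sum_(0 <= t < N) fejer k f t * g t = \sum_(0 <= t < N) f t * fejer k g t.
Proof.
move=> kK pf pg; rewrite sum_fejer//.
under [RHS]eq_bigr do rewrite mulrC.
rewrite sum_fejer// exchange_big_nat/=; congr (_ * _).
by apply: eq_bigr => i _; apply: eq_bigr => j _; apply: eq_bigr => t _; rewrite mulrC.
Qed.

Lemma fejerD k f g t : fejer k (fun i => f i + g i) t = fejer k f t + fejer k g t.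
Proof.
by rewrite /fejer -mulrDr -big_split; congr (_ * _); apply: eq_bigr => i _; rewrite big_split.
Qed.

Lemma fejerZ k a f t : fejer k (fun i => a * f i) t = a * fejer k f t.
Proof.
rewrite /fejer mulrCA; congr (_ * _); rewrite mulr_sumr.
by apply: eq_bigr => i _; rewrite mulr_sumr.
Qed.

Lemma fejer_cst k a t : fejer k (fun=> a) t = a.
Proof.
rewrite /fejer !big_const_nat !subn0 !iter_addr !addr0 -mulrnA -[_ *+ (2 ^ k * 2 ^ k)]mulr_natl.
by rewrite -expnMn natrX mulrA mulVf ?mul1r// expf_neq0.
Qed.

Lemma fejer_sqr k g t : fejer k g t ^+ 2 <= fejer k (fun i => g i ^+ 2) t.
Proof.
set m := fejer k g t.
have : 0 <= fejer k (fun i => (g i - m) ^+ 2) t by apply: fejer_ge0 => i; exact: sqr_ge0.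
rewrite (_ : (fun i => (g i - m) ^+ 2) = (fun i => (g i ^+ 2 + (-2 * m) * g i) + m ^+ 2)).
  by rewrite fejerD fejer_cst fejerD fejerZ -/m; nra.
by apply/funext => i; ring.
Qed.

Lemma fejer_sumr k (I : Type) (r : seq I) (F : I -> nat -> R) t :
  fejer k (fun i => \sum_(x <- r) F x i) t = \sum_(x <- r) fejer k (F x) t.
Proof.
elim: r => [|x r IH].
  by rewrite big_nil -[RHS](fejer_cst k 0 t); congr fejer; apply/funext => i; rewrite big_nil.
rewrite big_cons -IH -fejerD; congr fejer; apply/funext => i.
by rewrite big_cons.
Qed.

(** The mean of dyadic maximal functions over all grids. It dominates every Fejer mean and inherits
    Doob's inequality through [mean_shift], so no separate maximal theorem for Fejer means is
    needed. *)
Definition Mx g t := \sum_(0 <= s < N) N%:R^-1 * Hm K 0 (shift g (t + (N - s))) s.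

Lemma Mx_ge0 g t : (forall i, 0 <= g i) -> 0 <= Mx g t.
Proof.
by move=> g0; apply: sumr_ge0 => s _; rewrite mulr_ge0 ?invr_ge0// Hm_ge0// => i; exact: g0.
Qed.

Lemma fejer_le_Mx k g t : (k <= K)%N -> periodic g -> fejer k g t <= Mx g t.
Proof.
move=> kK pg; rewrite fejer_mean//; apply: ler_sum => s _.
by rewrite ler_wpM2l ?invr_ge0// avg_le_Hm0.
Qed.

End PeriodicAveraging.

(** * Maximal, square function and dual estimates for Fejer means *)

Section PeriodicInequalities.
Context {R : realType}.

Lemma Mx_bound (p : R) : 1 < p -> exists2 C : R, 0 < C &
  forall K (g : nat -> R), periodic K g -> (forall i, 0 <= g i) ->
  \sum_(0 <= t < 2 ^ K) Mx K g t `^ p <= C * \sum_(0 <= t < 2 ^ K) g t `^ p.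
Proof.
move=> p1; have [C C0 hC] := doob_exists p1; exists C => // K g pg g0.
(* [mean_shift] asks for an estimate valid for every function, Doob's inequality holds for
   nonnegative ones; the absolute value reconciles the two. *)
apply: (@le_trans _ _ (\sum_(0 <= t < 2 ^ K) \sum_(0 <= s < 2 ^ K) (2 ^ K)%:R^-1 * Hm K 0 (fun i => `|shift g (t + (2 ^ K - s)) i|) s `^ p)).
  apply: ler_sum => t _.
  apply: le_trans (jensen_powR _ _ _ (mean_weights K)) _; first exact: ltW.
  - by move=> s; rewrite invr_ge0.
  - by move=> s; apply: Hm_ge0 => i; exact: g0.
  apply: ler_sum => s _; rewrite ler_wpM2l ?invr_ge0//.
  by rewrite (_ : (fun i => `|_|) = shift g (t + (2 ^ K - s)))//; apply/funext => i; rewrite ger0_norm// g0.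
apply: le_trans (mean_shift (A := fun w s => Hm K 0 (fun i => `|w i|) s `^ p) (B := fun x => `|x| `^ p) (C := C) pg _) _.
  by move=> w; apply: hC.
by rewrite ler_pM2l// le_eqVlt; apply/orP; left; apply/eqP; apply: eq_bigr => t _; rewrite ger0_norm.
Qed.

Definition vfejer (J : Type) K k (u : nat -> J -> R) t (j : J) := fejer K k (u^~ j) t.
Definition phi (J : Type) K k (u : nat -> J -> R) t (j : J) := vfejer K k u t j - vfejer K k.+1 u t j.

Lemma periodic_comp (T T' : Type) K (u : nat -> T) (F : T -> T') : periodic K u -> periodic K (fun t => F (u t)).
Proof. by move=> pu t; rewrite pu. Qed.

Lemma periodic_phi (J : Type) K k (u : nat -> J -> R) : periodic K u -> periodic K (phi K k u).
Proof.
move=> pu t; apply/funext => j; rewrite /phi /vfejer.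
by rewrite !periodic_fejer//; apply: (periodic_comp (fun v => v j)).
Qed.

(** By [fejer_mean] each [phi] is a mean of martingale differences over the grids; convexity of both
    l^2-norms and Jensen's inequality pull the mean out, and [martingale_square] applies in each
    grid. *)
Lemma square_phi (p : R) : 1 < p -> exists2 C : R, 0 < C &
  forall K (J : Type) (r : seq J) (u : nat -> J -> R), periodic K u ->
  \sum_(0 <= t < 2 ^ K) enorm (index_iota 0 K) (fun k => enorm r (phi K k u t)) `^ p
  <= C * \sum_(0 <= t < 2 ^ K) enorm r (u t) `^ p.
Proof.
move=> p1; have p0 : 0 < p by apply: lt_trans p1.
have [C C0 hC] := martingale_square p1; exists C => // K J r u pu.
apply: le_trans (mean_shift (A := fun w s => sqf r K w s `^ p) (B := fun x => enorm r x `^ p) pu (hC K J r)).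
apply: ler_sum => t _.
have e k : (k < K)%N -> enorm r (phi K k u t) <= \sum_(0 <= s < 2 ^ K) (2 ^ K)%:R^-1 * enorm r (vdiff k (shift u (t + (2 ^ K - s))) s).
  move=> kK.
  rewrite (eq_enorm r (b := fun j => \sum_(0 <= s < 2 ^ K) (2 ^ K)%:R^-1 * vdiff k (shift u (t + (2 ^ K - s))) s j)).
    apply: le_trans (enorm_sum _ _ _ _) _; apply: ler_sum => s _.
    by rewrite ger0_norm// invr_ge0.
  move=> j; have puj : periodic K (u^~ j) by apply: (periodic_comp (fun v => v j)).
  rewrite /phi /vfejer (fejer_mean _ (ltnW kK) puj) (fejer_mean _ kK puj) -sumrB.
  by apply: eq_bigr => s _; rewrite -mulrBr.
apply: (@le_trans _ _ ((\sum_(0 <= s < 2 ^ K) (2 ^ K)%:R^-1 * sqf r K (shift u (t + (2 ^ K - s))) s) `^ p)).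
  apply: powR_le => //; [exact: ltW|exact: enorm_ge0|].
  apply: (@le_trans _ _ (enorm (index_iota 0 K) (fun k => \sum_(0 <= s < 2 ^ K) (2 ^ K)%:R^-1 * enorm r (vdiff k (shift u (t + (2 ^ K - s))) s)))).
    rewrite /enorm ler_wsqrtr// big_nat [leRHS]big_nat; apply: ler_sum => k /andP[_ kK].
    by rewrite lerXn2r ?nnegrE ?enorm_ge0 ?e// (le_trans (enorm_ge0 _ _) (e k kK)).
  apply: le_trans (enorm_sum _ _ _ _) _; apply: ler_sum => s _.
  by rewrite ger0_norm// invr_ge0.
apply: (jensen_powR _ _ _ (mean_weights K)); first exact: ltW.
- by move=> s; rewrite invr_ge0.
- by move=> s; apply: sqf_ge0.
Qed.

Lemma conj_exp (p : R) : 1 < p -> 1 < p / (p - 1).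
Proof. by move=> p1; rewrite ltr_pdivlMr ?subr_gt0// mul1r gtrBl. Qed.

Lemma powR_split (p x : R) : 0 <= x -> x `^ p = x ^+ 2 * x `^ (p - 2) \/ x = 0.
Proof.
rewrite le_eqVlt => /predU1P[<-|x0]; [by right|left].
rewrite -powR_mulrn ?ltW// -powRD; last by rewrite (gt_eqF x0) implybT.
by congr (_ `^ _); lra.
Qed.

Lemma powR_split_le (p x : R) : p != 0 -> 0 <= x -> x `^ p <= x ^+ 2 * x `^ (p - 2).
Proof.
move=> p0 x0; have [->//|->] := powR_split p x0.
by rewrite powR0// mulr_ge0 ?sqr_ge0 ?powR_ge0.
Qed.

(** V |V|^(p - 2) is the vector that norms V: it pairs with V to |V|^p. This is its size in the
    conjugate exponent, as needed when an estimate is tested against it. *)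
Lemma dual_exponent (p : R) (J : Type) (r : seq J) (V : J -> R) : 1 < p ->
  enorm r (fun j => V j * enorm r V `^ (p - 2)) `^ (p / (p - 1)) <= enorm r V `^ p.
Proof.
move=> p1; have p0 : 0 < p by apply: lt_trans p1.
rewrite (eq_enorm r (b := fun j => enorm r V `^ (p - 2) * V j)); last by move=> j; rewrite mulrC.
rewrite enormZ ger0_norm ?powR_ge0//.
have := enorm_ge0 r V; rewrite le_eqVlt => /predU1P[<-|x0].
  by rewrite mulr0 !powR0// gt_eqF// divr_gt0// subr_gt0.
set x := enorm r V in x0 *.
rewrite le_eqVlt; apply/orP; left; apply/eqP.
rewrite -{2}(powRr1 (ltW x0)) -powRD; last by rewrite (gt_eqF x0) implybT.
rewrite -powRrM; congr (_ `^ _).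
by field; rewrite subr_eq0 gt_eqF.
Qed.

(* Stein's inequality: positive averages are bounded on L^p(l^2). *)
Lemma fejer_l2 (p : R) : 1 < p -> exists2 C : R, 0 < C &
  forall K (I : Type) (r : seq I) (l : I -> nat) (g : I -> nat -> R),
  (forall i, (l i <= K)%N) -> (forall i, periodic K (g i)) ->
  \sum_(0 <= t < 2 ^ K) enorm r (fun i => fejer K (l i) (g i) t) `^ p
  <= C * \sum_(0 <= t < 2 ^ K) enorm r (fun i => g i t) `^ p.
Proof.
(* Above 2 the weight S^(p - 2) is used: the square goes inside the mean by [fejer_sqr], the mean is
   moved to the weight by symmetry, and there the maximal function dominates all levels at once. *)
move: p; have large (p : R) : 2 < p -> exists2 C : R, 0 < C &
  forall K (I : Type) (r : seq I) (l : I -> nat) (g : I -> nat -> R),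
  (forall i, (l i <= K)%N) -> (forall i, periodic K (g i)) ->
  \sum_(0 <= t < 2 ^ K) enorm r (fun i => fejer K (l i) (g i) t) `^ p
  <= C * \sum_(0 <= t < 2 ^ K) enorm r (fun i => g i t) `^ p.
  move=> p2; have p0 : 0 < p by apply: lt_trans p2.
  have pB : 0 < p - 2 by rewrite subr_gt0.
  have r1 : 1 < p / (p - 2) by rewrite ltr_pdivlMr// mul1r gtrBl.
  have [D D0 hD] := Mx_bound r1.
  exists (boot_cst p 2 1 D + 1); first by rewrite ltr_pwDr// boot_cst_ge0.
  move=> K I r l g lK pg.
  set S := fun t => enorm r (fun i => fejer K (l i) (g i) t).
  have S0 t : 0 <= S t by exact: enorm_ge0.
  have pS : periodic K S.
    by move=> t; apply: eq_enorm => i; rewrite periodic_fejer.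
  pose h t := S t `^ (p - 2).
  have ph : periodic K h by move=> t; rewrite /h pS.
  have h0 t : 0 <= h t by exact: powR_ge0.
  apply: (@le_trans _ _ (boot_cst p 2 1 D * \sum_(0 <= t < 2 ^ K) enorm r (fun i => g i t) `^ p)); last first.
    apply: ler_wpM2r; last by rewrite lerDl.
    by apply: sumr_ge0 => s _; exact: powR_ge0.
  apply: (@bootstrap _ _ _ S (fun t => enorm r (fun i => g i t)) (Mx K h)) => //.
  - by rewrite p2 andbT.
  - by move=> t; exact: enorm_ge0.
  - by move=> t; exact: Mx_ge0.
  - apply: (@le_trans _ _ (\sum_(0 <= t < 2 ^ K) S t ^+ 2 * h t)).
      by apply: ler_sum => t _; apply: powR_split_le => //; rewrite gt_eqF.
    apply: (@le_trans _ _ (\sum_(0 <= t < 2 ^ K) \sum_(i <- r) fejer K (l i) (fun s => g i s ^+ 2) t * h t)).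
      apply: ler_sum => t _; rewrite sqr_enorm mulr_suml; apply: ler_sum => i _.
      by rewrite ler_wpM2r// fejer_sqr.
    rewrite exchange_big/= (eq_bigr (fun i => \sum_(0 <= t < 2 ^ K) g i t ^+ 2 * fejer K (l i) h t)); last first.
      move=> i _; rewrite fejer_adjoint//.
      by move=> t; rewrite pg.
    rewrite exchange_big/= mul1r; apply: ler_sum => t _.
    rewrite (powR_mulrn 2 (enorm_ge0 _ _)) sqr_enorm mulr_suml; apply: ler_sum => i _.
    by rewrite ler_wpM2l ?sqr_ge0// fejer_le_Mx.
  - apply: le_trans (hD K _ ph h0) _; rewrite ler_pM2l// le_eqVlt; apply/orP; left; apply/eqP.
    by apply: eq_bigr => s _; rewrite /h -powRrM mulrC divfK// gt_eqF.
move=> p p1; have p0 : 0 < p by apply: lt_trans p1.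
have [p2|p2|->] := ltgtP p 2; last 2 first.
- exact: large.
- exists 1 => // K I r l g lK pg; rewrite mul1r.
  apply: (@le_trans _ _ (\sum_(0 <= t < 2 ^ K) \sum_(i <- r) fejer K (l i) (fun s => g i s ^+ 2) t * 1)).
    apply: ler_sum => t _; rewrite (powR_mulrn 2 (enorm_ge0 _ _)) sqr_enorm; apply: ler_sum => i _.
    by rewrite mulr1 fejer_sqr.
  rewrite exchange_big/= (eq_bigr (fun i => \sum_(0 <= t < 2 ^ K) g i t ^+ 2 * fejer K (l i) (fun=> 1) t)); last first.
    move=> i _; rewrite -fejer_adjoint//.
    by move=> t; rewrite pg.
  rewrite exchange_big/=; apply: ler_sum => t _.
  rewrite (powR_mulrn 2 (enorm_ge0 _ _)) sqr_enorm; apply: ler_sum => i _.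
  by rewrite fejer_cst mulr1.
(* Below 2 the conjugate exponent exceeds 2, so the case [large] applies to the test functions
   [y]. *)
have pB : 0 < p - 1 by rewrite subr_gt0.
have [|C C0 hC] := large (p / (p - 1)).
  by rewrite ltr_pdivlMr//; lra.
exists (boot_cst p 1 1 C + 1); first by rewrite ltr_pwDr// boot_cst_ge0.
move=> K I r l g lK pg.
apply: (@le_trans _ _ (boot_cst p 1 1 C * \sum_(0 <= t < 2 ^ K) enorm r (fun i => g i t) `^ p)); last first.
  apply: ler_wpM2r; last by rewrite lerDl.
  by apply: sumr_ge0 => s _; exact: powR_ge0.
set S := fun t => enorm r (fun i => fejer K (l i) (g i) t).
pose y i t := fejer K (l i) (g i) t * S t `^ (p - 2).
have pS : periodic K S by move=> t; apply: eq_enorm => i; rewrite periodic_fejer.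
have py i : periodic K (y i) by move=> t; rewrite /y pS periodic_fejer.
apply: (@bootstrap _ _ _ S (fun t => enorm r (fun i => g i t)) (fun t => enorm r (fun i => fejer K (l i) (y i) t))) => //.
- by rewrite ltr01.
- by move=> t; exact: enorm_ge0.
- by move=> t; exact: enorm_ge0.
- by move=> t; exact: enorm_ge0.
- apply: (@le_trans _ _ (\sum_(0 <= t < 2 ^ K) \sum_(i <- r) fejer K (l i) (g i) t * y i t)).
    apply: ler_sum => t _; apply: (le_trans (powR_split_le _ (enorm_ge0 _ _))); first by rewrite gt_eqF.
    rewrite sqr_enorm mulr_suml; apply: ler_sum => i _.
    by rewrite /y mulrA expr2.
  rewrite exchange_big/= (eq_bigr (fun i => \sum_(0 <= t < 2 ^ K) g i t * fejer K (l i) (y i) t)); last first.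
    by move=> i _; rewrite fejer_adjoint.
  rewrite exchange_big/= mul1r; apply: ler_sum => t _.
  by rewrite powRr1 ?enorm_ge0//; exact: cauchy_schwarz.
- apply: le_trans (hC K I r l y lK py) _; rewrite ler_pM2l//; apply: ler_sum => t _.
  exact: dual_exponent.
Qed.

(** The sum V is tested against V |V|^(p - 2); symmetry of the Fejer means moves each [phi] onto the
    test function, where [square_phi] holds at the conjugate exponent. *)
Lemma dual_phi (p : R) : 1 < p -> exists2 C : R, 0 < C &
  forall K (J : Type) (r : seq J) (g : nat -> nat -> J -> R), (forall k, periodic K (g k)) ->
  \sum_(0 <= t < 2 ^ K) enorm r (fun j => \sum_(0 <= k < K) phi K k (g k) t j) `^ p
  <= C * \sum_(0 <= t < 2 ^ K) enorm (index_iota 0 K) (fun k => enorm r (g k t)) `^ p.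
Proof.
move=> p1; have p0 : 0 < p by apply: lt_trans p1.
have [C C0 hC] := square_phi (conj_exp p1).
exists (boot_cst p 1 1 C + 1); first by rewrite ltr_pwDr// boot_cst_ge0.
move=> K J r g pg.
set V := fun t j => \sum_(0 <= k < K) phi K k (g k) t j.
set G := fun t => enorm (index_iota 0 K) (fun k => enorm r (g k t)).
pose y t j := V t j * enorm r (V t) `^ (p - 2).
have pV : periodic K V.
  by move=> t; apply/funext => j; apply: eq_bigr => k _; rewrite periodic_phi.
have py : periodic K y by move=> t; rewrite /y pV.
apply: (@le_trans _ _ (boot_cst p 1 1 C * \sum_(0 <= t < 2 ^ K) G t `^ p)); last first.
  apply: ler_wpM2r; last by rewrite lerDl.
  by apply: sumr_ge0 => s _; exact: powR_ge0.
apply: (@bootstrap _ _ _ (fun t => enorm r (V t)) G (fun t => enorm (index_iota 0 K) (fun k => enorm r (phi K k y t)))) => //.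
- by rewrite ltr01.
- by move=> t; exact: enorm_ge0.
- by move=> t; exact: enorm_ge0.
- by move=> t; exact: enorm_ge0.
- apply: (@le_trans _ _ (\sum_(0 <= t < 2 ^ K) \sum_(0 <= k < K) \sum_(j <- r) phi K k (g k) t j * y t j)).
    apply: ler_sum => t _; apply: (le_trans (powR_split_le _ (enorm_ge0 _ _))); first by rewrite gt_eqF.
    rewrite sqr_enorm mulr_suml exchange_big; apply: ler_sum => j _.
    by rewrite -mulr_suml -/(V t j) /y mulrA expr2.
  rewrite mul1r exchange_big/=.
  apply: (@le_trans _ _ (\sum_(0 <= k < K) \sum_(0 <= t < 2 ^ K) \sum_(j <- r) g k t j * phi K k y t j)).
    rewrite big_nat [leRHS]big_nat; apply: ler_sum => k /andP[_ kK].
    rewrite exchange_big [leRHS]exchange_big/= le_eqVlt; apply/orP; left; apply/eqP.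
    apply: eq_bigr => j _.
    have pgj : periodic K (fun t => g k t j) by move=> t; rewrite pg.
    have pyj : periodic K (fun t => y t j) by move=> t; rewrite py.
    rewrite /phi /vfejer.
    under eq_bigr do rewrite mulrBl.
    under [RHS]eq_bigr do rewrite mulrBr.
    by rewrite !sumrB !fejer_adjoint// ltnW.
  rewrite exchange_big/=; apply: ler_sum => t _; rewrite powRr1 ?enorm_ge0//.
  apply: le_trans (cauchy_schwarz _ _ _); apply: ler_sum => k _; exact: cauchy_schwarz.
- apply: le_trans (hC K J r y py) _; rewrite ler_pM2l//; apply: ler_sum => t _.
  exact: dual_exponent.
Qed.

(** The dual of the maximal inequality: testing against S^(p - 1) and moving the means over replaces
    them all by the single function [Mx] at the conjugate exponent. *)
Lemma fejer_l1 (p : R) : 1 < p -> exists2 C : R, 0 < C &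
  forall K (I : Type) (r : seq I) (l : I -> nat) (g : I -> nat -> R),
  (forall i, (l i <= K)%N) -> (forall i, periodic K (g i)) -> (forall i t, 0 <= g i t) ->
  \sum_(0 <= t < 2 ^ K) (\sum_(i <- r) fejer K (l i) (g i) t) `^ p
  <= C * \sum_(0 <= t < 2 ^ K) (\sum_(i <- r) g i t) `^ p.
Proof.
move=> p1; have p0 : 0 < p by apply: lt_trans p1.
have pB : 0 < p - 1 by rewrite subr_gt0.
have [C C0 hC] := Mx_bound (conj_exp p1).
exists (boot_cst p 1 1 C + 1); first by rewrite ltr_pwDr// boot_cst_ge0.
move=> K I r l g lK pg g0.
set S := fun t => \sum_(i <- r) fejer K (l i) (g i) t.
have S0 t : 0 <= S t by apply: sumr_ge0 => i _; apply: fejer_ge0.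
pose h t := S t `^ (p - 1).
have ph : periodic K h by move=> t; congr (_ `^ _); apply: eq_bigr => i _; rewrite periodic_fejer.
have h0 t : 0 <= h t by exact: powR_ge0.
apply: (@le_trans _ _ (boot_cst p 1 1 C * \sum_(0 <= t < 2 ^ K) (\sum_(i <- r) g i t) `^ p)); last first.
  apply: ler_wpM2r; last by rewrite lerDl.
  by apply: sumr_ge0 => s _; exact: powR_ge0.
apply: (@bootstrap _ _ _ S (fun t => \sum_(i <- r) g i t) (Mx K h)) => //.
- by rewrite ltr01.
- by move=> t; apply: sumr_ge0.
- by move=> t; exact: Mx_ge0.
- rewrite mul1r; apply: (@le_trans _ _ (\sum_(0 <= t < 2 ^ K) \sum_(i <- r) fejer K (l i) (g i) t * h t)).
    by apply: ler_sum => t _; rewrite -mulr_suml -/(S t) mulr_powRB1.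
  rewrite exchange_big/= (eq_bigr (fun i => \sum_(0 <= t < 2 ^ K) g i t * fejer K (l i) h t)); last first.
    by move=> i _; rewrite fejer_adjoint.
  rewrite exchange_big/=; apply: ler_sum => t _; rewrite powRr1 ?sumr_ge0// mulr_suml.
  by apply: ler_sum => i _; rewrite ler_wpM2l// fejer_le_Mx.
- apply: le_trans (hC K _ ph h0) _; rewrite ler_pM2l// le_eqVlt; apply/orP; left; apply/eqP.
  by apply: eq_bigr => s _; rewrite /h -powRrM mulrC divfK// gt_eqF.
Qed.

End PeriodicInequalities.

(** * Polynomials of the shift *)

Section PolynomialAction.
Context {F : comNzRingType}.
Implicit Types (q : {poly F}) (f : nat -> F).

Definition act q f t := \sum_(i < size q) q`_i * f (t + i)%N.

Lemma act_wide q f t m : (size q <= m)%N -> act q f t = \sum_(i < m) q`_i * f (t + i)%N.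
Proof.
move=> qm; rewrite /act (big_ord_widen m (fun i => q`_i * f (t + i)%N))// [RHS](bigID (fun i : 'I_m => (i < size q)%N))/=.
rewrite [X in _ = _ + X]big1 ?addr0// => i; rewrite -leqNgt => h.
by rewrite nth_default ?mul0r.
Qed.

Lemma actD q q' f t : act (q + q') f t = act q f t + act q' f t.
Proof.
pose m := maxn (size q) (size q').
rewrite !(@act_wide _ _ _ m) ?leq_maxl ?leq_maxr ?size_polyD// -big_split.
by apply: eq_bigr => i _; rewrite coefD mulrDl.
Qed.

Lemma actZ c q f t : act (c *: q) f t = c * act q f t.
Proof.
rewrite (@act_wide _ _ _ (size q)) ?size_scale_leq// /act mulr_sumr.
by apply: eq_bigr => i _; rewrite coefZ mulrA.
Qed.

Lemma actN q f t : act (- q) f t = - act q f t.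
Proof. by rewrite -scaleN1r actZ mulN1r. Qed.

Lemma actB q q' f t : act (q - q') f t = act q f t - act q' f t.
Proof. by rewrite actD actN. Qed.

Lemma act0 f t : act 0 f t = 0.
Proof. by rewrite /act size_poly0 big_ord0. Qed.

Lemma actXn n f t : act 'X^n f t = f (t + n)%N.
Proof.
rewrite /act size_polyXn big_ord_recr/= big1 ?add0r ?coefXn ?eqxx ?mul1r// => i _.
by rewrite coefXn (ltn_eqF (ltn_ord i)) mul0r.
Qed.

Lemma act_sum (I : Type) (r : seq I) (G : I -> {poly F}) f t :
  act (\sum_(i <- r) G i) f t = \sum_(i <- r) act (G i) f t.
Proof. by elim: r => [|x r IH]; rewrite ?big_nil ?act0// !big_cons actD IH. Qed.

Lemma actMXn q n f t : act (q * 'X^n) f t = act q f (t + n)%N.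
Proof.
rewrite (@act_wide _ _ _ (n + size q)); last first.
  by rewrite (leq_trans (size_polyMleq _ _))// size_polyXn addnS addnC.
rewrite big_split_ord/= big1 ?add0r; last first.
  by move=> i _; rewrite coefMXn ltn_ord mul0r.
by apply: eq_bigr => i _; rewrite coefMXn ltnNge leq_addr addKn addnA.
Qed.

Lemma eq_act q f f' t : f =1 f' -> act q f t = act q f' t.
Proof. by move=> h; apply: eq_bigr => i _; rewrite h. Qed.

Lemma actM q q' f t : act (q * q') f t = act q (act q' f) t.
Proof.
rewrite mulrC; elim/poly_ind: q' t => [|q' c IH] t.
  by rewrite mul0r act0; apply/esym/big1 => i _; rewrite act0 mulr0.
have e s : act (q' * 'X + c%:P) f s = act q' f (s + 1)%N + c * f s.
  by rewrite actD -['X]expr1 actMXn -[c%:P]mulr1 mul_polyC actZ -(expr0 'X) actXn addn0.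
rewrite mulrDl actD -mulrA (mulrC 'X) mulrA -['X]expr1 actMXn IH mul_polyC actZ expr1.
rewrite (eq_act _ _ e) /act mulr_sumr -big_split; apply: eq_bigr => i _.
by rewrite -/(act q' f _) mulrDr addnAC mulrCA.
Qed.

End PolynomialAction.

Lemma sum_addn (R : nmodType) (G : nat -> R) a b :
  \sum_(a <= i < a + b) G i = \sum_(0 <= i < b) G (i + a)%N.
Proof. by rewrite -{1}[a]add0n big_addn addKn. Qed.

(** * Dyadic averages, Fejer differences and geometric kernels as polynomials of the shift *)

Section Kernels.
Context {R : realType}.
Implicit Types (f g : nat -> R).

(** [dav] and [Rpoly] are a_k and R_k. The field is a parameter because norms are estimated for real
    sequences while T needs complex polynomials; the coefficients are real, so real and imaginary
    parts decouple. *)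
Definition dav (F : fieldType) k : {poly F} := (2 ^+ k)^-1 *: \sum_(0 <= i < 2 ^ k) 'X^i.
Definition Rpoly (F : fieldType) k : {poly F} := dav F k ^+ 3 * (1 - 'X^(2 ^ k)) ^+ 2.

Lemma davS k : dav R k.+1 = dav R k * (2^-1 *: (1 + 'X^(2 ^ k))).
Proof.
rewrite /dav -scalerAl -scalerAr scalerA exprS invfM mulrC; congr (_ *: _).
rewrite expnS mul2n -addnn (@big_cat_nat _ _ _ (2 ^ k))//= ?leq_addr//.
rewrite mulrDr mulr1 mulr_suml; congr (_ + _).
rewrite -{1}(add0n (2 ^ k)%N) big_addn addnK; apply: eq_bigr => i _.
by rewrite exprD.
Qed.

(** The Fejer kernel is symmetric but [act] only looks forward; the translation by 2^k - 1 moves the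
    support of the kernel to nonnegative times. *)
Lemma fejer_act K k f t : (k <= K)%N -> periodic K f ->
  fejer K k f (t + (2 ^ k - 1))%N = act (dav R k ^+ 2) f t.
Proof.
move=> kK pf; have kN : (2 ^ k <= 2 ^ K)%N by rewrite leq_exp2l.
have k0 : (0 < 2 ^ k)%N by rewrite expn_gt0.
rewrite /dav exprZn [X in act (_ *: X)]expr2 mulr_suml actZ act_sum /fejer; congr (_ * _).
  have -> : (4 : R) = 2 * 2 by rewrite -natrM.
  by rewrite exprMn invfM expr2.
rewrite big_nat_rev/= add0n big_nat [RHS]big_nat; apply: eq_bigr => i' /andP[_ ik].
rewrite mulr_sumr act_sum; apply: eq_bigr => i _.
rewrite -exprD actXn -(pf (t + (i' + i))%N); congr f.
lia.
Qed.

(** With X = u_k one has a_{k+1} = a_k (1 + X) / 2, and X - (1 + X)^2 / 4 = - (1 - X)^2 / 4. The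
    extra factor X comes from aligning the two translations 2^k - 1 and 2^(k+1) - 1. *)
Lemma phi_act K k f t : (k < K)%N -> periodic K f ->
  fejer K k f (t + (2 ^ k.+1 - 1))%N - fejer K k.+1 f (t + (2 ^ k.+1 - 1))%N =
  act (- (4^-1 *: (dav R k ^+ 2 * (1 - 'X^(2 ^ k)) ^+ 2))) f t.
Proof.
move=> kK pf; have k0 : (0 < 2 ^ k)%N by rewrite expn_gt0.
rewrite (fejer_act _ kK pf).
have -> : (t + (2 ^ k.+1 - 1) = (t + 2 ^ k) + (2 ^ k - 1))%N by rewrite expnS; lia.
rewrite (fejer_act _ (ltnW kK) pf) -actMXn -actB; congr (act _ f t).
rewrite davS -!scalerAr -mul_polyC.
have -> : (4 : R)^-1 = 2^-1 * 2^-1 by rewrite -invfM -natrM.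
set a := dav R k; set X := 'X^(2 ^ k).
rewrite -!mul_polyC polyCM.
set c := (2^-1)%:P.
have c2 : c + c = 1 by rewrite /c -polyCD -[RHS]polyC1; congr _%:P; lra.
have -> : a ^+ 2 * X = (c + c) * (c + c) * (a ^+ 2 * X) by rewrite c2 !mul1r.
ring.
Qed.

(** For every i' < M the window of length 2^l starting at t - i' contains the B points from t on, so
    the double sum counts each of them at least M times. *)
Lemma fejer_dom K l M B g t : (l <= K)%N -> (M + B <= (2 ^ l).+1)%N -> periodic K g ->
  (forall i, 0 <= g i) ->
  M%:R * \sum_(0 <= n < B) g (t + n)%N <= 4 ^+ l * fejer K l g t.
Proof.
move=> lK MB pg g0; have lN : (2 ^ l <= 2 ^ K)%N by rewrite leq_exp2l.
rewrite /fejer mulrA divff ?expf_neq0// mul1r.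
have [->|M0] := posnP M.
  by rewrite mul0r sumr_ge0// => i _; rewrite sumr_ge0.
have [->|B0] := posnP B.
  by rewrite big_geq// mulr0 sumr_ge0// => i _; rewrite sumr_ge0.
have Ml : (M <= 2 ^ l)%N by lia.
rewrite (@big_cat_nat _ _ _ M 0 (2 ^ l))//= -[leLHS]addr0 lerD//; last first.
  by rewrite sumr_ge0// => i _; rewrite sumr_ge0.
rewrite (_ : M%:R * _ = \sum_(0 <= i' < M) \sum_(0 <= n < B) g (t + n)%N); last first.
  by rewrite big_const_nat subn0 iter_addr addr0 mulr_natl.
apply: ler_sum_nat => i' /andP[_ iM].
have iB : (i' + B <= 2 ^ l)%N by lia.
rewrite (@big_cat_nat _ _ _ i' 0 (2 ^ l))//=; last by lia.
rewrite (@big_cat_nat _ _ _ (i' + B) i' (2 ^ l))//=; last by lia.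
rewrite -[leLHS]add0r lerD ?sumr_ge0//.
rewrite -[leLHS]addr0 lerD ?sumr_ge0//.
rewrite [leRHS]sum_addn le_eqVlt; apply/orP; left; apply/eqP.
apply: eq_bigr => n _; rewrite -(pg (t + n)%N); congr g.
lia.
Qed.


Lemma act_dav k f t : act (dav R k) f t = (2 ^+ k)^-1 * \sum_(0 <= i < 2 ^ k) f (t + i)%N.
Proof.
by rewrite /dav actZ act_sum; congr (_ * _); apply: eq_bigr => i _; rewrite actXn.
Qed.

(** Only two of the three factors a_k go into the Fejer difference. The third stays outside as the
    average that makes the translation harmless in [shifted_avg_le]. *)
Lemma Rpoly_act_out K k f t : (k < K)%N -> periodic K f ->
  act (Rpoly R k) f t = -4 * ((2 ^+ k)^-1 * \sum_(0 <= i < 2 ^ k)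
    (fejer K k f (t + i + (2 ^ k.+1 - 1))%N - fejer K k.+1 f (t + i + (2 ^ k.+1 - 1))%N)).
Proof.
move=> kK pf; pose G s := fejer K k f (s + (2 ^ k.+1 - 1))%N - fejer K k.+1 f (s + (2 ^ k.+1 - 1))%N.
suff : act (Rpoly R k) f t = -4 * act (dav R k) G t by rewrite act_dav.
rewrite -actZ /G.
rewrite [RHS](eq_act _ _ (f' := act (- (4^-1 *: (dav R k ^+ 2 * (1 - 'X^(2 ^ k)) ^+ 2))) f)); last first.
  by move=> s; exact: phi_act.
rewrite -actM; congr act; rewrite /Rpoly -scalerAl mulrN -scalerAr scalerN scalerA.
have -> : -4 * 4^-1 = -1 :> R by lra.
by rewrite scaleN1r opprK; ring.
Qed.

(** The translated window lies among the first 3 2^k points after t. [fejer_dom] with M = 2^k and B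
    = 3 2^k covers these at level k + 2, and 16 is 4^(k+2) / (2^k 2^k). *)
Lemma shifted_avg_le K k g t : (k.+2 <= K)%N -> periodic K g -> (forall i, 0 <= g i) ->
  (2 ^+ k)^-1 * \sum_(0 <= i < 2 ^ k) g (t + i + (2 ^ k.+1 - 1))%N <= 16 * fejer K k.+2 g t.
Proof.
move=> kK pg g0; rewrite ler_pdivrMl ?exprn_gt0//.
have h := @fejer_dom K k.+2 (2 ^ k)%N (3 * 2 ^ k)%N g t kK _ pg g0.
have k0 : (0 < 2 ^ k)%N by rewrite expn_gt0.
have : (2 ^ k)%:R * \sum_(0 <= n < 3 * 2 ^ k) g (t + n)%N <= 4 ^+ k.+2 * fejer K k.+2 g t.
  by apply: h; rewrite !expnS; lia.
rewrite natrX !exprS.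
have -> : (4 : R) ^+ k = 2 ^+ k * 2 ^+ k by rewrite -exprMn -natrM.
rewrite -!mulrA !(mulrCA _ (2 ^+ k)) ler_pM2l ?exprn_gt0// => h'.
apply: (@le_trans _ _ (\sum_(0 <= n < 3 * 2 ^ k) g (t + n)%N)); last first.
  apply: le_trans h' _; rewrite -subr_ge0 le_eqVlt; apply/orP; left; apply/eqP; ring.
rewrite (@big_cat_nat _ _ _ (2 ^ k.+1 - 1) 0 (3 * 2 ^ k))//=; last by rewrite expnS; lia.
rewrite (@big_cat_nat _ _ _ (3 * 2 ^ k - 1) (2 ^ k.+1 - 1) (3 * 2 ^ k))//=; last 2 first.
  - by rewrite expnS; lia.
  - by lia.
rewrite -[leLHS]add0r lerD ?sumr_ge0// -[leLHS]addr0 lerD ?sumr_ge0//.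
have -> : (3 * 2 ^ k - 1 = (2 ^ k.+1 - 1) + 2 ^ k)%N by rewrite expnS; lia.
rewrite [leRHS]sum_addn.
by rewrite le_eqVlt; apply/orP; left; apply/eqP; apply: eq_bigr => i _; rewrite addnA.
Qed.

Lemma shifted_avg_dom k g t l K : (l < K)%N -> periodic K g -> (forall i, 0 <= g i) -> k = l ->
  (2 ^+ l)^-1 * \sum_(0 <= i < 2 ^ l) g (t + i)%N <= 4 * fejer K l.+1 g t.
Proof.
move=> lK pg g0 _; rewrite ler_pdivrMl ?exprn_gt0//.
have h := @fejer_dom K l.+1 (2 ^ l)%N (2 ^ l)%N g t lK _ pg g0.
have : (2 ^ l)%:R * \sum_(0 <= n < 2 ^ l) g (t + n)%N <= 4 ^+ l.+1 * fejer K l.+1 g t.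
  by apply: h; rewrite expnS; lia.
rewrite natrX !exprS.
have -> : (4 : R) ^+ l = 2 ^+ l * 2 ^+ l by rewrite -exprMn -natrM.
by rewrite -!mulrA !(mulrCA _ (2 ^+ l)) ler_pM2l ?exprn_gt0.
Qed.

Lemma bernoulli_ineq (x : R) n : 0 <= x -> 1 + n%:R * x <= (1 + x) ^+ n.
Proof.
move=> x0; elim: n => [|n IH]; first by rewrite mul0r addr0.
rewrite exprS -natr1; have n0 : (0 : R) <= n%:R by [].
have : (1 + x) * (1 + n%:R * x) <= (1 + x) * (1 + x) ^+ n.
  by apply: ler_wpM2l => //; lra.
by nra.
Qed.

Lemma geom_dom (eta : R) : 0 < eta -> exists l : nat, forall m n, (n < 2 ^ (l + m))%N ->
  eta / (1 + eta) ^+ n.+1 <= \sum_(0 <= i < m.+1) 16 / 2 ^+ i * ((2 ^+ (l + i))^-1 * (n < 2 ^ (l + i))%N%:R).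
Proof.
move=> e0.
have [l0 hl0] : exists l : nat, eta^-1 <= 2 ^+ l.
  exists (Num.bound eta^-1); rewrite ltW// (lt_le_trans (archi_boundP _)) ?invr_ge0 ?ltW//.
  by rewrite -natrX ltr_nat ltn_expl.
have ex : exists l, eta^-1 <= 2 ^+ l by exists l0.
case: (ex_minnP ex) => l hl lmin {l0 hl0 ex}; exists l => m n.
have hl' : (2 ^+ l)^-1 <= eta by rewrite -[leRHS]invrK lef_pV2 ?posrE ?invr_gt0 ?exprn_gt0.
have e1 : 0 < 1 + eta by lra.
elim: m => [|m IH].
  rewrite addn0 big_nat1 addn0 => nl; rewrite nl mulr1 expr0 divr1.
  have : eta / (1 + eta) ^+ n.+1 <= eta / (1 + eta).
    by rewrite ler_pM2l// lef_pV2 ?posrE ?exprn_gt0// ler_eXnr//; lra.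
  move/le_trans; apply.
  case: l hl hl' lmin nl => [|l] hl hl' lmin nl.
    by rewrite expr0 invr1 mulr1 ler_pdivrMr//; lra.
  have : ~~ (eta^-1 <= 2 ^+ l) by apply/negP => /lmin; rewrite ltnn.
  rewrite -ltNge => h.
  have : eta < (2 ^+ l)^-1 by rewrite -[ltLHS]invrK ltf_pV2 ?posrE ?invr_gt0 ?exprn_gt0.
  rewrite exprS invfM => h1.
  have : eta / (1 + eta) <= eta by rewrite ler_pdivrMr// ler_peMr ?ltW//; lra.
  lra.
rewrite addnS expnS => nl.
rewrite big_nat_recr//=.
have s0 : 0 <= \sum_(0 <= i < m.+1) 16 / 2 ^+ i * ((2 ^+ (l + i))^-1 * (n < 2 ^ (l + i))%N%:R : R).
  by apply: sumr_ge0 => i _; rewrite !mulr_ge0 ?invr_ge0 ?exprn_ge0.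
have [nl'|ln] := ltnP n (2 ^ (l + m)).
  by rewrite (le_trans (IH nl'))// lerDl !mulr_ge0 ?invr_ge0 ?exprn_ge0.
rewrite -[leLHS]add0r lerD//.
rewrite addnS expnS nl mulr1.
have n1 : (0 < n)%N by rewrite (leq_trans _ ln)// expn_gt0.
have n0 : (0 : R) < n%:R by rewrite ltr0n.
(* Bernoulli's inequality at half the exponent, squared. *)
have key : (n%:R * eta) ^+ 2 / 4 <= (1 + eta) ^+ n.+1.
  have hh : (n <= 2 * uphalf n <= n.+1)%N by lia.
  have : 1 + (uphalf n)%:R * eta <= (1 + eta) ^+ uphalf n by exact: bernoulli_ineq (ltW e0).
  have : n%:R <= 2 * (uphalf n)%:R :> R by rewrite -natrM ler_nat; case/andP: hh.
  have : (1 + eta) ^+ (uphalf n * 2) <= (1 + eta) ^+ n.+1.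
    by apply: ler_weXn2l; [lra|rewrite mulnC; case/andP: hh].
  rewrite exprM; set y := (1 + eta) ^+ uphalf n; set z := (1 + eta) ^+ n.+1 => h1 h2 h3.
  have h4 : n%:R * eta / 2 <= y by nra.
  have h5 : 0 <= n%:R * eta by rewrite mulr_ge0 ?ltW.
  nra.
rewrite ler_pdivrMr ?exprn_gt0//.
apply: le_trans (ler_wpM2l _ key); last first.
  by rewrite !mulr_ge0 ?invr_ge0 ?exprn_ge0.
have hn : 2 ^+ l * 2 ^+ m <= n%:R :> R by rewrite -exprD -natrX ler_nat.
rewrite (exprS 2 m) (exprS 2 (l + m)) exprD.
have l1 : 1 <= 2 ^+ l * eta by rewrite -ler_pdivrMr// div1r.
set x := (2 ^+ l : R) in hn l1 *; set y := (2 ^+ m : R) in hn *.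
have x0 : 0 < x by rewrite exprn_gt0.
have y0 : 0 < y by rewrite exprn_gt0.
have -> : 16 / (2 * y) * (2 * (x * y))^-1 * ((n%:R * eta) ^+ 2 / 4) = (n%:R / (x * y)) ^+ 2 * (x * eta) * eta.
  by field; rewrite !gt_eqF.
have : 1 <= n%:R / (x * y) by rewrite ler_pdivlMr ?mulr_gt0// mul1r.
set w := n%:R / (x * y) => w1.
have w2 : 1 <= w ^+ 2 by rewrite exprn_ege1.
rewrite -{1}(mul1r eta) ler_pM2r// -[leLHS]mulr1 ler_pM//; lra.
Qed.

End Kernels.

(** * Finite l^1, l^2 and l^oo norms of complex families *)

Inductive lq := l1 | l2 | loo.

Section LatticeNorms.
Context {R : realType}.
Local Notation C := R[i].

Definition lnorm (q : lq) (A : Type) (r : seq A) (v : A -> C) : R :=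
  match q with
  | l1 => \sum_(a <- r) normc (v a)
  | l2 => enorm r (fun a => normc (v a))
  | loo => \big[Num.max/0]_(a <- r) normc (v a)
  end.

Lemma normc_ge0 (z : C) : 0 <= normc z.
Proof. by case: z => a b; rewrite sqrtr_ge0. Qed.

Lemma ler_normcD (x y : C) : normc (x + y) <= normc x + normc y.
Proof. exact: (@le_normcD R x y). Qed.

Lemma normc_sqr (z : C) : normc z ^+ 2 = complex.Re z ^+ 2 + complex.Im z ^+ 2.
Proof. by case: z => a b; rewrite /= sqr_sqrtr// addr_ge0 ?sqr_ge0. Qed.

Lemma normc_real (x : R) : normc (x%:C)%C = `|x|.
Proof. by rewrite /= expr0n/= addr0 sqrtr_sqr. Qed.

Lemma normcN' (x : C) : normc (- x) = normc x.
Proof. exact: (@normcN R x). Qed.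

Lemma bigmax_ge (A : Type) (r : seq A) (v : A -> R) : 0 <= \big[Num.max/0]_(a <- r) v a.
Proof. by elim: r => [|a r IH]; rewrite ?big_nil// big_cons le_max IH orbT. Qed.

Lemma lnorm_ge0 q (A : Type) (r : seq A) v : 0 <= lnorm q r v.
Proof.
case: q => /=; first by apply: sumr_ge0 => a _; exact: normc_ge0.
- exact: enorm_ge0.
- exact: bigmax_ge.
Qed.

Lemma enorm_homo (A : Type) (r : seq A) (v w : A -> R) :
  (forall a, 0 <= v a) -> (forall a, v a <= w a) -> enorm r v <= enorm r w.
Proof. by move=> v0 h; apply: le_enorm => a; rewrite ger0_norm. Qed.

Lemma bigmax_homo (A : Type) (r : seq A) (v w : A -> R) :
  (forall a, v a <= w a) -> \big[Num.max/0]_(a <- r) v a <= \big[Num.max/0]_(a <- r) w a.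
Proof.
move=> h; elim: r => [|a r IH]; rewrite ?big_nil// !big_cons.
by rewrite ge_max !le_max h IH orbT.
Qed.

Lemma bigmaxD (A : Type) (r : seq A) (v w : A -> R) :
  \big[Num.max/0]_(a <- r) (v a + w a) <= \big[Num.max/0]_(a <- r) v a + \big[Num.max/0]_(a <- r) w a.
Proof.
elim: r => [|a r IH]; rewrite ?big_nil ?addr0// !big_cons ge_max; apply/andP; split.
  by apply: lerD; rewrite le_max lexx.
by apply: (le_trans IH); apply: lerD; rewrite le_max lexx orbT.
Qed.

Lemma lnormD q (A : Type) (r : seq A) v w :
  lnorm q r (fun a => v a + w a) <= lnorm q r v + lnorm q r w.
Proof.
case: q => /=.
- by rewrite -big_split; apply: ler_sum => a _; exact: ler_normcD.
- apply: le_trans (enormD _ _ _); apply: enorm_homo => a; first exact: normc_ge0.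
  exact: ler_normcD.
- apply: le_trans (bigmaxD _ _ _); apply: bigmax_homo => a; exact: ler_normcD.
Qed.

Lemma bigmaxZ (A : Type) (r : seq A) (c : R) (v : A -> R) : 0 <= c ->
  \big[Num.max/0]_(a <- r) (c * v a) = c * \big[Num.max/0]_(a <- r) v a.
Proof.
move=> c0; elim: r => [|a r IH]; first by rewrite !big_nil mulr0.
by rewrite !big_cons IH maxr_pMr.
Qed.

Lemma lnormZ q (A : Type) (r : seq A) (c : C) v :
  lnorm q r (fun a => c * v a) = normc c * lnorm q r v.
Proof.
case: q => /=.
- by rewrite mulr_sumr; apply: eq_bigr => a _; rewrite normcM.
- rewrite (eq_enorm r (b := fun a => normc c * normc (v a))).
    by rewrite enormZ ger0_norm ?normc_ge0.
  by move=> a; rewrite normcM.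
- by under eq_bigr do rewrite normcM; rewrite bigmaxZ ?normc_ge0.
Qed.

Lemma lnorm_le1 q (A : Type) (r : seq A) v : lnorm q r v <= \sum_(a <- r) normc (v a).
Proof.
case: q => //=; elim: r => [|a r IH].
- by rewrite /enorm !big_nil sqrtr0.
- rewrite big_cons -(ler_pXn2r (n := 2))// ?nnegrE ?enorm_ge0 ?addr_ge0 ?normc_ge0 ?sumr_ge0//; last first.
    by move=> *; exact: normc_ge0.
  rewrite sqr_enorm big_cons -sqr_enorm.
  have := normc_ge0 (v a); have := enorm_ge0 r (fun a => normc (v a)).
  by move: IH; set x := normc _; set y := enorm _ _; set z := \sum_(_ <- _) _; nra.
- by rewrite !big_nil.
- rewrite !big_cons ge_max lerDl; apply/andP; split.
    by apply: sumr_ge0 => *; exact: normc_ge0.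
  by apply: (le_trans IH); rewrite lerDr normc_ge0.
Qed.

Lemma lnorm0 q (A : Type) (r : seq A) : lnorm q r (fun _ => 0) = 0.
Proof.
apply/eqP; rewrite eq_le lnorm_ge0 andbT (le_trans (lnorm_le1 _ _ _))//.
by rewrite big1// => a _; rewrite normc0.
Qed.

Lemma eq_lnorm q (A : Type) (r : seq A) v w : v =1 w -> lnorm q r v = lnorm q r w.
Proof. by move=> h; congr lnorm; apply/funext. Qed.

Lemma lnorm_sum q (A I : Type) (r : seq A) (s : seq I) (w : I -> C) (v : I -> A -> C) :
  lnorm q r (fun a => \sum_(i <- s) w i * v i a) <= \sum_(i <- s) normc (w i) * lnorm q r (v i).
Proof.
elim: s => [|i s IH].
  by rewrite big_nil (eq_lnorm _ _ (w := fun=> 0)) ?lnorm0// => a; rewrite big_nil.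
rewrite big_cons (eq_lnorm _ _ (w := fun a => w i * v i a + \sum_(j <- s) w j * v j a)).
  by apply: le_trans (lnormD _ _ _ _) _; rewrite lnormZ lerD2l.
by move=> a; rewrite big_cons.
Qed.

Lemma le_lnorm q (A : Type) (r : seq A) v w :
  (forall a, normc (v a) <= normc (w a)) -> lnorm q r v <= lnorm q r w.
Proof.
case: q => /= h; first by apply: ler_sum.
- by apply: enorm_homo => // a; exact: normc_ge0.
- exact: bigmax_homo.
Qed.

Lemma lnorm_seq1 q (A : Type) (a : A) v : lnorm q [:: a] v = normc (v a).
Proof.
case: q => /=; rewrite ?big_seq1//.
- by rewrite /enorm big_seq1 sqrtr_sqr ger0_norm ?normc_ge0.
- by rewrite big_cons big_nil (max_idPl (normc_ge0 _)).
Qed.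

(** A complex family as a real one over a doubled index set with the same l^2-norm; real
    vector-valued estimates for kernels with real coefficients then give the complex ones. *)
Definition cpair (A : Type) (v : A -> C) (ab : A * bool) : R :=
  if ab.2 then complex.Re (v ab.1) else complex.Im (v ab.1).
Definition cseq (A : Type) (r : seq A) : seq (A * bool) := [seq (a, b) | a <- r, b <- [:: true; false]].

Lemma enorm_cpair (A : Type) (r : seq A) v : enorm (cseq r) (cpair v) = lnorm l2 r v.
Proof.
rewrite /= /enorm; congr Num.sqrt; rewrite big_allpairs_dep; apply: eq_bigr => a _.
by rewrite !big_cons big_nil /cpair /= addr0 normc_sqr.
Qed.

End LatticeNorms.

Section ComplexKernels.
Context {R : realType}.
Local Notation C := R[i].

Lemma RpolyC k : Rpoly C k = map_poly (real_complex R) (Rpoly R k).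
Proof.
have e n : map_poly (real_complex R) 'X^n = 'X^n by rewrite rmorphXn/= map_polyX.
have ed : map_poly (real_complex R) (dav R k) = dav C k.
  rewrite /dav map_polyZ/= rmorph_sum/=; congr (_ *: _).
    by rewrite rmorphV/= ?rmorphXn/= ?rmorph_nat ?unitfE ?expf_neq0.
  by apply: eq_bigr => i _; rewrite e.
by rewrite /Rpoly rmorphM/= !(rmorphXn (map_poly (real_complex R)))/= rmorphB rmorph1/= e ed.
Qed.

Lemma act_Re (q : {poly R}) (f : nat -> C) t :
  complex.Re (act (map_poly (real_complex R) q) f t) = act q (fun s => complex.Re (f s)) t.
Proof.
rewrite (@act_wide _ _ _ _ (size q)); last by rewrite size_poly.
rewrite /act raddf_sum/=; apply: eq_bigr => i _; rewrite coef_map/=.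
by case: (f _) => a b /=; rewrite mul0r subr0.
Qed.

Lemma act_Im (q : {poly R}) (f : nat -> C) t :
  complex.Im (act (map_poly (real_complex R) q) f t) = act q (fun s => complex.Im (f s)) t.
Proof.
rewrite (@act_wide _ _ _ _ (size q)); last by rewrite size_poly.
rewrite /act raddf_sum/=; apply: eq_bigr => i _; rewrite coef_map/=.
by case: (f _) => a b /=; rewrite mul0r addr0.
Qed.



End ComplexKernels.

(** * Estimates for R_k and for geometric kernels on periodic sequences *)

Section KernelInequalities.
Context {R : realType}.
Local Notation C := R[i].

Lemma enorm_cat (I : Type) (r1 r2 : seq I) (v : I -> R) : enorm r1 v <= enorm (r1 ++ r2) v.
Proof. by rewrite /enorm ler_wsqrtr// big_cat lerDl sumsq_ge0. Qed.

Lemma ler_enorm_seq (m : nat) (v w : nat -> R) : (forall k, (k < m)%N -> 0 <= v k <= w k) ->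
  enorm (index_iota 0 m) v <= enorm (index_iota 0 m) w.
Proof.
move=> h; rewrite /enorm ler_wsqrtr//; apply: ler_sum_nat => k /andP[_ km].
by have /andP[v0 vw] := h k km; rewrite lerXn2r ?nnegrE// (le_trans v0 vw).
Qed.

Lemma index_iota_cat m n : (m <= n)%N -> index_iota 0 n = index_iota 0 m ++ index_iota m n.
Proof. by move=> mn; rewrite /index_iota !subn0 -{1}(subnKC mn) iotaD. Qed.

Lemma Rpoly_dom K k (J : Type) (r : seq J) (u : nat -> J -> R) t :
  (k.+2 <= K)%N -> periodic K u ->
  enorm r (fun j => act (Rpoly R k) (u^~ j) t) <=
  64 * fejer K k.+2 (fun s => enorm r (phi K k u s)) t.
Proof.
move=> kK pu; have kK1 : (k < K)%N by exact: ltnW.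
rewrite (eq_enorm r (b := fun j => \sum_(0 <= i < 2 ^ k) (-4 * (2 ^+ k)^-1) * phi K k u (t + i + (2 ^ k.+1 - 1))%N j)); last first.
  move=> j; rewrite (Rpoly_act_out _ kK1); last by move=> s; rewrite pu.
  by rewrite mulrA mulr_sumr.
apply: le_trans (enorm_sum _ _ _ _) _.
rewrite -mulr_sumr normrM normrN (ger0_norm (x := 4))// ger0_norm ?invr_ge0 ?exprn_ge0//.
rewrite -mulrA; have -> : 64 = 4 * 16 :> R by rewrite -natrM.
rewrite -[leRHS]mulrA ler_pM2l//; apply: shifted_avg_le => //.
- move=> s; apply: eq_enorm => j; congr (_ - _); rewrite /vfejer periodic_fejer//.
    by move=> s'; rewrite pu.
  by move=> s'; rewrite pu.
- by move=> s; exact: enorm_ge0.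
Qed.

(** [Rpoly_dom] leaves Fejer means of the norms of [phi]. Stein's inequality removes the means and
    [square_phi] does the rest. The condition m + 2 <= K makes room for the levels k + 2. *)
Lemma square_kernel_real (p : R) : 1 < p -> exists2 A : R, 0 < A &
  forall m K (J : Type) (r : seq J) (u : nat -> J -> R), (m.+2 <= K)%N -> periodic K u ->
  \sum_(0 <= t < 2 ^ K) enorm (index_iota 0 m) (fun k => enorm r (fun j => act (Rpoly R k) (u^~ j) t)) `^ p
  <= A * \sum_(0 <= t < 2 ^ K) enorm r (u t) `^ p.
Proof.
move=> p1; have p0 : 0 < p by apply: lt_trans p1.
have [A A0 hA] := square_phi p1; have [B B0 hB] := fejer_l2 p1.
exists (64 `^ p * (B * A)); first by rewrite !mulr_gt0// powR_gt0.
move=> m K J r u mK pu.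
pose g k s := enorm r (phi K k u s).
have pg k : periodic K (g k).
  by move=> t; rewrite /g periodic_phi.
(* Stein's inequality wants admissible levels for all indices; for k < m the minimum is k + 2. *)
pose l k := minn k.+2 K.
apply: (@le_trans _ _ (\sum_(0 <= t < 2 ^ K) 64 `^ p * enorm (index_iota 0 m) (fun k => fejer K (l k) (g k) t) `^ p)).
  apply: ler_sum => t _; rewrite -powRM ?enorm_ge0//.
  apply: powR_le; [exact: ltW|exact: enorm_ge0|].
  rewrite -[X in X * _](ger0_norm (x := 64))// -enormZ.
  apply: ler_enorm_seq => k km; rewrite enorm_ge0/=.
  have kK : (k.+2 <= K)%N by lia.
  by rewrite /l (minn_idPl kK); exact: Rpoly_dom.
rewrite -mulr_sumr -mulrA ler_pM2l ?powR_gt0// -mulrA.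
apply: le_trans (hB K _ _ l g _ pg) _; first by move=> k; rewrite geq_minr.
rewrite ler_pM2l//; apply: le_trans (hA K J r u pu); apply: ler_sum => t _.
apply: powR_le; [exact: ltW|exact: enorm_ge0|].
rewrite (@index_iota_cat m K); last by lia.
exact: enorm_cat.
Qed.

(** The same two tools in the opposite order: the outer average a_k is applied to the input first,
    giving [G k], so that [dual_phi] acts on the outside and Stein's inequality on the averaged
    inputs. *)
Lemma dual_kernel_real (p : R) : 1 < p -> exists2 A : R, 0 < A &
  forall m K (J : Type) (r : seq J) (g : nat -> nat -> J -> R), (m.+2 <= K)%N ->
  (forall k, periodic K (g k)) ->
  \sum_(0 <= t < 2 ^ K) enorm r (fun j => \sum_(0 <= k < m) act (Rpoly R k) (fun s => g k s j) t) `^ p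
  <= A * \sum_(0 <= t < 2 ^ K) enorm (index_iota 0 m) (fun k => enorm r (g k t)) `^ p.
Proof.
move=> p1; have p0 : 0 < p by apply: lt_trans p1.
have [A A0 hA] := dual_phi p1; have [B B0 hB] := fejer_l2 p1.
exists (A * (64 `^ p * B)); first by rewrite !mulr_gt0// powR_gt0.
move=> m K J r g mK pg.
pose G k s j := if (k < m)%N then \sum_(0 <= i < 2 ^ k) (-4 * (2 ^+ k)^-1) * g k (s + i + (2 ^ k.+1 - 1))%N j else 0.
have pG k : periodic K (G k).
  move=> s; apply/funext => j; rewrite /G; case: ifP => // _; apply: eq_bigr => i _; congr (_ * _).
  by rewrite -(pg k (s + i + (2 ^ k.+1 - 1))%N); congr (g k _ j); lia.
have actE k t j : (k < m)%N -> act (Rpoly R k) (fun s => g k s j) t = phi K k (G k) t j.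
  move=> km; have kK : (k < K)%N by lia.
  rewrite (Rpoly_act_out _ kK); last by move=> s; rewrite pg.
  rewrite /phi /vfejer /G km !fejer_sumr -sumrB mulrA mulr_sumr; apply: eq_bigr => i _.
  rewrite !fejerZ -mulrBr; congr (_ * (_ - _)).
    congr (_ * _); apply: eq_bigr => i1 _; apply: eq_bigr => i2 _.
    by congr (g k _ j); lia.
  congr (_ * _); apply: eq_bigr => i1 _; apply: eq_bigr => i2 _.
  by congr (g k _ j); lia.
have GE t j : \sum_(0 <= k < m) act (Rpoly R k) (fun s => g k s j) t = \sum_(0 <= k < K) phi K k (G k) t j.
  rewrite [RHS](@big_cat_nat _ _ _ m)//=; last by lia.
  rewrite [X in _ = _ + X]big_nat [X in _ = _ + X]big1 ?addr0.
    by rewrite !big_nat; apply: eq_bigr => k /andP[_ km]; rewrite actE.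
  move=> k /andP[mk _]; rewrite /phi /vfejer /G ltnNge mk/=.
  by rewrite !fejer_cst subrr.
under eq_bigr do rewrite (eq_enorm r (GE _)).
apply: le_trans (hA K J r G pG) _; rewrite -mulrA ler_pM2l//.
pose l k := minn k.+2 K.
pose h k s := enorm r (g k s).
have ph k : periodic K (h k) by move=> t; rewrite /h pg.
apply: (@le_trans _ _ (\sum_(0 <= t < 2 ^ K) 64 `^ p * enorm (index_iota 0 m) (fun k => fejer K (l k) (h k) t) `^ p)).
  apply: ler_sum => t _; rewrite -powRM ?enorm_ge0//.
  apply: powR_le; [exact: ltW|exact: enorm_ge0|].
  rewrite (@index_iota_cat m K); last by lia.
  rewrite /enorm big_cat/= [X in _ + X]big_nat [X in _ + X]big1 ?addr0; last first.
    by move=> k /andP[mk _]; rewrite /G ltnNge mk/= big1 ?sqrtr0 ?expr0n// => j _; rewrite expr0n.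
  rewrite -[X in X * _](ger0_norm (x := 64))// -enormZ -/(enorm _ _).
  apply: ler_enorm_seq => k km; rewrite enorm_ge0/=.
  have kK : (k.+2 <= K)%N by lia.
  rewrite /l (minn_idPl kK) /G km.
  apply: le_trans (enorm_sum _ _ (fun=> -4 * (2 ^+ k)^-1) (fun i j => g k (t + i + (2 ^ k.+1 - 1))%N j)) _.
  rewrite -mulr_sumr normrM normrN (ger0_norm (x := 4))// ger0_norm ?invr_ge0 ?exprn_ge0//.
  rewrite -mulrA; have -> : 64 = 4 * 16 :> R by rewrite -natrM.
  rewrite -[leRHS]mulrA ler_pM2l//; apply: (@shifted_avg_le _ K k (h k)) => //.
  by move=> s; exact: enorm_ge0.
rewrite -mulr_sumr -mulrA ler_pM2l ?powR_gt0//.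
by apply: (hB K _ _ l h _ ph) => k; rewrite geq_minr.
Qed.


Lemma act_RpolyC_norm k (A : Type) (f : nat -> A -> C) (r : seq A) t :
  lnorm l2 r (fun a => act (Rpoly C k) (f^~ a) t) =
  enorm (cseq r) (fun ab => act (Rpoly R k) (fun s => cpair (f s) ab) t).
Proof.
rewrite -enorm_cpair; apply: eq_enorm => -[a b]; rewrite /cpair/= RpolyC.
by case: b; rewrite ?act_Re ?act_Im.
Qed.

Lemma square_kernel (p : R) : 1 < p -> exists2 A : R, 0 < A &
  forall m K (f : nat -> unit -> C), (m.+2 <= K)%N -> periodic K f ->
  \sum_(0 <= t < 2 ^ K) lnorm l2 (index_iota 0 m) (fun k => act (Rpoly C k) (f^~ tt) t) `^ p
  <= A * \sum_(0 <= t < 2 ^ K) lnorm l2 [:: tt] (f t) `^ p.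
Proof.
move=> p1; have [A A0 hA] := square_kernel_real p1; exists A => // m K f mK pf.
have := hA m K _ (cseq [:: tt]) (fun s => cpair (f s)) mK.
under [X in (_ -> _ <= _ * X) -> _]eq_bigr do rewrite enorm_cpair.
move=> h; apply: le_trans (h _); last by move=> t; rewrite pf.
rewrite le_eqVlt; apply/orP; left; apply/eqP; apply: eq_bigr => t _; congr (_ `^ _).
apply: eq_enorm => k; rewrite -act_RpolyC_norm.
by rewrite lnorm_seq1.
Qed.

Lemma dual_kernel (p : R) : 1 < p -> exists2 A : R, 0 < A &
  forall m K (B : Type) (rb : seq B) (f : nat -> nat * B -> C), (m.+2 <= K)%N -> periodic K f ->
  \sum_(0 <= t < 2 ^ K) lnorm l2 rb
     (fun b => \sum_(k <- index_iota 0 m) act (Rpoly C k) (f^~ (k, b)) t) `^ p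
  <= A * \sum_(0 <= t < 2 ^ K) lnorm l2 [seq (k, b) | k <- index_iota 0 m, b <- rb] (f t) `^ p.
Proof.
move=> p1; have [A A0 hA] := dual_kernel_real p1; exists A => // m K B rb f mK pf.
pose g k s (bb : B * bool) := cpair (fun b => f s (k, b)) bb.
have pg k : periodic K (g k) by move=> t; rewrite /g pf.
have := hA m K _ (cseq rb) g mK pg.
rewrite (_ : \sum_(0 <= t < 2 ^ K) enorm (index_iota 0 m) (fun k => enorm (cseq rb) (g k t)) `^ p =
  \sum_(0 <= t < 2 ^ K) lnorm l2 [seq (k, b) | k <- index_iota 0 m, b <- rb] (f t) `^ p); last first.
  apply: eq_bigr => t _; congr (_ `^ _); rewrite /= /enorm; congr Num.sqrt.
  rewrite big_allpairs_dep; apply: eq_bigr => k _.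
  by rewrite -[X in X ^+ 2]/(enorm _ _) /g enorm_cpair sqr_enorm.
apply: le_trans; rewrite le_eqVlt; apply/orP; left; apply/eqP; apply: eq_bigr => t _; congr (_ `^ _).
rewrite -enorm_cpair; apply: eq_enorm => -[b bb]; rewrite /cpair/=.
case: bb; rewrite raddf_sum/=; apply: eq_bigr => k _; rewrite RpolyC.
  by rewrite act_Re.
by rewrite act_Im.
Qed.

Lemma normc_sum (I : Type) (r : seq I) (F : I -> C) :
  normc (\sum_(i <- r) F i) <= \sum_(i <- r) normc (F i).
Proof.
elim: r => [|i r IH]; first by rewrite !big_nil normc0.
by rewrite !big_cons (le_trans (ler_normcD _ _))// lerD2l.
Qed.

Lemma bigmax_le_seq (A : eqType) (r : seq A) (v : A -> R) x : 0 <= x ->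
  (forall a, a \in r -> v a <= x) -> \big[Num.max/0]_(a <- r) v a <= x.
Proof.
move=> x0; elim: r => [|a r IH] h; rewrite ?big_nil// big_cons ge_max h ?mem_head//=.
by apply: IH => b br; apply: h; rewrite inE br orbT.
Qed.

Lemma sum_half m : \sum_(0 <= i < m) ((2 : R) ^+ i)^-1 <= 2.
Proof.
suff : \sum_(0 <= i < m) ((2 : R) ^+ i)^-1 = 2 - 2 * (2 ^+ m)^-1.
  by move=> ->; rewrite gerBl mulr_ge0 ?invr_ge0 ?exprn_ge0.
elim: m => [|m IH]; first by rewrite big_geq// expr0 invr1; ring.
by rewrite big_nat_recr//= IH exprS invfM; lra.
Qed.

(* A polynomial dominated by a geometric kernel acts boundedly on L^p(l^q) for q = 1 and q = oo. *)
Lemma geometric_kernel (p : R) q : 1 < p -> q <> l2 -> exists2 D : R, 0 < D &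
  forall (A : finType) (r : seq A) (c : A -> {poly C}) (eta : A -> R) (M : R), 0 < M ->
  (forall a, 0 < eta a) ->
  (forall a n, normc (c a)`_n <= M * (eta a / (1 + eta a) ^+ n.+1)) ->
  exists K0, forall K (f : nat -> A -> C), (K0 <= K)%N -> periodic K f ->
  \sum_(0 <= t < 2 ^ K) lnorm q r (fun a => act (c a) (f^~ a) t) `^ p
  <= (D * M) `^ p * \sum_(0 <= t < 2 ^ K) lnorm q r (f t) `^ p.
Proof.
move=> p1 q2; have p0 : 0 < p by apply: lt_trans p1.
have [A1 A10 hA1] := fejer_l1 p1; have [A2 A20 hA2] := Mx_bound p1.
exists (128 * (A1 + A2) `^ p^-1); first by rewrite mulr_gt0// powR_gt0// addr_gt0.
move=> A r c eta M M0 e0 cM.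
have /choice[l hl] : forall a, exists l : nat, forall m n, (n < 2 ^ (l + m))%N ->
  eta a / (1 + eta a) ^+ n.+1 <= \sum_(0 <= i < m.+1) 16 / 2 ^+ i * ((2 ^+ (l + i))^-1 * (n < 2 ^ (l + i))%N%:R).
  by move=> a; exact: geom_dom (e0 a).
(* All coefficient indices are below m, hence below 2^(l a + m), the range of [geom_dom]; the bound
   on K then makes room for every level l a + i + 1. *)
pose m := \max_a size (c a).
pose lm := \max_a l a.
exists (lm + m).+1 => K f KK pf.
pose lev (a : A) i := minn (l a + i).+1 K.
pose g (ai : A * nat) t := normc (f t ai.1).
have pg ai : periodic K (g ai) by move=> t; rewrite /g pf.
have g0 ai t : 0 <= g ai t by exact: normc_ge0.
have sm a : (size (c a) <= m)%N by rewrite /m (bigD1 a)//= leq_maxl.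
have ll a : (l a <= lm)%N by rewrite /lm (bigD1 a)//= leq_maxl.
have pt (a : A) t : normc (act (c a) (f^~ a) t) <= M * \sum_(0 <= i < m.+1) 64 / 2 ^+ i * fejer K (lev a i) (g (a, 0%N)) t.
  rewrite (act_wide _ _ (sm a)).
  rewrite -(big_mkord xpredT (fun i => (c a)`_i * f (t + i)%N a)).
  apply: (le_trans (normc_sum _ _)).
  apply: (@le_trans _ _ (\sum_(0 <= n < m) M * \sum_(0 <= i < m.+1) 16 / 2 ^+ i * ((2 ^+ (l a + i))^-1 * (n < 2 ^ (l a + i))%N%:R) * g (a, 0%N) (t + n)%N)).
    apply: ler_sum_nat => n /andP[_ nm]; rewrite normcM.
    apply: (@le_trans _ _ (M * (eta a / (1 + eta a) ^+ n.+1) * g (a, 0%N) (t + n)%N)).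
      by apply: ler_wpM2r; [exact: normc_ge0|exact: cM].
    rewrite -mulrA ler_pM2l// -mulr_suml ler_wpM2r//; apply: hl.
    by rewrite (ltn_trans nm)// (leq_trans (ltn_expl m (ltnSn 1)))// leq_exp2l// leq_addl.
  rewrite -mulr_sumr ler_pM2l// exchange_big_nat/=; apply: ler_sum_nat => i /andP[_ im].
  have lK : (l a + i < K)%N by have := ll a; lia.
  rewrite /lev (minn_idPl lK).
  rewrite (eq_bigr (fun n => 16 / 2 ^+ i * ((2 ^+ (l a + i))^-1 * ((n < 2 ^ (l a + i))%N%:R * g (a, 0%N) (t + n)%N)))); last first.
    by move=> n _; ring.
  rewrite -!mulr_sumr.
  have -> : 64 / 2 ^+ i = 16 / 2 ^+ i * 4 :> R by lra.
  rewrite -[leRHS]mulrA ler_wpM2l ?mulr_ge0 ?invr_ge0 ?exprn_ge0//.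
  apply: le_trans (shifted_avg_dom t lK (pg (a, 0%N)) (g0 (a, 0%N)) erefl).
  rewrite ler_wpM2l ?invr_ge0 ?exprn_ge0//.
  have [mm|mm] := leqP m (2 ^ (l a + i)).
    rewrite [leRHS](@big_cat_nat _ _ _ m)//= -[leLHS]addr0 lerD ?sumr_ge0//.
    by apply: ler_sum_nat => n _; rewrite ler_piMl// lern1 leq_b1.
  rewrite (@big_cat_nat _ _ _ (2 ^ (l a + i)))//=; last exact: ltnW.
  rewrite [X in _ + X]big_nat [X in _ + X]big1 ?addr0; last first.
    by move=> n /andP[mn _]; rewrite ltnNge mn mul0r.
  by apply: ler_sum_nat => n _; rewrite ler_piMl// lern1 leq_b1.
have half : \sum_(0 <= i < m.+1) 64 / 2 ^+ i <= 128 :> R.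
  by rewrite -mulr_sumr; have := sum_half m.+1; lra.
have cst0 : 0 <= (128 * (A1 + A2) `^ p^-1 * M) by rewrite !mulr_ge0 ?powR_ge0// ltW.
have cstE : (128 * (A1 + A2) `^ p^-1 * M) `^ p = (A1 + A2) * (128 * M) `^ p.
  rewrite (_ : 128 * _ * M = (A1 + A2) `^ p^-1 * (128 * M)); last by ring.
  rewrite powRM ?powR_ge0 ?mulr_ge0// ?(ltW M0)//.
  by rewrite -powRrM mulVf ?gt_eqF// powRr1// ltW// addr_gt0.
rewrite cstE -mulrA.
case: q q2 => // _ /=.
(* For l^1 the pairs (a, i) form a single family, with the weights 64 / 2^i put into the functions,
   and [fejer_l1] handles their sum. *)
- pose G t := \sum_(a <- r) g (a, 0%N) t.
  pose rr := [seq (a, i) | a <- r, i <- index_iota 0 m.+1].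
  pose h (ai : A * nat) t := 64 / 2 ^+ ai.2 * g (ai.1, 0%N) t.
  have ph ai : periodic K (h ai) by move=> t; rewrite /h (pg (ai.1, 0%N)).
  have h0 ai t : 0 <= h ai t by rewrite mulr_ge0 // ?mulr_ge0 ?invr_ge0 ?exprn_ge0.
  apply: (@le_trans _ _ (M `^ p * (A1 * \sum_(0 <= t < 2 ^ K) (\sum_(ai <- rr) h ai t) `^ p))); last first.
    set S0 := \sum_(0 <= t < 2 ^ K) (\sum_(a <- r) normc (f t a)) `^ p.
    have hS : \sum_(0 <= t < 2 ^ K) (\sum_(ai <- rr) h ai t) `^ p <= 128 `^ p * S0.
      rewrite mulr_sumr; apply: ler_sum => t _.
      rewrite -powRM//; last by apply: sumr_ge0 => a _; exact: normc_ge0.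
      apply: powR_le; [exact: ltW|exact: sumr_ge0|].
      rewrite big_allpairs_dep/= /h /= mulr_sumr; apply: ler_sum => a _.
      by rewrite -mulr_suml ler_wpM2r// g0.
    have S00 : 0 <= 128 `^ p * S0.
      by rewrite mulr_ge0 ?powR_ge0// sumr_ge0// => *; exact: powR_ge0.
    have -> : (128 * M) `^ p = 128 `^ p * M `^ p by rewrite powRM// ltW.
    rewrite (_ : (A1 + A2) * _ = M `^ p * ((A1 + A2) * (128 `^ p * S0))); last by ring.
    rewrite ler_pM2l ?powR_gt0//; apply: (@le_trans _ _ (A1 * (128 `^ p * S0))).
      by rewrite ler_pM2l.
    by rewrite ler_wpM2r// lerDl ltW.
  apply: (@le_trans _ _ (\sum_(0 <= t < 2 ^ K) M `^ p * (\sum_(ai <- rr) fejer K (lev ai.1 ai.2) (h ai) t) `^ p)).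
    apply: ler_sum => t _; rewrite -powRM//; [|exact: ltW|by apply: sumr_ge0 => *; exact: fejer_ge0].
    apply: powR_le; [exact: ltW|by apply: sumr_ge0 => *; exact: normc_ge0|].
    rewrite big_allpairs_dep/= mulr_sumr; apply: ler_sum => a _; apply: (le_trans (pt a t)).
    by rewrite ler_pM2l//; apply: ler_sum => i _; rewrite /h fejerZ.
  rewrite -mulr_sumr ler_pM2l ?powR_gt0//.
  by apply: hA1 => // ai; rewrite geq_minr.
(* For l^oo every Fejer mean of every coordinate is below the maximal function of the fibrewise
   maximum. *)
- pose G t := \big[Num.max/0]_(a <- r) g (a, 0%N) t.
  have pG : periodic K G by move=> t; apply: eq_bigr => a _; rewrite (pg (a, 0%N)).
  have G0 t : 0 <= G t by exact: bigmax_ge.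
  have gG a t : a \in r -> g (a, 0%N) t <= G t.
    rewrite /G; elim: (r) => // b s IH; rewrite inE big_cons le_max => /predU1P[->|/IH ->].
      by rewrite lexx.
    by rewrite orbT.
  apply: (@le_trans _ _ (\sum_(0 <= t < 2 ^ K) (128 * M) `^ p * Mx K G t `^ p)).
    apply: ler_sum => t _; rewrite -powRM ?mulr_ge0 ?Mx_ge0 ?(ltW M0)//.
    apply: powR_le; [exact: ltW|exact: bigmax_ge|].
    apply: bigmax_le_seq; first by rewrite !mulr_ge0 ?Mx_ge0 ?(ltW M0).
    - move=> a ar; apply: (le_trans (pt a t)); rewrite -mulrA mulrCA ler_pM2l//.
      apply: (@le_trans _ _ (\sum_(0 <= i < m.+1) 64 / 2 ^+ i * Mx K G t)).
        apply: ler_sum => i _; rewrite ler_wpM2l ?mulr_ge0 ?invr_ge0 ?exprn_ge0//.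
        apply: le_trans (fejer_le_Mx t (geq_minr _ K) pG).
        by apply: fejer_le => s; exact: gG.
      by rewrite -mulr_suml ler_wpM2r ?Mx_ge0.
  rewrite -mulr_sumr mulrCA ler_pM2l ?powR_gt0 ?mulr_gt0//.
  apply: le_trans (hA2 K G pG G0) _; apply: ler_wpM2r; last by rewrite lerDr ltW.
  by apply: sumr_ge0 => *; exact: powR_ge0.
Qed.

End KernelInequalities.

(** * Extremal vectors and transference for matrices *)

Section Extremal.
Context {R : realType}.

Lemma powR_tangent (p a b : R) : 1 < p -> 0 <= a -> 0 <= b ->
  a `^ p - b `^ p <= p * a `^ (p - 1) * (a - b).
Proof.
move=> p1 a0 b0; have p0 : 0 < p by apply: lt_trans p1.
have th : 0 < p^-1 < 1 by rewrite invr_gt0 p0 invf_lt1.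
have := powR_young (powR_ge0 b p) (powR_ge0 a p) th.
rewrite -!powRrM divff ?gt_eqF// powRr1// mulrBr divff ?gt_eqF// mulr1.
move=> /(ler_wpM2l (ltW p0)); rewrite mulrDr !mulrA divff ?gt_eqF// mulrBr divff ?gt_eqF// mulr1 !mul1r.
have aE : a * a `^ (p - 1) = a `^ p by apply: mulr_powRB1.
rewrite mulrBr -(mulrA p _ a) (mulrC _ a) aE.
have -> : p * b * a `^ (p - 1) = p * a `^ (p - 1) * b by ring.
lra.
Qed.

Lemma powR_continuous (p : R) : 1 < p -> continuous (fun x : R => `|x| `^ p).
Proof.
move=> p1 x; have p0 : 0 < p by apply: lt_trans p1.
apply/cvgrPdist_le => e e0.
set M := p * (`|x| + 1) `^ (p - 1).
have M0 : 0 < M by rewrite mulr_gt0// powR_gt0// ltr_wpDl.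
have eM : 0 < e / M by exact: divr_gt0.
near=> y.
have yx1 : `|x - y| <= 1 by near: y; apply: (@cvgr_dist_le _ _ _ _ _ id x) => //; exact: cvg_id.
have yx2 : `|x - y| <= e / M.
  by near: y; apply: (@cvgr_dist_le _ _ _ _ _ id x) => //; exact: cvg_id.
have dd : `| `|x| - `|y| | <= `|x - y| by exact: ler_dist_dist.
have y1 : `|y| <= `|x| + 1.
  have : `|y| - `|x| <= `|x - y| by rewrite distrC (le_trans (ler_norm _))// ler_dist_dist.
  lra.
have bd (a b : R) : 0 <= a -> 0 <= b -> a <= `|x| + 1 -> `|a - b| <= e / M -> a `^ p - b `^ p <= e.
  move=> a0 b0 ax ab; apply: (le_trans (powR_tangent p1 a0 b0)).
  apply: (@le_trans _ _ (M * (e / M))); last by rewrite mulrC divfK// gt_eqF.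
  apply: (@le_trans _ _ (p * a `^ (p - 1) * `|a - b|)).
    by rewrite ler_wpM2l ?ler_norm// mulr_ge0 ?powR_ge0// ltW.
  rewrite ler_pM ?mulr_ge0 ?powR_ge0 ?(ltW p0)// ler_pM2l//.
  by apply: powR_le => //; rewrite subr_ge0 ltW.
rewrite ler_norml lerNl opprB; apply/andP; split.
  by apply: bd => //; rewrite distrC (le_trans dd).
apply: bd => //; first by rewrite lerDl.
exact: le_trans dd yx2.
Unshelve. all: by end_near. Qed.

Lemma coord_cont n (j : 'I_n) : continuous (fun u : 'rV[R]_n => u ord0 j).
Proof. exact: coord_continuous. Qed.

Lemma sum_cont n (I : Type) (r : seq I) (F : I -> 'rV[R]_n -> R) : (forall i, continuous (F i)) ->
  continuous (fun u => \sum_(i <- r) F i u).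
Proof.
move=> cF; elim: r => [|i r IH] u.
  rewrite (_ : (fun _ => _) = cst 0); last by apply/funext => v; rewrite big_nil.
  exact: cst_continuous.
rewrite (_ : (fun _ => _) = (fun v => F i v + \sum_(i <- r) F i v)); last by apply/funext => v; rewrite big_cons.
by apply: continuousD; [exact: cF|exact: IH].
Qed.

Lemma powsum_cont n m (p : R) (a : 'I_m -> 'I_n -> R) : 1 < p ->
  continuous (fun u : 'rV[R]_n => \sum_i `|\sum_j a i j * u ord0 j| `^ p).
Proof.
move=> p1; apply: sum_cont => i u.
apply: (@continuous_comp _ _ _ (fun v : 'rV[R]_n => \sum_j a i j * v ord0 j) (fun x => `|x| `^ p)); last exact: powR_continuous.
apply: (@sum_cont n _ _ (fun j v => a i j * v ord0 j)) => j v.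
by apply: continuousM; [exact: cst_continuous|exact: coord_cont].
Qed.

Lemma extremal_rV n (p : R) (a : 'I_n.+1 -> 'I_n.+1 -> R) : 1 < p -> 
  exists u : 'rV[R]_n.+1, [/\ (forall j, 0 <= u ord0 j), \sum_j u ord0 j `^ p = 1 &
   forall w : 'rV[R]_n.+1, (forall j, 0 <= w ord0 j) -> \sum_j w ord0 j `^ p = 1 ->
    \sum_i `|\sum_j a i j * w ord0 j| `^ p <= \sum_i `|\sum_j a i j * u ord0 j| `^ p].
Proof.
move=> p1; have p0 : 0 < p by apply: lt_trans p1.
pose A := [set u : 'rV[R]_n.+1 | (forall j, 0 <= u ord0 j) /\ \sum_j `|u ord0 j| `^ p = 1].
have cN : continuous (fun u : 'rV[R]_n.+1 => \sum_j `|u ord0 j| `^ p).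
  have -> : (fun u : 'rV[R]_n.+1 => \sum_j `|u ord0 j| `^ p) =
      (fun u => \sum_i `|\sum_j (i == j)%:R * u ord0 j| `^ p).
    apply/funext => u; apply: eq_bigr => i _; congr (`|_| `^ _).
    by rewrite (bigD1 i)//= eqxx mul1r big1 ?addr0// => j ji; rewrite eq_sym (negPf ji) mul0r.
  exact: powsum_cont.
have cA : compact A.
  apply: bounded_closed_compact.
    exists 1; split=> // M M1 u [u0 u1]; rewrite /Num.norm/= mx_normrE.
    apply: bigmax_le; first by rewrite (le_trans ler01)// ltW.
    move=> [i j] _ /=; rewrite (ord1 i) (le_trans _ (ltW M1))//.
    have h : `|u ord0 j| `^ p <= 1.
      by rewrite -u1 (bigD1 j)//= lerDl sumr_ge0// => *; exact: powR_ge0.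
    have := powR_root p0 (normr_ge0 _) ler01 h.
    by rewrite powR1.
  have -> : A = (\bigcap_(j in [set: 'I_n.+1]) (fun u : 'rV[R]_n.+1 => u ord0 j) @^-1` [set x | 0 <= x])
     `&` (fun u : 'rV[R]_n.+1 => \sum_j `|u ord0 j| `^ p) @^-1` [set 1].
    apply/seteqP; split=> u /=.
      by move=> [h1 h2]; split => // j _; exact: h1.
    by move=> [h1 h2]; split => // j; exact: h1.
  apply: closedI.
    apply: closed_bigI => j _; apply: closed_comp; last exact: closed_ge.
    by move=> u _; exact: coord_cont.
  apply: closed_comp; last exact: closed_eq.
  by move=> u _; exact: cN.
have A0 : A !=set0.
  exists (\row_j (j == ord0)%:R); split; first by move=> j; rewrite mxE.
  rewrite (bigD1 ord0)//= mxE eqxx normr1 powR1 big1 ?addr0// => j j0.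
  by rewrite mxE (negPf j0) normr0 powR0// gt_eqF.
have [u /[!inE] -[u0 u1] umax] := @EVT_max_rV R n.+1 (fun u => \sum_i `|\sum_j a i j * u ord0 j| `^ p) A A0 cA
  (continuous_subspaceT (powsum_cont p1 (a := a))).
exists u; split => //.
  by rewrite -u1; apply: eq_bigr => j _; rewrite ger0_norm.
move=> w w0 w1; apply: umax; rewrite inE; split => //.
by rewrite -w1; apply: eq_bigr => j _; rewrite ger0_norm.
Qed.

Lemma extremal_scaled n (p : R) (a : 'I_n.+1 -> 'I_n.+1 -> R) : 1 < p -> (forall i j, 0 < a i j) ->
  exists u : 'I_n.+1 -> R, [/\ (forall j, 0 <= u j), \sum_j u j `^ p = 1 &
   forall w, (forall j, 0 <= w j) ->
    \sum_i (\sum_j a i j * w j) `^ p <= (\sum_i (\sum_j a i j * u j) `^ p) * \sum_j w j `^ p].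
Proof.
move=> p1 a0; have p0 : 0 < p by apply: lt_trans p1.
have [u [u0 u1 umax]] := extremal_rV a p1.
have ab w i : (forall j, 0 <= w j) -> 0 <= \sum_j a i j * w j.
  by move=> w0; rewrite sumr_ge0// => j _; rewrite mulr_ge0// ltW.
exists (u ord0); split => // w w0.
have s0 : 0 <= \sum_j w j `^ p by rewrite sumr_ge0// => j _; exact: powR_ge0.
move: s0; rewrite le_eqVlt => /predU1P[/esym s0|s0].
  have wz j : w j = 0.
    apply/eqP; have := eqxx (\sum_j w j `^ p); rewrite {1}s0 eq_sym psumr_eq0; last by move=> *; exact: powR_ge0.
    by move=> /allP/(_ j); rewrite mem_index_enum => /(_ isT)/implyP/(_ isT); rewrite powR_eq0 => /andP[].
  rewrite s0 mulr0 big1// => i _; rewrite big1 ?powR0 ?gt_eqF// => j _.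
  by rewrite wz mulr0.
set s := \sum_j w j `^ p in s0 *; pose c := s `^ p^-1.
have c0 : 0 < c by exact: powR_gt0.
have cp : c `^ p = s by rewrite -powRrM mulVf ?gt_eqF// powRr1// ltW.
have := umax (\row_j (w j / c)).
have H i : \sum_j a i j * (\row_j (w j / c)) ord0 j = c^-1 * \sum_j a i j * w j.
  by rewrite mulr_sumr; apply: eq_bigr => j _; rewrite mxE; ring.
have Hw : \sum_j (\row_j (w j / c)) ord0 j `^ p = 1.
  under eq_bigr do rewrite mxE.
  under eq_bigr do rewrite powRM ?invr_ge0 ?(ltW c0)//.
  by rewrite -mulr_suml -/s -cp -powRM ?invr_ge0 ?(ltW c0)// divff ?gt_eqF// powR1.
have wc j : 0 <= (\row_j (w j / c)) ord0 j by rewrite mxE divr_ge0// ltW.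
move=> /(_ wc Hw).
under eq_bigr do rewrite H ger0_norm ?mulr_ge0 ?invr_ge0 ?(ltW c0) ?ab// powRM ?invr_ge0 ?(ltW c0) ?ab//.
rewrite -mulr_sumr.
under [X in _ <= X -> _]eq_bigr do rewrite ger0_norm ?ab//.
move=> /(ler_wpM2r (ltW s0)); rewrite -{1}cp mulrAC -powRM ?invr_ge0 ?(ltW c0)//.
by rewrite mulVf ?gt_eqF// powR1 mul1r.
Qed.

(** The last equation is the Euler-Lagrange equation of a maximizer u of the l^p-norm of a u on the
    positive part of the unit sphere, kappa being the maximum. Positivity of the entries forces v >
    0, and then u > 0 by the equation itself. *)
Lemma positive_extremal n (p : R) (a : 'I_n.+1 -> 'I_n.+1 -> R) : 1 < p -> (forall i j, 0 < a i j) ->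
  (forall y, (forall j, 0 <= y j) -> \sum_i (\sum_j a i j * y j) `^ p <= \sum_j y j `^ p) ->
  exists u v kappa, [/\ (forall j : 'I_n.+1, 0 < u j), (forall i, 0 < v i), (forall i, v i = \sum_j a i j * u j),
    0 < kappa <= 1 & forall j, \sum_i a i j * v i `^ (p - 1) = kappa * u j `^ (p - 1)].
Proof.
move=> p1 a0 ctr; have p0 : 0 < p by apply: lt_trans p1.
have p10 : 0 < p - 1 by rewrite subr_gt0.
have [u [u0 u1 umax]] := extremal_scaled p1 a0.
pose v i := \sum_j a i j * u j; pose k := \sum_i v i `^ p.
have [j0 uj0] : exists j, 0 < u j.
  apply: contrapT => /forallNP h; move: u1; rewrite big1 => [/eqP|j _]; first by rewrite eq_sym oner_eq0.
  by have /negP := h j; rewrite -leNgt => uj; rewrite (_ : u j = 0) ?powR0 ?gt_eqF//; apply/eqP; rewrite eq_le uj u0.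
have v0 i : 0 < v i.
  rewrite /v (bigD1 j0)//= ltr_wpDr ?mulr_gt0//.
  by rewrite sumr_ge0// => j _; rewrite mulr_ge0// ltW.
have k0 : 0 < k by rewrite /k (bigD1 ord0)//= ltr_wpDr ?powR_gt0// sumr_ge0// => *; exact: powR_ge0.
have ge j : \sum_i a i j * v i `^ (p - 1) <= k * u j `^ (p - 1).
  set c := \sum_i _.
  have c0 : 0 <= c by rewrite sumr_ge0// => i _; rewrite mulr_ge0 ?powR_ge0// ltW.
  (* Only one coordinate is moved, and only upwards, so the competitor stays nonnegative; convexity
     of the power replaces differentiation, and d tends to 0 afterwards. This gives one inequality
     for each coordinate. *)
  have H d : 0 < d -> c <= k * (u j + d) `^ (p - 1).
    move=> d0; pose w l := u l + (l == j)%:R * d.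
    have w0 l : 0 <= w l by rewrite addr_ge0// mulr_ge0// ltW.
    have := umax w w0; rewrite -/k.
    have -> : \sum_l w l `^ p = 1 + ((u j + d) `^ p - u j `^ p).
      rewrite -u1 [in RHS](bigD1 j)//= (bigD1 j)//= {1}/w eqxx mul1r.
      rewrite (eq_bigr (fun l => u l `^ p)); first lra.
      by move=> l /negPf lj; rewrite /w lj mul0r addr0.
    have wv i : \sum_l a i l * w l = v i + d * a i j.
      rewrite /v /w; under eq_bigr do rewrite mulrDr.
      rewrite big_split/=; congr (_ + _); rewrite (bigD1 j)//= eqxx mul1r big1 ?addr0; first by ring.
      by move=> l /negPf ->; rewrite mul0r mulr0.
    under eq_bigr do rewrite wv.
    have t1 : k + p * d * c <= \sum_i (v i + d * a i j) `^ p.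
      rewrite /k /c mulr_sumr -big_split/=; apply: ler_sum => i _.
      have := powR_tangent p1 (ltW (v0 i)) (ltW (addr_gt0 (v0 i) (mulr_gt0 d0 (a0 i j)))).
      lra.
    have t2 := powR_tangent p1 (addr_ge0 (u0 j) (ltW d0)) (u0 j).
    rewrite addrAC subrr add0r in t2.
    move=> t3; have t4 : p * d * c <= p * d * (k * (u j + d) `^ (p - 1)).
      have := ler_wpM2l (ltW k0) t2; lra.
    by move: t4; rewrite ler_pM2l// mulr_gt0.
  have ck : c = k * ((c / k) `^ (p - 1)^-1) `^ (p - 1).
    by rewrite -powRrM mulVf ?gt_eqF// powRr1 ?divr_ge0 ?(ltW k0)// mulrC divfK ?gt_eqF.
  rewrite ck ler_pM2l//; apply: powR_le; [exact: ltW|exact: powR_ge0|].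
  apply/ler_addgt0Pr => d d0; have ud : 0 <= u j + d by rewrite addr_ge0// ltW.
  rewrite [leRHS](_ : _ = ((u j + d) `^ (p - 1)) `^ (p - 1)^-1); last first.
    by rewrite -powRrM divff ?gt_eqF// powRr1.
  apply: powR_le.
  - by rewrite invr_ge0 ltW.
  - by rewrite divr_ge0// ltW.
  by rewrite ler_pdivrMr// mulrC; exact: H.
have ku j : 0 < u j.
  have : 0 < k * u j `^ (p - 1).
    apply: lt_le_trans (ge j); rewrite (bigD1 ord0)//= ltr_wpDr ?mulr_gt0 ?powR_gt0//.
    by rewrite sumr_ge0// => i _; rewrite mulr_ge0 ?powR_ge0// ltW.
  rewrite pmulr_rgt0// => h; rewrite lt0r u0 andbT; apply: contraTneq h => ->.
  by rewrite powR0 ?gt_eqF// ltxx.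
exists u, v, k; split => //.
  by rewrite k0 -u1 ctr.
(* Paired with u, both sides of the inequalities have the sum k; as all u j are positive, each
   inequality is an equality. *)
have S : \sum_j (k * u j `^ (p - 1) - \sum_i a i j * v i `^ (p - 1)) * u j = 0.
  under eq_bigr do rewrite mulrBl.
  rewrite sumrB; apply/eqP; rewrite subr_eq0; apply/eqP.
  transitivity k.
    under eq_bigr do rewrite -mulrA (mulrC (_ `^ _)) mulr_powRB1 ?u0//.
    by rewrite -mulr_sumr u1 mulr1.
  under eq_bigr do rewrite mulr_suml.
  rewrite exchange_big /k; apply: eq_bigr => i _ /=.
  rewrite -(mulr_powRB1 (ltW (v0 i)) p0) {1}/v mulr_suml; apply: eq_bigr => j _; ring.
move=> j; apply/eqP; rewrite eq_sym -subr_eq0.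
have := eqxx (0 : R); rewrite -{1}S psumr_eq0; last by move=> l _; rewrite mulr_ge0// subr_ge0.
by move=> /allP/(_ j); rewrite mem_index_enum => /(_ isT)/implyP/(_ isT); rewrite mulf_eq0 (gt_eqF (ku j)) orbF.
Qed.

End Extremal.

Lemma eq_lnorm_in {R : realType} q (A : eqType) (r : seq A) (v w : A -> R[i]) :
  {in r, v =1 w} -> lnorm q r v = lnorm q r w.
Proof.
move=> vw; rewrite /lnorm; case: q.
- by apply: eq_big_seq => a ar; rewrite vw.
- by rewrite /enorm; congr Num.sqrt; apply: eq_big_seq => a ar; rewrite vw.
- by apply: eq_big_seq => a ar; rewrite vw.
Qed.

(** * Transference from the shift to matrices along weighted paths *)

Section Transference.
Context {R : realType}.
Notation C := R[i].

(** [terms b] lists which polynomial acts on which input. One format thus covers square functions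
    (one input, many outputs), their duals (sums of many inputs) and diagonal families. *)
Definition kout (A B : Type) (terms : B -> seq ({poly C} * A)) (f : nat -> A -> C) (t : nat) (b : B) :=
  \sum_(qa <- terms b) act qa.1 (f^~ qa.2) t.

Definition mapply n (T : 'I_n.+1 -> 'I_n.+1 -> C) (x : 'I_n.+1 -> C) i := \sum_j T i j * x j.

Definition mact n T (q : {poly C}) (x : 'I_n.+1 -> C) i := \sum_(l < size q) q`_l * iter l (mapply T) x i.

Definition mout n (T : 'I_n.+1 -> 'I_n.+1 -> C) (A B : Type) (terms : B -> seq ({poly C} * A))
  (x : 'I_n.+1 -> A -> C) (i : 'I_n.+1) (b : B) := \sum_(qa <- terms b) mact T qa.1 (x^~ qa.2) i.

(** Contractivity of the entrywise modulus, which for a matrix is what regular norm at most 1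
    amounts to. *)
Definition mcontraction n (p : R) (T : 'I_n.+1 -> 'I_n.+1 -> C) :=
  forall y, (forall j, 0 <= y j) -> \sum_i (\sum_j normc (T i j) * y j) `^ p <= \sum_j y j `^ p.

Section Paths.
Context (n : nat) (P : 'I_n.+1 -> 'I_n.+1 -> R) (W : 'I_n.+1 -> 'I_n.+1 -> C).
Notation I := 'I_n.+1.

Fixpoint paths N : seq (seq I) :=
  if N is N'.+1 then [seq j :: s | j <- index_enum I, s <- paths N'] else [:: [::]].

Fixpoint weight (i : I) (s : seq I) : R := if s is j :: s' then P i j * weight j s' else 1.

(** Along a path, a power of the matrix P W becomes a translation in time multiplied by this
    cocycle; averaging over the paths with [weight] returns the power ([path_iter]). *)
Fixpoint cocycle (i : I) (s : seq I) (t : nat) {struct t} : C :=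
  match t, s with t'.+1, j :: s' => W i j * cocycle j s' t' | _, _ => 1 end.

Lemma big_paths (V : nmodType) N (F : seq I -> V) :
  \sum_(s <- paths N.+1) F s = \sum_j \sum_(s <- paths N) F (j :: s).
Proof. by rewrite /= big_allpairs_dep. Qed.

Lemma size_paths N s : s \in paths N -> size s = N.
Proof.
elim: N s => [|N IH] s /=; first by rewrite inE => /eqP ->.
by move=> /allpairsP[[j s'] /= [_ /IH <- ->]].
Qed.

Hypothesis P0 : forall i j, 0 <= P i j.
Hypothesis P1 : forall i, \sum_j P i j = 1.

Lemma weight_ge0 i s : 0 <= weight i s.
Proof. by elim: s i => //= j s IH i; rewrite mulr_ge0. Qed.

Lemma sum_weight N i : \sum_(s <- paths N) weight i s = 1.
Proof.
elim: N i => [|N IH] i; first by rewrite big_seq1.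
rewrite big_paths/= -(P1 i); apply: eq_bigr => j _.
by rewrite -mulr_sumr IH mulr1.
Qed.

Lemma cocycleD i s t m : (t <= size s)%N ->
  cocycle i s (t + m) = cocycle i s t * cocycle (nth i (i :: s) t) (drop t s) m.
Proof.
elim: t i s => [|t IH] i s; first by rewrite drop0 mul1r.
case: s => //= j s ts; rewrite IH// mulrA; congr (_ * cocycle _ _ _).
by apply: set_nth_default; rewrite /= ltnS.
Qed.

(* The measure built from the extremal vector is stationary up to the factor [k]. *)
Lemma stationary (p k : R) (Phi : I -> seq I -> R) N t : (t <= N)%N ->
  (forall j, \sum_i P i j * normc (W i j) `^ p = k) ->
  \sum_i \sum_(s <- paths N) weight i s * normc (cocycle i s t) `^ p * Phi (nth i (i :: s) t) (drop t s)
  = k ^+ t * \sum_i \sum_(s <- paths (N - t)) weight i s * Phi i s.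
Proof.
move=> tN Wk; elim: t N tN => [|t IH] N tN.
  rewrite subn0 expr0 mul1r; apply: eq_bigr => i _; apply: eq_bigr => s _.
  by rewrite (_ : cocycle i s 0 = 1)// normc1 powR1 mulr1 drop0.
case: N tN => // N tN; rewrite subSS exprS -mulrA -(IH N)// mulr_sumr.
under eq_bigr do rewrite big_paths.
rewrite exchange_big; apply: eq_bigr => j _ /=.
rewrite -(Wk j) mulr_suml; apply: eq_bigr => i _; rewrite mulr_sumr.
rewrite big_seq [RHS]big_seq; apply: eq_bigr => s /size_paths sN.
rewrite normcM powRM ?normc_ge0//.
rewrite (set_nth_default j) /=; last by rewrite sN.
by ring.
Qed.

Lemma path_iter (x : I -> C) N l i : (l <= N)%N ->
  \sum_(s <- paths N) (weight i s)%:C%C * (cocycle i s l * x (nth i (i :: s) l))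
  = iter l (mapply (fun i j => (P i j)%:C%C * W i j)) x i.
Proof.
elim: l N i => [|l IH] N i lN.
  rewrite /= -[RHS]mul1r; under eq_bigr do rewrite mul1r.
  rewrite -mulr_suml -rmorph_sum sum_weight//.
case: N lN => // N lN; rewrite big_paths iterS [RHS]/mapply; apply: eq_bigr => j _.
rewrite -(IH N j lN) mulr_sumr big_seq [RHS]big_seq; apply: eq_bigr => s /size_paths sN /=.
rewrite rmorphM (set_nth_default j) /=; last by rewrite sN.
by ring.
Qed.

Definition pout (A B : Type) (terms : B -> seq ({poly C} * A)) (x : I -> A -> C) i s b :=
  \sum_(qa <- terms b) \sum_(l < size qa.1) qa.1`_l * (cocycle i s l * x (nth i (i :: s) l) qa.2).

Lemma pout_mean (A B : Type) (terms : B -> seq ({poly C} * A)) (x : I -> A -> C) i b N :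
  (forall qa, List.In qa (terms b) -> (size qa.1 <= N)%N) ->
  \sum_(s <- paths N) (weight i s)%:C%C * pout terms x i s b
  = mout (fun i j => (P i j)%:C%C * W i j) terms x i b.
Proof.
rewrite /pout /mout; elim: (terms b) => [|qa l IH] H.
  by rewrite big_nil big1// => s _; rewrite big_nil mulr0.
under eq_bigr do rewrite big_cons mulrDr.
rewrite big_split/= big_cons; congr (_ + _); last by apply: IH => q ql; apply: H; right.
rewrite /mact; under eq_bigr do rewrite mulr_sumr.
rewrite exchange_big/=; apply: eq_bigr => m _.
rewrite -(@path_iter (x^~ qa.2) N m i); last by rewrite (leq_trans (ltnW (ltn_ord m)))// H//; left.
by rewrite mulr_sumr; apply: eq_bigr => s _; ring.
Qed.

(** As t plus the degrees stays within N, the reduction modulo N is not felt. The cocycle up to time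
    t factors out, leaving the same expression for the path that starts at time t. *)
Lemma kout_path (A B : Type) (terms : B -> seq ({poly C} * A)) (x : I -> A -> C) i s b N t :
  size s = N -> (forall qa, List.In qa (terms b) -> (t + size qa.1 <= N)%N) ->
  kout terms (fun t a => cocycle i s (t %% N) * x (nth i (i :: s) (t %% N)) a) t b
  = cocycle i s t * pout terms x (nth i (i :: s) t) (drop t s) b.
Proof.
move=> sN; rewrite /kout /pout; elim: (terms b) => [|qa l IH] H.
  by rewrite !big_nil mulr0.
rewrite !big_cons mulrDr; congr (_ + _); last by apply: IH => q ql; apply: H; right.
rewrite /act mulr_sumr; apply: eq_bigr => m _.
have tm : (t + m < N)%N.
  by apply: (@leq_trans (t + size qa.1)); [rewrite ltn_add2l|apply: H; left].
rewrite modn_small// cocycleD; last by rewrite sN; lia.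
rewrite [RHS]mulrCA; congr (_ * _); rewrite -mulrA; congr (_ * (_ * x _ _)).
have -> : nth i (i :: s) t :: drop t s = drop t (i :: s).
  by rewrite [RHS](drop_nth i)//= sN; lia.
by rewrite nth_drop; apply: set_nth_default; rewrite /= sN ltnS ltnW.
Qed.

End Paths.

Lemma List_In_mem (A : eqType) (a : A) (s : seq A) : a \in s <-> List.In a s.
Proof.
elim: s => //= b s IH; rewrite inE; split => [/predU1P[->|/IH]|[->|/IH ->]]; [by left|by right|by rewrite eqxx|by rewrite orbT].
Qed.

Lemma leq_bigmax_In (A : Type) (s : seq A) (F : A -> nat) a : List.In a s -> (F a <= \max_(b <- s) F b)%N.
Proof.
elim: s => //= b s IH [->|/IH h]; rewrite big_cons leq_max ?leqnn// h orbT//.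
Qed.

(** The hypothesis is used on the periodic sequence of each path and then averaged over paths. By
    [stationary] the input at time t has mean k^t X. The output has mean at least k^t Y, by Jensen's
    inequality, since the conditional mean over the rest of the path is the output of the matrix.
    Only the last L times are lost, L bounding the degrees. *)
Theorem matrix_transference n (p : R) (T : 'I_n.+1 -> 'I_n.+1 -> C) (A : Type) (B : eqType) (terms : B -> seq ({poly C} * A))
  (ra : seq A) (rb : seq B) qi qo (D : R) K0 : 1 < p -> 0 <= D ->
  (forall K f, (K0 <= K)%N -> periodic K f ->
    \sum_(0 <= t < 2 ^ K) lnorm qo rb (kout terms f t) `^ p <= D * \sum_(0 <= t < 2 ^ K) lnorm qi ra (f t) `^ p) ->
  (forall i j, T i j != 0) -> mcontraction p T -> forall x : 'I_n.+1 -> A -> C,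
  \sum_i lnorm qo rb (mout T terms x i) `^ p <= D * \sum_i lnorm qi ra (x i) `^ p.
Proof.
move=> p1 D0 H T0 Tc x; have p0 : 0 < p by apply: lt_trans p1.
have n0 i j : 0 < normc (T i j).
  by rewrite lt0r normc_ge0 andbT; apply: contraNneq (T0 i j) => /eq0_normc ->.
have [u [v [k [u0 v0 vE k01 kE]]]] := positive_extremal p1 n0 Tc.
have /andP[k0 k1] := k01.
(* The Doob transform of the modulus by u, Markov because v is the image of u. [W] carries the phase
   and the ratio v i / u j, so that P W is the given matrix. *)
pose P i j := normc (T i j) * u j / v i.
pose W i j : C := (v i / u j)%:C%C * (T i j / (normc (T i j))%:C%C).
have P0 i j : 0 <= P i j by rewrite /P divr_ge0 ?mulr_ge0 ?normc_ge0// ltW.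
have P1 i : \sum_j P i j = 1 by rewrite -mulr_suml -vE divff// gt_eqF.
have nC (z : R) : z != 0 -> (z%:C)%C != 0 :> C by move=> z0; rewrite -(rmorph0 (real_complex R)) (inj_eq (@complexI R)).
have nW i j : normc (W i j) = v i / u j.
  rewrite !normcM normcV !normc_real ger0_norm ?divr_ge0 ?(ltW (v0 _)) ?(ltW (u0 _))//.
  by rewrite ger0_norm ?normc_ge0// divff ?mulr1// gt_eqF.
have PW : (fun i j => (P i j)%:C%C * W i j) = T.
  apply/funext => i; apply/funext => j; rewrite /P /W !rmorphM !fmorphV /=.
  by field; rewrite !nC// gt_eqF.
(* The Euler-Lagrange equation of u divided by u j^(p - 1). *)
have Wk j : \sum_i P i j * normc (W i j) `^ p = k.
  have uj := powR_gt0 (p - 1) (u0 j).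
  apply: (mulIf (lt0r_neq0 uj)); rewrite -kE mulr_suml; apply: eq_bigr => i _.
  have h : (v i / u j) * u j = v i by rewrite divfK// gt_eqF.
  rewrite nW -[(v i / u j) `^ p]mulr_powRB1 ?divr_ge0 ?(ltW (v0 _)) ?(ltW (u0 _))//.
  have e : v i `^ (p - 1) = (v i / u j) `^ (p - 1) * u j `^ (p - 1).
    by rewrite -powRM ?divr_ge0 ?(ltW (v0 _)) ?(ltW (u0 _))// h.
  rewrite e /P.
  by field; rewrite !gt_eqF.
pose L := \max_(b <- rb) \max_(qa <- terms b) size qa.1.
have Lb b qa : b \in rb -> List.In qa (terms b) -> (size qa.1 <= L)%N.
  move=> /List_In_mem brb qab; apply: leq_trans (leq_bigmax_In (fun b => \max_(qa <- terms b) size qa.1) brb).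
  exact: (leq_bigmax_In (fun qa : {poly C} * A => size qa.1) qab).
set Y := \sum_i _; set X := \sum_i _.
have Y0 : 0 <= Y by rewrite sumr_ge0// => *; exact: powR_ge0.
have X0 : 0 <= X by rewrite sumr_ge0// => *; exact: powR_ge0.
have main K : (K0 <= K)%N -> (L <= 2 ^ K)%N ->
  (\sum_(0 <= t < 2 ^ K - L) k ^+ t) * Y <= D * ((\sum_(0 <= t < 2 ^ K) k ^+ t) * X).
  move=> KK LK; set N := (2 ^ K)%N.
  pose f (i : 'I_n.+1) s t a := cocycle W i s (t %% N) * x (nth i (i :: s) (t %% N)) a.
  have pf i s : periodic K (f i s) by move=> t; rewrite /f modnDr.
  have HH : \sum_i \sum_(s <- paths n N) weight P i s * \sum_(0 <= t < N) lnorm qo rb (kout terms (f i s) t) `^ p <=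
     D * \sum_i \sum_(s <- paths n N) weight P i s * \sum_(0 <= t < N) lnorm qi ra (f i s t) `^ p.
    rewrite mulr_sumr; apply: ler_sum => i _; rewrite mulr_sumr; apply: ler_sum => s _.
    by rewrite mulrCA ler_wpM2l ?weight_ge0//; exact: H.
  have sw (G : 'I_n.+1 -> seq 'I_n.+1 -> nat -> R) : \sum_i \sum_(s <- paths n N) weight P i s * \sum_(0 <= t < N) G i s t =
    \sum_(0 <= t < N) \sum_i \sum_(s <- paths n N) weight P i s * G i s t.
    rewrite [RHS]exchange_big/=; apply: eq_bigr => i _.
    by rewrite [RHS]exchange_big/=; apply: eq_bigr => s _; rewrite mulr_sumr.
  rewrite !sw in HH; apply: (le_trans _ (le_trans HH _)).
    rewrite [leRHS](@big_cat_nat _ _ _ (N - L))//=; last exact: leq_subr.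
    rewrite -[leLHS]addr0 lerD//; last first.
      rewrite sumr_ge0// => t _; rewrite sumr_ge0// => i _; rewrite sumr_ge0// => s _.
      by rewrite mulr_ge0 ?weight_ge0 ?powR_ge0.
    rewrite mulr_suml; apply: ler_sum_nat => t /andP[_ tN].
    pose Phi i s := lnorm qo rb (pout W terms x i s) `^ p.
    have tL : (t + L <= N)%N by rewrite ltn_subRL in tN; rewrite addnC ltnW.
    have tN' : (t <= N)%N by apply: leq_trans tL; exact: leq_addr.
    apply: (@le_trans _ _ (k ^+ t * \sum_i \sum_(s <- paths n (N - t)) weight P i s * Phi i s)); last first.
      rewrite -(stationary Phi tN' Wk); apply: ler_sum => i _; rewrite big_seq [leRHS]big_seq.
      apply: ler_sum => s /size_paths sN; rewrite -mulrA ler_wpM2l ?weight_ge0//.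
      rewrite -powRM ?normc_ge0 ?lnorm_ge0// -lnormZ; apply: powR_le; [exact: ltW|exact: lnorm_ge0|].
      rewrite le_eqVlt; apply/orP; left; apply/eqP; apply: eq_lnorm_in => b brb.
      rewrite [RHS](@kout_path _ _ _ _ terms x i s b N t sN)// => qa /(Lb _ _ brb) h.
      by apply: leq_trans tL; rewrite leq_add2l.
    rewrite ler_wpM2l ?exprn_ge0 ?(ltW k0)//; apply: ler_sum => i _.
    have sw1 : \sum_(s <- paths n (N - t)) weight P i s <= 1 by rewrite sum_weight.
    apply: le_trans (jensen_powR (ltW p1) (weight_ge0 P0 i) (fun s => lnorm_ge0 qo rb (pout W terms x i s)) sw1).
    apply: powR_le; [exact: ltW|exact: lnorm_ge0|].
    rewrite [leLHS](_ : _ = lnorm qo rb (fun b => \sum_(s <- paths n (N - t)) (weight P i s)%:C%C * pout W terms x i s b)).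
      apply: le_trans (lnorm_sum _ _ _ _ _) _.
      by apply: ler_sum => s _; rewrite normc_real ger0_norm// weight_ge0.
    apply: eq_lnorm_in => b brb; rewrite pout_mean ?PW// => qa /(Lb _ _ brb) h.
    by rewrite leq_subRL// (leq_trans _ tL)// leq_add2l.
  rewrite ler_wpM2l// mulr_suml; apply: ler_sum_nat => t /andP[_ tN].
  have tN' : (t <= N)%N by exact: ltnW.
  have := stationary (fun i _ => lnorm qi ra (x i) `^ p) tN' Wk.
  rewrite /X; under [X in _ = _ * X -> _]eq_bigr do rewrite -mulr_suml sum_weight// mul1r.
  move=> <-; apply: ler_sum => i _; apply: ler_sum => s _.
  rewrite -mulrA ler_wpM2l ?weight_ge0// /f modn_small// lnormZ powRM ?normc_ge0 ?lnorm_ge0//.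
(* Since k <= 1, the first M terms of the geometric sum are at least k^M each and the last L at most
   k^M. Their ratio is at most L / M and tends to 0, whatever k is. *)
have lim K : (K0 <= K)%N -> (L < 2 ^ K)%N -> (2 ^ K - L)%:R * (Y - D * X) <= D * X * L%:R.
  move=> KK LK; have := main K KK (ltnW LK); set M := (2 ^ K - L)%N.
  have M0 : (0 < M)%N by rewrite subn_gt0.
  rewrite (_ : (2 ^ K)%N = (M + L)%N); last by rewrite subnK// ltnW.
  rewrite [X in _ <= D * (X * _)](@big_cat_nat _ _ _ M)//=; last exact: leq_addr.
  set s1 := \sum_(0 <= t < M) _; set s2 := \sum_(M <= t < _) _.
  have h2 : s2 <= L%:R * k ^+ M.
    rewrite /s2 -[X in \big[_/_]_(X <= _ < _) _]add0n big_addn addKn.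
    apply: (@le_trans _ _ (\sum_(0 <= i < L) k ^+ M)).
      by apply: ler_sum => i _; rewrite exprD ler_piMl ?exprn_ge0 ?exprn_ile1 ?(ltW k0).
    by rewrite sumr_const_nat subn0 mulr_natl.
  have h1 : M%:R * k ^+ M <= s1.
    rewrite mulr_natl -[X in _ *+ X]subn0 -sumr_const_nat; apply: ler_sum_nat => i /andP[_ iM].
    by apply: ler_wiXn2l => //; [exact: ltW|exact: ltnW].
  have s10 : 0 < s1.
    apply: lt_le_trans h1; rewrite mulr_gt0 ?exprn_gt0// ltr0n//.
  move=> h; rewrite -(ler_pM2l s10).
  have DX : 0 <= D * X by rewrite mulr_ge0.
  have e1 : M%:R * s1 * Y <= M%:R * (D * ((s1 + s2) * X)).
    by rewrite -mulrA ler_wpM2l.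
  have e2 : M%:R * s2 <= L%:R * s1.
    apply: (@le_trans _ _ (M%:R * (L%:R * k ^+ M))); first by rewrite ler_wpM2l.
    by rewrite mulrCA ler_wpM2l.
  have := ler_wpM2l DX e2; lra.
rewrite -subr_le0 leNgt; apply/negP => YX.
have [m Hm] : exists m : nat, D * X * L%:R / (Y - D * X) < m%:R.
  exists (Num.trunc (D * X * L%:R / (Y - D * X))).+1.
  exact: truncnS_gt.
pose K := (K0 + L + m)%N.
have KE : (K < 2 ^ K)%N by exact: ltn_expl.
have KK : (K0 <= K)%N by rewrite /K -addnA leq_addr.
have LK : (L < 2 ^ K)%N by apply: leq_ltn_trans KE; rewrite /K addnAC leq_addl.
have := lim K KK LK; apply/negP; rewrite -ltNge.
move: Hm; rewrite ltr_pdivrMr// => /lt_le_trans; apply.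
by rewrite ler_wpM2r ?(ltW YX)// ler_nat; lia.
Qed.

End Transference.

(** * Real and complex L^p norms *)

(** An infinite integral gives the value 0 here, so this number is the norm only for functions in
    [rLp]. *)
HB.lock Definition pnorm (d : measure_display) (Omega : measurableType d) (R : realType)
  (mu : {measure set Omega -> \bar R}) (p : R) (h : Omega -> R) : R :=
  (\int[mu]_w (`|h w| `^ p)) `^ p^-1.

Section RealLp.
Context {d : measure_display} {Omega : measurableType d} {R : realType}.
Variable mu : {measure set Omega -> \bar R}.
Variable p : R.
Hypothesis p1 : 1 < p.
Implicit Types h g : Omega -> R.

Let p0 : 0 < p. Proof. exact: lt_trans p1. Qed.

Definition rLp h := measurable_fun setT h /\ mu.-integrable setT (fun w => (`|h w| `^ p)%:E).

Notation nm := (pnorm mu p).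

Lemma nm_ge0 h : 0 <= nm h. Proof. by rewrite unlock powR_ge0. Qed.

Lemma measurable_power h : measurable_fun setT h -> measurable_fun setT (fun w => `|h w| `^ p).
Proof.
move=> mh; apply: (measurableT_comp (measurable_powR p)).
by apply: measurableT_comp => //; exact: normr_measurable.
Qed.

Lemma powR_nm h : rLp h -> (nm h `^ p)%:E = (\int[mu]_w (`|h w| `^ p)%:E)%E.
Proof.
move=> [mh ih]; rewrite unlock -powRrM mulVf ?gt_eqF// powRr1.
  by rewrite /Rintegral fineK// integrable_fin_num.
by apply: Rintegral_ge0 => w _; exact: powR_ge0.
Qed.

Lemma power_EFin h : (\int[mu]_x (`|(EFin \o h) x| `^ p) = \int[mu]_x (`|h x| `^ p)%:E)%E.
Proof. by apply: eq_integral => x _; reflexivity. Qed.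

Lemma power_norm h : (\int[mu]_x `|(`|h x| `^ p)%:E| = \int[mu]_x (`|h x| `^ p)%:E)%E.
Proof. by apply: eq_integral => x _; rewrite gee0_abs// lee_fin powR_ge0. Qed.

Lemma LnormE h : rLp h -> Lnorm mu p%:E (EFin \o h) = (nm h)%:E.
Proof.
move=> Lh; rewrite unlock power_EFin.
by rewrite -powR_nm// poweR_EFin -powRrM divff ?gt_eqF// powRr1// nm_ge0.
Qed.

Lemma rLpP h : rLp h <-> measurable_fun setT h /\ (Lnorm mu p%:E (EFin \o h) < +oo)%E.
Proof.
split=> [Lh|[mh fh]]; first by rewrite LnormE//; split => //; [case: Lh|exact: ltry].
split => //; apply/integrableP; split.
  by apply/measurable_EFinP; exact: measurable_power.
have := @poweR_lty _ _ p fh; rewrite poweR_Lnorm ?gt_eqF//.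
by rewrite power_EFin power_norm.
Qed.

Lemma rLp_le h g : measurable_fun setT h -> rLp g -> (forall w, `|h w| <= `|g w|) -> rLp h.
Proof.
move=> mh [mg ig] hg; split => //; apply: le_integrable ig => //.
  by apply/measurable_EFinP; exact: measurable_power.
move=> w _; rewrite /= lee_fin [leLHS]ger0_norm ?[leRHS]ger0_norm ?powR_ge0//.
by apply: powR_le; rewrite ?(ltW p0).
Qed.

Lemma nm_le h g : measurable_fun setT h -> rLp g -> (forall w, `|h w| <= `|g w|) -> nm h <= nm g.
Proof.
move=> mh Lg hg; have Lh := rLp_le mh Lg hg.
have nE f : rLp f -> nm f `^ p = \int[mu]_w (`|f w| `^ p).
  by move=> Lf; apply: EFin_inj; rewrite powR_nm// /Rintegral fineK// integrable_fin_num//; case: Lf.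
have : nm h `^ p <= nm g `^ p.
  rewrite (nE _ Lh) (nE _ Lg); apply: le_Rintegral; [exact: measurableT|by case: Lh|by case: Lg|].
  by move=> w _; apply: powR_le; rewrite ?(ltW p0).
move=> /(powR_root p0 (nm_ge0 h) (powR_ge0 _ _)).
by rewrite -powRrM divff ?gt_eqF// powRr1// nm_ge0.
Qed.

Lemma nm_ae h g : measurable_fun setT h -> rLp g -> ae_eq mu setT h g -> rLp h /\ nm h = nm g.
Proof.
move=> mh Lg hg; have [mg ig] := Lg.
have E : (\int[mu]_w (`|h w| `^ p)%:E = \int[mu]_w (`|g w| `^ p)%:E)%E.
  apply: ae_eq_integral => //.
  - by apply/measurable_EFinP; exact: measurable_power.
  - by apply/measurable_EFinP; exact: measurable_power.
  by apply: filterS hg => w /= hgw _; rewrite hgw.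
split; last by rewrite unlock /Rintegral E.
split => //; apply/integrableP; split; first by apply/measurable_EFinP; exact: measurable_power.
by have /integrableP[_] := ig; rewrite !power_norm E.
Qed.

Lemma rLpD h g : rLp h -> rLp g -> rLp (h \+ g) /\ nm (h \+ g) <= nm h + nm g.
Proof.
move=> Lh Lg; have [mh _] := Lh; have [mg _] := Lg.
have M := minkowski_EFin mu mh mg (ltW p1).
have L : rLp (h \+ g).
  apply/rLpP; split; first exact: measurable_funD.
  by apply: le_lt_trans M _; rewrite !LnormE// -EFinD ltry.
split; first exact: L.
by move: M; rewrite (LnormE Lh) (LnormE Lg) (LnormE L) -EFinD lee_fin.
Qed.

Lemma rLpZ c h : rLp h -> rLp (fun w => c * h w) /\ nm (fun w => c * h w) = `|c| * nm h.
Proof.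
move=> Lh; have [mh ih] := Lh.
have H : (fun w => (`|c * h w| `^ p)%:E) = (fun w => (`|c| `^ p)%:E * (`|h w| `^ p)%:E)%E.
  by apply/funext => w; rewrite normrM powRM// EFinM.
have L : rLp (fun w => c * h w).
  split; first by apply: measurable_funM => //; exact: measurable_cst.
  by rewrite H; exact: integrableZl.
split => //.
have : nm (fun w => c * h w) `^ p = (`|c| * nm h) `^ p.
  apply: EFin_inj; rewrite powR_nm// H integralZl// -powR_nm// -EFinM.
  by rewrite powRM ?nm_ge0.
move=> /(congr1 (fun x => x `^ p^-1)).
have nK x : 0 <= x -> (x `^ p) `^ p^-1 = x by move=> x0; rewrite -powRrM divff ?gt_eqF// powRr1.
by rewrite !nK// ?mulr_ge0// nm_ge0.
Qed.

Lemma rLp0 : rLp (fun _ => 0) /\ nm (fun _ => 0) = 0.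
Proof.
have L : rLp (fun _ => 0).
  split; first exact: measurable_cst.
  by under eq_fun do rewrite normr0 powR0 ?gt_eqF//; exact: integrable0.
split; first exact: L.
have [_] := rLpZ 0 L; rewrite normr0 [RHS]mul0r => nz; rewrite -[RHS]nz.
by congr pnorm; apply/funext => w; rewrite mul0r.
Qed.

Lemma rLp_sum (I : Type) (r : seq I) (h : I -> Omega -> R) : (forall i, rLp (h i)) ->
  rLp (fun w => \sum_(i <- r) h i w) /\ nm (fun w => \sum_(i <- r) h i w) <= \sum_(i <- r) nm (h i).
Proof.
move=> Lh; elim: r => [|i r [IH1 IH2]].
  rewrite big_nil (_ : (fun _ => _) = fun _ => 0); last by apply/funext => w; rewrite big_nil.
  by have [? ->] := rLp0.
rewrite big_cons (_ : (fun _ => _) = h i \+ (fun w => \sum_(i <- r) h i w)); last by apply/funext => w; rewrite big_cons.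
have [L1 L2] := rLpD (Lh i) IH1; split => //; apply: le_trans L2 _.
by rewrite lerD2l.
Qed.

End RealLp.

(** * Norming functionals for finite lattice norms *)

Section Norming.
Context {R : realType}.
Notation C := R[i].

(** The unimodular factor that rotates z to its modulus; it is 0 for z = 0, hence only the bound by
    1 in [normc_unphase]. *)
Definition unphase (z : C) : C := (complex.Re z -i* complex.Im z)%C / (normc z)%:C%C.

Lemma normc_conj (z : C) : normc (complex.Re z -i* complex.Im z)%C = normc z.
Proof. by case: z => a b; rewrite /normc/= sqrrN. Qed.

Lemma unphaseM (z : C) : unphase z * z = (normc z)%:C%C.
Proof.
rewrite /unphase; have [->|z0] := eqVneq z 0; first by rewrite mulr0 normc0.
have nz : (normc z)%:C%C != 0 :> C.
  by rewrite -(rmorph0 (real_complex R)) (inj_eq (@complexI R)); apply: contraNneq z0 => /eq0_normc ->.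
apply: (mulfI nz); rewrite mulrA [X in X * z]mulrC divfK// -rmorphM/= -expr2 normc_sqr.
by case: z {z0 nz} => a b; apply/eqP; rewrite eq_complex/=; apply/andP; split; apply/eqP; ring.
Qed.

Lemma normc_unphase (z : C) : normc (unphase z) <= 1.
Proof.
rewrite /unphase normcM normcV normc_conj normc_real ger0_norm ?normc_ge0//.
by have [->|z0] := eqVneq (normc z) 0; rewrite ?mul0r// divff.
Qed.

(** Writing the norm as a finite linear combination lets it pass through linear maps such as
    integration over a cell. The functional is a list of coefficients with indices, because for l^oo
    a single coordinate attains the norm. *)
Lemma norming q (A : Type) (r : seq A) (v : A -> C) : exists s : seq (C * A),
  \sum_(ca <- s) ca.1 * v ca.2 = (lnorm q r v)%:C%C /\
  forall w, normc (\sum_(ca <- s) ca.1 * w ca.2) <= lnorm q r w.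
Proof.
case: q.
- exists [seq (unphase (v a), a) | a <- r]; rewrite /lnorm; split.
    by rewrite big_map rmorph_sum; apply: eq_bigr => a _ /=; rewrite unphaseM.
  move=> w; rewrite big_map; apply: (le_trans (normc_sum _ _)); apply: ler_sum => a _ /=.
  by rewrite normcM ler_piMl ?normc_ge0 ?normc_unphase.
- have [n0|n0] := eqVneq (lnorm l2 r v) 0.
    exists [::]; split=> [|w]; rewrite big_nil ?n0// normc0 lnorm_ge0//.
  exists [seq ((complex.Re (v a) -i* complex.Im (v a))%C / (lnorm l2 r v)%:C%C, a) | a <- r]; split.
    rewrite big_map/=; under eq_bigr do rewrite mulrAC.
    have nz : (lnorm l2 r v)%:C%C != 0 :> C by rewrite -(rmorph0 (real_complex R)) (inj_eq (@complexI R)).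
    rewrite -mulr_suml; apply: (mulIf nz); rewrite divfK// -rmorphM/= -expr2 /lnorm sqr_enorm rmorph_sum.
    apply: eq_bigr => a _; rewrite normc_sqr.
    by case: (v a) => x y; apply/eqP; rewrite eq_complex/=; apply/andP; split; apply/eqP; ring.
  move=> w; rewrite big_map/=; apply: (le_trans (normc_sum _ _)).
  have n1 : 0 < lnorm l2 r v by rewrite lt0r n0 lnorm_ge0.
  under eq_bigr do rewrite !normcM normcV normc_conj normc_real ger0_norm ?(ltW n1)// mulrAC.
  rewrite -mulr_suml ler_pdivrMr// mulrC; exact: cauchy_schwarz.
elim: r => [|a r [s [s1 s2]]].
  by exists [::]; split=> [|w]; rewrite /lnorm !big_nil ?normc0.
have loo_cons w : lnorm loo (a :: r) w = Num.max (normc (w a)) (lnorm loo r w) by rewrite /lnorm big_cons.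
have [h|h] := leP (normc (v a)) (lnorm loo r v).
  exists s; split; first by rewrite s1 loo_cons max_r.
  by move=> w; apply: (le_trans (s2 w)); rewrite loo_cons le_max lexx orbT.
exists [:: (unphase (v a), a)]; split.
  by rewrite loo_cons big_seq1 [LHS]unphaseM max_l// ltW.
by move=> w; rewrite loo_cons big_seq1 le_max normcM ler_piMl ?normc_ge0 ?normc_unphase.
Qed.

End Norming.

Section ComplexLp.
Context {d : measure_display} {Omega : measurableType d} {R : realType}.
Variable mu : {measure set Omega -> \bar R}.
Variable p : R.
Hypothesis p1 : 1 < p.
Notation C := R[i].
Notation Lp := (inLp mu p).
Implicit Types f g : Omega -> C.

Let p0 : 0 < p. Proof. exact: lt_trans p1. Qed.

Definition cmeas f := measurable_fun setT (fun w => complex.Re (f w)) /\ measurable_fun setT (fun w => complex.Im (f w)).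

Lemma cmeas_abs f : cmeas f -> measurable_fun setT (cabs f).
Proof.
move=> [mr mi]; rewrite (_ : cabs f = fun w => Num.sqrt (complex.Re (f w) ^+ 2 + complex.Im (f w) ^+ 2)).
  apply: (measurableT_comp (f := @Num.sqrt R)).
    by apply: continuous_measurable_fun; exact: sqrt_continuous.
  by apply: measurable_funD; apply: measurable_funX.
by apply/funext => w; rewrite /cabs -normc_sqr sqrtr_sqr ger0_norm// normc_ge0.
Qed.

Lemma cmeas_lin (a : C) f g : cmeas f -> cmeas g -> cmeas (fun w => a * f w + g w).
Proof.
move=> [mf1 mf2] [mg1 mg2]; case: a => x y; split.
  rewrite (_ : (fun _ => _) = (fun w => (x * complex.Re (f w) - y * complex.Im (f w)) + complex.Re (g w))).
    by apply: measurable_funD => //; apply: measurable_funB; apply: measurable_funM => //; exact: measurable_cst.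
  by apply/funext => w; case: (f w) (g w) => [? ?] [? ?].
rewrite (_ : (fun _ => _) = (fun w => (x * complex.Im (f w) + y * complex.Re (f w)) + complex.Im (g w))).
  by apply: measurable_funD => //; apply: measurable_funD; apply: measurable_funM => //; exact: measurable_cst.
by apply/funext => w; case: (f w) (g w) => [? ?] [? ?].
Qed.

Lemma inLpP f : Lp f <-> cmeas f /\ rLp mu p (cabs f).
Proof.
split=> [[mr [mi fl]]|[[mr mi] /(rLpP mu p1)[mc fl]]]; last by [].
by split => //; apply/(rLpP mu p1); split => //; exact: cmeas_abs.
Qed.

Definition cn f := pnorm mu p (cabs f).

Lemma cLnormE f : Lp f -> cLnorm mu p f = (cn f)%:E.
Proof. by move=> /inLpP[_ Lf]; exact: LnormE. Qed.

Lemma cn_ge0 f : 0 <= cn f. Proof. exact: nm_ge0. Qed.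

Lemma inLp_lin (a : C) f g : Lp f -> Lp g ->
  Lp (fun w => a * f w + g w) /\ cn (fun w => a * f w + g w) <= normc a * cn f + cn g.
Proof.
move=> /inLpP[mf Lf] /inLpP[mg Lg]; have m := cmeas_lin a mf mg.
have [L1 N1] := rLpZ p1 (normc a) Lf; have [L2 N2] := rLpD p1 L1 Lg.
rewrite ger0_norm ?normc_ge0// in N1.
have H w : `|cabs (fun w => a * f w + g w) w| <= `|((fun w => normc a * cabs f w) \+ cabs g) w|.
  rewrite !ger0_norm /= ?addr_ge0 ?mulr_ge0 ?normc_ge0//.
  by apply: (le_trans (ler_normcD _ _)); rewrite normcM.
split; first by apply/inLpP; split => //; exact: (rLp_le p1 (cmeas_abs m) L2 H).
by apply: (le_trans (nm_le p1 (cmeas_abs m) L2 H)); apply: (le_trans N2); rewrite N1.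
Qed.

Lemma inLp0 : Lp (fun _ => 0) /\ cn (fun _ => 0) = 0.
Proof.
have e : cabs (fun _ : Omega => 0 : C) = fun _ => 0 by apply/funext => w; rewrite /cabs normc0.
have [L N] := rLp0 mu p1; split; last by rewrite /cn e.
by apply/inLpP; split; [split; exact: measurable_cst|rewrite e].
Qed.

Lemma inLpZ (a : C) f : Lp f -> Lp (fun w => a * f w) /\ cn (fun w => a * f w) = normc a * cn f.
Proof.
move=> Lf; have [L0 _] := inLp0; have [L _] := inLp_lin a Lf L0.
have e : (fun w => a * f w) = (fun w => a * f w + 0) by apply/funext => w; rewrite addr0.
rewrite e; split; first exact: L.
rewrite -e /cn (_ : cabs (fun w => a * f w) = fun w => normc a * cabs f w); last first.
  by apply/funext => w; rewrite /cabs normcM.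
have /inLpP[_ Lf'] := Lf; have [_ ->] := rLpZ p1 (normc a) Lf'.
by rewrite ger0_norm// normc_ge0.
Qed.

Lemma inLpD f g : Lp f -> Lp g -> Lp (fun w => f w + g w) /\ cn (fun w => f w + g w) <= cn f + cn g.
Proof.
move=> Lf Lg; have := inLp_lin 1 Lf Lg.
rewrite (_ : (fun w => 1 * f w + g w) = fun w => f w + g w); last by apply/funext => w; rewrite mul1r.
by rewrite normc1 mul1r.
Qed.

Lemma inLp_sum (I : Type) (r : seq I) (f : I -> Omega -> C) : (forall i, Lp (f i)) ->
  Lp (fun w => \sum_(i <- r) f i w) /\ cn (fun w => \sum_(i <- r) f i w) <= \sum_(i <- r) cn (f i).
Proof.
move=> Lf; elim: r => [|i r [IH1 IH2]].
  rewrite big_nil (_ : (fun _ => _) = fun _ => 0); last by apply/funext => w; rewrite big_nil.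
  by have [? ->] := inLp0.
rewrite big_cons (_ : (fun _ => _) = fun w => f i w + (\sum_(i <- r) f i w)); last by apply/funext => w; rewrite big_cons.
have [L1 L2] := inLpD (Lf i) IH1; split; first exact: L1.
by apply: le_trans L2 _; rewrite lerD2l.
Qed.

Lemma cn_ae f g : cmeas f -> Lp g -> ae_eqC mu f g -> Lp f /\ cn f = cn g.
Proof.
move=> mf /inLpP[mg Lg] fg.
have [|L N] := nm_ae (cmeas_abs mf) Lg; last by split=> //; apply/inLpP.
by apply: filterS fg => w /= fgw _; rewrite /cabs fgw.
Qed.

Definition mixed q (A : Type) (r : seq A) (x : A -> Omega -> C) (w : Omega) : R := lnorm q r (x^~ w).

Definition mn q (A : Type) (r : seq A) (x : A -> Omega -> C) : R := pnorm mu p (mixed q r x).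

Lemma measurable_mixed q (A : Type) (r : seq A) x : (forall a, cmeas (x a)) -> measurable_fun setT (mixed q r x).
Proof.
move=> mx; have ma a := cmeas_abs (mx a); rewrite /mixed /lnorm; case: q.
- by apply: measurable_sum => a; exact: ma.
- apply: (measurableT_comp (f := @Num.sqrt R)).
    by apply: continuous_measurable_fun; exact: sqrt_continuous.
  by apply: measurable_sum => a; apply: measurable_funX; exact: ma.
elim: r => [|a r IH].
  by under eq_fun do rewrite big_nil; exact: measurable_cst.
rewrite (_ : (fun _ => _) = (fun w => Num.max (normc (x a w)) (\big[Num.max/0]_(a <- r) normc (x a w)))); last first.
  by apply/funext => w; rewrite big_cons.
by apply: measurable_maxr => //; exact: ma.
Qed.

Lemma rLp_mixed q (A : Type) (r : seq A) x : (forall a, Lp (x a)) ->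
  rLp mu p (mixed q r x) /\ mn q r x <= \sum_(a <- r) cn (x a).
Proof.
move=> Lx; have mx a : cmeas (x a) by have /inLpP[] := Lx a.
have Lx' a : rLp mu p (cabs (x a)) by have /inLpP[] := Lx a.
have [LS NS] := rLp_sum p1 r Lx'.
have H w : `|mixed q r x w| <= `|\sum_(a <- r) cabs (x a) w|.
  rewrite !ger0_norm ?lnorm_ge0 ?sumr_ge0//; last by move=> a _; exact: normc_ge0.
  exact: lnorm_le1.
have mm := measurable_mixed q r mx.
split; first exact: (rLp_le p1 mm LS H).
by apply: le_trans NS; exact: (nm_le p1 mm LS H).
Qed.

Lemma mn_ge0 q (A : Type) (r : seq A) x : 0 <= mn q r x. Proof. exact: nm_ge0. Qed.

Lemma mnD q (A : Type) (r : seq A) x y : (forall a, Lp (x a)) -> (forall a, Lp (y a)) ->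
  mn q r (fun a w => x a w + y a w) <= mn q r x + mn q r y.
Proof.
move=> Lx Ly; have [L1 _] := rLp_mixed q r Lx; have [L2 _] := rLp_mixed q r Ly.
have Lxy a : Lp (fun w => x a w + y a w) by have [] := inLpD (Lx a) (Ly a).
have [[mm _] _] := rLp_mixed q r Lxy.
have [L3 N3] := rLpD p1 L1 L2; apply: le_trans N3; apply: (nm_le p1 mm L3) => w.
rewrite !ger0_norm /= ?addr_ge0 ?lnorm_ge0//; exact: lnormD.
Qed.

Lemma mnZ q (A : Type) (r : seq A) (c : C) x : (forall a, Lp (x a)) ->
  mn q r (fun a w => c * x a w) = normc c * mn q r x.
Proof.
move=> Lx; have [L1 _] := rLp_mixed q r Lx; have [_ N] := rLpZ p1 (normc c) L1.
rewrite ger0_norm ?normc_ge0// in N; rewrite -N; congr pnorm.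
by apply/funext => w; rewrite /mixed lnormZ.
Qed.

Lemma mn_ae q (A : Type) (r : seq A) x y : (forall a, Lp (x a)) -> (forall a, Lp (y a)) ->
  (forall a, ae_eqC mu (x a) (y a)) -> mn q r x = mn q r y.
Proof.
move=> Lx Ly xy; have [[mx _] _] := rLp_mixed q r Lx; have [Ly' _] := rLp_mixed q r Ly.
suff : ae_eq mu setT (mixed q r x) (mixed q r y) by move=> h; have [] := nm_ae mx Ly' h.
have : \forall w \ae mu, List.Forall (fun a => x a w = y a w) r.
  elim: r {mx Ly'} => [|a r IH]; first by apply: aeW => w; constructor.
  apply: filterS2 IH (xy a) => w h1 h2; constructor => //; exact: h2.
clear mx Ly'; apply: filterS => w h _; rewrite /mixed /lnorm.
have nE : List.Forall (fun a => normc (x a w) = normc (y a w)) r.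
  by elim: h => [|a s e _ IH]; constructor => //; rewrite e.
case: q.
- by elim: nE => [|a s e _ IH]; rewrite ?big_nil// !big_cons e IH.
- rewrite /enorm; congr Num.sqrt.
  by elim: nE => [|a s e _ IH]; rewrite ?big_nil// !big_cons e IH.
by elim: nE => [|a s e _ IH]; rewrite ?big_nil// !big_cons e IH.
Qed.

Lemma mn_seq1 q (A : Type) (a : A) x : mn q [:: a] x = cn (x a).
Proof. by congr pnorm; apply/funext => w; rewrite /mixed lnorm_seq1. Qed.

End ComplexLp.

(** * Discretization *)

Section Averages.
Context {d : measure_display} {Omega : measurableType d} {R : realType}.
Variable mu : {measure set Omega -> \bar R}.
Variable p : R.
Hypothesis p1 : 1 < p.
Notation C := R[i].
Notation Lp := (inLp mu p).

Let p0 : 0 < p. Proof. exact: lt_trans p1. Qed.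

Section OneSet.
Variable A : set Omega.
Hypothesis mA : measurable A.
Hypothesis fA : (mu A < +oo)%E.

Let m : R := fine (mu A).

Lemma fin_muA : mu A = m%:E.
Proof. by rewrite fineK// ge0_fin_numE. Qed.

Lemma integrable_cst_on (c : R) : mu.-integrable A (EFin \o (fun _ => c)).
Proof.
apply/integrableP; split; first exact: measurable_cst.
by rewrite integral_cst//= fin_muA -EFinM ltry.
Qed.

Lemma pow_integrable_on (h : Omega -> R) : rLp mu p h -> mu.-integrable A (EFin \o (fun w => `|h w| `^ p)).
Proof. by move=> [_ ih]; apply: integrableS ih. Qed.

Lemma rLp_integrable_on (h : Omega -> R) : rLp mu p h -> mu.-integrable A (EFin \o h).
Proof.
move=> Lh; have mh : measurable_fun A h by case: Lh => mh _; exact: measurable_funTS mh.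
apply: (@le_integrable _ _ _ _ _ _ _ (EFin \o (fun w => 1 + `|h w| `^ p))) => //.
- exact/measurable_EFinP.
- move=> w _; rewrite /= lee_fin [leRHS]ger0_norm ?addr_ge0 ?powR_ge0//.
  have [h1|h1] := leP `|h w| 1; first by rewrite (le_trans h1)// lerDl powR_ge0.
  rewrite ler_wpDl// -[leLHS]powRr1//; apply: ler_powR; exact: ltW.
exact: (integrableD mA (integrable_cst_on 1) (pow_integrable_on Lh)).
Qed.

(** Jensen's inequality on A, from the tangent of x^p at the mean c of h over A. *)
Lemma average_power (h : Omega -> R) : rLp mu p h -> (forall w, 0 <= h w) ->
  (m `^ (p^-1 - 1) * \int[mu]_(w in A) h w) `^ p <= \int[mu]_(w in A) (h w `^ p).
Proof.
move=> Lh h0; set I := Rintegral _ _ h.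
have I0 : 0 <= I by exact: Rintegral_ge0.
have m0 : 0 <= m by exact: fine_ge0.
have pi : mu.-integrable A (EFin \o (fun w => h w `^ p)).
  have := pow_integrable_on Lh; congr (_.-integrable _ _); apply/funext => w /=; by rewrite ger0_norm.
(* On a null set the exponent p^-1 - 1 is negative, but [powR] still gives 0 at 0. *)
move: m0; rewrite le_eqVlt => /predU1P[m0|m0].
  rewrite -m0 powR0; last by rewrite subr_eq0 invr_eq1 gt_eqF.
  rewrite mul0r powR0 ?gt_eqF//; apply: Rintegral_ge0 => w _; exact: powR_ge0.
pose c := I / m; have c0 : 0 <= c by rewrite divr_ge0// ltW.
have -> : (m `^ (p^-1 - 1) * I) `^ p = m * c `^ p.
  rewrite powRM ?powR_ge0// -powRrM mulrBl mulVf ?gt_eqF// mul1r.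
  rewrite /c powRM ?invr_ge0 ?(ltW m0)// -powR_inv1 ?(ltW m0)// -powRrM mulN1r.
  have -> : m `^ (1 - p) = m * m `^ (- p).
    by rewrite powRD ?powRr1 ?(ltW m0)//; apply/implyP => _; rewrite gt_eqF.
  by ring.
have ic := integrable_cst_on.
have ih := rLp_integrable_on Lh.
have iB : mu.-integrable A (EFin \o (fun w => h w - c)) by exact: (integrableB mA ih (ic c)).
have iZ : mu.-integrable A (EFin \o (fun w => p * c `^ (p - 1) * (h w - c))) by exact: (integrableZl mA _ iB).
have -> : m * c `^ p = \int[mu]_(w in A) (c `^ p + (p * c `^ (p - 1)) * (h w - c)).
  rewrite RintegralD// RintegralZl// RintegralB// !Rintegral_cst// -/m -/I /c.
  by rewrite divfK ?gt_eqF// subrr mulr0 addr0 mulrC.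
apply: le_Rintegral => //; first exact: (integrableD mA (ic (c `^ p)) iZ).
by move=> w _; have := powR_tangent p1 c0 (h0 w); lra.
Qed.

Definition cint (g : Omega -> C) : C :=
  (\int[mu]_(w in A) complex.Re (g w) +i* \int[mu]_(w in A) complex.Im (g w))%C.

Lemma Lp_Re g : Lp g -> rLp mu p (fun w => complex.Re (g w)) /\ rLp mu p (fun w => complex.Im (g w)).
Proof.
move=> /(inLpP mu p1)[[mr mi] Lg].
split; apply: (rLp_le p1 _ Lg) => // w; rewrite [leRHS]ger0_norm ?normc_ge0//.
  rewrite -[leLHS]sqrtr_sqr -[leRHS]ger0_norm ?normc_ge0// -sqrtr_sqr ler_wsqrtr// normc_sqr lerDl sqr_ge0//.
rewrite -[leLHS]sqrtr_sqr -[leRHS]ger0_norm ?normc_ge0// -sqrtr_sqr ler_wsqrtr// normc_sqr lerDr sqr_ge0//.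
Qed.

Lemma cint_lin (a : C) f g : Lp f -> Lp g -> cint (fun w => a * f w + g w) = a * cint f + cint g.
Proof.
move=> /Lp_Re[fr fi] /Lp_Re[gr gi].
have [ifr ifi igr igi] : [/\ mu.-integrable A (EFin \o (fun w => complex.Re (f w))),
  mu.-integrable A (EFin \o (fun w => complex.Im (f w))), mu.-integrable A (EFin \o (fun w => complex.Re (g w))) &
  mu.-integrable A (EFin \o (fun w => complex.Im (g w)))].
  by split; exact: rLp_integrable_on.
have iZ (c : R) (h : Omega -> R) : mu.-integrable A (EFin \o h) -> mu.-integrable A (EFin \o (fun w => c * h w)).
  by move=> ih; exact: (integrableZl mA c ih).
have iB (h k : Omega -> R) : mu.-integrable A (EFin \o h) -> mu.-integrable A (EFin \o k) -> mu.-integrable A (EFin \o (fun w => h w - k w)).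
  by move=> ih ik; exact: (integrableB mA ih ik).
have iD (h k : Omega -> R) : mu.-integrable A (EFin \o h) -> mu.-integrable A (EFin \o k) -> mu.-integrable A (EFin \o (fun w => h w + k w)).
  by move=> ih ik; exact: (integrableD mA ih ik).
case: a => x y; apply/eqP; rewrite eq_complex/=; apply/andP; split; apply/eqP.
  rewrite (_ : (fun w => _) = (fun w => (x * complex.Re (f w) - y * complex.Im (f w)) + complex.Re (g w))).
    rewrite RintegralD//; last by apply: iB; exact: iZ.
    by rewrite RintegralB ?RintegralZl//; exact: iZ.
  by apply/funext => w; case: (f w) (g w) => [? ?] [? ?].
rewrite (_ : (fun w => _) = (fun w => (x * complex.Im (f w) + y * complex.Re (f w)) + complex.Im (g w))).
  rewrite RintegralD//; last by apply: iD; exact: iZ.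
  by rewrite RintegralD ?RintegralZl//; exact: iZ.
by apply/funext => w; case: (f w) (g w) => [? ?] [? ?].
Qed.

Lemma cint0 : cint (fun _ => 0) = 0.
Proof. by rewrite /cint /= !Rintegral_cst// mul0r. Qed.

Lemma normc_cint g : Lp g -> normc (cint g) <= \int[mu]_(w in A) normc (g w).
Proof.
move=> Lg; pose th := unphase (cint g).
have [L0 _] := inLp0 mu p1.
have [Lt _] := inLpZ p1 th Lg.
have E : cint (fun w => th * g w) = (normc (cint g))%:C%C.
  have := cint_lin th Lg L0; rewrite cint0 addr0 /th unphaseM => <-.
  by congr cint; apply/funext => w; rewrite addr0.
have -> : normc (cint g) = \int[mu]_(w in A) complex.Re (th * g w) by have /(congr1 (@complex.Re R)) := E.
have [Lr _] := Lp_Re Lt; have /(inLpP mu p1)[_ Lg'] := Lg.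
apply: le_Rintegral => //; [exact: rLp_integrable_on|exact: rLp_integrable_on|].
move=> w _; apply: (@le_trans _ _ (normc (th * g w))).
  rewrite (le_trans (ler_norm _))// -sqrtr_sqr -[leRHS]ger0_norm ?normc_ge0// -[leRHS]sqrtr_sqr.
  by rewrite ler_wsqrtr// normc_sqr lerDl sqr_ge0.
by rewrite normcM ler_piMl ?normc_ge0// normc_unphase.
Qed.

Lemma cint_ae f g : Lp f -> Lp g -> ae_eqC mu f g -> cint f = cint g.
Proof.
move=> /Lp_Re[fr fi] /Lp_Re[gr gi] fg; rewrite /cint /Rintegral; congr (_ +i* _)%C; congr fine.
  apply: ae_eq_integral => //; try (apply/measurable_EFinP; apply: measurable_funTS).
  - by case: fr.
  - by case: gr.
  by apply: filterS fg => w /= e _; rewrite e.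
apply: ae_eq_integral => //; try (apply/measurable_EFinP; apply: measurable_funTS).
- by case: fi.
- by case: gi.
by apply: filterS fg => w /= e _; rewrite e.
Qed.

End OneSet.
End Averages.

(** * Analysis and synthesis on finitely many disjoint cells *)

Section Cells.
Context {d : measure_display} {Omega : measurableType d} {R : realType}.
Variable mu : {measure set Omega -> \bar R}.
Variable p : R.
Hypothesis p1 : 1 < p.
Notation C := R[i].
Notation Lp := (inLp mu p).

Let p0 : 0 < p. Proof. exact: lt_trans p1. Qed.

Section Family.
Variables (n : nat) (A : 'I_n -> set Omega).
Hypothesis mA : forall i, measurable (A i).
Hypothesis fA : forall i, (mu (A i) < +oo)%E.
Hypothesis dA : forall i j w, A i w -> A j w -> i = j.

Let m i : R := fine (mu (A i)).

(** The normalised indicators of the cells. The exponents of vectors and coefficients add up to -1,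
    so the sum of coefficient times vector is the conditional expectation on the cells, while the
    coefficients carry the l^p-norm. *)
Definition cell_vec i : Omega -> C := fun w => (m i `^ (- p^-1) * \1_(A i) w)%:C%C.
Definition cell_coef i (g : Omega -> C) : C := (m i `^ (p^-1 - 1))%:C%C * cint mu (A i) g.

Lemma m_ge0 i : 0 <= m i. Proof. exact: fine_ge0. Qed.

Lemma sum_cells (h : Omega -> R) : rLp mu p h ->
  \sum_i \int[mu]_(w in A i) (`|h w| `^ p) <= pnorm mu p h `^ p.
Proof.
move=> Lh; have [mh ih] := Lh; rewrite -lee_fin (powR_nm p1 Lh) -sumEFin.
have iA i : mu.-integrable (A i) (fun w => (`|h w| `^ p)%:E) by apply: integrableS ih.
rewrite (eq_bigr (fun i => \int[mu]_(w in A i) (`|h w| `^ p)%:E)%E); last first.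
  by move=> i _; rewrite /Rintegral fineK// integrable_fin_num.
have mp : measurable_fun setT (fun w => (`|h w| `^ p)%:E) by apply/measurable_EFinP; exact: measurable_power.
rewrite -(@ge0_integral_bigsetU _ _ _ mu 'I_n A (fun w => (`|h w| `^ p)%:E) (index_enum 'I_n))//.
- by apply: ge0_subset_integral => //; apply: bigsetU_measurable.
- exact: index_enum_uniq.
- by move=> i j _ _ [w [/= wi wj]]; exact: dA wi wj.
- exact: measurable_funTS.
Qed.

Lemma inLp_indic i (c : C) : Lp (fun w => c * (\1_(A i) w)%:C%C).
Proof.
apply: (inLpZ p1 c _).1; apply/(inLpP mu p1); split.
  split; last by rewrite (_ : (fun _ => _) = fun _ => 0)//; exact: measurable_cst.
  exact: measurable_indic.
have e : cabs (fun w => (\1_(A i) w)%:C%C : C) = \1_(A i).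
  by apply/funext => w; rewrite /cabs normc_real ger0_norm.
rewrite e; split; first exact: measurable_indic.
rewrite (_ : (fun w => _) = (fun w => (\1_(A i) w)%:E)); last first.
  by apply/funext => w; rewrite indicE; case: (_ \in _); rewrite ?normr1 ?powR1// normr0 powR0// gt_eqF.
apply/integrableP; split; first by apply/measurable_EFinP; exact: measurable_indic.
rewrite (eq_integral (fun w => (\1_(A i) w)%:E)).
  by rewrite integral_indic// setIT.
by move=> w _; rewrite gee0_abs// lee_fin.
Qed.

Lemma cell_vec_Lp i : Lp (cell_vec i).
Proof.
have := inLp_indic i (m i `^ (- p^-1))%:C%C; congr (inLp _ _ _).
by apply/funext => w; rewrite /cell_vec rmorphM.
Qed.

Lemma cell_coef_lin i (a : C) f g : Lp f -> Lp g ->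
  cell_coef i (fun w => a * f w + g w) = a * cell_coef i f + cell_coef i g.
Proof. by move=> Lf Lg; rewrite /cell_coef (cint_lin p1 (mA i) (fA i))//; ring. Qed.

Lemma cell_coef_ae i f g : Lp f -> Lp g -> ae_eqC mu f g -> cell_coef i f = cell_coef i g.
Proof. by move=> Lf Lg fg; rewrite /cell_coef (cint_ae p1 (mA i) Lf Lg fg). Qed.

Lemma normc_cell_coef i g : Lp g -> normc (cell_coef i g) <= m i `^ (p^-1 - 1) * \int[mu]_(w in A i) normc (g w).
Proof.
move=> Lg; rewrite normcM normc_real ger0_norm ?powR_ge0// ler_wpM2l ?powR_ge0//.
exact: (normc_cint p1 (mA i) (fA i)).
Qed.

(** On each cell the lattice norm of the coefficients is the coefficient of one linear combination
    of the x b, by [norming], and this combination is pointwise below the lattice norm of x;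
    [average_power] then applies to a scalar function. *)
Lemma cell_analysis q (B : Type) (r : seq B) (x : B -> Omega -> C) : (forall b, Lp (x b)) ->
  \sum_i lnorm q r (fun b => cell_coef i (x b)) `^ p <= mn mu p q r x `^ p.
Proof.
move=> Lx; have [Lm _] := rLp_mixed p1 q r Lx; apply: le_trans (sum_cells Lm).
apply: ler_sum => i _.
have M0 w : 0 <= mixed q r x w by exact: lnorm_ge0.
rewrite (_ : (fun w => `|mixed q r x w| `^ p) = (fun w => mixed q r x w `^ p)); last first.
  by apply/funext => w; rewrite ger0_norm.
apply: le_trans (average_power p1 (mA i) (fA i) Lm M0).
apply: powR_le; [exact: ltW|exact: lnorm_ge0|].
have [s [s1 s2]] := norming q r (fun b => cell_coef i (x b)).
have E : cell_coef i (fun w => \sum_(ca <- s) ca.1 * x ca.2 w) = (lnorm q r (fun b => cell_coef i (x b)))%:C%C.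
  rewrite -s1; elim: {s1 s2} s => [|ca s IH].
    rewrite big_nil (_ : (fun w => _) = fun _ => 0); last by apply/funext => w; rewrite big_nil.
    by rewrite /cell_coef (cint0 mu (mA i)) mulr0.
  rewrite big_cons -IH (_ : (fun w => _) = (fun w => ca.1 * x ca.2 w + \sum_(ca <- s) ca.1 * x ca.2 w)).
    apply: cell_coef_lin; first exact: Lx.
    by have [] := inLp_sum p1 s (fun ca => (inLpZ p1 ca.1 (Lx ca.2)).1).
  by apply/funext => w; rewrite big_cons.
have Ls : Lp (fun w => \sum_(ca <- s) ca.1 * x ca.2 w).
  by have [] := inLp_sum p1 s (fun ca => (inLpZ p1 ca.1 (Lx ca.2)).1).
have -> : lnorm q r (fun b => cell_coef i (x b)) = normc (cell_coef i (fun w => \sum_(ca <- s) ca.1 * x ca.2 w)).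
  by rewrite E normc_real ger0_norm// lnorm_ge0.
apply: (le_trans (normc_cell_coef i Ls)); rewrite ler_wpM2l ?powR_ge0//.
have /(inLpP mu p1)[_ Ls'] := Ls.
apply: le_Rintegral => //; [exact: (rLp_integrable_on p1)|exact: (rLp_integrable_on p1)|].
by move=> w _; exact: s2.
Qed.

(** At most one cell contributes at a point, so the powers simply add. Cells of measure zero count
    only on the right, which is why this is an inequality. *)
Lemma cell_synthesis q (B : Type) (r : seq B) (y : 'I_n -> B -> C) :
  mn mu p q r (fun b w => \sum_i y i b * cell_vec i w) `^ p <= \sum_i lnorm q r (y i) `^ p.
Proof.
have Ly b : Lp (fun w => \sum_i y i b * cell_vec i w).
  by have [] := inLp_sum p1 (index_enum 'I_n) (fun i => (inLpZ p1 (y i b) (cell_vec_Lp i)).1).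
have [Lm _] := rLp_mixed p1 q r Ly.
have E w : `|mixed q r (fun b w => \sum_i y i b * cell_vec i w) w| `^ p
    = \sum_i (m i `^ (-1) * lnorm q r (y i) `^ p) * \1_(A i) w.
  rewrite ger0_norm ?lnorm_ge0// /mixed.
  have [[i wi]|nw] := pselect (exists i, A i w).
    have z j : j != i -> \1_(A j) w = 0 :> R.
      by move=> ji; rewrite indicE memNset// => wj; move: ji; rewrite (dA wi wj) eqxx.
    have i1 : \1_(A i) w = 1 :> R by rewrite indicE mem_set.
    rewrite (@eq_lnorm _ q _ r _ (fun b => (m i `^ (- p^-1))%:C%C * y i b)).
      rewrite lnormZ normc_real ger0_norm ?powR_ge0// powRM ?powR_ge0 ?lnorm_ge0// -powRrM mulNr mulVf ?gt_eqF//.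
      rewrite [RHS](bigD1 i)//= i1 mulr1 big1 ?addr0// => j ji; by rewrite z// mulr0.
    move=> b; rewrite (bigD1 i)//= /cell_vec i1 mulr1 mulrC big1 ?addr0// => j ji.
    by rewrite z// mulr0 mulr0.
  have z j : \1_(A j) w = 0 :> R by rewrite indicE memNset// => wj; apply: nw; exists j.
  rewrite (@eq_lnorm _ q _ r _ (fun b => 0)); last first.
    by move=> b; rewrite big1// => j _; rewrite /cell_vec z !mulr0.
  by rewrite lnorm0 powR0 ?gt_eqF// big1// => j _; rewrite z mulr0.
rewrite -lee_fin (powR_nm p1 Lm); under eq_integral do rewrite E -sumEFin.
rewrite ge0_integral_sum//; last 2 first.
- by move=> i; apply/measurable_EFinP; apply: measurable_funM; [exact: measurable_cst|exact: measurable_indic].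
- by move=> i w _; rewrite lee_fin !mulr_ge0 ?powR_ge0.
rewrite -sumEFin; apply: lee_sum => i _.
under eq_integral do rewrite EFinM.
rewrite ge0_integralZl_EFin//; last 2 first.
- by apply/measurable_EFinP; exact: measurable_indic.
- by rewrite mulr_ge0 ?powR_ge0.
rewrite integral_indic// setIT (fin_muA (fA i)) -EFinM lee_fin -/(m i).
rewrite mulrAC ler_piMl ?powR_ge0//.
have := m_ge0 i; rewrite le_eqVlt => /predU1P[<-|m0]; first by rewrite mulr0.
by rewrite powR_inv1 ?(ltW m0)// mulVf// gt_eqF.
Qed.

Lemma cint_indic i (c : 'I_n -> C) : cint mu (A i) (fun w => \sum_j c j * (\1_(A j) w)%:C%C) = c i * (m i)%:C%C.
Proof.
have E w : A i w -> \sum_j c j * (\1_(A j) w)%:C%C = c i.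
  move=> wi; rewrite (bigD1 i)//= indicE mem_set// mulr1 big1 ?addr0// => j ji.
  by rewrite indicE memNset ?mulr0// => wj; move: ji; rewrite (dA wi wj) eqxx.
rewrite /cint (@eq_Rintegral _ _ _ mu (A i) (fun _ => complex.Re (c i))); last by move=> w /set_mem /E ->.
rewrite [X in (_ +i* X)%C](@eq_Rintegral _ _ _ mu (A i) (fun _ => complex.Im (c i))); last by move=> w /set_mem /E ->.
rewrite !Rintegral_cst// -/(m i); case: (c i) => x y.
by apply/eqP; rewrite eq_complex/= !mulr0 subr0 add0r !eqxx.
Qed.

(** Only almost everywhere: on a cell of measure zero the coefficient vanishes whatever the function
    is. *)
Lemma cell_reproduce (c : 'I_n -> C) :
  ae_eqC mu (fun w => \sum_i cell_coef i (fun w => \sum_j c j * (\1_(A j) w)%:C%C) * cell_vec i w)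
    (fun w => \sum_i c i * (\1_(A i) w)%:C%C).
Proof.
have : \forall w \ae mu, forall i, m i = 0 -> ~ A i w.
  apply: filter_forall => i; have [mi|mi] := eqVneq (m i) 0; last first.
    by apply: aeW => w mi0; move: mi; rewrite mi0 eqxx.
  exists (A i); split => //; first by rewrite (fin_muA (fA i)) -/(m i) mi.
  by move=> w /=; apply: contra_notP => nw _.
apply: filterS => w h _; apply: eq_bigr => i _.
rewrite /cell_coef cint_indic /cell_vec.
have := m_ge0 i; rewrite le_eqVlt => /predU1P[/esym mi|mi].
  by rewrite indicE memNset ?mulr0 ?mulr0//; exact: h.
have e : m i `^ (p^-1 - 1) * m i * m i `^ (- p^-1) = 1.
  rewrite -{2}(powRr1 (ltW mi)) -!powRD; try by apply/implyP => _; rewrite gt_eqF.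
  by rewrite (_ : _ + _ = 0) ?powRr0//; ring.
rewrite rmorphM/=.
have -> : (m i `^ (p^-1 - 1))%:C%C * (c i * (m i)%:C%C) * ((m i `^ (- p^-1))%:C%C * (\1_(A i) w)%:C%C)
  = (m i `^ (p^-1 - 1) * m i * m i `^ (- p^-1))%:C%C * (c i * (\1_(A i) w)%:C%C).
  by rewrite !rmorphM/=; ring.
by rewrite e mul1r.
Qed.

End Family.
End Cells.

(** * Approximation by functions that are constant on cells *)

Section Density.
Context {d : measure_display} {Omega : measurableType d} {R : realType}.
Variable mu : {measure set Omega -> \bar R}.
Variable p : R.
Hypothesis p1 : 1 < p.
Notation C := R[i].
Notation Lp := (inLp mu p).
Notation nm := (pnorm mu p).

Let p0 : 0 < p. Proof. exact: lt_trans p1. Qed.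

Import HBNNSimple.

Definition simple (h : Omega -> R) := rLp mu p h /\ finite_set (range h).

Lemma simple_dense_nonneg (h : Omega -> R) (e : R) : rLp mu p h -> (forall w, 0 <= h w) -> 0 < e ->
  exists2 phi, simple phi & nm (fun w => h w - phi w) <= e.
Proof.
move=> Lh h0 e0; have [mh ih] := Lh.
have mE : measurable_fun setT (EFin \o h) by exact/measurable_EFinP.
pose phi n := nnsfun_approx measurableT mE n.
have phi_cvg w : phi n w @[n --> \oo] --> h w.
  have H : forall x, [set: Omega] x -> (0 <= (EFin \o h) x)%E by move=> x _; rewrite lee_fin.
  by have /fine_cvgP[_] := @cvg_nnsfun_approx _ _ _ _ measurableT _ mE H w I.
have phi_nd w : {homo (fun n => phi n w) : m n / (m <= n)%N >-> m <= n}.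
  by move=> a b ab; have /lefP := nd_nnsfun_approx measurableT mE ab; exact.
have phi_le n w : phi n w <= h w.
  rewrite -(cvg_lim (@Rhausdorff R) (phi_cvg w)).
  by apply: nondecreasing_cvgn_le; [exact: phi_nd|apply/cvg_ex; exists (h w)].
have phi0 n w : 0 <= phi n w by [].
have mphi n : measurable_fun setT (phi n) by exact: measurable_funPT.
have Lphi n : rLp mu p (phi n).
  by apply: (rLp_le p1 (mphi n) Lh) => w; rewrite !ger0_norm.
have md n : measurable_fun setT (fun w => h w - phi n w) by exact: measurable_funB.
have Ld n : rLp mu p (fun w => h w - phi n w).
  apply: (rLp_le p1 (md n) Lh) => w; rewrite !ger0_norm ?subr_ge0//.
  by rewrite gerBl.
have cv : (\int[mu]_w (`|h w - phi n w| `^ p)%:E)%E @[n --> \oo] --> (\int[mu]_w (cst 0 w))%E.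
  apply: (@dominated_cvg _ _ _ _ _ measurableT _ _ (fun w => (`|h w| `^ p)%:E)).
  - by move=> n; apply/measurable_EFinP; exact: measurable_power.
  - move=> w _; apply: cvg_EFin; first by apply: nearW.
    have H : (fun n => h w - phi n w) @ \oo --> h w - h w by apply: cvgB; [exact: cvg_cst|exact: phi_cvg].
    rewrite subrr in H; have := continuous_cvg _ (powR_continuous p1 (x := 0)) H.
    by rewrite normr0 powR0 ?gt_eqF// => HH; apply: HH.
  - by [].
  - exact: ih.
  move=> n w _; rewrite /= lee_fin ger0_norm ?powR_ge0//; apply: powR_le; [exact: ltW|by []|].
  by rewrite !ger0_norm ?subr_ge0// gerBl.
rewrite integral0 in cv.
have ep : 0 < e `^ p by exact: powR_gt0.
have := cv [set x | (x < (e `^ p)%:E)%E].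
have nb : nbhs (0 : \bar R)%E [set x | (x < (e `^ p)%:E)%E].
  by apply: open_nbhs_nbhs; split; [exact: open_ereal_lt_ereal|rewrite /= lte_fin].
move=> /(_ nb)[n _ /(_ n (leqnn n))/= H].
exists (phi n); first by split; [exact: Lphi|exact: fimfunP].
have := H; rewrite -(powR_nm p1 (Ld n)) lte_fin => /ltW/(powR_root p0 (nm_ge0 _ _ _) (powR_ge0 _ _)).
by rewrite -powRrM divff ?gt_eqF// powRr1// ltW.
Qed.

Lemma finite_map_range (l : seq (Omega -> R)) : (forall g, List.In g l -> finite_set (range g)) ->
  finite_set (range (fun w => [seq g w | g <- l])).
Proof.
elim: l => [|g l IH] H.
  by apply: (sub_finite_set (B := [set [::]])) => // v [w _ <-].
apply: (sub_finite_set (B := [set x :: v | x in range g & v in range (fun w => [seq g w | g <- l])])).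
  by move=> v [w _ <-] /=; exists (g w); [by exists w|exists [seq g w | g <- l] => //; exists w].
by apply: finite_image2; [apply: H; left|apply: IH => f fl; apply: H; right].
Qed.

Lemma measurable_map_preimage (l : seq (Omega -> R)) v : (forall g, List.In g l -> measurable_fun setT g) ->
  measurable [set w | [seq g w | g <- l] = v].
Proof.
elim: l v => [|g l IH] [|x v] H /=.
- by rewrite (_ : [set _ | _] = setT)//; apply/seteqP; split.
- by rewrite (_ : [set _ | _] = set0)//; apply/seteqP; split.
- by rewrite (_ : [set _ | _] = set0)//; apply/seteqP; split.
rewrite (_ : [set _ | _] = (g @^-1` [set x]) `&` [set w | [seq g w | g <- l] = v]).
  apply: measurableI; last by apply: IH => f fl; apply: H; right.
  by rewrite -[X in measurable X]setTI; apply: H => //; left.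
by apply/seteqP; split => w /=; [move=> [-> ->]|move=> [-> ->]].
Qed.

(** The cells are the level sets of the joint map [Psi], for joint values that are not entirely
    zero. On such a set some function of the list is a nonzero constant, and its integrability makes
    the measure finite although mu need not be sigma-finite. *)
Lemma simple_partition (l : seq (Omega -> R)) : (forall g, List.In g l -> simple g) ->
  exists n (A : 'I_n.+1 -> set Omega), [/\ (forall i, measurable (A i)), (forall i, (mu (A i) < +oo)%E),
    (forall i j w, A i w -> A j w -> i = j) &
    forall g, List.In g l -> exists c : 'I_n.+1 -> R, forall w, g w = \sum_i c i * \1_(A i) w].
Proof.
move=> Sl; pose Psi w := [seq g w | g <- l].
have fP : finite_set (range Psi) by apply: finite_map_range => g /Sl[].
pose L := [seq v <- finmap.enum_fset (fset_set (range Psi)) | has (fun x : R => x != 0) v].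
(* The last index is an empty cell, so that the index type is inhabited even when all the functions
   vanish. *)
pose A (i : 'I_(size L).+1) := [set w | (i < size L)%N /\ Psi w = nth [::] L i].
have Lu : uniq L by rewrite filter_uniq// finmap.fset_uniq.
have inL w : has (fun x : R => x != 0) (Psi w) -> Psi w \in L.
  by move=> h; rewrite mem_filter h/= in_fset_set// inE; exists w.
have lm g : List.In g l -> exists2 k, forall w, nth 0 (Psi w) k = g w & forall w, g w != 0 -> has (fun x : R => x != 0) (Psi w).
  rewrite /Psi; elim: (l) => //= f s IH [->|/IH[k h1 h2]]; first by exists 0%N => // w ->.
  by exists k.+1 => // w /h2 ->; rewrite orbT.
exists (size L), A; split.
- move=> i; have [iL|iL] := ltnP i (size L); last first.
    by rewrite (_ : A i = set0)//; apply/seteqP; split=> w; rewrite /A /= ltnNge iL => -[].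
  rewrite (_ : A i = [set w | Psi w = nth [::] L i]); first by apply: measurable_map_preimage => g /Sl[[]].
  by apply/seteqP; split=> w; rewrite /A /=; [case|split].
- move=> i; have [iL|iL] := ltnP i (size L); last first.
    by rewrite (_ : A i = set0) ?measure0//; apply/seteqP; split=> w; rewrite /A /= ltnNge iL => -[].
  have /(mem_nth [::]) := iL; rewrite mem_filter => /andP[/(has_nthP 0)[k kv cn0] _].
  set v := nth [::] L i in kv cn0.
  have [->|/set0P[w0 Aw0]] := eqVneq (A i) set0; first by rewrite measure0.
  have [g gl gE] : exists2 g, List.In g l & forall w, nth 0 (Psi w) k = g w.
    have kl : (k < size l)%N by move: kv; rewrite /v -(proj2 Aw0) size_map.
    exists (nth (fun _ => 0) l k); first by apply/List_In_mem; exact: mem_nth.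
    by move=> w; rewrite (nth_map (fun _ => 0)).
  have [[mg ig] _] := Sl g gl.
  set c := nth 0 v k in cn0.
  have mAi : measurable (A i).
    by rewrite (_ : A i = [set w | Psi w = v]); [apply: measurable_map_preimage => f /Sl[[]]|apply/seteqP; split => w; rewrite /A/=; [case|split]].
  have c0 : 0 < `|c| `^ p by rewrite powR_gt0// normr_gt0.
  rewrite -(@lte_pmul2l _ (`|c| `^ p)%:E)// mulry gtr0_sg// mul1e.
  have /integrableP[_] := ig; apply: le_lt_trans.
  rewrite -(setIT (A i)) -integral_indic// -ge0_integralZl_EFin ?(ltW c0)//; last first.
    by apply/measurable_EFinP; exact: measurable_indic.
  apply: ge0_le_integral => //.
  - by apply/measurable_EFinP; apply: measurable_funM; [exact: measurable_cst|exact: measurable_indic].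
  - by apply/measurable_EFinP; apply: measurableT_comp => //; exact: measurable_power.
  move=> w _; rewrite -EFinM gee0_abs ?lee_fin ?powR_ge0// indicE.
  have [/set_mem [_ Aw]|_] := boolP (w \in A i); last by rewrite mulr0 powR_ge0.
  by rewrite mulr1 -gE /c /v -Aw.
- move=> i j w [iL iw] [jL jw]; apply/val_inj/eqP.
  by rewrite -(nth_uniq [::] iL jL Lu) -iw -jw.
move=> g gl; have [k gE gn] := lm g gl.
exists (fun i => nth 0 (nth [::] L i) k) => w.
have [g0|g0] := eqVneq (g w) 0.
  rewrite g0 big1// => i _; rewrite indicE.
  have [/set_mem[_ Aw]|_] := boolP (w \in A i); last by rewrite mulr0.
  by rewrite -Aw gE g0 mul0r.
have wL := inL w (gn w g0).
have iL : (index (Psi w) L < size L)%N by rewrite index_mem.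
have iL' : (index (Psi w) L < (size L).+1)%N by exact: ltnW.
rewrite (bigD1 (Ordinal iL'))//= nth_index// gE indicE mem_set; last by split => //=; rewrite nth_index.
rewrite mulr1 big1 ?addr0// => i ij; rewrite indicE memNset ?mulr0// => -[ii iw].
by move: ij; rewrite -val_eqE/= iw index_uniq// eqxx.
Qed.

(** The two booleans choose between real and imaginary part and between positive and negative part,
    so four nonnegative functions are approximated, each within e / 4. *)
Lemma simple_dense (f : Omega -> C) (e : R) : Lp f -> 0 < e ->
  exists a : bool -> bool -> Omega -> R, (forall b c, simple (a b c)) /\
   cn mu p (fun w => f w - ((a true true w - a true false w) +i* (a false true w - a false false w))%C) <= e.
Proof.
move=> Lf e0; have [Lr Li] := Lp_Re p1 Lf.
pose part (b c : bool) w := let x := if b then complex.Re (f w) else complex.Im (f w) in Num.max (if c then x else - x) 0.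
have Lpart b c : rLp mu p (part b c).
  have L1 : rLp mu p (fun w => if b then complex.Re (f w) else complex.Im (f w)) by case: (b).
  apply: (rLp_le p1 _ L1).
    apply: measurable_maxr; last exact: measurable_cst.
    by case: c; [by case: L1|apply: measurableT_comp => //; case: L1].
  move=> w; rewrite ger0_norm ?le_max ?lexx ?orbT// /part; set x := (if b then _ else _).
  by case: c; rewrite ge_max normr_ge0 andbT ?ler_norm// -normrN ler_norm.
have p4 b c w : 0 <= part b c w by rewrite /part le_max lexx orbT.
have e4 : 0 < e / 4 by rewrite divr_gt0.
have /choice[a Ha] : forall bc : bool * bool, exists phi, simple phi /\ nm (fun w => part bc.1 bc.2 w - phi w) <= e / 4.
  by move=> [b c]; have [phi ? ?] := simple_dense_nonneg (Lpart b c) (p4 b c) e4; exists phi.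
exists (fun b c => a (b, c)); split; first by move=> b c; case: (Ha (b, c)).
pose dif b c w := part b c w - a (b, c) w.
have Ldif b c : rLp mu p (dif b c).
  have [[La _] _] := Ha (b, c).
  have := (rLpD p1 (Lpart b c) (rLpZ p1 (-1) La).1).1.
  by congr (rLp _ _ _); apply/funext => w; rewrite /= mulN1r.
have Ldif' bc : rLp mu p (fun w => `|dif bc.1 bc.2 w|).
  apply: (rLp_le p1 _ (Ldif bc.1 bc.2)) => [|w]; last by rewrite normr_id.
  by apply: measurableT_comp => //; case: (Ldif bc.1 bc.2).
have [LS NS] := rLp_sum p1 [:: (true, true); (true, false); (false, true); (false, false)] Ldif'.
have maxB (x : R) : Num.max x 0 - Num.max (- x) 0 = x.
  by have [x0|/ltW x0] := leP x 0; [rewrite max_l ?oppr_ge0//|rewrite max_r ?oppr_le0//]; lra.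
set g := fun w => _.
have gE w : g w = ((dif true true w - dif true false w) +i* (dif false true w - dif false false w))%C.
  rewrite /g /dif /part /=; case: (f w) => x y /=.
  have hx := esym (maxB x); have hy := esym (maxB y).
  apply/eqP; rewrite eq_complex /=; apply/andP; split; apply/eqP.
    by rewrite {1}hx; ring.
  by rewrite {1}hy; ring.
have mg : cmeas g.
  have md b c : measurable_fun setT (dif b c) by case: (Ldif b c).
  by split; under eq_fun do rewrite gE /=; exact: measurable_funB.
have bnd w : `|cabs g w| <= `|\sum_(bc <- [:: (true, true); (true, false); (false, true); (false, false)]) `|dif bc.1 bc.2 w| |.
  rewrite !ger0_norm ?normc_ge0//; last by rewrite sumr_ge0.
  rewrite /cabs gE !big_cons big_nil /=.
  have cx (x y : R) : normc (x +i* y)%C <= `|x| + `|y|.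
    rewrite -[leRHS]ger0_norm ?addr_ge0// -sqrtr_sqr /normc ler_wsqrtr//.
    by rewrite sqrrD !real_normK ?num_real// -addrA lerD2l lerDr mulrn_wge0// mulr_ge0.
  apply: (le_trans (cx _ _)).
  have := ler_normB (dif true true w) (dif true false w).
  have := ler_normB (dif false true w) (dif false false w); lra.
apply: (le_trans (nm_le p1 (cmeas_abs mg) LS bnd)); apply: (le_trans NS).
have nabs b c : nm (fun w => `|dif b c w|) <= e / 4.
  have [_] := Ha (b, c); apply: le_trans; apply: (nm_le p1 _ (Ldif b c)) => [|w]; last by rewrite normr_id.
  by have [] := Ldif' (b, c).
rewrite !big_cons big_nil /=.
have := nabs true true; have := nabs true false; have := nabs false true; have := nabs false false; lra.
Qed.

Lemma proj_contraction n (A : 'I_n -> set Omega) : (forall i, measurable (A i)) -> (forall i, (mu (A i) < +oo)%E) ->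
  (forall i j w, A i w -> A j w -> i = j) -> forall g, Lp g ->
  Lp (fun w => \sum_i cell_coef mu p A i g * cell_vec mu p A i w) /\
  cn mu p (fun w => \sum_i cell_coef mu p A i g * cell_vec mu p A i w) <= cn mu p g.
Proof.
move=> mA fA dA g Lg; split.
  by have [] := inLp_sum p1 (index_enum 'I_n) (fun i => (inLpZ p1 (cell_coef mu p A i g) (cell_vec_Lp p1 mA fA i)).1).
have := cell_synthesis p1 mA fA dA l1 [:: tt] (fun i _ => cell_coef mu p A i g).
rewrite mn_seq1 => h1.
have := @cell_analysis _ _ _ mu p p1 _ A mA fA dA l1 unit [:: tt] (fun _ => g) (fun _ => Lg).
rewrite mn_seq1 => h2.
have /(powR_root p0 (cn_ge0 _ _ _) (powR_ge0 _ _)) := le_trans h1 h2.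
by rewrite -powRrM divff ?gt_eqF// powRr1// cn_ge0.
Qed.

(** If psi is a function on the cells within e / 2 of g and P is the conditional expectation, then P
    psi = psi almost everywhere and g - P g = (g - psi) - P (g - psi), where P is contractive. *)
Lemma discretize (gs : seq (Omega -> C)) (e : R) : 0 < e -> (forall g, List.In g gs -> Lp g) ->
  exists n (A : 'I_n.+1 -> set Omega), [/\ (forall i, measurable (A i)), (forall i, (mu (A i) < +oo)%E),
    (forall i j w, A i w -> A j w -> i = j) &
    forall g, List.In g gs -> cn mu p (fun w => g w - \sum_i cell_coef mu p A i g * cell_vec mu p A i w) <= e].
Proof.
move=> e0 Lgs; have e2 : 0 < e / 2 by rewrite divr_gt0.
have /choice[a Ha] : forall g : Omega -> C, exists a : bool -> bool -> Omega -> R, Lp g -> (forall b c, simple (a b c)) /\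
   cn mu p (fun w => g w - ((a true true w - a true false w) +i* (a false true w - a false false w))%C) <= e / 2.
  move=> g; have [Lg|nL] := pselect (Lp g); last by exists (fun _ _ _ => 0).
  by have [a aP] := simple_dense Lg e2; exists a.
pose four g := [:: a g true true; a g true false; a g false true; a g false false].
have [|n [A [mA fA dA HA]]] := @simple_partition (flatten [seq four g | g <- gs]).
  elim: gs Lgs => //= g gs IH Lgs h; have [Sg _] := Ha g (Lgs g (or_introl erefl)).
  move=> [<-|[<-|[<-|[<-|hs]]]]; [exact: Sg|exact: Sg|exact: Sg|exact: Sg|].
  by apply: IH hs => f fs; apply: Lgs; right.
exists n, A; split => // g gin.
have Lg := Lgs g gin; have [Sg Ng] := Ha g Lg.
have cin b c : exists cc : 'I_n.+1 -> R, forall w, a g b c w = \sum_i cc i * \1_(A i) w.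
  apply: HA; elim: gs gin {Lgs} => //= f gs IH [->|h]; last by right; right; right; right; apply: IH.
  by case: b c {IH} => [] []; [left|right; left|right; right; left|right; right; right; left].
have [c1 C1] := cin true true; have [c2 C2] := cin true false.
have [c3 C3] := cin false true; have [c4 C4] := cin false false.
pose c i : C := ((c1 i - c2 i) +i* (c3 i - c4 i))%C.
pose psi w := \sum_i c i * (\1_(A i) w)%:C%C.
have psiE w : ((a g true true w - a g true false w) +i* (a g false true w - a g false false w))%C = psi w.
  rewrite C1 C2 C3 C4 -!sumrB /psi /c.
  have sumC (x y : 'I_n.+1 -> R) : ((\sum_i x i) +i* (\sum_i y i))%C = \sum_i (x i +i* y i)%C.
    by apply/eqP; rewrite eq_complex !raddf_sum /=; apply/andP.
  rewrite sumC; apply: eq_bigr => i _.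
  by apply/eqP; rewrite eq_complex /=; apply/andP; split; apply/eqP; ring.
have Lpsi : Lp psi by have [] := inLp_sum p1 (index_enum 'I_n.+1) (fun i => inLp_indic p1 mA fA i (c i)).
pose P (f : Omega -> C) w := \sum_i cell_coef mu p A i f * cell_vec mu p A i w.
have [Ld Nd] := inLp_lin p1 (-1) Lpsi Lg.
have Nd' : cn mu p (fun w => -1 * psi w + g w) <= e / 2.
  apply: le_trans Ng; rewrite le_eqVlt; apply/orP; left; apply/eqP; congr (cn mu p _); apply/funext => w.
  by rewrite psiE mulN1r addrC.
have [LP NP] := proj_contraction mA fA dA Ld.
have [LPg _] := proj_contraction mA fA dA Lg.
have [LPp _] := proj_contraction mA fA dA Lpsi.
have PE w : P (fun w => -1 * psi w + g w) w = - P psi w + P g w.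
  rewrite /P -sumrN -big_split/=; apply: eq_bigr => i _.
  by rewrite cell_coef_lin//; ring.
have [LmP NmP] := inLpZ p1 (-1) LP.
have [Lt Nt] := inLpD p1 Ld LmP.
have := le_trans Nt (lerD Nd' (_ : _ <= e / 2)).
rewrite NmP normcN' normc1 mul1r => /(_ (le_trans NP Nd')).
rewrite -splitr; apply: le_trans; rewrite le_eqVlt; apply/orP; left; apply/eqP.
have [Lg1 _] := inLp_lin p1 (-1) LPg Lg.
have mg1 : cmeas (fun w => g w - P g w).
  have /(inLpP mu p1)[m _] := Lg1; move: m; congr cmeas; apply/funext => w; by rewrite mulN1r addrC.
have E : ae_eqC mu (fun w => g w - P g w)
    (fun w => (-1 * psi w + g w) + -1 * \sum_i cell_coef mu p A i (fun w => -1 * psi w + g w) * cell_vec mu p A i w).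
  have : \forall w \ae mu, setT w -> P psi w = psi w := cell_reproduce p mA fA dA c.
  apply: filterS => w /(_ I) h' _.
  transitivity ((-1 * psi w + g w) + -1 * P (fun w => -1 * psi w + g w) w); last by [].
  by rewrite PE h'; ring.
by have [_ ->] := @cn_ae _ _ _ mu p p1 _ _ mg1 Lt E.
Qed.

End Density.

HB.lock Definition lpn_ (R : realType) (p : R) (I : Type) (r : seq I) (v : I -> R) : R :=
  (\sum_(i <- r) v i `^ p) `^ p^-1.

(** * Finite l^p norms and perturbation of matrices *)

Section FiniteLp.
Context {R : realType}.
Variable p : R.
Hypothesis p1 : 1 < p.
Notation C := R[i].

Let p0 : 0 < p. Proof. exact: lt_trans p1. Qed.

Notation lpn := (lpn_ p).

Lemma lpn_ge0 (I : Type) (r : seq I) v : 0 <= lpn r v. Proof. by rewrite unlock powR_ge0. Qed.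

Lemma lpn_pow (I : Type) (r : seq I) v : lpn r v `^ p = \sum_(i <- r) v i `^ p.
Proof. by rewrite unlock -powRrM mulVf ?gt_eqF// powRr1// sumr_ge0// => *; exact: powR_ge0. Qed.

Lemma lpn_le_pow (I : Type) (r : seq I) v x : 0 <= x -> \sum_(i <- r) v i `^ p <= x `^ p -> lpn r v <= x.
Proof.
move=> x0 h; rewrite unlock -[leRHS]powRr1// -(divff (lt0r_neq0 p0)) powRrM; apply: powR_le => //.
  by rewrite invr_ge0 ltW.
by rewrite sumr_ge0// => *; exact: powR_ge0.
Qed.

(** Convexity of x^p for the combination of x / a and y / b with weights a / (a + b) and b / (a +
    b). The added e / 2 keeps a and b positive. *)
Lemma lpnD (I : Type) (r : seq I) (v w : I -> R) : (forall i, 0 <= v i) -> (forall i, 0 <= w i) ->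
  lpn r (fun i => v i + w i) <= lpn r v + lpn r w.
Proof.
move=> v0 w0; apply/ler_addgt0Pr => e e0.
pose a := lpn r v + e / 2; pose b := lpn r w + e / 2.
have e2 : 0 < e / 2 by rewrite divr_gt0.
have a0 : 0 < a by rewrite ltr_wpDl ?lpn_ge0.
have b0 : 0 < b by rewrite ltr_wpDl ?lpn_ge0.
have -> : lpn r v + lpn r w + e = a + b by rewrite /a /b; lra.
have va : lpn r v <= a by rewrite lerDl ltW.
have wb : lpn r w <= b by rewrite lerDl ltW.
clearbody a b; have ab0 : 0 < a + b := addr_gt0 a0 b0.
apply: lpn_le_pow; first exact: ltW.
have one x y : 0 <= x -> 0 <= y -> (x + y) `^ p <= (a + b) `^ p * (a / (a + b) * (x / a) `^ p + b / (a + b) * (y / b) `^ p).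
  move=> x0 y0.
  have := @jensen_powR R bool [:: true; false] (fun i => if i then a / (a + b) else b / (a + b))
    (fun i => if i then x / a else y / b) p (ltW p1).
  rewrite !big_cons !big_nil /= !addr0 => H.
  have {}H := H _ _ _; have -> : x + y = (a + b) * (a / (a + b) * (x / a) + b / (a + b) * (y / b)).
    by field; rewrite !gt_eqF.
  rewrite powRM ?(ltW ab0)//; last by rewrite addr_ge0// mulr_ge0// divr_ge0// ltW.
  rewrite ler_wpM2l ?powR_ge0//; apply: H.
  - by case; rewrite divr_ge0// ltW.
  - by case; rewrite divr_ge0// ltW.
  by rewrite -mulrDl divff// gt_eqF.
apply: le_trans (ler_sum _ (fun i _ => one _ _ (v0 i) (w0 i))) _.
rewrite -mulr_sumr big_split/= -!mulr_sumr ler_piMr ?powR_ge0//.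
have part (c : R) (z : I -> R) : 0 < c -> lpn r z <= c -> (forall i, 0 <= z i) -> \sum_(i <- r) (z i / c) `^ p <= 1.
  move=> c0 zc z0; under eq_bigr do rewrite powRM ?invr_ge0 ?(ltW c0)//.
  rewrite -mulr_suml -lpn_pow -powRM ?lpn_ge0 ?invr_ge0 ?(ltW c0)//.
  rewrite [leRHS](_ : 1 = 1 `^ p); last by rewrite powR1.
  apply: powR_le; [exact: ltW|by rewrite divr_ge0 ?lpn_ge0// ltW|].
  by rewrite ler_pdivrMr// mul1r.
have h1 : \sum_(i <- r) (v i / a) `^ p <= 1 by apply: part.
have h2 : \sum_(i <- r) (w i / b) `^ p <= 1 by apply: part.
have -> : 1 = a / (a + b) * 1 + b / (a + b) * 1 by field; rewrite gt_eqF.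
by rewrite lerD// ler_wpM2l// divr_ge0// ltW.
Qed.

Lemma lpn_homo (I : Type) (r : seq I) (v w : I -> R) : (forall i, 0 <= v i <= w i) -> lpn r v <= lpn r w.
Proof.
move=> vw; rewrite unlock; apply: powR_le; first by rewrite invr_ge0 ltW.
  by rewrite sumr_ge0// => *; exact: powR_ge0.
by apply: ler_sum => i _; have /andP[? ?] := vw i; apply: powR_le => //; exact: ltW.
Qed.

Lemma lpnZ (I : Type) (r : seq I) (c : R) (v : I -> R) : 0 <= c -> (forall i, 0 <= v i) ->
  lpn r (fun i => c * v i) = c * lpn r v.
Proof.
move=> c0 v0; rewrite unlock; under eq_bigr do rewrite powRM//.
rewrite -mulr_sumr powRM ?powR_ge0 ?sumr_ge0//; last by move=> *; exact: powR_ge0.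
by rewrite -powRrM divff ?gt_eqF// powRr1.
Qed.

Section Perturb.
Variables (n : nat) (T : 'I_n.+1 -> 'I_n.+1 -> C).
Hypothesis Tc : mcontraction p T.
Notation I := 'I_n.+1.
Notation ln := (lpn (index_enum 'I_n.+1)).

Lemma mcontraction_lpn (S : I -> I -> C) : mcontraction p S -> forall y,
  ln (fun i => normc (mapply S y i)) <= ln (fun i => normc (y i)).
Proof.
move=> Sc y; apply: (@le_trans _ _ (ln (fun i => \sum_j normc (S i j) * normc (y j)))).
  apply: lpn_homo => i; rewrite normc_ge0/=; apply: (le_trans (normc_sum _ _)).
  by apply: ler_sum => j _; rewrite normcM.
apply: lpn_le_pow; first exact: lpn_ge0.
by rewrite lpn_pow; apply: Sc => j; exact: normc_ge0.
Qed.

(** Transference needs all entries nonzero. Zero entries are filled from the averaging matrix; the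
    modulus stays below the convex combination (1 - e) |t| + e (average), so the result is still a
    contraction in the sense of [mcontraction]. *)
Definition perturb (e : R) : I -> I -> C := fun i j =>
  if T i j == 0 then (e / n.+1%:R)%:C%C else (1 - e)%:C%C * T i j.

Lemma mean_lpn (y : I -> R) : (forall j, 0 <= y j) -> ln (fun i => \sum_j n.+1%:R^-1 * y j) <= ln y.
Proof.
move=> y0; apply: lpn_le_pow; first exact: lpn_ge0.
rewrite lpn_pow sumr_const card_ord -[_ *+ n.+1]mulr_natl.
have N0 : (0 : R) < n.+1%:R by [].
have := @jensen_powR R I (index_enum I) (fun _ => n.+1%:R^-1) y p (ltW p1) (fun _ => ltW (_ : 0 < n.+1%:R^-1)) y0.
rewrite invr_gt0 => /(_ N0); rewrite sumr_const card_ord -[_ *+ n.+1]mulr_natl divff ?gt_eqF// lexx => /(_ isT).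
rewrite -[X in _ <= X -> _]mulr_sumr => h.
by have := ler_wpM2l (ltW N0) h; rewrite mulrA divff ?gt_eqF// mul1r.
Qed.

Lemma perturb_dom e i j : 0 < e < 1 -> normc (perturb e i j) <= (1 - e) * normc (T i j) + e * n.+1%:R^-1.
Proof.
move=> /andP[e0 e1]; rewrite /perturb; case: eqP => [->|_].
  by rewrite normc0 mulr0 add0r normc_real ger0_norm// divr_ge0// ltW.
by rewrite normcM normc_real ger0_norm ?subr_ge0 ?(ltW e1)// lerDl mulr_ge0 ?invr_ge0// ltW.
Qed.

Lemma perturb_contraction e : 0 < e < 1 -> mcontraction p (perturb e).
Proof.
move=> e01 y y0; have /andP[e0 e1] := e01.
have E0 : 0 <= 1 - e by rewrite subr_ge0 ltW.
pose a i := \sum_j normc (T i j) * y j; pose b (i : I) := \sum_j n.+1%:R^-1 * y j.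
have a0 i : 0 <= a i by rewrite sumr_ge0// => j _; rewrite mulr_ge0 ?normc_ge0.
have b0 i : 0 <= b i by rewrite sumr_ge0// => j _; rewrite mulr_ge0.
suff : ln (fun i => \sum_j normc (perturb e i j) * y j) <= ln y.
  by move=> h; have := powR_le (ltW p0) (lpn_ge0 _ _) h; rewrite !lpn_pow; exact.
apply: (@le_trans _ _ (ln (fun i => (1 - e) * a i + e * b i))).
  apply: lpn_homo => i; apply/andP; split.
    by rewrite sumr_ge0// => j _; rewrite mulr_ge0 ?normc_ge0.
  rewrite /a /b !mulr_sumr -big_split/=; apply: ler_sum => j _.
  by rewrite !mulrA -mulrDl ler_wpM2r//; exact: perturb_dom.
apply: le_trans (lpnD _ _ _) _.
- by move=> i; rewrite mulr_ge0.
- by move=> i; rewrite mulr_ge0// ltW.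
rewrite !lpnZ ?(ltW e0)//.
have h1 : ln a <= ln y by apply: lpn_le_pow; rewrite ?lpn_ge0// lpn_pow; exact: Tc.
have h2 : ln b <= ln y by exact: mean_lpn.
have -> : ln y = (1 - e) * ln y + e * ln y by ring.
by rewrite lerD// ler_wpM2l// ltW.
Qed.

Lemma perturb_neq0 e i j : 0 < e < 1 -> perturb e i j != 0.
Proof.
move=> /andP[e0 e1].
have nC (z : R) : z != 0 -> (z%:C)%C != 0 :> C by move=> z0; rewrite -(rmorph0 (real_complex R)) (inj_eq (@complexI R)).
rewrite /perturb; case: ifPn => [_|Tij]; first by apply: nC; rewrite gt_eqF// divr_gt0.
by rewrite mulf_neq0//; apply: nC; rewrite subr_eq0 gt_eqF.
Qed.

Lemma perturb_close e y : 0 < e < 1 ->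
  ln (fun i => normc (mapply (perturb e) y i - mapply T y i)) <= 2 * e * ln (fun i => normc (y i)).
Proof.
move=> /andP[e0 e1].
pose a i := \sum_j normc (T i j) * normc (y j); pose b (i : I) := \sum_j n.+1%:R^-1 * normc (y j).
have a0 i : 0 <= a i by rewrite sumr_ge0// => j _; rewrite mulr_ge0 ?normc_ge0.
have b0 i : 0 <= b i by rewrite sumr_ge0// => j _; rewrite mulr_ge0 ?normc_ge0.
apply: (@le_trans _ _ (ln (fun i => e * a i + e * b i))).
  apply: lpn_homo => i; rewrite normc_ge0/= /mapply -sumrB.
  apply: (le_trans (normc_sum _ _)); rewrite /a /b !mulr_sumr -big_split/=; apply: ler_sum => j _.
  rewrite -mulrBl normcM !mulrA -mulrDl ler_wpM2r ?normc_ge0// /perturb; case: eqP => [->|_].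
    by rewrite subr0 normc0 mulr0 add0r normc_real ger0_norm// divr_ge0// ltW.
  have -> : (1 - e)%:C%C * T i j - T i j = (- e)%:C%C * T i j by rewrite rmorphB rmorph1 rmorphN /=; ring.
  by rewrite normcM normc_real normrN ger0_norm ?(ltW e0)// lerDl mulr_ge0 ?invr_ge0// ltW.
apply: le_trans (lpnD _ _ _) _; try by move=> i; rewrite mulr_ge0// ltW.
rewrite !lpnZ ?(ltW e0)//.
have h1 : ln a <= ln (fun i => normc (y i)).
  by apply: lpn_le_pow; rewrite ?lpn_ge0// lpn_pow; apply: Tc => j; exact: normc_ge0.
have h2 : ln b <= ln (fun i => normc (y i)) by apply: mean_lpn => j; exact: normc_ge0.
by rewrite -mulrA mulr_natl mulr2n; apply: lerD; apply: ler_wpM2l => //; exact: ltW.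
Qed.

End Perturb.
End FiniteLp.

(** * Transference for contractively regular operators *)

Lemma le_bigmax_In {R : realType} (A : Type) (s : seq A) (F : A -> R) a :
  List.In a s -> F a <= \big[Num.max/0]_(b <- s) F b.
Proof.
elim: s => [//|b s IH] /= [->|/IH h]; rewrite big_cons le_max; first by rewrite lexx.
by rewrite h orbT.
Qed.

Section Operator.
Context {d : measure_display} {Omega : measurableType d} {R : realType}.
Variable mu : {measure set Omega -> \bar R}.
Variable p : R.
Hypothesis p1 : 1 < p.
Notation C := R[i].
Notation Lp := (inLp mu p).
Notation cn := (cn mu p).
Notation mn := (mn mu p).
Variable T : (Omega -> C) -> Omega -> C.
Hypothesis bT : bounded_operator_Lp mu p T.
Hypothesis rT : contractively_regular mu p T.

Let p0 : 0 < p. Proof. exact: lt_trans p1. Qed.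

Lemma T_Lp x : Lp x -> Lp (T x). Proof. by case: bT => h _; exact: h. Qed.

Lemma T_ae x y : Lp x -> Lp y -> ae_eqC mu x y -> ae_eqC mu (T x) (T y).
Proof. by case: bT => _ [h _]; exact: h. Qed.

Lemma T_lin (a : C) x y : Lp x -> Lp y -> ae_eqC mu (T (fun w => a * x w + y w)) (fun w => a * T x w + T y w).
Proof. by case: bT => _ [_ [h _]]; exact: h. Qed.

Lemma aeC_refl (x : Omega -> C) : ae_eqC mu x x. Proof. exact: ae_eq_refl. Qed.
Lemma aeC_sym (x y : Omega -> C) : ae_eqC mu x y -> ae_eqC mu y x. Proof. exact: ae_eq_sym. Qed.
Lemma aeC_trans (x y z : Omega -> C) : ae_eqC mu x y -> ae_eqC mu y z -> ae_eqC mu x z.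
Proof. exact: ae_eq_trans. Qed.

Lemma aeC_lin (a : C) x y x' y' : ae_eqC mu x x' -> ae_eqC mu y y' ->
  ae_eqC mu (fun w => a * x w + y w) (fun w => a * x' w + y' w).
Proof. by apply: filterS2 => w h1 h2 I; rewrite h1// h2. Qed.

Lemma T0 : ae_eqC mu (T (fun _ => 0)) (fun _ => 0).
Proof.
have [L0 _] := inLp0 mu p1; have := T_lin (-1) L0 L0.
rewrite (_ : (fun w : Omega => -1 * 0 + 0 : C) = fun _ => 0); last by apply/funext => w; ring.
by apply: filterS => w h I; rewrite h//; ring.
Qed.

Lemma Lp_lincomb (I : Type) (r : seq I) (c : I -> C) (x : I -> Omega -> C) : (forall i, Lp (x i)) ->
  Lp (fun w => \sum_(i <- r) c i * x i w).
Proof. by move=> Lx; have [] := inLp_sum p1 r (fun i => (inLpZ p1 (c i) (Lx i)).1). Qed.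

Lemma T_sum (I : Type) (r : seq I) (c : I -> C) (x : I -> Omega -> C) : (forall i, Lp (x i)) ->
  ae_eqC mu (T (fun w => \sum_(i <- r) c i * x i w)) (fun w => \sum_(i <- r) c i * T (x i) w).
Proof.
move=> Lx; elim: r => [|i r IH].
  rewrite (_ : (fun w => _) = fun _ => 0); last by apply/funext => w; rewrite big_nil.
  rewrite [X in ae_eqC _ _ X](_ : _ = fun _ => 0); last by apply/funext => w; rewrite big_nil.
  exact: T0.
rewrite (_ : (fun w => \sum_(j <- i :: r) c j * x j w) = fun w => c i * x i w + \sum_(j <- r) c j * x j w); last first.
  by apply/funext => w; rewrite big_cons.
rewrite [X in ae_eqC _ _ X](_ : _ = fun w => c i * T (x i) w + \sum_(j <- r) c j * T (x j) w); last first.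
  by apply/funext => w; rewrite big_cons.
apply: aeC_trans (T_lin (c i) (Lx i) (Lp_lincomb r c Lx)) _.
exact: aeC_lin (aeC_refl _) IH.
Qed.

Lemma T_regular (A : Type) (r : seq A) (x : A -> Omega -> C) : (forall a, Lp (x a)) ->
  mn loo r (fun a => T (x a)) <= mn loo r x.
Proof.
move=> Lx; have := rT (s := [seq x a | a <- r]).
have E (y : A -> Omega -> C) : (fun w => (\big[Num.max/0]_(z <- [seq y a | a <- r]) normc (z w))%:E) = EFin \o mixed loo r y.
  by apply/funext => w; rewrite /= big_map.
have E2 : (fun w => (\big[Num.max/0]_(z <- [seq x a | a <- r]) normc (T z w))%:E) = EFin \o mixed loo r (fun a => T (x a)).
  by apply/funext => w; rewrite /= big_map.
rewrite (E x) E2.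
have [L1 _] := rLp_mixed p1 loo r Lx; have [L2 _] := rLp_mixed p1 loo r (fun a => T_Lp (Lx a)).
rewrite (LnormE p1 L1) (LnormE p1 L2) -EFinM lee_fin mul1r; apply.
by move=> y /List_In_mem; elim: r {L1 L2 E E2} => //= a r IH [<-|/IH].
Qed.

Lemma T_contraction x : Lp x -> cn (T x) <= cn x.
Proof. by move=> Lx; have := T_regular [:: tt] (fun _ => Lx); rewrite !mn_seq1. Qed.

Lemma opow_Lp n x : Lp x -> Lp (opow T n x).
Proof. by move=> Lx; elim: n => //= n IH; exact: T_Lp. Qed.

Lemma opow_contraction n x : Lp x -> cn (opow T n x) <= cn x.
Proof. by move=> Lx; elim: n => //= n IH; apply: le_trans IH; apply: T_contraction; exact: opow_Lp. Qed.

Section Compression.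
Variables (n : nat) (A : 'I_n.+1 -> set Omega).
Hypothesis mA : forall i, measurable (A i).
Hypothesis fA : forall i, (mu (A i) < +oo)%E.
Hypothesis dA : forall i j w, A i w -> A j w -> i = j.
Notation D := (cell_coef mu p A).
Notation e := (cell_vec mu p A).
Notation ln := (lpn_ p (index_enum 'I_n.+1)).

Definition compress (i j : 'I_n.+1) : C := D i (T (e j)).

Lemma cell_coef_sum (I : Type) (r : seq I) (c : I -> C) (x : I -> Omega -> C) i : (forall k, Lp (x k)) ->
  D i (fun w => \sum_(k <- r) c k * x k w) = \sum_(k <- r) c k * D i (x k).
Proof.
move=> Lx; elim: r => [|k r IH].
  rewrite big_nil (_ : (fun w => _) = fun _ => 0); last by apply/funext => w; rewrite big_nil.
  by rewrite /cell_coef (cint0 mu (mA i)) mulr0.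
rewrite big_cons -IH (_ : (fun w => _) = fun w => c k * x k w + \sum_(k <- r) c k * x k w); last first.
  by apply/funext => w; rewrite big_cons.
by apply: (cell_coef_lin p1 mA fA) => //; exact: Lp_lincomb.
Qed.

Lemma compressE y i : mapply compress y i = D i (T (fun w => \sum_j y j * e j w)).
Proof.
have Le j : Lp (e j) by exact: (cell_vec_Lp p1 mA fA).
have -> : D i (T (fun w => \sum_j y j * e j w)) = D i (fun w => \sum_j y j * T (e j) w).
  apply: (cell_coef_ae p1 mA); last exact: T_sum.
    by apply: T_Lp; exact: Lp_lincomb.
  by apply: Lp_lincomb => j; exact: T_Lp.
rewrite cell_coef_sum; last by move=> j; exact: T_Lp.
by apply: eq_bigr => j _; rewrite mulrC.
Qed.

Lemma lpn_cell_coef g : Lp g -> ln (fun i => normc (D i g)) <= cn g.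
Proof.
move=> Lg; apply: (lpn_le_pow p1); first exact: cn_ge0.
have := @cell_analysis _ _ _ mu p p1 _ A mA fA dA l1 unit [:: tt] (fun _ => g) (fun _ => Lg).
rewrite mn_seq1; apply: le_trans; apply: ler_sum => i _.
by rewrite lnorm_seq1.
Qed.

Lemma cn_cell_vec (y : 'I_n.+1 -> C) : cn (fun w => \sum_i y i * e i w) <= ln (fun i => normc (y i)).
Proof.
have := cell_synthesis p1 mA fA dA l1 [:: tt] (fun i _ => y i).
rewrite mn_seq1 => h; have e1 : \sum_i lnorm l1 [:: tt] (fun _ => y i) `^ p = ln (fun i => normc (y i)) `^ p.
  by rewrite (lpn_pow p1); apply: eq_bigr => i _; rewrite lnorm_seq1.
rewrite e1 in h; have := powR_root p0 (cn_ge0 _ _ _) (powR_ge0 _ _) h.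
by rewrite -powRrM divff ?gt_eqF// powRr1// lpn_ge0.
Qed.

(** For each row i the input x_i carries the phases that make the i-th entry of the image equal to
    the sum of the moduli. All x_i are bounded by the same function, the synthesis of y, so
    regularity for this finite family controls the supremum of the images, hence all rows at
    once. *)
Lemma compress_contraction : mcontraction p compress.
Proof.
move=> y y0; have Le j : Lp (e j) by exact: (cell_vec_Lp p1 mA fA).
pose x (i : 'I_n.+1) w := \sum_j (unphase (compress i j) * (y j)%:C%C) * e j w.
have Lx i : Lp (x i) by exact: Lp_lincomb.
have Dx i : D i (T (x i)) = (\sum_j normc (compress i j) * y j)%:C%C.
  rewrite -compressE /mapply rmorph_sum; apply: eq_bigr => j _.
  transitivity ((normc (compress i j))%:C%C * (y j)%:C%C); last by rewrite -rmorphM.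
  by rewrite -unphaseM; ring.
apply: (@le_trans _ _ (\sum_i lnorm loo (index_enum 'I_n.+1) (fun a => D i (T (x a))) `^ p)).
  apply: ler_sum => i _; apply: powR_le; first exact: ltW.
    by rewrite sumr_ge0// => j _; rewrite mulr_ge0 ?normc_ge0.
  have -> : \sum_j normc (compress i j) * y j = normc (D i (T (x i))).
    by rewrite Dx normc_real ger0_norm// sumr_ge0// => j _; rewrite mulr_ge0 ?normc_ge0.
  rewrite /lnorm; have : List.In i (index_enum 'I_n.+1) by apply/List_In_mem; exact: mem_index_enum.
  exact: (le_bigmax_In (fun a => normc (D i (T (x a))))).
apply: le_trans (cell_analysis p1 mA fA dA loo (index_enum 'I_n.+1) (fun a => T_Lp (Lx a))) _.
apply: (@le_trans _ _ (cn (fun w => \sum_j (y j)%:C%C * e j w) `^ p)); last first.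
  have := cell_synthesis p1 mA fA dA l1 [:: tt] (fun i _ => (y i)%:C%C).
  rewrite mn_seq1 => h; apply: (le_trans h).
  apply: ler_sum => i _; rewrite lnorm_seq1 normc_real ger0_norm//.
apply: powR_le; [exact: ltW|exact: mn_ge0|].
apply: le_trans (T_regular _ Lx) _.
have Ly : Lp (fun w => \sum_j (y j)%:C%C * e j w) by exact: Lp_lincomb.
have [[mm _] _] := rLp_mixed p1 loo (index_enum 'I_n.+1) Lx.
have /(inLpP mu p1)[_ Ly'] := Ly.
apply: (nm_le p1 mm Ly') => w; rewrite !ger0_norm ?normc_ge0 ?lnorm_ge0// /mixed /lnorm.
apply: bigmax_le => [|i _]; first exact: normc_ge0.
apply: (le_trans (normc_sum _ _)).
have -> : cabs (fun w => \sum_j (y j)%:C%C * e j w) w = \sum_j y j * normc (e j w).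
  rewrite /cabs; have -> : \sum_j (y j)%:C%C * e j w = (\sum_j y j * normc (e j w))%:C%C.
    rewrite rmorph_sum; apply: eq_bigr => j _; rewrite rmorphM; congr (_ * _).
    by rewrite /cell_vec [normc _]normc_real ger0_norm// mulr_ge0 ?powR_ge0.
  by rewrite normc_real ger0_norm// sumr_ge0// => j _; rewrite mulr_ge0 ?normc_ge0.
apply: ler_sum => j _; rewrite (normcM (_ * _)) (normcM (unphase _)) [normc (y j)%:C%C]normc_real (ger0_norm (y0 j)) ler_wpM2r ?normc_ge0//.
by rewrite ler_piMl// normc_unphase.
Qed.

End Compression.

(** The partition is fitted to the whole orbit up to time L. Each step of the matrix iteration then
    adds at most 3 X ep: 2 ep X for making the entries nonzero and ep for projecting T^l g to the
    cells. Contractivity of S keeps old errors from growing. *)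
Lemma approx_orbit (gs : seq (Omega -> C)) (L : nat) (eta : R) : 0 < eta -> (forall g, List.In g gs -> Lp g) ->
  exists n (A : 'I_n.+1 -> set Omega) (S : 'I_n.+1 -> 'I_n.+1 -> C),
  [/\ (forall i, measurable (A i)), (forall i, (mu (A i) < +oo)%E) & (forall i j w, A i w -> A j w -> i = j)] /\
  [/\ (forall i j, S i j != 0), mcontraction p S &
   forall g l, List.In g gs -> (l < L)%N ->
     cn (fun w => opow T l g w - \sum_i iter l (mapply S) (fun i => cell_coef mu p A i g) i * cell_vec mu p A i w) <= eta].
Proof.
move=> eta0 Lgs.
pose X := 1 + \sum_(g <- gs) cn g.
have X1 : 1 <= X by rewrite lerDl sumr_ge0// => g _; exact: cn_ge0.
have X0 : 0 < X by apply: lt_le_trans X1.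
have gX g : List.In g gs -> cn g <= X.
  rewrite /X; elim: (gs) => //= f s IH [->|/IH h]; rewrite big_cons.
    by rewrite addrCA lerDl addr_ge0// sumr_ge0// => k _; exact: cn_ge0.
  by rewrite addrCA; apply: (le_trans h); rewrite lerDr cn_ge0.
pose ep := Num.min (1 / 2) (eta / (L.+1%:R * (3 * X))).
have ep0 : 0 < ep by rewrite lt_min !divr_gt0// !mulr_gt0.
have ep1 : 0 < ep < 1 by rewrite ep0 gt_min ltr_pdivrMr// mul1r ltr1n.
have epL : L.+1%:R * (3 * X * ep) <= eta.
  by rewrite mulrA -ler_pdivlMl ?mulr_gt0// mulrC /ep ge_min lexx orbT.
pose orbits := [seq opow T l g | g <- gs, l <- iota 0 L].
have Lall g : List.In g orbits -> Lp g.
  by move=> /List_In_mem/allpairsP[[f l] /= [/List_In_mem/Lgs Lf _ ->]]; exact: opow_Lp.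
have [n [A [mA fA dA HA]]] := discretize p1 ep0 Lall.
have HA' g l : List.In g gs -> (l < L)%N ->
    cn (fun w => opow T l g w - \sum_i cell_coef mu p A i (opow T l g) * cell_vec mu p A i w) <= ep.
  move=> gin lL; apply: HA; apply/List_In_mem/allpairsP; exists (g, l); split => //=.
    exact/List_In_mem.
  by rewrite mem_iota.
pose S := perturb (compress A) ep.
have Sc : mcontraction p S by apply: perturb_contraction => //; exact: compress_contraction.
exists n, A, S; split => //; split => //.
  by move=> i j; exact: perturb_neq0.
move=> g l gin lL; have Lg := Lgs g gin.
pose D f i := cell_coef mu p A i f; pose e := cell_vec mu p A.
have Le j : Lp (e j) by exact: (cell_vec_Lp p1 mA fA).
pose P f w := \sum_i D f i * e i w.
pose z l := D (opow T l g); pose v l := iter l (mapply S) (D g).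
have Lo l' : Lp (opow T l' g) by exact: opow_Lp.
have LP f : Lp (P f) by exact: Lp_lincomb.
have mapplyB (a b : 'I_n.+1 -> C) i : mapply S a i - mapply S b i = mapply S (fun j => a j - b j) i.
  by rewrite /mapply -sumrB; apply: eq_bigr => j _; ring.
have close l' : (l' <= l)%N -> lpn_ p (index_enum 'I_n.+1) (fun i => normc (v l' i - z l' i)) <= l'%:R * (3 * X * ep).
  elim: l' => [|k IH] kl.
    rewrite mul0r; apply: (lpn_le_pow p1) => //.
    rewrite big1 ?powR_ge0// => i _; have -> : v 0%N i = z 0%N i by [].
    by rewrite subrr normc0 powR0// gt_eqF.
  have kL : (k < L)%N by exact: ltn_trans kl lL.
  pose a i := normc (v k i - z k i).
  pose t1 i := normc (mapply S (fun j => v k j - z k j) i).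
  pose t2 i := normc (mapply S (z k) i - mapply (compress A) (z k) i).
  pose t3 i := normc (D (fun w => -1 * opow T k.+1 g w + T (P (opow T k g)) w) i).
  (* The three errors of one step: S on the old error, S against the unperturbed compression, and
     T^k g against its projection. *)
  apply: (@le_trans _ _ (lpn_ p (index_enum 'I_n.+1) (fun i => t1 i + (t2 i + t3 i)))).
    apply: (lpn_homo p1) => i; rewrite normc_ge0 /=.
    have -> : v k.+1 i - z k.+1 i = mapply S (fun j => v k j - z k j) i +
       ((mapply S (z k) i - mapply (compress A) (z k) i) + D (fun w => -1 * opow T k.+1 g w + T (P (opow T k g)) w) i).
      have -> : D (fun w => -1 * opow T k.+1 g w + T (P (opow T k g)) w) i = -1 * D (opow T k.+1 g) i + D (T (P (opow T k g))) i.
        by apply: (cell_coef_lin p1 mA fA); [exact: (Lo k.+1)|exact: T_Lp (LP _)].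
      rewrite -mapplyB (compressE mA fA) /z /v /= /D /P /e; ring.
    by apply: (le_trans (ler_normcD _ _)); rewrite lerD2l; exact: ler_normcD.
  have h1 : lpn_ p (index_enum 'I_n.+1) t1 <= k%:R * (3 * X * ep).
    by apply: le_trans (IH (ltnW kl)); exact: (mcontraction_lpn p1 Sc).
  have zX : lpn_ p (index_enum 'I_n.+1) (fun i => normc (z k i)) <= X.
    apply: le_trans (gX g gin); apply: le_trans (opow_contraction k Lg).
    exact: (lpn_cell_coef mA fA dA (Lo k)).
  have h2 : lpn_ p (index_enum 'I_n.+1) t2 <= 2 * ep * X.
    apply: le_trans (perturb_close p1 (compress_contraction mA fA dA) (z k) ep1) _.
    by rewrite ler_wpM2l// mulr_ge0// ltW.
  have h3 : lpn_ p (index_enum 'I_n.+1) t3 <= ep.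
    have [Ld _] := inLp_lin p1 (-1) (Lo k) (LP (opow T k g)).
    have [Ld' _] := inLp_lin p1 (-1) (Lo k.+1) (T_Lp (LP (opow T k g))).
    apply: (le_trans (lpn_cell_coef mA fA dA Ld')).
    have E : ae_eqC mu (fun w => -1 * opow T k.+1 g w + T (P (opow T k g)) w) (T (fun w => -1 * opow T k g w + P (opow T k g) w)).
      exact: aeC_sym (T_lin _ (Lo k) (LP _)).
    have /(inLpP mu p1)[md' _] := Ld'.
    have [_ ->] := cn_ae p1 md' (T_Lp Ld) E.
    apply: (le_trans (T_contraction Ld)); apply: le_trans (HA' g k gin kL).
    have [_ N] := inLpZ p1 (-1) Ld; rewrite normcN' normc1 mul1r in N; rewrite -N.
    rewrite le_eqVlt; apply/orP; left; apply/eqP; congr (cn _); apply/funext => w.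
    by rewrite /P /D /e; ring.
  apply: le_trans (lpnD p1 _ _ _) _; [by move=> i; exact: normc_ge0|by move=> i; rewrite addr_ge0 ?normc_ge0|].
  apply: (@le_trans _ _ (k%:R * (3 * X * ep) + (2 * ep * X + ep))).
    rewrite lerD//; apply: le_trans (lpnD p1 _ _ _) _; [by move=> i; exact: normc_ge0|by move=> i; exact: normc_ge0|].
    by rewrite lerD.
  have : ep <= ep * X by rewrite ler_pMr.
  have kE : k.+1%:R = k%:R + 1 :> R by rewrite natr1.
  move=> epX; rewrite kE; lra.
have [Ld1 _] := inLp_lin p1 (-1) (LP (opow T l g)) (Lo l).
have Ld2 : Lp (fun w => \sum_i (z l i - v l i) * e i w) by exact: Lp_lincomb.
have [_ N] := inLpD p1 Ld1 Ld2.
have -> : (fun w => opow T l g w - \sum_i iter l (mapply S) (fun i => cell_coef mu p A i g) i * cell_vec mu p A i w)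
  = (fun w => (-1 * P (opow T l g) w + opow T l g w) + \sum_i (z l i - v l i) * e i w).
  apply/funext => w; rewrite /P.
  under [X in _ = _ + X]eq_bigr do rewrite mulrBl.
  by rewrite sumrB /z /v /D /e; ring.
apply: (le_trans N).
have h1 : cn (fun w => -1 * P (opow T l g) w + opow T l g w) <= ep.
  apply: le_trans (HA' g l gin lL); rewrite le_eqVlt; apply/orP; left; apply/eqP; congr (cn _); apply/funext => w.
  by rewrite /P /D /e; ring.
have h2 : cn (fun w => \sum_i (z l i - v l i) * e i w) <= l%:R * (3 * X * ep).
  apply: (le_trans (cn_cell_vec mA fA dA _)); apply: le_trans (close l (leqnn l)).
  by apply: (lpn_homo p1) => i; rewrite normc_ge0/= -normcN' opprB.
apply: (le_trans (lerD h1 h2)); apply: le_trans epL.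
have e3 : ep <= 3 * X * ep by rewrite ler_pMl//; lra.
have E0 : 0 <= 3 * X * ep by rewrite !mulr_ge0// ltW.
have lL' : l%:R + 1 <= L.+1%:R :> R by rewrite natr1 ler_nat ltnW.
have := ler_wpM2r E0 lL'; lra.
Qed.

Definition tout (A B : Type) (terms : B -> seq ({poly C} * A)) (x : A -> Omega -> C) (b : B) (w : Omega) : C :=
  \sum_(qa <- terms b) polyT qa.1 T (x qa.2) w.

Lemma polyT_Lp q x : Lp x -> Lp (polyT q T x).
Proof. by move=> Lx; apply: Lp_lincomb => i; exact: opow_Lp. Qed.

Lemma tout_Lp (A B : Type) (terms : B -> seq ({poly C} * A)) x b : (forall a, Lp (x a)) -> Lp (tout terms x b).
Proof.
move=> Lx; have := (inLp_sum p1 (terms b) (fun qa => polyT_Lp qa.1 (Lx qa.2))).1; exact.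
Qed.

(** Polynomials involve finitely many powers of T on finitely many vectors, so [approx_orbit]
    replaces T by a matrix. Analysis and synthesis on the cells are contractive for every lattice
    norm, hence the constant is that of [matrix_transference]. *)
Theorem transference (A B : eqType) (terms : B -> seq ({poly C} * A)) (ra : seq A) (rb : seq B) qi qo (D : R) K0 :
  0 <= D ->
  (forall K f, (K0 <= K)%N -> periodic K f ->
    \sum_(0 <= t < 2 ^ K) lnorm qo rb (kout terms f t) `^ p <= D * \sum_(0 <= t < 2 ^ K) lnorm qi ra (f t) `^ p) ->
  (forall b qa, b \in rb -> qa \in terms b -> qa.2 \in ra) ->
  forall x : A -> Omega -> C, (forall a, Lp (x a)) ->
  mn qo rb (tout terms x) <= D `^ p^-1 * mn qi ra x.
Proof.
move=> D0 H Hin x Lx.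
pose L := \max_(b <- rb) \max_(qa <- terms b) size qa.1.
have Lb b qa : b \in rb -> List.In qa (terms b) -> (size qa.1 <= L)%N.
  move=> /List_In_mem brb qab; apply: leq_trans (leq_bigmax_In (fun b => \max_(qa <- terms b) size qa.1) brb).
  exact: (leq_bigmax_In (fun qa : {poly C} * A => size qa.1) qab).
(* The factor by which the coefficients can magnify the error of an orbit in the outputs. *)
pose K := 1 + \sum_(b <- rb) \sum_(qa <- terms b) \sum_(l < size qa.1) normc (qa.1`_l).
have K0' : 0 < K by rewrite ltr_pwDl// !sumr_ge0// => b _; rewrite sumr_ge0// => qa _; rewrite sumr_ge0// => l _; exact: normc_ge0.
apply/ler_addgt0Pr => eps eps0.
have eta0 : 0 < eps / K by rewrite divr_gt0.
pose gs := [seq x a | a <- ra].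
have Lgs g : List.In g gs -> Lp g by move=> /List_In_mem/mapP[a _ ->].
have [n [As [S [[mA fA dA] [S0 Sc HS]]]]] := approx_orbit L eta0 Lgs.
pose y i a := cell_coef mu p As i (x a); pose e := cell_vec mu p As.
have Le j : Lp (e j) by exact: (cell_vec_Lp p1 mA fA).
pose main b w := \sum_i mout S terms y i b * e i w.
pose diff b w := tout terms x b w - main b w.
have Lm b : Lp (main b) by exact: Lp_lincomb.
have Lt b : Lp (tout terms x b) by exact: tout_Lp.
have Ld b : Lp (diff b).
  have := (inLp_lin p1 (-1) (Lm b) (Lt b)).1; congr (inLp _ _ _).
  by apply/funext => w; rewrite /diff; ring.
have step1 : mn qo rb (tout terms x) <= mn qo rb main + mn qo rb diff.
  apply: le_trans (mnD p1 qo rb Lm Ld); rewrite le_eqVlt; apply/orP; left; apply/eqP; congr (mn _ _ _).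
  by apply/funext => b; apply/funext => w; rewrite /diff; ring.
have step2 : mn qo rb main <= D `^ p^-1 * mn qi ra x.
  have h1 := cell_synthesis p1 mA fA dA qo rb (fun i => mout S terms y i).
  have h2 := matrix_transference p1 D0 H S0 Sc y.
  have h3 := cell_analysis p1 mA fA dA qi ra Lx.
  have {h1 h2 h3} := le_trans h1 (le_trans h2 (ler_wpM2l D0 h3)).
  rewrite -/(mn qo rb main) => /(powR_root p0 (mn_ge0 _ _ _ _ _)) => /(_ (mulr_ge0 D0 (powR_ge0 _ _))).
  by rewrite powRM ?powR_ge0// -powRrM divff ?gt_eqF// powRr1// mn_ge0.
have step3 : mn qo rb diff <= eps.
  apply: (le_trans (rLp_mixed p1 qo rb Ld).2).
  apply: (@le_trans _ _ (\sum_(b <- rb) \sum_(qa <- terms b) \sum_(l < size qa.1) normc (qa.1`_l) * (eps / K))).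
    rewrite big_seq [leRHS]big_seq; apply: ler_sum => b brb.
    pose dl (qa : {poly C} * A) (l : nat) w := opow T l (x qa.2) w - \sum_i iter l (mapply S) (y^~ qa.2) i * e i w.
    have Ldl qa l : Lp (dl qa l).
      have Lv : Lp (fun w => \sum_i iter l (mapply S) (y^~ qa.2) i * e i w) by exact: Lp_lincomb.
      have := (inLp_lin p1 (-1) Lv (opow_Lp l (Lx qa.2))).1; congr (inLp _ _ _).
      by apply/funext => w; rewrite /dl; ring.
    have -> : diff b = fun w => \sum_(qa <- terms b) (\sum_(l < size qa.1) qa.1`_l * dl qa l w).
      apply/funext => w; rewrite /diff /main /tout /mout.
      under [X in _ - X]eq_bigr do rewrite mulr_suml.
      rewrite exchange_big -sumrB; apply: eq_bigr => qa _ /=.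
      rewrite /polyT /mact; under [X in _ - X]eq_bigr do rewrite mulr_suml.
      rewrite exchange_big -sumrB; apply: eq_bigr => l _ /=.
      rewrite /dl mulrBr mulr_sumr; congr (_ - _); apply: eq_bigr => i _; ring.
    apply: (le_trans (inLp_sum p1 (terms b) (fun qa => Lp_lincomb (index_enum 'I_(size qa.1)) (fun l => qa.1`_l) (fun l => Ldl qa l))).2).
    rewrite big_seq [leRHS]big_seq; apply: ler_sum => qa qab.
    apply: (le_trans (inLp_sum p1 (index_enum 'I_(size qa.1)) (fun l => (inLpZ p1 (qa.1`_l) (Ldl qa l)).1)).2).
    apply: ler_sum => l _; rewrite (inLpZ p1 (qa.1`_l) (Ldl qa l)).2 ler_wpM2l ?normc_ge0//.
    apply: HS; first by apply/List_In_mem/map_f; exact: Hin qab.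
    apply: leq_trans (ltn_ord l) _; apply: (Lb b qa brb); exact/List_In_mem.
  under eq_bigr do under eq_bigr do rewrite -mulr_suml.
  under eq_bigr do rewrite -mulr_suml.
  rewrite -mulr_suml mulrA ler_pdivrMr// mulrC ler_wpM2l ?(ltW eps0)//.
  by rewrite lerDr.
by apply: (le_trans step1); rewrite lerD.
Qed.

End Operator.

(** * Complex interpolation *)

Section ThreeLines.
Context {R : realType}.
Notation C := R[i].

Lemma sin_mvt (u : R) : 0 <= u -> exists2 c, 0 <= c <= u & sin u = cos c * u.
Proof.
move=> u0; have [c] := @MVT_segment R sin cos 0 u u0 (fun x _ => is_derive_sin x) (continuous_subspaceT (@continuous_sin R)).
by rewrite in_itv /= sin0 !subr0 => cu E; exists c.
Qed.

Lemma cos_mvt (u : R) : 0 <= u -> exists2 c, 0 <= c <= u & cos u = 1 - sin c * u.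
Proof.
move=> u0; have [c] := @MVT_segment R cos (fun x => - sin x) 0 u u0 (fun x _ => is_derive_cos x) (continuous_subspaceT (@continuous_cos R)).
rewrite in_itv /= cos0 subr0 => cu E; exists c => //; lra.
Qed.

Lemma sin_bounds (u : R) : 0 <= u <= 1 -> u - u ^+ 2 <= sin u <= u.
Proof.
move=> /andP[u0 u1]; have [c /andP[c0 cu] ->] := sin_mvt u0.
have [c' /andP[c'0 c'c] cE] := cos_mvt c0.
have h1 : cos c <= 1 by exact: cos_le1.
have h2 : 1 - u <= cos c.
  have : sin c' * c <= c by rewrite ler_piMl// sin_le1.
  lra.
apply/andP; split; last by rewrite ler_piMl.
have := ler_wpM2r u0 h2; rewrite expr2; lra.
Qed.

Lemma expR_bounds (u : R) : 0 <= u <= 1 / 2 -> 2 * u - u ^+ 2 <= expR u - expR (- u) <= 2 * u + 2 * u ^+ 2.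
Proof.
move=> /andP[u0 u2].
have e1 := expR_ge1Dx u; have e2 := expR_ge1Dx (- u).
have p1 : 0 < 1 - u by lra.
have p2 : 0 < 1 + u by lra.
have E : expR u * expR (- u) = 1 by rewrite expRN divff// gt_eqF// expR_gt0.
have i1 : expR u * (1 - u) <= 1 by rewrite -[leRHS]E ler_wpM2l ?expR_ge0//; lra.
have i2 : expR (- u) * (1 + u) <= 1 by rewrite -[leRHS]E mulrC ler_wpM2r ?expR_ge0//; lra.
apply/andP; split.
  have : expR (- u) <= 1 - u + u ^+ 2.
    rewrite -(ler_pM2r p2); apply: (le_trans i2).
    have : 0 <= u ^+ 3 by rewrite exprn_ge0.
    by rewrite !exprS expr0; lra.
  lra.
have : expR u <= 1 + u + 2 * u ^+ 2.
  rewrite -(ler_pM2r p1); apply: (le_trans i1).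
  have : 0 <= u ^+ 2 * (1 / 2 - u) by rewrite mulr_ge0 ?exprn_ge0//; lra.
  by rewrite !exprS expr0; lra.
lra.
Qed.

(** With u = |y| / 2 the expression is (e^u - e^-u)^2 - (2 sin u)^2, a product of a factor of order
    u^2 and one of order u. It is the discrete Laplacian of an exponential at the origin, and third
    order suffices below. *)
Lemma four_point_defect (y : R) : `|y| <= 1 -> `|expR y + expR (- y) + 2 * cos y - 4| <= 3 * `|y| ^+ 3.
Proof.
move=> y1.
have -> : expR y + expR (- y) + 2 * cos y - 4 = expR `|y| + expR (- `|y|) + 2 * cos `|y| - 4.
  by have [y0|y0] := leP 0 y; [rewrite ger0_norm|rewrite ltr0_norm// opprK cosN; ring].
set u := `|y| / 2; have yE : `|y| = u + u by rewrite /u; lra.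
have u0 : 0 <= u by rewrite divr_ge0.
have u2 : u <= 1 / 2 by rewrite /u; lra.
have := expR_bounds (_ : 0 <= u <= 1 / 2); rewrite u0 u2 => /(_ isT)/andP[e1 e2].
have := sin_bounds (_ : 0 <= u <= 1); rewrite u0 (_ : u <= 1); last lra.
move=> /(_ isT)/andP[s1 s2].
have E : expR u * expR (- u) = 1 by rewrite expRN divff// gt_eqF// expR_gt0.
have -> : expR `|y| + expR (- `|y|) + 2 * cos `|y| - 4 = (expR u - expR (- u) - 2 * sin u) * (expR u - expR (- u) + 2 * sin u).
  rewrite yE opprD !expRD cosD.
  have := cos2Dsin2 u => cs.
  have : cos u * cos u = 1 - sin u * sin u by rewrite -!expr2 -cs; ring.
  move=> ->; have -> : 4 = 2 * (expR u * expR (- u)) + 2 :> R by rewrite E; ring.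
  by ring.
have uu : 0 <= u * u by rewrite mulr_ge0.
have uu2 : u * u <= u * (1 / 2) by rewrite ler_wpM2l.
rewrite normrM; apply: (@le_trans _ _ (4 * u ^+ 2 * (5 * u))).
  apply: ler_pM => //; rewrite ler_norml; apply/andP; split; rewrite ?expr2 in e1 e2 s1 s2 *; lra.
have -> : 3 * `|y| ^+ 3 = 24 * u ^+ 3 by rewrite yE; ring.
have : 0 <= u ^+ 3 by rewrite exprn_ge0.
by rewrite !exprS expr0; lra.
Qed.

Definition cis (t : R) : C := (cos t +i* sin t)%C.

Lemma cisD a b : cis (a + b) = cis a * cis b.
Proof. by apply/eqP; rewrite eq_complex/= cosD sinD; apply/andP; split; apply/eqP; ring. Qed.

Lemma cis0 : cis 0 = 1.
Proof. by rewrite /cis cos0 sin0. Qed.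

Lemma normc_cis t : normc (cis t) = 1.
Proof. by rewrite /normc/= cos2Dsin2 sqrtr1. Qed.

Definition expsum (s : seq (C * R)) (a t : R) : C := \sum_(cb <- s) cb.1 * (expR (cb.2 * a))%:C%C * cis (cb.2 * t).

Lemma expsum_bound s a t : 0 <= a <= 1 -> normc (expsum s a t) <= \sum_(cb <- s) normc cb.1 * expR `|cb.2|.
Proof.
move=> /andP[a0 a1]; apply: (le_trans (normc_sum _ _)); apply: ler_sum => cb _.
rewrite !normcM normc_cis mulr1 normc_real ger0_norm ?expR_ge0// ler_wpM2l ?normc_ge0// ler_expR.
by rewrite (le_trans (ler_norm _))// normrM ler_piMr// ger0_norm.
Qed.

(** Discrete harmonicity of the sums of c e^(b z) at z = a + i t, up to h^3. It is the only trace of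
    holomorphy used in the three lines theorem. *)
Lemma expsum_four s : exists2 K, 0 <= K & forall a t h, 0 <= a <= 1 -> 0 <= h <= 1 -> (forall cb, List.In cb s -> `|cb.2| * h <= 1) ->
  normc (expsum s (a + h) t + expsum s (a - h) t + expsum s a (t + h) + expsum s a (t - h) - 4%:R * expsum s a t) <= K * h ^+ 3.
Proof.
exists (\sum_(cb <- s) normc cb.1 * expR `|cb.2| * (3 * `|cb.2| ^+ 3)).
  by rewrite sumr_ge0// => cb _; rewrite !mulr_ge0 ?normc_ge0 ?expR_ge0// exprn_ge0.
move=> a t h a01 /andP[h0 h1] H.
have -> : expsum s (a + h) t + expsum s (a - h) t + expsum s a (t + h) + expsum s a (t - h) - 4%:R * expsum s a t
  = \sum_(cb <- s) cb.1 * (expR (cb.2 * a))%:C%C * cis (cb.2 * t) *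
    (expR (cb.2 * h) + expR (- (cb.2 * h)) + 2 * cos (cb.2 * h) - 4)%:C%C.
  rewrite /expsum mulr_sumr -!big_split/= -sumrB; apply: eq_bigr => cb _.
  rewrite !mulrDr !mulrN !expRD !cisD.
  have -> : cis (cb.2 * h) = (cos (cb.2 * h))%:C%C + (0 +i* sin (cb.2 * h))%C.
    by apply/eqP; rewrite eq_complex/= addr0 add0r !eqxx.
  have -> : cis (- (cb.2 * h)) = (cos (cb.2 * h))%:C%C - (0 +i* sin (cb.2 * h))%C.
    by apply/eqP; rewrite eq_complex/= cosN sinN subr0 sub0r !eqxx.
  rewrite !(rmorphD, rmorphM, rmorphN, rmorph_nat) /=; ring.
rewrite mulr_suml; apply: (le_trans (normc_sum _ _)).
have : forall cb, List.In cb s -> normc (cb.1 * (expR (cb.2 * a))%:C%C * cis (cb.2 * t) *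
    (expR (cb.2 * h) + expR (- (cb.2 * h)) + 2 * cos (cb.2 * h) - 4)%:C%C) <= normc cb.1 * expR `|cb.2| * (3 * `|cb.2| ^+ 3) * h ^+ 3.
  move=> cb /H cbh; rewrite !normcM normc_cis mulr1 !normc_real (ger0_norm (expR_ge0 _)) -[leRHS]mulrA.
  have bh : `|cb.2 * h| <= 1 by rewrite normrM (ger0_norm h0).
  apply: ler_pM; rewrite ?mulr_ge0 ?normc_ge0 ?expR_ge0//.
    rewrite ler_wpM2l ?normc_ge0// ler_expR; move: a01 => /andP[a0 a1].
    by rewrite (le_trans (ler_norm _))// normrM ler_piMr// ger0_norm.
  apply: (le_trans (four_point_defect bh)).
  by rewrite normrM (ger0_norm h0) exprMn mulrA.
elim: (s) => [|cb l IH] HH; first by rewrite !big_nil.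
rewrite !big_cons lerD//; first by apply: HH; left.
by apply: IH => c cl; apply: HH; right.
Qed.

Lemma rV_contM n (f g : 'rV[R]_n -> R) : continuous f -> continuous g -> continuous (fun v => f v * g v).
Proof. by move=> cf cg v; exact: (continuousM (cf v) (cg v)). Qed.

Lemma rV_contD n (f g : 'rV[R]_n -> R) : continuous f -> continuous g -> continuous (fun v => f v + g v).
Proof. by move=> cf cg v; exact: (continuousD (cf v) (cg v)). Qed.

Lemma rV_contB n (f g : 'rV[R]_n -> R) : continuous f -> continuous g -> continuous (fun v => f v - g v).
Proof. by move=> cf cg v; exact: (continuousB (cf v) (cg v)). Qed.

Lemma rV_contC n (c : R) : continuous (fun _ : 'rV[R]_n => c).
Proof. by move=> v; exact: cst_continuous. Qed.

Lemma expsum_cont s : continuous (fun v : 'rV[R]_2 => normc (expsum s (v ord0 ord0) (v ord0 ord_max)) ^+ 2).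
Proof.
pose FR (v : 'rV[R]_2) := \sum_(cb <- s) expR (cb.2 * v ord0 ord0) * (complex.Re cb.1 * cos (cb.2 * v ord0 ord_max) - complex.Im cb.1 * sin (cb.2 * v ord0 ord_max)).
pose FI (v : 'rV[R]_2) := \sum_(cb <- s) expR (cb.2 * v ord0 ord0) * (complex.Re cb.1 * sin (cb.2 * v ord0 ord_max) + complex.Im cb.1 * cos (cb.2 * v ord0 ord_max)).
have E (v : 'rV[R]_2) : expsum s (v ord0 ord0) (v ord0 ord_max) = (FR v +i* FI v)%C.
  rewrite /expsum /FR /FI; elim: (s) => [|cb l IH]; first by rewrite !big_nil.
  rewrite !big_cons IH; case: (cb.1) => x y.
  by apply/eqP; rewrite eq_complex/=; apply/andP; split; apply/eqP; ring.
have -> : (fun v : 'rV[R]_2 => normc (expsum s (v ord0 ord0) (v ord0 ord_max)) ^+ 2) = fun v => FR v * FR v + FI v * FI v.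
  by apply/funext => v; rewrite E normc_sqr /= !expr2.
have cl (b : R) j : continuous (fun v : 'rV[R]_2 => b * v ord0 j).
  by apply: rV_contM; [exact: rV_contC|move=> v; exact: coord_continuous].
have ce (b : R) : continuous (fun v : 'rV[R]_2 => expR (b * v ord0 ord0)).
  by move=> v; apply: (@continuous_comp _ _ _ (fun v : 'rV[R]_2 => b * v ord0 ord0)); [exact: cl|exact: continuous_expR].
have cc (b : R) : continuous (fun v : 'rV[R]_2 => cos (b * v ord0 ord_max)).
  by move=> v; apply: (@continuous_comp _ _ _ (fun v : 'rV[R]_2 => b * v ord0 ord_max)); [exact: cl|exact: continuous_cos].
have cs (b : R) : continuous (fun v : 'rV[R]_2 => sin (b * v ord0 ord_max)).
  by move=> v; apply: (@continuous_comp _ _ _ (fun v : 'rV[R]_2 => b * v ord0 ord_max)); [exact: cl|exact: continuous_sin].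
have cR : continuous FR.
  apply: (@sum_cont R 2 _ s (fun cb v => expR (cb.2 * v ord0 ord0) * (complex.Re cb.1 * cos (cb.2 * v ord0 ord_max) - complex.Im cb.1 * sin (cb.2 * v ord0 ord_max)))).
  by move=> cb; apply: rV_contM => //; apply: rV_contB; apply: rV_contM => //; exact: rV_contC.
have cI : continuous FI.
  apply: (@sum_cont R 2 _ s (fun cb v => expR (cb.2 * v ord0 ord0) * (complex.Re cb.1 * sin (cb.2 * v ord0 ord_max) + complex.Im cb.1 * cos (cb.2 * v ord0 ord_max)))).
  by move=> cb; apply: rV_contM => //; apply: rV_contD; apply: rV_contM => //; exact: rV_contC.
by apply: rV_contD; apply: rV_contM.
Qed.

Lemma four_squares (a b c e : C) : normc (a + b + c + e) ^+ 2 <= 4 * (normc a ^+ 2 + normc b ^+ 2 + normc c ^+ 2 + normc e ^+ 2).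
Proof.
apply: (@le_trans _ _ ((normc a + normc b + normc c + normc e) ^+ 2)).
  rewrite ler_sqr ?nnegrE ?addr_ge0 ?normc_ge0//.
  by rewrite !(le_trans (ler_normcD _ _))// lerD2r (le_trans (ler_normcD _ _))// lerD2r ler_normcD.
move: (normc a) (normc b) (normc c) (normc e) => x y z w.
have := sqr_ge0 (x - y); have := sqr_ge0 (x - z); have := sqr_ge0 (x - w); have := sqr_ge0 (y - z).
have := sqr_ge0 (y - w); have := sqr_ge0 (z - w); rewrite !expr2; lra.
Qed.

Lemma square_lower (n D S L : R) : 0 <= n <= S -> 0 <= D -> 0 <= L -> 4 * n - D <= L ->
  16 * n ^+ 2 - 8 * (D * S) <= L ^+ 2.
Proof.
move=> /andP[n0 nS] D0 L0 nL.
have h0 := mulr_ge0 n0 D0; have h1 := ler_wpM2r D0 nS.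
have [h|h] := leP D (4 * n).
  apply: (@le_trans _ _ ((4 * n - D) ^+ 2)).
    have := sqr_ge0 D; rewrite !expr2; lra.
  by rewrite ler_sqr// ?nnegrE// subr_ge0.
apply: le_trans (sqr_ge0 _).
have := ler_wpM2l n0 (ltW h); rewrite expr2; lra.
Qed.

(** A maximum principle on a rectangle: at an interior maximum of the strictly subharmonic
    perturbation g, the four-point comparison with step m would give e m^2 <= K S m^3, which fails
    for small m. Hence the maximum lies on the boundary. *)
Theorem three_lines s (th : R) : 0 <= th <= 1 ->
  (forall t, normc (expsum s 0 t) <= 1) -> (forall t, normc (expsum s 1 t) <= 1) -> normc (expsum s th 0) <= 1.
Proof.
move=> th01 H0 H1.
pose S := \sum_(cb <- s) normc cb.1 * expR `|cb.2|.
have S0 : 0 <= S by rewrite sumr_ge0// => cb _; rewrite mulr_ge0 ?normc_ge0 ?expR_ge0.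
suff main e : 0 < e -> normc (expsum s th 0) ^+ 2 <= 1 + 2 * e.
  rewrite -(@ler_pXn2r _ 2)// ?nnegrE ?normc_ge0// expr1n.
  by apply/ler_addgt0Pr => e e0; have := main (e / 2); rewrite divr_gt0// => /(_ isT); rewrite mulrCA divff// mulr1.
(* High enough that at |t| = tt the term - e t^2 outweighs the crude bound S^2 of the square of the
   sum. *)
move=> e0; pose tt := 1 + S ^+ 2 / e.
have t1 : 1 <= tt by rewrite lerDl divr_ge0 ?sqr_ge0// ltW.
have tS : S ^+ 2 <= e * tt ^+ 2.
  apply: (@le_trans _ _ (e * tt)); last by rewrite ler_pM2l// ler_eXnr.
  by rewrite /tt mulrDr mulrCA divff ?gt_eqF// !mulr1 lerDr ltW.
(* 2 a^2 - t^2 has positive Laplacian, is at most 2 on the strip, and tends to minus infinity along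
   it. *)
pose g (v : 'rV[R]_2) := normc (expsum s (v ord0 ord0) (v ord0 ord_max)) ^+ 2 + e * (2 * (v ord0 ord0 * v ord0 ord0) - v ord0 ord_max * v ord0 ord_max).
have cj (j : 'I_2) : continuous (fun v : 'rV[R]_2 => v ord0 j) by move=> v; exact: coord_continuous.
have cg : continuous g.
  apply: rV_contD; first exact: expsum_cont.
  apply: rV_contM; first exact: rV_contC.
  apply: rV_contB; last by apply: rV_contM; exact: cj.
  by apply: rV_contM; [exact: rV_contC|apply: rV_contM; exact: cj].
pose A := [set v : 'rV[R]_2 | 0 <= v ord0 ord0 <= 1 /\ - tt <= v ord0 ord_max <= tt].
have cA : compact A.
  apply: bounded_closed_compact.
    exists tt; split; [exact: num_real|] => M M1 v [/andP[v0 v1] /andP[w0 w1]]; rewrite /Num.norm/= mx_normrE.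
    apply: bigmax_le; first by rewrite (le_trans _ (ltW M1))// (le_trans _ t1).
    move=> [i j] _ /=; rewrite (ord1 i) (le_trans _ (ltW M1))//.
    have [->|->] : j = ord0 \/ j = ord_max by case: j => [[|[|//]]] ?; [left|right]; exact/val_inj.
      by rewrite ger0_norm// (le_trans v1).
    by rewrite ler_norml w0.
  have -> : A = ((fun v : 'rV[R]_2 => v ord0 ord0) @^-1` [set x | 0 <= x] `&` (fun v : 'rV[R]_2 => v ord0 ord0) @^-1` [set x | x <= 1])
    `&` ((fun v : 'rV[R]_2 => v ord0 ord_max) @^-1` [set x | - tt <= x] `&` (fun v : 'rV[R]_2 => v ord0 ord_max) @^-1` [set x | x <= tt]).
    apply/seteqP; split=> v /=; first by move=> [/andP[? ?] /andP[? ?]].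
    by move=> [[? ?] [? ?]]; split; apply/andP.
  by apply: closedI; apply: closedI; (apply: closed_comp; [by move=> v _; exact: cj|first [exact: closed_ge|exact: closed_le]]).
pose pt (x y : R) : 'rV[R]_2 := \row_j (if j == ord0 then x else y).
have ptE x y : (pt x y) ord0 ord0 = x /\ (pt x y) ord0 ord_max = y by rewrite !mxE.
have inA x y : 0 <= x <= 1 -> - tt <= y <= tt -> pt x y \in A.
  by move=> hx hy; rewrite inE /A /=; have [-> ->] := ptE x y.
have A0 : A !=set0.
  by exists (pt th 0); have := inA th 0 th01; rewrite inE; apply; apply/andP; split; lra.
have [u /[!inE] -[/andP[u0 u1] /andP[w0 w1]] umax] := @EVT_max_rV R 2 g A A0 cA (continuous_subspaceT cg).
set a := u ord0 ord0 in u0 u1; set t := u ord0 ord_max in w0 w1.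
have gu : g u = normc (expsum s a t) ^+ 2 + e * (2 * (a * a) - t * t) by [].
have gpt x y : 0 <= x <= 1 -> - tt <= y <= tt -> normc (expsum s x y) ^+ 2 + e * (2 * (x * x) - y * y) <= g u.
  by move=> hx hy; have := umax _ (inA x y hx hy); rewrite /g; have [-> ->] := ptE x y.
suff gu1 : g u <= 1 + 2 * e.
  apply: le_trans gu1; apply: le_trans (gpt th 0 th01 _); last by apply/andP; split; lra.
  by rewrite lerDl mulr_ge0 ?(ltW e0)// mulr0 subr0 !mulr_ge0//; case/andP: th01.
have aa : a * a <= 1 by rewrite -[leRHS]mulr1 ler_pM.
have a00 : 0 <= a * a by rewrite mulr_ge0.
have tt0 : 0 <= t * t by rewrite -expr2 sqr_ge0.
have e1 : e * (a * a) <= e by rewrite ler_piMr// ltW.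
have e2 : 0 <= e * (a * a) by rewrite mulr_ge0// ltW.
have e3 : 0 <= e * (t * t) by rewrite mulr_ge0// ltW.
have sq1 (x : C) : normc x <= 1 -> normc x ^+ 2 <= 1 by move=> h; rewrite exprn_ile1 ?normc_ge0.
have [aE|aN0] := eqVneq a 0; first by rewrite gu aE; have := sq1 _ (H0 t); lra.
have [aE|aN1] := eqVneq a 1; first by rewrite gu aE; have := sq1 _ (H1 t); lra.
have [tE|tN] := eqVneq (t * t) (tt * tt).
  rewrite gu tE; have : normc (expsum s a t) ^+ 2 <= S ^+ 2.
    by rewrite ler_sqr ?nnegrE ?normc_ge0//; apply: expsum_bound; rewrite u0.
  rewrite -expr2 mulrBr; lra.
exfalso.
have a0 : 0 < a by rewrite lt0r aN0.
have a1 : a < 1 by rewrite lt_neqAle aN1.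
have t0 : - tt < t by rewrite lt_neqAle w0 andbT; apply: contraNneq tN => <-; rewrite mulrNN.
have t2 : t < tt by rewrite lt_neqAle w1 andbT; apply: contraNneq tN => ->.
have [K K0 HK] := expsum_four s.
pose B := 1 + \sum_(cb <- s) `|cb.2|.
have B1 : 1 <= B by rewrite lerDl sumr_ge0.
(* One step length for all purposes: it stays inside the rectangle, keeps every frequency times m
   below 1, and makes K S m < e. *)
pose m := Num.min (Num.min (Num.min a (1 - a)) (Num.min (t + tt) (tt - t))) (Num.min B^-1 (e / (1 + K * S))).
have KS : 0 < 1 + K * S by rewrite ltr_wpDr// mulr_ge0.
have m0 : 0 < m by rewrite !lt_min a0 subr_gt0 a1 invr_gt0 (lt_le_trans ltr01 B1) divr_gt0// -ltrBlDr sub0r t0 subr_gt0 t2.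
have : m <= m by [].
rewrite {2}/m !le_min => /andP[/andP[/andP[ma ma1] /andP[mt mt1]] /andP[mB mK]].
have h01 : 0 <= m <= 1 by rewrite (ltW m0) (le_trans mB)// invf_le1// (lt_le_trans ltr01).
have Hb cb : List.In cb s -> `|cb.2| * m <= 1.
  move=> cbs; apply: (@le_trans _ _ (B * B^-1)); last by rewrite divff// gt_eqF// (lt_le_trans ltr01).
  apply: ler_pM => //; first exact: ltW.
  rewrite /B; elim: (s) cbs => //= c l IH [->|/IH h]; rewrite big_cons.
    by rewrite addrCA lerDl addr_ge0// sumr_ge0.
  by rewrite addrCA (le_trans h)// lerDr.
have a01 : 0 <= a <= 1 by rewrite u0.
have := HK a t m a01 h01 Hb.
set F1 := expsum s (a + m) t; set F2 := expsum s (a - m) t; set F3 := expsum s a (t + m); set F4 := expsum s a (t - m).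
set F := expsum s a t => HD.
have FS : normc F <= S by apply: expsum_bound.
have ww : - tt <= t <= tt by rewrite w0.
have q1 := gpt (a + m) t _ ww; have q2 := gpt (a - m) t _ ww.
have q3 := gpt a (t + m) a01 _; have q4 := gpt a (t - m) a01 _.
have {}q1 := q1 (_ : 0 <= a + m <= 1); have {}q2 := q2 (_ : 0 <= a - m <= 1).
have {}q3 := q3 (_ : - tt <= t + m <= tt); have {}q4 := q4 (_ : - tt <= t - m <= tt).
have r1 : 0 <= a + m <= 1 by rewrite addr_ge0 ?(ltW m0)//= -lerBrDl.
have r2 : 0 <= a - m <= 1 by rewrite subr_ge0 ma/= lerBlDr ler_wpDr// ltW.
have r3 : - tt <= t + m <= tt by rewrite ler_wpDr ?(ltW m0)//= -lerBrDl.
have r4 : - tt <= t - m <= tt by rewrite lerBrDr addrC lerBlDr mt/= lerBlDr ler_wpDr// ltW.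
have {r1}q1 := q1 r1; have {r2}q2 := q2 r2; have {r3}q3 := q3 r3; have {r4}q4 := q4 r4.
have sq := four_squares F1 F2 F3 F4.
have n4 : normc (4%:R * F) = 4 * normc F.
  by rewrite normcM -[4%:R](rmorph_nat (real_complex R)) normc_real ger0_norm.
have lo : 4 * normc F - K * m ^+ 3 <= normc (F1 + F2 + F3 + F4).
  rewrite -n4 lerBlDr.
  have -> : 4%:R * F = (F1 + F2 + F3 + F4) - (F1 + F2 + F3 + F4 - 4%:R * F) by ring.
  by apply: (le_trans (ler_normcD _ _)); rewrite normcN' lerD2l.
have sqlo : 16 * normc F ^+ 2 - 8 * (K * m ^+ 3 * S) <= normc (F1 + F2 + F3 + F4) ^+ 2.
  by apply: square_lower lo; rewrite ?normc_ge0 ?FS// mulr_ge0// exprn_ge0// ltW.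
rewrite gu -/F in q1 q2 q3 q4.
have : e * (m * m) <= K * m ^+ 3 * S.
  move: sqlo sq q1 q2 q3 q4; rewrite -/F1 -/F2 -/F3 -/F4; clear.
  move: (normc F1 ^+ 2) (normc F2 ^+ 2) (normc F3 ^+ 2) (normc F4 ^+ 2) (normc F ^+ 2) (normc _ ^+ 2) (K * _ * S) => x1 x2 x3 x4 x x5 y.
  lra.
apply/negP; rewrite -ltNge.
have -> : K * m ^+ 3 * S = (K * S * m) * (m * m) by ring.
rewrite ltr_pM2r ?mulr_gt0//.
apply: (@le_lt_trans _ _ (K * S * (e / (1 + K * S)))); first by rewrite ler_wpM2l// mulr_ge0.
rewrite mulrA ltr_pdivrMr// mulrC ltr_pM2l// ltrDr//.
Qed.

End ThreeLines.

(** * Interpolation of matrices on l^p(l^2) *)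

Section RieszThorin.
Context {R : realType}.
Notation C := R[i].

Definition dualq q := match q with l1 => loo | l2 => l2 | loo => l1 end.

Lemma lnorm_pairing q (A : Type) (r : seq A) (u v : A -> C) : q <> l2 ->
  \sum_(a <- r) normc (u a) * normc (v a) <= lnorm q r u * lnorm (dualq q) r v.
Proof.
have H (f g : A -> C) : \sum_(a <- r) normc (f a) * normc (g a) <= lnorm l1 r f * lnorm loo r g.
  rewrite /lnorm mulr_suml; elim: r => [|a r IH]; first by rewrite !big_nil.
  rewrite !big_cons lerD//.
    by rewrite ler_wpM2l ?normc_ge0// le_max lexx.
  apply: (le_trans IH); apply: ler_sum => b _; rewrite ler_wpM2l ?normc_ge0//.
  by rewrite le_max lexx orbT.
case: q => [_|/(_ erefl)//|_]; first exact: (H u v).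
by rewrite [leRHS]mulrC; under eq_bigr do rewrite mulrC; exact: H.
Qed.

(** The Riesz-Thorin family x / |x| |x|^b G^(1 - b) with b = b0 + kb (s + i t), relative to the
    fibre norm G. The part with b0 goes into the coefficients of an exponential sum and the part
    with kb into its frequencies. *)
Definition fam (b0 kb : R) (x : C) (G s t : R) : C :=
  if x == 0 then 0 else x / (normc x)%:C%C * (expR (b0 * (ln (normc x) - ln G) + ln G))%:C%C *
    ((expR (kb * (ln (normc x) - ln G) * s))%:C%C * cis (kb * (ln (normc x) - ln G) * t)).

Lemma normc_gt0 (x : C) : x != 0 -> 0 < normc x.
Proof. by move=> x0; rewrite lt0r normc_ge0 andbT; apply: contraNneq x0 => /eq0_normc ->. Qed.

Lemma cplx_neq0 (z : R) : z != 0 -> (z%:C)%C != 0 :> C.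
Proof. by move=> z0; rewrite -(rmorph0 (real_complex R)) (inj_eq (@complexI R)). Qed.

Lemma normc_fam b0 kb x G s t : x != 0 -> 0 < G ->
  normc (fam b0 kb x G s t) = normc x `^ (b0 + kb * s) * G `^ (1 - (b0 + kb * s)).
Proof.
move=> x0 G0; have n0 := normc_gt0 x0.
rewrite /fam (negPf x0) !normcM normc_cis mulr1 normcV !normc_real !(ger0_norm (expR_ge0 _)) (ger0_norm (normc_ge0 x)).
rewrite divff ?gt_eqF// mul1r -expRD /powR !gt_eqF// -expRD; congr expR; ring.
Qed.

Lemma fam_id b0 kb x G s : b0 + kb * s = 1 -> (x != 0 -> 0 < G) -> fam b0 kb x G s 0 = x.
Proof.
move=> e H; rewrite /fam; case: eqP => [->//|/eqP x0].
have n0 := normc_gt0 x0; have G0 := H x0.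
rewrite mulr0 cis0 mulr1 -mulrA -rmorphM -expRD.
have -> : b0 * (ln (normc x) - ln G) + ln G + kb * (ln (normc x) - ln G) * s = ln (normc x).
  have -> : b0 * (ln (normc x) - ln G) + ln G + kb * (ln (normc x) - ln G) * s =
    (b0 + kb * s) * (ln (normc x) - ln G) + ln G by ring.
  rewrite e; ring.
by rewrite lnK ?posrE// divfK// cplx_neq0// gt_eqF.
Qed.

Section Bounds.
Variables (A : eqType) (r : seq A) (x : A -> C).
Let G := lnorm l2 r x.

Lemma lnorm2_gt0 a : a \in r -> x a != 0 -> 0 < G.
Proof.
move=> ar xa; rewrite /G /lnorm /enorm sqrtr_gt0; elim: r ar => // b s IH; rewrite inE big_cons => /predU1P[<-|/IH h].
  by rewrite ltr_wpDr ?sumr_ge0 ?exprn_gt0 ?normc_gt0// => *; exact: sqr_ge0.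
by rewrite ltr_wpDl ?sqr_ge0.
Qed.

(** At the real exponent 2 / P the P-th power of the modulus is |x|^2 G^(P - 2), and the fibre sum
    of |x|^2 is G^2. *)
Lemma sum_fam_sqr b0 kb s t (P : R) : 0 < P -> b0 + kb * s = 2 / P ->
  \sum_(a <- r) normc (fam b0 kb (x a) G s t) `^ P <= G `^ P.
Proof.
move=> P0 bE; have G0 : 0 <= G by exact: lnorm_ge0.
have [Gz|Gnz] := eqVneq G 0.
  rewrite big_seq big1 ?powR_ge0// => a ar.
  have [xa|xa] := eqVneq (x a) 0; first by rewrite /fam xa eqxx normc0 powR0// gt_eqF.
  by have := lnorm2_gt0 ar xa; rewrite Gz ltxx.
have Gp : 0 < G by rewrite lt0r Gnz.
apply: (@le_trans _ _ (\sum_(a <- r) normc (x a) ^+ 2 * G `^ (P - 2))).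
  apply: ler_sum => a _.
  have [xa|xa] := eqVneq (x a) 0.
    by rewrite /fam xa eqxx normc0 powR0 ?gt_eqF// mulr_ge0 ?powR_ge0// sqr_ge0.
  rewrite normc_fam// bE powRM ?powR_ge0// -!powRrM divfK ?gt_eqF// mulrBl mul1r divfK ?gt_eqF//.
  by rewrite -powR_mulrn ?normc_ge0.
rewrite -mulr_suml -(sqr_enorm r (fun a => normc (x a))) -[enorm _ _]/(G) -powR_mulrn// -powRD ?Gnz ?implybT//.
by rewrite addrC subrK.
Qed.

(** The other endpoint: exponent 2 gives |x|^2 / G, of l^1-norm at most G; exponent 0 gives modulus
    G wherever x is nonzero. *)
Lemma sup_fam q b0 kb s t : b0 + kb * s = (if q is l1 then 2 else 0) -> q <> l2 ->
  lnorm q r (fun a => fam b0 kb (x a) G s t) <= G.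
Proof.
move=> bE q2; have G0 : 0 <= G by exact: lnorm_ge0.
have z a : a \in r -> G = 0 -> x a = 0.
  by move=> ar Gz; apply/eqP/negPn/negP => xa; have := lnorm2_gt0 ar xa; rewrite Gz ltxx.
case: q bE q2 => // bE _; rewrite /lnorm.
  have [Gz|Gnz] := eqVneq G 0.
    by rewrite big_seq big1// => a ar; rewrite /fam (z a ar Gz) eqxx normc0.
  have Gp : 0 < G by rewrite lt0r Gnz.
  apply: (@le_trans _ _ (\sum_(a <- r) normc (x a) ^+ 2 * G^-1)).
    apply: ler_sum => a _; have [xa|xa] := eqVneq (x a) 0.
      by rewrite /fam xa eqxx normc0 mulr_ge0 ?invr_ge0// sqr_ge0.
    rewrite normc_fam// bE (_ : 1 - 2 = -1); last by ring.
    by rewrite powR_inv1 ?(ltW Gp)// -powR_mulrn ?normc_ge0.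
  rewrite -mulr_suml -(sqr_enorm r (fun a => normc (x a))) -[enorm _ _]/(G) expr2 mulfK//.
apply: bigmax_le_seq => // a ar; have [xa|xa] := eqVneq (x a) 0.
  by rewrite /fam xa eqxx normc0.
by rewrite normc_fam ?(lnorm2_gt0 ar xa)// bE powRr0 mul1r subr0 powRr1.
Qed.

End Bounds.

Lemma young (p p' a b e : R) : 1 < p -> p^-1 + p'^-1 = 1 -> 0 <= a -> 0 <= b -> 0 < e ->
  a * b <= e * ((a / e) `^ p / p + b `^ p' / p').
Proof.
move=> p1 pp a0 b0 e0; have p0 : 0 < p by apply: lt_trans p1.
have th : 0 < p^-1 < 1 by rewrite invr_gt0 p0 invf_lt1.
have p'E : 1 - p^-1 = p'^-1 by rewrite -pp; ring.
have p'0 : 0 < p'^-1 by rewrite -p'E subr_gt0; case/andP: th.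
have ae : 0 <= a / e by rewrite divr_ge0// ltW.
have := powR_young (powR_ge0 (a / e) p) (powR_ge0 b p') th.
have n1 : ((a / e) `^ p) `^ p^-1 = a / e by rewrite -powRrM divff ?gt_eqF// powRr1.
have n2 : (b `^ p') `^ p'^-1 = b.
  by rewrite -powRrM divff ?powRr1//; rewrite invr_gt0 in p'0; rewrite gt_eqF.
rewrite p'E n1 n2 => h.
rewrite -[leLHS](_ : e * (a / e * b) = _); last by rewrite mulrA mulrCA divff ?gt_eqF// mulr1.
by rewrite ler_pM2l// (le_trans h)// ![_^-1 * _]mulrC.
Qed.

Lemma reassoc (w sx ex sy ey e0 E1 E2 E3 c1 c2 c3 : C) :
  w * (sx * ex) * (sy * ey) * e0 * (E1 * E2 * E3) * (c1 * c2 * c3) =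
  e0 * E3 * c3 * (w * (sx * ex * (E1 * c1)) * (sy * ey * (E2 * c2))).
Proof. by ring. Qed.

(** With x and y replaced by their families the form is an exponential sum. On s = 0 the fibres are
    those of l^p and l^p', where each W a acts alone with bound eps; on s = 1 they are those of l^q
    and its dual, where B applies. The relation between p and th says that the exponents are 1 at s
    = th. *)
Theorem riesz_thorin_bilinear n (p p' th eps B : R) q (A : eqType) (r : seq A) (W : A -> 'I_n.+1 -> 'I_n.+1 -> C) :
  1 < p -> p^-1 + p'^-1 = 1 -> 0 <= th <= 1 -> q <> l2 ->
  2 / p * (1 - th) + (if q is l1 then 2 else 0) * th = 1 -> 0 < eps -> 0 < B ->
  (forall a y, a \in r -> \sum_i normc (mapply (W a) y i) `^ p <= eps `^ p * \sum_i normc (y i) `^ p) ->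
  (forall y : A -> 'I_n.+1 -> C, \sum_i lnorm q r (fun a => mapply (W a) (y a) i) `^ p
      <= B `^ p * \sum_i lnorm q r (fun a => y a i) `^ p) ->
  forall x y : A -> 'I_n.+1 -> C,
  \sum_i lnorm l2 r (fun a => x a i) `^ p <= 1 -> \sum_i lnorm l2 r (fun a => y a i) `^ p' <= 1 ->
  normc (\sum_(a <- r) \sum_i mapply (W a) (x a) i * y a i) <= eps `^ (1 - th) * B `^ th.
Proof.
move=> p1 pp th01 q2 thE eps0 B0 Heps HB x y x1 y1.
have p0 : 0 < p by apply: lt_trans p1.
have p'E : p'^-1 = 1 - p^-1 by rewrite -pp; ring.
have p'i : 0 < p'^-1 by rewrite p'E subr_gt0 invf_lt1.
have p'0 : 0 < p' by rewrite -invr_gt0.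
pose al1 : R := if q is l1 then 2 else 0.
pose ka := al1 - 2 / p.
pose G i := lnorm l2 r (fun a => x a i); pose H i := lnorm l2 r (fun a => y a i).
pose X a s t j := fam (2 / p) ka (x a j) (G j) s t.
pose Y a s t i := fam (2 / p') (- ka) (y a i) (H i) s t.
pose dx a j := ln (normc (x a j)) - ln (G j); pose dy a i := ln (normc (y a i)) - ln (H i).
(* The factor eps^-1 e^(le s) brings both edge bounds to 1; at s = th it is the inverse of the
   claimed bound. *)
pose le := ln eps - ln B.
pose cf a i j : C := if (x a j == 0) || (y a i == 0) then 0 else W a i j *
  (x a j / (normc (x a j))%:C%C * (expR (2 / p * dx a j + ln (G j)))%:C%C) *
  (y a i / (normc (y a i))%:C%C * (expR (2 / p' * dy a i + ln (H i)))%:C%C) * (eps^-1)%:C%C.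
pose s : seq (C * R) := [seq (cf aij.1 aij.2.1 aij.2.2, ka * dx aij.1 aij.2.2 + (- ka) * dy aij.1 aij.2.1 + le) |
  aij <- [seq (a, ij) | a <- r, ij <- [seq (i, j) | i <- index_enum 'I_n.+1, j <- index_enum 'I_n.+1]]].
have sE a t : expsum s a t = (eps^-1 * expR (le * a))%:C%C * cis (le * t) *
   \sum_(k <- r) \sum_i mapply (W k) (X k a t) i * Y k a t i.
  rewrite /expsum /s big_map big_allpairs_dep mulr_sumr; apply: eq_bigr => k _.
  rewrite big_allpairs_dep mulr_sumr; apply: eq_bigr => i _.
  rewrite /mapply mulr_suml mulr_sumr; apply: eq_bigr => j _ /=.
  rewrite /cf /X /Y /fam -/(dx k j) -/(dy k i).
  have [x0|x0] := eqVneq (x k j) 0; first by rewrite /= !(mul0r, mulr0).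
  have [y0|y0] := eqVneq (y k i) 0; first by rewrite /= !(mul0r, mulr0).
  rewrite /= !mulrDl !expRD !cisD !rmorphM /=.
  exact: reassoc.
have modM a t : normc ((eps^-1 * expR (le * a))%:C%C * cis (le * t)) = eps^-1 * expR (le * a).
  by rewrite normcM normc_cis mulr1 normc_real ger0_norm// mulr_ge0 ?invr_ge0 ?expR_ge0// ltW.
have one : p^-1 * 1 + p'^-1 * 1 = 1 by rewrite !mulr1.
have e2 : 2 / p' + - ka * 0 = 2 / p' by ring.
have e1 : 2 / p + ka * 0 = 2 / p by ring.
have bound0 t : normc (expsum s 0 t) <= 1.
  rewrite sE normcM modM mulr0 expR0 mulr1 mulrC ler_pdivrMr// mul1r.
  apply: (@le_trans _ _ (\sum_(k <- r) \sum_i eps * ((normc (mapply (W k) (X k 0 t) i) / eps) `^ p / p + normc (Y k 0 t i) `^ p' / p'))).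
    apply: (le_trans (normc_sum _ _)); apply: ler_sum => k _.
    apply: (le_trans (normc_sum _ _)); apply: ler_sum => i _; rewrite normcM.
    by apply: young => //; exact: normc_ge0.
  under eq_bigr do rewrite -mulr_sumr big_split/= -!mulr_suml.
  rewrite -mulr_sumr big_split/= -!mulr_suml -[leRHS]mulr1 ler_pM2l// -[leRHS]one ![_^-1 * 1]mulrC.
  apply: lerD; rewrite ler_pM2r ?invr_gt0//.
    apply: le_trans x1; rewrite [leRHS](_ : _ = \sum_i G i `^ p)//.
    apply: (@le_trans _ _ (\sum_(k <- r) \sum_i normc (X k 0 t i) `^ p)).
      rewrite big_seq [leRHS]big_seq; apply: ler_sum => k kr.
      under eq_bigr do rewrite powRM ?normc_ge0 ?invr_ge0 ?(ltW eps0)//.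
      rewrite -mulr_suml -[eps^-1]powR_inv1 ?(ltW eps0)// -powRrM mulN1r powRN ler_pdivrMr ?powR_gt0// mulrC.
      exact: Heps.
    rewrite exchange_big/=; apply: ler_sum => i _; exact: sum_fam_sqr.
  apply: le_trans y1; rewrite exchange_big/=; apply: ler_sum => i _; exact: sum_fam_sqr.
have f1 : 2 / p + ka * 1 = al1 by rewrite /ka; ring.
have f2 : 2 / p' + - ka * 1 = (if dualq q is l1 then 2 else 0).
  rewrite /ka p'E /al1; case: (q) q2 => //= _; ring.
have bound1 t : normc (expsum s 1 t) <= 1.
  rewrite sE normcM modM mulr1 /le expRD expRN !lnK ?posrE// mulrA mulVf ?gt_eqF// mul1r mulrC ler_pdivrMr// mul1r.
  apply: (@le_trans _ _ (\sum_i B * ((lnorm q r (fun k => mapply (W k) (X k 1 t) i) / B) `^ p / p + H i `^ p' / p'))).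
    rewrite exchange_big/=; apply: (le_trans (normc_sum _ _)); apply: ler_sum => i _.
    apply: le_trans (young p1 pp (lnorm_ge0 _ _ _) (lnorm_ge0 _ _ _) B0).
    apply: (le_trans (normc_sum _ _)); under eq_bigr do rewrite normcM.
    apply: (le_trans (lnorm_pairing r _ _ q2)).
    rewrite ler_wpM2l ?lnorm_ge0//; apply: sup_fam => //.
    by case: (q) q2.
  rewrite -mulr_sumr big_split/= -!mulr_suml -[leRHS]mulr1 ler_pM2l// -[leRHS]one ![_^-1 * 1]mulrC.
  apply: lerD; rewrite ler_pM2r ?invr_gt0//.
  apply: le_trans x1.
  under eq_bigr do rewrite powRM ?lnorm_ge0 ?invr_ge0 ?(ltW B0)//.
  rewrite -mulr_suml -[B^-1]powR_inv1 ?(ltW B0)// -powRrM mulN1r powRN ler_pdivrMr ?powR_gt0// [leRHS]mulrC.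
  apply: (le_trans (HB _)); rewrite ler_wpM2l ?powR_ge0//; apply: ler_sum => i _.
  apply: powR_le; [exact: ltW|exact: lnorm_ge0|].
  exact: (@sup_fam A r (fun a => x a i) q (2 / p) ka 1 t f1 q2).
have := three_lines th01 bound0 bound1; rewrite sE normcM modM.
(* Exponent 1 means that the families of x and y return x and y themselves. *)
have g1 : 2 / p + ka * th = 1 by rewrite -[RHS]thE /ka -/al1; ring.
have g2 : 2 / p' + - ka * th = 1 by move: g1; rewrite p'E mulNr; lra.
have -> : \sum_(k <- r) \sum_i mapply (W k) (X k th 0) i * Y k th 0 i = \sum_(k <- r) \sum_i mapply (W k) (x k) i * y k i.
  rewrite big_seq [RHS]big_seq; apply: eq_bigr => k kr; apply: eq_bigr => i _; congr (_ * _).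
    apply: eq_bigr => j _; congr (_ * _); apply: fam_id => // xk.
    exact: (@lnorm2_gt0 A r (fun a => x a j) k).
  apply: fam_id => // yk; exact: (@lnorm2_gt0 A r (fun a => y a i) k).
rewrite -ler_pdivlMl ?mulr_gt0 ?invr_gt0 ?expR_gt0// mulr1 invfM invrK => h.
apply: (le_trans h); rewrite le_eqVlt; apply/orP; left; apply/eqP.
rewrite /powR !gt_eqF// -expRN -{1}(lnK (_ : eps \is Num.pos)) ?posrE// -!expRD /le.
by congr expR; ring.
Qed.

Lemma powRK (p x : R) : p != 0 -> 0 <= x -> (x `^ p) `^ p^-1 = x.
Proof. by move=> p0 x0; rewrite -powRrM divff// powRr1. Qed.

Lemma lnorm_eq0 (A : eqType) (r : seq A) (v : A -> C) a : lnorm l2 r v = 0 -> a \in r -> v a = 0.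
Proof. by move=> h ar; apply/eqP/negPn/negP => va; have := lnorm2_gt0 ar va; rewrite h ltxx. Qed.

(** The bilinear bound is applied to the norming y of the image: its conjugate, times the power p -
    2 of the fibre norm, normalised in l^p'(l^2). *)
Theorem riesz_thorin n (p th eps B : R) q (A : eqType) (r : seq A) (W : A -> 'I_n.+1 -> 'I_n.+1 -> C) :
  1 < p -> 0 <= th <= 1 -> q <> l2 ->
  2 / p * (1 - th) + (if q is l1 then 2 else 0) * th = 1 -> 0 < eps -> 0 < B ->
  (forall a y, a \in r -> \sum_i normc (mapply (W a) y i) `^ p <= eps `^ p * \sum_i normc (y i) `^ p) ->
  (forall y : A -> 'I_n.+1 -> C, \sum_i lnorm q r (fun a => mapply (W a) (y a) i) `^ p
      <= B `^ p * \sum_i lnorm q r (fun a => y a i) `^ p) ->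
  forall x : A -> 'I_n.+1 -> C,
  \sum_i lnorm l2 r (fun a => mapply (W a) (x a) i) `^ p
  <= (eps `^ (1 - th) * B `^ th) `^ p * \sum_i lnorm l2 r (fun a => x a i) `^ p.
Proof.
move=> p1 th01 q2 thE eps0 B0 Heps HB.
have p0 : 0 < p by apply: lt_trans p1.
pose p' := p / (p - 1); have pp : p^-1 + p'^-1 = 1.
  by rewrite /p' invf_div; field; rewrite gt_eqF.
have p'1 : 1 < p' by exact: conj_exp.
have p'0 : 0 < p' by apply: lt_trans p'1.
set M := eps `^ (1 - th) * B `^ th.
have M0 : 0 < M by rewrite mulr_gt0 ?powR_gt0.
have unit x : \sum_i lnorm l2 r (fun a => x a i) `^ p <= 1 -> \sum_i lnorm l2 r (fun a => mapply (W a) (x a) i) `^ p <= M `^ p.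
  move=> x1; set V := \sum_i _.
  have V0 : 0 <= V by rewrite sumr_ge0// => i _; exact: powR_ge0.
  have [Vz|Vnz] := eqVneq V 0; first by rewrite Vz powR_ge0.
  have Vp : 0 < V by rewrite lt0r Vnz.
  pose v i := lnorm l2 r (fun a => mapply (W a) (x a) i).
  have v0 i : 0 <= v i by exact: lnorm_ge0.
  pose cj (z : C) : C := (complex.Re z -i* complex.Im z)%C.
  have cjM (z : C) : z * cj z = (normc z ^+ 2)%:C%C.
    by rewrite normc_sqr /cj; case: z => a b; apply/eqP; rewrite eq_complex/=; apply/andP; split; apply/eqP; ring.
  pose y a i := (v i `^ (p - 2) * V `^ (- p'^-1))%:C%C * cj (mapply (W a) (x a) i).
  have yn i : lnorm l2 r (fun a => y a i) = v i `^ (p - 2) * V `^ (- p'^-1) * v i.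
    rewrite lnormZ normc_real ger0_norm ?mulr_ge0 ?powR_ge0//; congr (_ * _).
    by rewrite /v /lnorm; apply: eq_enorm => a; rewrite normc_conj.
  have vp i : v i `^ (p - 2) * v i ^+ 2 = v i `^ p.
    have [vz|vnz] := eqVneq (v i) 0; first by rewrite vz expr0n mulr0 powR0// gt_eqF.
    by rewrite -powR_mulrn// -powRD ?subrK// vnz implybT.
  have y1 : \sum_i lnorm l2 r (fun a => y a i) `^ p' <= 1.
    have E i : lnorm l2 r (fun a => y a i) `^ p' = v i `^ p * V^-1.
      rewrite yn.
      have -> : v i `^ (p - 2) * V `^ (- p'^-1) * v i = v i `^ (p - 1) * V `^ (- p'^-1).
        have [vz|vnz] := eqVneq (v i) 0; first by rewrite vz mulr0 powR0 ?mul0r// subr_eq0 gt_eqF.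
        rewrite mulrAC -{2}(powRr1 (v0 i)) -powRD ?vnz ?implybT//; congr (_ `^ _ * _); ring.
      rewrite powRM ?powR_ge0// -!powRrM mulNr mulVf ?gt_eqF// powR_inv1//; congr (_ `^ _ * _).
      by rewrite /p' mulrC divfK// subr_eq0 gt_eqF.
    by under eq_bigr do rewrite E; rewrite -mulr_suml divff.
  have := riesz_thorin_bilinear p1 pp th01 q2 thE eps0 B0 Heps HB x1 y1; rewrite -/M.
  have -> : \sum_(a <- r) \sum_i mapply (W a) (x a) i * y a i = (V `^ p^-1)%:C%C.
    rewrite exchange_big/=.
    transitivity (\sum_i ((v i `^ p * V `^ (- p'^-1))%:C%C : C)).
      apply: eq_bigr => i _; rewrite -vp.
      transitivity ((v i `^ (p - 2) * V `^ (- p'^-1))%:C%C * \sum_(a <- r) mapply (W a) (x a) i * cj (mapply (W a) (x a) i)).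
        by rewrite mulr_sumr; apply: eq_bigr => a _; rewrite /y; ring.
      under eq_bigr do rewrite cjM.
      rewrite -rmorph_sum -rmorphM; congr (_%:C)%C; rewrite -sqr_enorm -/(lnorm l2 r _) -/(v i); ring.
    rewrite -rmorph_sum -mulr_suml; congr (_%:C)%C; rewrite -/V -{1}(powRr1 V0) -powRD; last by rewrite Vnz implybT.
    by congr (_ `^ _); rewrite -pp; ring.
  rewrite normc_real ger0_norm ?powR_ge0// => h.
  by rewrite -[leLHS](@powRK p^-1) ?invr_neq0 ?gt_eqF// invrK; apply: powR_le; rewrite ?powR_ge0// ltW.
move=> x; set X := \sum_i lnorm l2 r (fun a => x a i) `^ p.
have X0 : 0 <= X by rewrite sumr_ge0// => i _; exact: powR_ge0.
have [Xz|Xnz] := eqVneq X 0.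
  have xz a i : a \in r -> x a i = 0.
    move=> ar; apply: (@lnorm_eq0 A r (fun a => x a i)) => //; apply/eqP.
    have := eqxx X; rewrite {2}Xz /X psumr_eq0; last by move=> *; exact: powR_ge0.
    by move=> /allP/(_ i); rewrite mem_index_enum => /(_ isT)/implyP/(_ isT); rewrite powR_eq0 => /andP[].
  rewrite Xz mulr0 big1// => i _; rewrite (@eq_lnorm_in _ _ _ _ _ (fun _ => 0)) ?lnorm0 ?powR0 ?gt_eqF// => a ar.
  by rewrite /mapply big1// => j _; rewrite xz// mulr0.
have Xp : 0 < X by rewrite lt0r Xnz.
pose c : R := X `^ (- p^-1); have c0 : 0 < c by exact: powR_gt0.
have cp : c `^ p = X^-1 by rewrite -powRrM mulNr mulVf ?gt_eqF// powR_inv1.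
have sc (f : 'I_n.+1 -> A -> C) : \sum_i lnorm l2 r (fun a => c%:C%C * f i a) `^ p = X^-1 * \sum_i lnorm l2 r (f i) `^ p.
  rewrite mulr_sumr; apply: eq_bigr => i _; rewrite lnormZ normc_real ger0_norm ?(ltW c0)//.
  by rewrite powRM ?lnorm_ge0 ?(ltW c0)// cp.
have := unit (fun a i => c%:C%C * x a i); rewrite (sc (fun i a => x a i)) mulVf// lexx => /(_ isT).
have -> : \sum_i lnorm l2 r (fun a => mapply (W a) (fun i => c%:C%C * x a i) i) `^ p =
   \sum_i lnorm l2 r (fun a => c%:C%C * mapply (W a) (x a) i) `^ p.
  apply: eq_bigr => i _; congr (_ `^ _); apply: eq_lnorm => a.
  by rewrite /mapply mulr_sumr; apply: eq_bigr => j _; ring.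
by rewrite (sc (fun i a => mapply (W a) (x a) i)) ler_pdivrMl// mulrC.
Qed.

End RieszThorin.

(** * Operator and mixed norms of polynomials *)

Section PolyOperator.
Context {d : measure_display} {Omega : measurableType d} {R : realType}.
Variable mu : {measure set Omega -> \bar R}.
Variable p : R.
Hypothesis p1 : 1 < p.
Notation C := R[i].
Notation Lp := (inLp mu p).
Notation cn := (cn mu p).
Notation mn := (mn mu p).
Variable T : (Omega -> C) -> Omega -> C.
Hypothesis bT : bounded_operator_Lp mu p T.
Hypothesis rT : contractively_regular mu p T.

Let p0 : 0 < p. Proof. exact: lt_trans p1. Qed.

Lemma opow_ae n x y : Lp x -> Lp y -> ae_eqC mu x y -> ae_eqC mu (opow T n x) (opow T n y).
Proof. by move=> Lx Ly xy; elim: n => //= n IH; apply: (T_ae bT) => //; apply: (opow_Lp bT). Qed.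

Lemma opow_lin n (a : C) x y : Lp x -> Lp y ->
  ae_eqC mu (opow T n (fun w => a * x w + y w)) (fun w => a * opow T n x w + opow T n y w).
Proof.
move=> Lx Ly; elim: n => [|n IH] /=; first exact: aeC_refl.
have Lxn : Lp (opow T n x) by exact: (opow_Lp bT).
have Lyn : Lp (opow T n y) by exact: (opow_Lp bT).
have [Lxy _] := inLp_lin p1 a Lx Ly; have [Lxyn _] := inLp_lin p1 a Lxn Lyn.
apply: aeC_trans (T_ae bT _ Lxyn IH) (T_lin bT a Lxn Lyn).
exact: (opow_Lp bT).
Qed.

Lemma aeC_sum (I : Type) (r : seq I) (c : I -> C) (x y : I -> Omega -> C) : (forall i, ae_eqC mu (x i) (y i)) ->
  ae_eqC mu (fun w => \sum_(i <- r) c i * x i w) (fun w => \sum_(i <- r) c i * y i w).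
Proof.
move=> xy; elim: r => [|i r IH].
  by apply: aeW => w _; rewrite !big_nil.
by apply: filterS2 (xy i) IH => w h1 h2 I0; rewrite !big_cons h1// h2.
Qed.

Lemma polyT_wide (q : {poly C}) x w m : (size q <= m)%N -> polyT q T x w = \sum_(i < m) q`_i * opow T i x w.
Proof.
move=> qm; rewrite /polyT (big_ord_widen m (fun i => q`_i * opow T i x w))// [RHS](bigID (fun i : 'I_m => (i < size q)%N))/=.
rewrite [X in _ = _ + X]big1 ?addr0// => i; rewrite -leqNgt => h.
by rewrite nth_default// mul0r.
Qed.

Lemma polyTD (q q' : {poly C}) x w : polyT (q + q') T x w = polyT q T x w + polyT q' T x w.
Proof.
have h1 : (size q <= maxn (size q) (size q'))%N by exact: leq_maxl.
have h2 : (size q' <= maxn (size q) (size q'))%N by exact: leq_maxr.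
rewrite (polyT_wide _ _ (size_polyD q q')) (polyT_wide _ _ h1) (polyT_wide _ _ h2) -big_split/=.
by apply: eq_bigr => i _; rewrite coefD mulrDl.
Qed.

Lemma polyTZ (a : C) q x w : polyT (a *: q) T x w = a * polyT q T x w.
Proof.
rewrite (polyT_wide _ _ (size_scale_leq a q)) /polyT mulr_sumr.
by apply: eq_bigr => i _; rewrite coefZ mulrA.
Qed.

Lemma polyTN q x w : polyT (- q) T x w = - polyT q T x w.
Proof. by rewrite -scaleN1r polyTZ mulN1r. Qed.

Lemma polyT0 x w : polyT 0 T x w = 0.
Proof. by rewrite /polyT size_poly0 big_ord0. Qed.

Lemma polyT_sum (I : Type) (r : seq I) (q : I -> {poly C}) x w :
  polyT (\sum_(i <- r) q i) T x w = \sum_(i <- r) polyT (q i) T x w.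
Proof. by elim: r => [|i r IH]; rewrite ?big_nil ?polyT0// !big_cons polyTD IH. Qed.

Lemma polyTXn n x w : polyT 'X^n T x w = opow T n x w.
Proof.
rewrite /polyT size_polyXn (bigD1 ord_max)//= coefXn eqxx mul1r big1 ?addr0// => i im.
by rewrite coefXn (_ : (i == n :> nat) = false) ?mul0r//; apply: contraNF im => /eqP ii; apply/eqP/val_inj.
Qed.

Lemma polyT1 x w : polyT 1 T x w = x w.
Proof. by rewrite -(expr0 'X) polyTXn. Qed.

Lemma pT_Lp q x : Lp x -> Lp (polyT q T x).
Proof. exact: (polyT_Lp p1 bT). Qed.

Lemma polyTE q : polyT q T = fun x w => \sum_(i <- index_enum 'I_(size q)) q`_i * opow T i x w.
Proof. by []. Qed.

Lemma polyT_ae q x y : Lp x -> Lp y -> ae_eqC mu x y -> ae_eqC mu (polyT q T x) (polyT q T y).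
Proof. by move=> Lx Ly xy; rewrite polyTE; apply: aeC_sum => i; exact: opow_ae. Qed.

Lemma polyT_lin q (a : C) x y : Lp x -> Lp y ->
  ae_eqC mu (polyT q T (fun w => a * x w + y w)) (fun w => a * polyT q T x w + polyT q T y w).
Proof.
move=> Lx Ly; apply: aeC_trans (aeC_sum _ _ (fun i : 'I_(size q) => opow_lin i a Lx Ly)) _.
apply: aeW => w _; rewrite /polyT mulr_sumr -big_split/=; apply: eq_bigr => i _; ring.
Qed.

Lemma polyT_bounded q : bounded_operator_Lp mu p (polyT q T).
Proof.
split; first by move=> x; exact: pT_Lp.
split; first by move=> x y; exact: polyT_ae.
split; first by move=> a x y; exact: polyT_lin.
exists (\sum_(i < size q) normc q`_i) => x Lx.
rewrite !(cLnormE p1)//; last exact: pT_Lp.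
rewrite -EFinM lee_fin.
apply: (le_trans (inLp_sum p1 (index_enum 'I_(size q)) (fun i => (inLpZ p1 (q`_i) (opow_Lp bT i Lx)).1)).2).
rewrite mulr_suml; apply: ler_sum => i _; rewrite (inLpZ p1 (q`_i) (opow_Lp bT i Lx)).2.
by rewrite ler_wpM2l ?normc_ge0//; exact: (opow_contraction p1 bT rT).
Qed.

(** T is linear only up to null sets, so the functional calculus is multiplicative only almost
    everywhere; multiplication by a power of X comes first, by induction. *)
Lemma polyTM q q' x : Lp x -> ae_eqC mu (polyT (q * q') T x) (polyT q T (polyT q' T x)).
Proof.
move=> Lx.
have H n : ae_eqC mu (opow T n (polyT q' T x)) (polyT ('X^n * q') T x).
  elim: n => [|n IH] /=.
    by apply: aeW => w _; rewrite expr0 mul1r.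
  have Lq : Lp (polyT q' T x) by exact: pT_Lp.
  have E : ae_eqC mu (opow T n.+1 (polyT q' T x)) (T (polyT ('X^n * q') T x)).
    by apply: (T_ae bT) IH; [exact: (opow_Lp bT)|exact: pT_Lp].
  apply: aeC_trans E _.
  have := T_sum p1 bT (index_enum 'I_(size ('X^n * q'))) (fun i => ('X^n * q')`_i) (fun i => opow_Lp bT i Lx).
  move=> /aeC_trans; apply; apply: aeW => w _.
  have sz : leq (size ('X^(n.+1) * q')) (size ('X^n * q')).+1.
    by rewrite exprS -mulrA mulrC; apply: (leq_trans (size_polyMleq _ _)); rewrite size_polyX addn2.
  rewrite (polyT_wide _ _ sz) big_ord_recl /= exprS -mulrA coefXM eqxx mul0r add0r.
  by apply: eq_bigr => i _; rewrite coefXM.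
apply: aeC_sym; rewrite polyTE; apply: aeC_trans (aeC_sum _ _ (fun i : 'I_(size q) => H i)) _.
apply: aeW => w _; rewrite -[in RHS](coefK q) poly_def mulr_suml polyT_sum.
by apply: eq_bigr => i _; rewrite -scalerAl polyTZ.
Qed.

Definition opn q : R := inf [set c : R | 0 <= c /\ forall x, Lp x -> cn (polyT q T x) <= c * cn x].

Lemma opn_has_inf q : has_inf [set c : R | 0 <= c /\ forall x, Lp x -> cn (polyT q T x) <= c * cn x].
Proof.
split; last by exists 0 => c [].
exists (\sum_(i < size q) normc q`_i); split; first by rewrite sumr_ge0// => i _; exact: normc_ge0.
move=> x Lx; apply: (le_trans (inLp_sum p1 (index_enum 'I_(size q)) (fun i => (inLpZ p1 (q`_i) (opow_Lp bT i Lx)).1)).2).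
rewrite mulr_suml; apply: ler_sum => i _; rewrite (inLpZ p1 (q`_i) (opow_Lp bT i Lx)).2.
by rewrite ler_wpM2l ?normc_ge0//; exact: (opow_contraction p1 bT rT).
Qed.

Lemma opn_ge0 q : 0 <= opn q.
Proof. by apply: lb_le_inf; [case: (opn_has_inf q)|move=> c []]. Qed.

Lemma opn_le q c : 0 <= c -> (forall x, Lp x -> cn (polyT q T x) <= c * cn x) -> opn q <= c.
Proof. by move=> c0 H; apply: ge_inf; [case: (opn_has_inf q)|split]. Qed.

Lemma opnP q x : Lp x -> cn (polyT q T x) <= opn q * cn x.
Proof.
move=> Lx; have [[c [c0 Hc]] _] := opn_has_inf q.
have := cn_ge0 mu p x; rewrite le_eqVlt => /predU1P[e|x0].
  by have := Hc x Lx; rewrite -e !mulr0.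
rewrite -ler_pdivrMr//; apply: lb_le_inf; first by case: (opn_has_inf q).
by move=> b [b0 Hb]; rewrite ler_pdivrMr//; exact: Hb.
Qed.

Lemma cn_aeP x y : Lp x -> Lp y -> ae_eqC mu x y -> cn x = cn y.
Proof. by move=> /(inLpP mu p1)[mx _] Ly xy; have [] := cn_ae p1 mx Ly xy. Qed.

Lemma opnD q q' : opn (q + q') <= opn q + opn q'.
Proof.
apply: opn_le; first by rewrite addr_ge0// opn_ge0.
move=> x Lx; rewrite (_ : polyT (q + q') T x = fun w => polyT q T x w + polyT q' T x w); last by apply/funext => w; rewrite polyTD.
apply: (le_trans (inLpD p1 (pT_Lp q Lx) (pT_Lp q' Lx)).2); rewrite mulrDl.
by apply: lerD; exact: opnP.
Qed.

Lemma opnM q q' : opn (q * q') <= opn q * opn q'.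
Proof.
apply: opn_le; first by rewrite mulr_ge0// opn_ge0.
move=> x Lx; rewrite (cn_aeP (pT_Lp _ Lx) (pT_Lp q (pT_Lp q' Lx)) (polyTM q q' Lx)).
by apply: (le_trans (opnP q (pT_Lp q' Lx))); rewrite -mulrA ler_wpM2l ?opn_ge0//; exact: opnP.
Qed.

Lemma opnZ (a : C) q : opn (a *: q) <= normc a * opn q.
Proof.
apply: opn_le; first by rewrite mulr_ge0 ?opn_ge0 ?normc_ge0.
move=> x Lx; rewrite (_ : polyT (a *: q) T x = fun w => a * polyT q T x w); last by apply/funext => w; rewrite polyTZ.
by rewrite (inLpZ p1 a (pT_Lp q Lx)).2 -mulrA ler_wpM2l ?normc_ge0//; exact: opnP.
Qed.

Lemma opnXn n : opn 'X^n <= 1.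
Proof.
apply: opn_le => // x Lx; rewrite mul1r (_ : polyT 'X^n T x = opow T n x); first exact: (opow_contraction p1 bT rT).
by apply/funext => w; rewrite polyTXn.
Qed.

(** Boundedness of the diagonal operator with entries u_a(T) on L^p(l^q). For q = [l2], with
    repetitions of a polynomial allowed, this is R-boundedness. *)
Definition Qb q (A : Type) (r : seq A) (u : A -> {poly C}) (c : R) :=
  forall x : A -> Omega -> C, (forall a, Lp (x a)) -> mn q r (fun a => polyT (u a) T (x a)) <= c * mn q r x.

Lemma QbD q (A : Type) (r : seq A) u v b c : Qb q r u b -> Qb q r v c -> Qb q r (fun a => u a + v a) (b + c).
Proof.
move=> Hu Hv x Lx; rewrite (_ : (fun a => _) = fun a w => polyT (u a) T (x a) w + polyT (v a) T (x a) w); last first.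
  by apply/funext => a; apply/funext => w; rewrite polyTD.
apply: (le_trans (mnD p1 q r (fun a => pT_Lp (u a) (Lx a)) (fun a => pT_Lp (v a) (Lx a)))).
by rewrite mulrDl lerD//; [exact: Hu|exact: Hv].
Qed.

Lemma QbM q (A : Type) (r : seq A) u v b c : 0 <= b -> Qb q r u b -> Qb q r v c -> Qb q r (fun a => u a * v a) (b * c).
Proof.
move=> b0 Hu Hv x Lx.
rewrite (mn_ae p1 q r (fun a => pT_Lp _ (Lx a)) (fun a => pT_Lp (u a) (pT_Lp (v a) (Lx a))) (fun a => polyTM (u a) (v a) (Lx a))).
apply: (le_trans (Hu _ (fun a => pT_Lp (v a) (Lx a)))); rewrite -mulrA ler_wpM2l//; exact: Hv.
Qed.

Lemma mn_homo q (A : eqType) (r : seq A) (x y : A -> Omega -> C) : (forall a, Lp (x a)) -> (forall a, Lp (y a)) ->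
  (forall a w, a \in r -> normc (x a w) <= normc (y a w)) -> mn q r x <= mn q r y.
Proof.
move=> Lx Ly xy; have [[mx _] _] := rLp_mixed p1 q r Lx; have [Ly' _] := rLp_mixed p1 q r Ly.
apply: (nm_le p1 mx Ly') => w; rewrite !ger0_norm ?lnorm_ge0// /mixed.
pose y' a := if a \in r then y a w else x a w.
rewrite (@eq_lnorm_in _ _ _ _ (y^~ w) y'); last by move=> a ar; rewrite /y' ar.
by apply: le_lnorm => a; rewrite /y'; case: ifP => // ar; exact: xy.
Qed.

Lemma Qb_scale q (A : eqType) (r : seq A) u (z : A -> C) b c : 0 <= b -> (forall a, a \in r -> normc (z a) <= b) ->
  Qb q r u c -> Qb q r (fun a => z a *: u a) (b * c).
Proof.
move=> b0 zb Hu x Lx.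
have L1 a : Lp (fun w => b%:C%C * polyT (u a) T (x a) w) by exact: (inLpZ p1 b%:C%C (pT_Lp (u a) (Lx a))).1.
apply: (@le_trans _ _ (mn q r (fun a w => b%:C%C * polyT (u a) T (x a) w))).
  apply: mn_homo => // [a|a w ar]; first exact: pT_Lp.
  by rewrite polyTZ !normcM normc_real ger0_norm// ler_wpM2r ?normc_ge0//; exact: zb.
rewrite (mnZ p1 q r b%:C%C (fun a => pT_Lp (u a) (Lx a))) normc_real ger0_norm// -mulrA ler_wpM2l//; exact: Hu.
Qed.

Lemma Qb_le q (A : Type) (r : seq A) u b c : b <= c -> Qb q r u b -> Qb q r u c.
Proof. by move=> bc Hu x Lx; apply: (le_trans (Hu x Lx)); rewrite ler_wpM2r// mn_ge0. Qed.

Lemma Qb_single q (A : Type) (a : A) u c : 0 <= c -> Qb q [:: a] u c -> opn (u a) <= c.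
Proof. by move=> c0 H; apply: opn_le => // x Lx; have := H (fun _ => x) (fun _ => Lx); rewrite !mn_seq1. Qed.

(** Riesz-Thorin is available for matrices only, so the x_a and u_a(T) x_a are discretised on a
    common partition and each u_a(T) is compressed to it, which preserves both bounds. The loss is
    at most (1 + eps) e / N for each index. *)
Lemma interpolation q th eps B (A : eqType) (r : seq A) (u : A -> {poly C}) :
  0 <= th <= 1 -> q <> l2 -> 2 / p * (1 - th) + (if q is l1 then 2 else 0) * th = 1 -> 0 < eps -> 0 < B ->
  (forall a, a \in r -> opn (u a) <= eps) -> Qb q r u B -> Qb l2 r u (eps `^ (1 - th) * B `^ th).
Proof.
move=> th01 q2 thE eps0 B0 Hop HB x Lx; set M := eps `^ (1 - th) * B `^ th.
have M0 : 0 < M by rewrite mulr_gt0 ?powR_gt0.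
apply/ler_addgt0Pr => e e0.
pose N := 1 + (size r)%:R * (1 + eps).
have N0 : 0 < N by rewrite ltr_pwDl// mulr_ge0// addr_ge0// ltW.
pose g a := polyT (u a) T (x a).
have Lg a : Lp (g a) by exact: pT_Lp.
have eN : 0 < e / N by rewrite divr_gt0.
have Lgs f : List.In f ([seq x a | a <- r] ++ [seq g a | a <- r]) -> Lp f.
  by move=> /List_In_mem; rewrite mem_cat => /orP[] /mapP[a _ ->].
have [n [As [mA fA dA HA]]] := discretize p1 eN Lgs.
pose D i f := cell_coef mu p As i f; pose ev := cell_vec mu p As.
have Le j : Lp (ev j) by exact: (cell_vec_Lp p1 mA fA).
pose P f w := \sum_i D i f * ev i w.
have LP f : Lp (P f) by exact: (Lp_lincomb p1).
pose W a := compress mu p (polyT (u a) T) As.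
have WE a y i : mapply (W a) y i = D i (polyT (u a) T (fun w => \sum_j y j * ev j w)).
  exact: (compressE p1 (polyT_bounded (u a)) mA fA).
have Lsyn y : Lp (fun w => \sum_j y j * ev j w) by exact: (Lp_lincomb p1).
have H1 a y : a \in r -> \sum_i normc (mapply (W a) y i) `^ p <= eps `^ p * \sum_i normc (y i) `^ p.
  move=> ar; rewrite -!(lpn_pow p1) -powRM ?lpn_ge0 ?(ltW eps0)//; apply: powR_le; [exact: ltW|exact: lpn_ge0|].
  rewrite (_ : (fun i => normc (mapply (W a) y i)) = fun i => normc (D i (polyT (u a) T (fun w => \sum_j y j * ev j w)))); last first.
    by apply/funext => i; rewrite WE.
  apply: (le_trans (lpn_cell_coef p1 mA fA dA (pT_Lp (u a) (Lsyn y)))).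
  apply: (le_trans (opnP (u a) (Lsyn y))).
  apply: ler_pM; rewrite ?opn_ge0 ?cn_ge0//; first exact: Hop.
  exact: (cn_cell_vec p1 mA fA dA).
have H2 (y : A -> 'I_n.+1 -> C) : \sum_i lnorm q r (fun a => mapply (W a) (y a) i) `^ p
      <= B `^ p * \sum_i lnorm q r (fun a => y a i) `^ p.
  have h1 := cell_analysis p1 mA fA dA q r (fun a => pT_Lp (u a) (Lsyn (y a))).
  rewrite (eq_bigr (fun i => lnorm q r (fun b => cell_coef mu p As i (polyT (u b) T (fun w => \sum_j y b j * ev j w))) `^ p)); last first.
    by move=> i _; congr (_ `^ _); apply: eq_lnorm => a; rewrite WE.
  apply: (le_trans h1); have h2 := HB _ (fun a => Lsyn (y a)).
  have h3 := cell_synthesis p1 mA fA dA q r (fun i a => y a i).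
  apply: (@le_trans _ _ ((B * mn q r (fun a w => \sum_j y a j * ev j w)) `^ p)).
    by apply: powR_le; [exact: ltW|exact: mn_ge0|].
  by rewrite powRM ?mn_ge0 ?(ltW B0)// ler_wpM2l ?powR_ge0.
have RT := riesz_thorin p1 th01 q2 thE eps0 B0 H1 H2 (fun a i => D i (x a)); rewrite -/M in RT.
pose main a w := \sum_i mapply (W a) (fun i => D i (x a)) i * ev i w.
have Lm a : Lp (main a) by exact: (Lp_lincomb p1).
pose diff a w := g a w - main a w.
have Ld a : Lp (diff a).
  by have := (inLp_lin p1 (-1) (Lm a) (Lg a)).1; congr (inLp _ _ _); apply/funext => w; rewrite /diff; ring.
have -> : (fun a => polyT (u a) T (x a)) = fun a w => main a w + diff a w.
  by apply/funext => a; apply/funext => w; rewrite /diff /g; ring.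
apply: (le_trans (mnD p1 l2 r Lm Ld)); apply: lerD.
  have h1 := cell_synthesis p1 mA fA dA l2 r (fun i a => mapply (W a) (fun i => D i (x a)) i).
  have h3 := cell_analysis p1 mA fA dA l2 r Lx.
  have := le_trans h1 (le_trans RT (ler_wpM2l (powR_ge0 M p) h3)).
  rewrite -powRM ?mn_ge0 ?(ltW M0)// => h.
  have M1 : 0 <= M * mn l2 r x by rewrite mulr_ge0 ?mn_ge0// ltW.
  have := powR_root p0 (mn_ge0 mu p l2 r main) (powR_ge0 _ _) h.
  by rewrite powRK// gt_eqF.
apply: (le_trans (rLp_mixed p1 l2 r Ld).2).
apply: (@le_trans _ _ (\sum_(a <- r) (1 + eps) * (e / N))); last first.
  rewrite big_const_seq count_predT iter_addr_0 -mulr_natl mulrA mulrCA -[leRHS]mulr1 ler_wpM2l ?(ltW e0)//.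
  by rewrite ler_pdivrMr// mul1r /N lerDr.
rewrite big_seq [leRHS]big_seq; apply: ler_sum => a ar.
have hx : cn (fun w => x a w - P (x a) w) <= e / N.
  by apply: HA; apply/List_In_mem; rewrite mem_cat map_f.
have hg : cn (fun w => g a w - P (g a) w) <= e / N.
  by apply: HA; apply/List_In_mem; rewrite mem_cat map_f ?orbT.
have Lx' : Lp (fun w => x a w - P (x a) w).
  by have := (inLp_lin p1 (-1) (LP (x a)) (Lx a)).1; congr (inLp _ _ _); apply/funext => w; ring.
have Lg' : Lp (fun w => g a w - P (g a) w).
  by have := (inLp_lin p1 (-1) (LP (g a)) (Lg a)).1; congr (inLp _ _ _); apply/funext => w; ring.
pose z := polyT (u a) T (fun w => x a w - P (x a) w).
have Lz : Lp z by exact: pT_Lp.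
have E : diff a = fun w => (g a w - P (g a) w) + P z w.
  apply/funext => w; rewrite /diff /main.
  have -> : P z w = P (g a) w - \sum_i mapply (W a) (fun i => D i (x a)) i * ev i w; last by ring.
  rewrite /P -sumrB; apply: eq_bigr => i _; rewrite WE -mulrBl; congr (_ * _).
  have -> : D i (g a) - D i (polyT (u a) T (fun w => \sum_j D j (x a) * ev j w)) =
     D i (fun w => -1 * polyT (u a) T (P (x a)) w + g a w).
    by rewrite /D (cell_coef_lin p1 mA fA)//; [ring|exact: pT_Lp].
  apply: (cell_coef_ae p1 mA) => //.
    by have [] := inLp_lin p1 (-1) (pT_Lp (u a) (LP (x a))) (Lg a).
  rewrite /z (_ : (fun w => x a w - P (x a) w) = fun w => -1 * P (x a) w + x a w); last by apply/funext => w'; ring.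
  exact: polyT_lin.
rewrite E; apply: (le_trans (inLpD p1 Lg' (LP z)).2).
rewrite mulrDl mul1r; apply: lerD; first exact: hg.
apply: (le_trans (proj_contraction p1 mA fA dA Lz).2).
apply: (le_trans (opnP (u a) Lx')); apply: ler_pM; rewrite ?opn_ge0 ?cn_ge0//; exact: Hop.
Qed.

End PolyOperator.

(** * Resolvents *)

Section Resolvents.
Context {R : realType}.
Notation C := R[i].

(** All that the resolvent and contour arguments need of the operator norm: a submultiplicative
    seminorm on polynomials, at most 1 on the powers of X. *)
Definition alg_seminorm (N : {poly C} -> R) := [/\ forall q, 0 <= N q,
  forall q q', N (q + q') <= N q + N q', forall q q', N (q * q') <= N q * N q',
  forall a q, N (a *: q) <= normc a * N q & forall n, N 'X^n <= 1].

Variable N : {poly C} -> R.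
Hypothesis NS : alg_seminorm N.

Lemma N_ge0 q : 0 <= N q. Proof. by case: NS => + _ _ _ _; exact. Qed.
Lemma ND q q' : N (q + q') <= N q + N q'. Proof. by case: NS => _ + _ _ _; exact. Qed.
Lemma NM q q' : N (q * q') <= N q * N q'. Proof. by case: NS => _ _ + _ _; exact. Qed.
Lemma NZ a q : N (a *: q) <= normc a * N q. Proof. by case: NS => _ _ _ + _; exact. Qed.
Lemma NX n : N 'X^n <= 1. Proof. by case: NS => _ _ _ _; exact. Qed.

Lemma N1 : N 1 <= 1. Proof. by rewrite -(expr0 'X) NX. Qed.

Lemma N_0 : N 0 = 0.
Proof. by apply/eqP; rewrite eq_le N_ge0 -(scale0r 0) andbT; apply: (le_trans (NZ _ _)); rewrite normc0 mul0r. Qed.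

Lemma NN q : N (- q) <= N q.
Proof. by rewrite -scaleN1r; apply: (le_trans (NZ _ _)); rewrite normcN' normc1 mul1r. Qed.

Lemma NB q q' : N (q - q') <= N q + N q'.
Proof. by apply: (le_trans (ND _ _)); rewrite lerD2l NN. Qed.

Lemma N_sum (I : Type) (r : seq I) (P : pred I) (q : I -> {poly C}) :
  N (\sum_(i <- r | P i) q i) <= \sum_(i <- r | P i) N (q i).
Proof.
elim/big_rec2: _ => [|i a b _ h]; first by rewrite N_0.
by apply: (le_trans (ND _ _)); rewrite lerD2l.
Qed.

Lemma N_pow q n : N (q ^+ n) <= N q ^+ n.
Proof.
elim: n => [|n IH]; first by rewrite !expr0 N1.
by rewrite !exprS; apply: (le_trans (NM _ _)); rewrite ler_wpM2l ?N_ge0.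
Qed.

(** The truncated Neumann series of the resolvent at l; by [resE] it misses the inverse of l - X by
    the single term l^-L X^L. *)
Definition res (l : C) L : {poly C} := \sum_(n < L) l^-1 ^+ n.+1 *: 'X^n.

Lemma resE l L : l != 0 -> (l%:P - 'X) * res l L = 1 - l^-1 ^+ L *: 'X^L.
Proof.
move=> l0; rewrite /res; elim: L => [|L IH]; first by rewrite big_ord0 mulr0 !expr0 scale1r subrr.
rewrite big_ord_recr/= mulrDr IH mulrBl mul_polyC scalerA exprS mulrA divff// mul1r -scalerAr -exprS.
by rewrite -exprS addrA addrNK.
Qed.

Lemma normc_unit_ge1 (l : C) : 1 <= normc l -> l != 0.
Proof. by move=> h; apply/eqP => l0; move: h; rewrite l0 normc0 ler10. Qed.

Lemma normc_inv_exp (l : C) n : normc (l^-1 ^+ n) = (normc l)^-1 ^+ n.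
Proof.
elim: n => [|n IH]; first by rewrite !expr0 normc1.
by rewrite !exprS normcM normcV IH.
Qed.

Lemma N_res_part l m n : 1 <= normc l -> N (\sum_(m <= k < m + n) l^-1 ^+ k.+1 *: 'X^k) <= n%:R.
Proof.
move=> l1; apply: (le_trans (N_sum _ _ _)); apply: (@le_trans _ _ (\sum_(m <= k < m + n) 1)).
  apply: ler_sum => k _; apply: (le_trans (NZ _ _)); rewrite -[leRHS]mulr1 ler_pM ?N_ge0 ?normc_ge0 ?NX//.
  by rewrite normc_inv_exp exprn_ile1 ?invr_ge0 ?normc_ge0// invf_le1// (lt_le_trans ltr01).
by rewrite big_const_nat iter_addr_0 addKn.
Qed.

Variable K : R.
Hypothesis NK : forall n, n.+1%:R * N ('X^(n.+1) - 'X^n) <= K.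

Lemma K_ge0 : 0 <= K.
Proof. by apply: le_trans (NK 0); rewrite mulr_ge0 ?N_ge0. Qed.

(* Multiplying the sum by X^M costs little since (l - 1) X^M r = X^M (l - X) r + X^M (X - 1) r, where the
   last term is at most K / (M + 1) N r and is absorbed for M of the order of K / |l - 1|. *)
Lemma N_res l L : 1 <= normc l -> l != 1 -> normc (l - 1) * N (res l L) <= 8 * K + 4.
Proof.
move=> l1 ln1; have l0 := normc_unit_ge1 l1.
have d0 : 0 < normc (l - 1).
  by rewrite lt_neqAle normc_ge0 eq_sym andbT; apply: contra ln1 => /eqP/eq0_normc/subr0_eq ->.
set d := normc (l - 1); have K0 := K_ge0.
pose M := Num.truncn (2 * K / d).
have /andP[M1 M2] : M%:R <= 2 * K / d < M.+1%:R by apply: truncn_itv; rewrite divr_ge0 ?mulr_ge0 ?(ltW d0).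
set r := res l L.
have rE : r = \sum_(0 <= k < 0 + M) l^-1 ^+ k.+1 *: 'X^k + l^-1 ^+ M *: ('X^M * r)
      - \sum_(L <= k < L + M) l^-1 ^+ k.+1 *: 'X^k.
  have -> : l^-1 ^+ M *: ('X^M * r) = \sum_(0 + M <= k < L + M) l^-1 ^+ k.+1 *: 'X^k.
    rewrite big_addn addnK big_mkord /r /res mulr_sumr scaler_sumr; apply: eq_bigr => k _.
    by rewrite -scalerAr scalerA -!exprD addnS addnC.
  rewrite add0n -big_cat_nat//=; last by rewrite leq_addl.
  by rewrite (@big_cat_nat _ _ _ L)//= ?leq_addr// addrK /r /res big_mkord.
have h1 : d * N ('X^M * r) <= 2 + K / M.+1%:R * N r.
  apply: (@le_trans _ _ (N ('X^M * (1 - l^-1 ^+ L *: 'X^L) + ('X^(M.+1) - 'X^M) * r))).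
    have -> : 'X^M * (1 - l^-1 ^+ L *: 'X^L) + ('X^(M.+1) - 'X^M) * r = (l - 1) *: ('X^M * r).
      by rewrite -(resE L l0) -/r -mul_polyC polyCB exprS; ring.
    have -> : 'X^M * r = (l - 1)^-1 *: ((l - 1) *: ('X^M * r)).
      by rewrite scalerA mulVf ?scale1r// subr_eq0.
    apply: (le_trans (ler_wpM2l (ltW d0) (NZ _ _))).
    by rewrite normcV scalerA mulfV ?scale1r ?subr_eq0// mulrA mulfV ?mul1r// gt_eqF.
  apply: (le_trans (ND _ _)); apply: lerD; last first.
    apply: (le_trans (NM _ _)); rewrite ler_wpM2r ?N_ge0// ler_pdivlMr ?ltr0Sn// mulrC; exact: NK.
  apply: (le_trans (NM _ _)); rewrite -[leRHS]mul1r ler_pM ?N_ge0 ?NX//.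
  apply: (le_trans (NB _ _)); apply: lerD; first exact: N1.
  apply: (le_trans (NZ _ _)); rewrite -[leRHS]mulr1 ler_pM ?N_ge0 ?normc_ge0 ?NX//.
  by rewrite normc_inv_exp exprn_ile1 ?invr_ge0 ?normc_ge0// invf_le1// (lt_le_trans ltr01).
have h2 : N r <= M%:R + N ('X^M * r) + M%:R.
  rewrite {1}rE; apply: (le_trans (NB _ _)); apply: lerD; last exact: N_res_part.
  apply: (le_trans (ND _ _)); apply: lerD; first exact: N_res_part.
  apply: (le_trans (NZ _ _)); rewrite ler_piMl ?N_ge0//.
  by rewrite normc_inv_exp exprn_ile1 ?invr_ge0 ?normc_ge0// invf_le1// (lt_le_trans ltr01).
have h3 : K / M.+1%:R <= d / 2.
  by move: M2; rewrite ltr_pdivrMr// ler_pdivrMr ?ltr0Sn// => h; nra.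
have h4 : M%:R * d <= 2 * K by rewrite -ler_pdivlMr.
(* Altogether d N(r) <= 2 M d + 2 + d N(r) / 2 with M d <= 2 K, which doubles to 8 K + 4. *)
move: (ler_wpM2r (N_ge0 r) h3) (ler_wpM2l (ltW d0) h2) h1 h4; rewrite -/d !mulrDr (mulrC M%:R) (mulrAC d).
set k := K / _ * _; set u := d * N ('X^M * r); set v := d * M%:R; set w := d * N r => h5 h6 h7 h8; lra.
Qed.

Lemma res_resolvent a b L : a != 0 -> b != 0 ->
  res a L - res b L = (b - a) *: (res a L * res b L) + res a L * (b^-1 ^+ L *: 'X^L) - res b L * (a^-1 ^+ L *: 'X^L).
Proof.
move=> a0 b0.
have -> : b^-1 ^+ L *: 'X^L = 1 - (b%:P - 'X) * res b L by rewrite resE//; ring.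
have -> : a^-1 ^+ L *: 'X^L = 1 - (a%:P - 'X) * res a L by rewrite resE//; ring.
rewrite -mul_polyC polyCB; ring.
Qed.

Lemma N_geom l e : 1 < normc l -> 0 < e -> exists L0, forall L, (L0 <= L)%N -> N (l^-1 ^+ L *: 'X^L) <= e.
Proof.
move=> l1 e0; have l0 : 0 < normc l by exact: lt_trans l1.
have l3 : `|(normc l)^-1| < 1 by rewrite ger0_norm ?invr_ge0 ?(ltW l0)// invf_lt1.
have /cvgrPdist_le/(_ e e0)[L0 _ H] := cvg_geometric 1 l3.
exists L0 => L /H; rewrite sub0r normrN /geometric/= mul1r ger0_norm ?exprn_ge0 ?invr_ge0 ?(ltW l0)// => h.
apply: (le_trans (NZ _ _)); rewrite -[leRHS]mulr1 ler_pM ?normc_ge0 ?N_ge0 ?NX//.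
by rewrite normc_inv_exp.
Qed.

End Resolvents.

(** * R-boundedness of (lambda - 1) (lambda - T)^-1 *)

Section RBoundedness.
Context {d : measure_display} {Omega : measurableType d} {R : realType}.
Variable mu : {measure set Omega -> \bar R}.
Variable p : R.
Hypothesis p1 : 1 < p.
Notation C := R[i].
Notation Lp := (inLp mu p).
Notation cn := (cn mu p).
Notation mn := (mn mu p).
Variable T : (Omega -> C) -> Omega -> C.
Hypothesis aT : analytic_operator mu p T.
Hypothesis rT : contractively_regular mu p T.
Notation N := (opn mu p T).
Notation Qb := (Qb mu p T).

Let p0 : 0 < p. Proof. exact: lt_trans p1. Qed.
Let bT : bounded_operator_Lp mu p T. Proof. by case: aT. Qed.

Lemma opn_seminorm : alg_seminorm N.
Proof.
split=> [q|q q'|q q'|a q|n]; [exact: opn_ge0|exact: (opnD p1 bT)|exact: (opnM p1 bT)|exact: (opnZ p1 bT)|exact: (opnXn p1 bT)].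
Qed.
Notation NS := opn_seminorm.

Lemma opn_analytic : exists K, forall n, n.+1%:R * N ('X^(n.+1) - 'X^n) <= K.
Proof.
case: aT => _ [_ [K HK]]; exists (Num.max K 0) => n.
rewrite mulrC -ler_pdivlMr//; apply: (opn_le p1 bT rT) => [|x Lx].
  by rewrite divr_ge0// le_max lexx orbT.
have := HK n.+1 x isT Lx; rewrite (cLnormE p1 Lx).
have E : polyT ('X^(n.+1) - 'X^n) T x = fun w => opow T n.+1 x w - opow T n x w.
  by apply/funext => w; rewrite polyTD polyTN !polyTXn.
have LE : Lp (fun w => opow T n.+1 x w - opow T n x w) by rewrite -E; exact: (pT_Lp p1 bT).
rewrite (cLnormE p1 LE) -!EFinM lee_fin E mulrAC ler_pdivlMr// mulrC => h.
by apply: (le_trans h); rewrite ler_wpM2r ?cn_ge0// le_max lexx.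
Qed.

Lemma Qb_sum q (A : Type) (r : seq A) n (u : nat -> A -> {poly C}) (c : nat -> R) :
  (forall k, (k < n)%N -> Qb q r (u k) (c k)) -> Qb q r (fun a => \sum_(k < n) u k a) (\sum_(k < n) c k).
Proof.
elim: n => [|n IH] H.
  move=> x Lx; rewrite big_ord0 mul0r (_ : (fun a => _) = fun a w => 0%:C%C * x a w); last first.
    by apply/funext => a; apply/funext => w; rewrite big_ord0 polyT0 mul0r.
  by rewrite (mnZ p1 q r 0%:C%C Lx) normc_real normr0 mul0r.
rewrite big_ord_recr/= (_ : (fun a => _) = fun a => \sum_(k < n) u k a + u n a); last first.
  by apply/funext => a; rewrite big_ord_recr.
by apply: (QbD p1 bT); [apply: IH => k kn; apply: H; exact: ltnW|exact: H].
Qed.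

Lemma Qb_pow q (A : Type) (r : seq A) (u : A -> {poly C}) c n : 0 <= c ->
  Qb q r u c -> Qb q r (fun a => u a ^+ n) (c ^+ n).
Proof.
move=> c0 Hu; elim: n => [|n IH].
  move=> x Lx; rewrite expr0 mul1r (_ : (fun a => _) = x)//.
  by apply/funext => a; apply/funext => w; rewrite expr0 polyT1.
rewrite exprS (_ : (fun a => _) = fun a => u a * u a ^+ n); last by apply/funext => a; rewrite exprS.
exact: (QbM p1 bT).
Qed.

(** Far enough outside the disc that the coefficients of the resolvent form a geometric kernel with
    eta = 2^-j |l - 1|; as j grows the point returns to l. *)
Definition push j (l : C) : C := l * (1 + 2^-1 ^+ j * normc (l - 1))%:C%C.

Lemma normc_push j l : normc (push j l) = normc l * (1 + 2^-1 ^+ j * normc (l - 1)).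
Proof. by rewrite normcM normc_real ger0_norm// addr_ge0// mulr_ge0 ?exprn_ge0 ?normc_ge0. Qed.

Lemma push_dist j l : 1 <= normc l -> normc (l - 1) <= normc (push j l - 1).
Proof.
move=> l1; rewrite /push; set t := 2^-1 ^+ j * normc (l - 1).
have t0 : 0 <= t by rewrite mulr_ge0 ?exprn_ge0 ?normc_ge0.
rewrite -(ler_pXn2r (ltn0Sn 1)) ?nnegrE ?normc_ge0// !normc_sqr.
have := normc_sqr l; case: l l1 @t t0 => a b l1 t t0 /=.
move=> e; rewrite !mulr0 !subr0 add0r; move: e.
rewrite -[Num.ExtraDef.sqrtr _]/(normc (a +i* b)%C) => e.
have a1 : a <= normc (a +i* b)%C.
  by rewrite (le_trans (ler_norm a))// -(sqrtr_sqr a) ler_wsqrtr// lerDl sqr_ge0.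
have : normc (a +i* b)%C <= normc (a +i* b)%C ^+ 2 by rewrite expr2 ler_peMl// normc_ge0.
move=> h; have h2 : a <= a ^+ 2 + b ^+ 2 by rewrite -e (le_trans a1).
have : 0 <= a ^+ 2 + b ^+ 2 - a by rewrite subr_ge0.
have : 0 <= a ^+ 2 + b ^+ 2 by rewrite -e exprn_ge0 ?normc_ge0.
by nra.
Qed.

(** The n-th coefficient is at most |l - 1| / (1 + eta)^(n+1) with eta = 2^-j |l - 1|, that is, 2^j
    times the normalised kernel of [geometric_kernel]. This normalisation is the origin of the
    growth 2^j. *)
Lemma geometric_res q : q <> l2 -> exists2 D : R, 0 < D &
  forall (A : finType) (r : seq A) (l : A -> C) j L, (forall a, l a != 1) -> (forall a, 1 <= normc (l a)) ->
  Qb q r (fun a => (normc (l a - 1))%:C%C *: res (push j (l a)) L) (D * 2 ^+ j).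
Proof.
move=> q2; have [D D0 HD] := geometric_kernel p1 q2; exists D => // A r l j L ln l1 x Lx.
have dl a : 0 < normc (l a - 1) by rewrite normc_gt0// subr_eq0.
pose c a := (normc (l a - 1))%:C%C *: res (push j (l a)) L.
have e0 a : 0 < 2^-1 ^+ j * normc (l a - 1) by rewrite mulr_gt0 ?exprn_gt0.
have cb a n : normc (c a)`_n <= 2 ^+ j * (2^-1 ^+ j * normc (l a - 1) / (1 + 2^-1 ^+ j * normc (l a - 1)) ^+ n.+1).
  rewrite mulrA mulrA -exprMn mulfV ?pnatr_eq0// expr1n mul1r /c coefZ normcM normc_real ger0_norm ?normc_ge0//.
  rewrite ler_wpM2l ?normc_ge0// /res -(poly_def L (fun n => (push j (l a))^-1 ^+ n.+1)) coef_poly.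
  case: ifP => _; last by rewrite normc0 invr_ge0 exprn_ge0// addr_ge0 ?(ltW (e0 a)).
  rewrite normc_inv_exp normc_push exprVn lef_pV2 ?posrE ?exprn_gt0 ?mulr_gt0 ?addr_gt0 ?(lt_le_trans ltr01 (l1 a))//.
  by rewrite ler_pXn2r ?nnegrE ?mulr_ge0 ?addr_ge0 ?normc_ge0 ?(ltW (e0 a))// ler_peMl// addr_ge0// ltW.
have j0 : 0 < 2 ^+ j :> R by rewrite exprn_gt0.
have [K0 HK] := HD A r c (fun a => 2^-1 ^+ j * normc (l a - 1)) (2 ^+ j) j0 e0 cb.
have := transference p1 bT rT (terms := fun a => [:: (c a, a)]) (ra := r) (rb := r) (qi := q) (qo := q) (K0 := K0) (powR_ge0 (D * 2 ^+ j) p) _ _ Lx.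
rewrite powRK ?gt_eqF// ?mulr_ge0 ?(ltW D0) ?(ltW j0)//.
rewrite (_ : tout _ _ _ = fun a => polyT (c a) T (x a)); last first.
  by apply/funext => a; apply/funext => w; rewrite /tout big_seq1.
apply => [K f K0K fK|b qa br]; last by rewrite inE => /eqP ->.
rewrite (_ : kout _ _ = fun t a => act (c a) (f^~ a) t); last first.
  by apply/funext => t; apply/funext => a; rewrite /kout big_seq1.
exact: HK.
Qed.

Lemma geom_uniform (I : finType) (m : I -> C) e : (forall i, 1 < normc (m i)) -> 0 < e ->
  exists L, forall i, N ((m i)^-1 ^+ L *: 'X^L) <= e.
Proof.
move=> m1 e0; have /boolp.choice[L HL] : forall i, exists L0, forall n, (L0 <= n)%N -> N ((m i)^-1 ^+ n *: 'X^n) <= e.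
  by move=> i; exact: (N_geom NS (m1 i) e0).
by exists (\max_i L i)%N => i; apply: HL; exact: leq_bigmax.
Qed.

Variable K : R.
Hypothesis NK : forall n, n.+1%:R * N ('X^(n.+1) - 'X^n) <= K.
Let C0 := 8 * K + 4.
Let C00 : 0 < C0. Proof. by have := K_ge0 NS NK; rewrite /C0 => h; rewrite ltr_wpDl// mulr_ge0. Qed.

Lemma push_ge1 j l : 1 <= normc l -> 1 <= normc (push j l).
Proof. by move=> l1; rewrite normc_push mulr_ege1// lerDl mulr_ge0 ?exprn_ge0 ?normc_ge0. Qed.

Lemma N_push j l L : l != 1 -> 1 <= normc l -> N ((normc (l - 1))%:C%C *: res (push j l) L) <= C0.
Proof.
move=> ln l1; apply: (le_trans (NZ NS _ _)); rewrite normc_real ger0_norm ?normc_ge0//.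
apply: le_trans (N_res NS NK L (push_ge1 j l1) _).
  by rewrite ler_wpM2r ?(N_ge0 NS)//; exact: push_dist.
apply: contra ln => /eqP e; have := push_dist j l1; rewrite e subrr normc0 => h.
by have /eq0_normc/subr0_eq -> : normc (l - 1) = 0 by apply/eqP; rewrite eq_le h normc_ge0.
Qed.

(** Consecutive points differ by 2^-(j+1) |l| |l - 1|, so the resolvent identity leaves one factor
    |l - 1| for each resolvent. The bound |l| <= 4 gives 2 C0^2, and the two truncation errors give
    2 C0. *)
Lemma res_step l j L e : l != 1 -> 1 <= normc l -> normc l <= 4 -> e <= 2^-1 ^+ j ->
  N ((push j l)^-1 ^+ L *: 'X^L) <= e -> N ((push j.+1 l)^-1 ^+ L *: 'X^L) <= e ->
  N ((normc (l - 1))%:C%C *: (res (push j.+1 l) L - res (push j l) L)) <= (2 * C0 ^+ 2 + 2 * C0) * 2^-1 ^+ j.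
Proof.
move=> ln l1 l4 ej Ej Ej1; set dl := normc (l - 1).
have dl0 : 0 < dl by rewrite normc_gt0// subr_eq0.
have a0 := normc_unit_ge1 (push_ge1 j.+1 l1); have b0 := normc_unit_ge1 (push_ge1 j l1).
have Na := N_push j.+1 L ln l1; have Nb := N_push j L ln l1; rewrite -/dl in Na Nb.
have -> : dl%:C%C *: (res (push j.+1 l) L - res (push j l) L) =
  ((push j l - push j.+1 l) * (dl^-1)%:C%C) *: ((dl%:C%C *: res (push j.+1 l) L) * (dl%:C%C *: res (push j l) L))
  + (dl%:C%C *: res (push j.+1 l) L) * ((push j l)^-1 ^+ L *: 'X^L)
  - (dl%:C%C *: res (push j l) L) * ((push j.+1 l)^-1 ^+ L *: 'X^L).
  rewrite [in LHS](res_resolvent L a0 b0) scalerBr scalerDr; congr (_ + _ - _); last 2 first.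
  - by rewrite -scalerAl.
  - by rewrite -scalerAl.
  rewrite -scalerAl -scalerAr !scalerA; congr (_ *: _).
  by rewrite -(mulrA _ (dl^-1)%:C%C) -rmorphM mulVf ?gt_eqF// rmorph1 mulr1 mulrC.
apply: (le_trans (NB NS _ _)); rewrite [leRHS]mulrDl.
have e2 x E : N x <= C0 -> N E <= e -> N (x * E) <= C0 * 2^-1 ^+ j.
  move=> h1 h2; apply: (le_trans (NM NS _ _)); apply: ler_pM => //; rewrite ?(N_ge0 NS)//.
  exact: le_trans ej.
rewrite (_ : 2 * C0 * _ = C0 * 2^-1 ^+ j + C0 * 2^-1 ^+ j); last by ring.
rewrite addrA; apply: lerD; last exact: e2.
apply: (le_trans (ND NS _ _)); apply: lerD; last exact: e2.
apply: (le_trans (NZ NS _ _)).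
have -> : 2 * C0 ^+ 2 * 2^-1 ^+ j = (2 * 2^-1 ^+ j) * (C0 * C0) by ring.
apply: ler_pM; rewrite ?normc_ge0 ?(N_ge0 NS)//; last first.
  apply: (le_trans (NM NS _ _)); exact: ler_pM (N_ge0 NS _) (N_ge0 NS _) Na Nb.
have -> : push j l - push j.+1 l = l * (2^-1 ^+ j.+1 * dl)%:C%C.
  rewrite /push -mulrBr -/dl; congr (l * _); rewrite -(rmorphB (real_complex R)) exprS -mulrA.
  have zE z : 1 + z - (1 + 2^-1 * z) = 2^-1 * z :> R by field.
  by rewrite zE.
rewrite -mulrA -(rmorphM (real_complex R)) -mulrA mulfV ?gt_eqF// mulr1 normcM normc_real ger0_norm ?exprn_ge0// exprS.
rewrite mulrA ler_wpM2r ?exprn_ge0// ler_pdivrMr//; apply: (le_trans l4); rewrite -natrM//.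
Qed.

Lemma powR_expn (a b : R) n : 0 <= a -> (a ^+ n) `^ b = (a `^ b) ^+ n.
Proof.
move=> a0; elim: n => [|n IH]; first by rewrite !expr0 powR1.
by rewrite !exprS powRM ?exprn_ge0// IH.
Qed.

(** For p <= 2 the parameter 1 - p / 2 with l^oo is below 1/2 precisely since p > 1; for p > 2 it is
    (p - 2) / (2 p - 2) with l^1. *)
Lemma interpolation_exponent : exists q th, [/\ q <> l2, 0 <= th, th < 1 / 2 &
  2 / p * (1 - th) + (if q is l1 then 2 else 0) * th = 1].
Proof.
have pn : p != 0 by rewrite gt_eqF.
have [p2|p2] := leP p 2.
  exists loo, (1 - p / 2); split=> //; move: p1 => p1'; [lra|lra|].
  by rewrite mul0r addr0; field.
have q0 : 0 < 2 * p - 2 by lra.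
exists l1, ((p - 2) / (2 * p - 2)); split=> //.
- by rewrite divr_ge0//; lra.
- by rewrite ltr_pdivrMr//; lra.
- by field; rewrite pn gt_eqF.
Qed.

(** Telescoping from [push 0] to [push J]: the first term and the differences are interpolated
    separately, with 3 D = 2 D + D for a difference of two levels. B does not depend on J, so the
    points may come arbitrarily close to l. *)
Lemma pushed_resolvents_R_bounded : exists2 B, 0 < B & forall J (I : finType) (l : I -> C),
  (forall i, l i != 1) -> (forall i, 1 <= normc (l i)) -> (forall i, normc (l i) <= 4) -> forall e, 0 < e ->
  exists L, (forall i, N ((push J (l i))^-1 ^+ L *: 'X^L) <= e) /\
    forall (A : finType) (r : seq A) (f : A -> I),
    Qb l2 r (fun a => (normc (l (f a) - 1))%:C%C *: res (push J (l (f a))) L) B.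
Proof.
have [q [th [q2 th0 thh thE]]] := interpolation_exponent.
have th01 : 0 <= th <= 1 by rewrite th0/=; lra.
have [D D0 HD] := geometric_res q2.
pose C1 := 2 * C0 ^+ 2 + 2 * C0.
have C10 : 0 < C1 by rewrite addr_gt0 ?mulr_gt0 ?exprn_gt0.
(* The ratio of successive interpolated bounds, below 1 because th < 1/2. *)
pose rho : R := (2^-1 `^ (1 - th)) * 2 `^ th.
have rho0 : 0 <= rho by rewrite mulr_ge0 ?powR_ge0.
have rho1 : rho < 1.
  rewrite /rho -powR_inv1// -powRrM -powRD ?pnatr_eq0 ?implybT//.
  rewrite /powR pnatr_eq0/= expR_lt1 pmulr_llt0 ?ln_gt0 ?ltr1n//; lra.
pose B0 := C0 `^ (1 - th) * D `^ th; pose B1 := C1 `^ (1 - th) * (3 * D) `^ th.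
exists (B0 + B1 / (1 - rho)).
  by rewrite ltr_pwDl ?mulr_gt0 ?powR_gt0// divr_ge0 ?mulr_ge0 ?powR_ge0// subr_ge0 ltW.
move=> J I l ln l1 l4 e e0.
pose e1 := Num.min e (2^-1 ^+ J).
have e10 : 0 < e1 by rewrite lt_min e0 exprn_gt0.
have m1 (ij : I * 'I_J.+1) : 1 < normc (push ij.2 (l ij.1)).
  case: ij => i j /=; rewrite normc_push; apply: (@lt_le_trans _ _ (1 + 2^-1 ^+ j * normc (l i - 1))).
    by rewrite ltrDl mulr_gt0 ?exprn_gt0// normc_gt0// subr_eq0.
  by rewrite ler_peMl// addr_ge0// mulr_ge0 ?exprn_ge0 ?normc_ge0.
have [L HL] := geom_uniform m1 e10.
  have HL' i j : (j <= J)%N -> N ((push j (l i))^-1 ^+ L *: 'X^L) <= e1.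
    by move=> jJ; exact: (HL (i, Ordinal (jJ : (j < J.+1)%N))).
  exists L; split=> [i|A r f]; first by rewrite (le_trans (HL' i J _))// ge_min lexx.
  pose u j a := (normc (l (f a) - 1))%:C%C *: res (push j (l (f a))) L.
  have base : Qb l2 r (u 0%N) B0.
    apply: (interpolation p1 bT rT th01 q2 thE C00 D0) => [a ar|]; first exact: N_push.
    by have := HD A r (l \o f) 0%N L; rewrite expr0 mulr1; apply=> a /=.
  have stp j : (j < J)%N -> Qb l2 r (fun a => u j.+1 a - u j a) (B1 * rho ^+ j).
    move=> jJ; have -> : B1 * rho ^+ j = (C1 * 2^-1 ^+ j) `^ (1 - th) * (3 * D * 2 ^+ j) `^ th.
      rewrite !powRM ?exprn_ge0 ?mulr_ge0 ?(ltW D0) ?(ltW C10)// /B1 /rho !powR_expn// exprMn.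
      by rewrite powRM ?(ltW D0)//; ring.
    apply: (interpolation p1 bT rT th01 q2 thE) => [| |a ar|].
    - by rewrite mulr_gt0// exprn_gt0.
    - by rewrite !mulr_gt0// exprn_gt0.
    - have ej : e1 <= 2^-1 ^+ j.
        rewrite ge_min; apply/orP; right; apply: ler_wiXn2l => //; [by rewrite invf_le1// ler1n|exact: ltnW].
      rewrite /u -scalerBr; exact: (res_step (ln _) (l1 _) (l4 _) ej (HL' _ _ (ltnW jJ)) (HL' _ _ jJ)).
    have := HD A r (l \o f) j.+1 L; have := HD A r (l \o f) j L.
    move=> /(_ (fun=> ln _) (fun=> l1 _)) h1 /(_ (fun=> ln _) (fun=> l1 _)) h2.
    have h3 : Qb q r (fun a => (-1) *: u j a) (1 * (D * 2 ^+ j)).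
      by apply: (Qb_scale p1 bT) h1 => // a _; rewrite normcN' normc1.
    have := QbD p1 bT h2 h3; rewrite (_ : (fun a => _) = fun a => u j.+1 a - u j a); last first.
      by apply/funext => a; rewrite scaleN1r.
    apply: Qb_le; rewrite exprS; lra.
  have tel a : u J a = u 0%N a + \sum_(j < J) (u j.+1 a - u j a).
    by rewrite -(big_mkord xpredT (fun j => u j.+1 a - u j a)) telescope_sumr// addrC subrK.
  rewrite -/(u J) (_ : u J = fun a => u 0%N a + \sum_(j < J) (u j.+1 a - u j a)); last exact/funext.
  apply: Qb_le (QbD p1 bT base (Qb_sum stp)); rewrite lerD2l -mulr_sumr ler_wpM2l ?mulr_ge0 ?powR_ge0//.
  rewrite -[leRHS]mul1r ler_pdivlMr ?subr_gt0// -(big_mkord xpredT (fun j => rho ^+ j)).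
  have -> : (\sum_(0 <= j < J) rho ^+ j) * (1 - rho) = 1 - rho ^+ J.
    elim: (J) => [|n IH]; first by rewrite big_geq// mul0r expr0 subrr.
    by rewrite big_nat_recr//= mulrDl IH exprS; ring.
  by rewrite gerDl oppr_le0 exprn_ge0.
Qed.

Lemma half_sum n : \sum_(k < n) 2^-1 ^+ k <= 2 :> R.
Proof.
suff -> : \sum_(k < n) 2^-1 ^+ k = 2 - 2 * 2^-1 ^+ n :> R by rewrite gerDl oppr_le0 mulr_ge0 ?exprn_ge0.
elim: n => [|n IH]; first by rewrite big_ord0 expr0 mulr1 subrr.
by rewrite big_ord_recr/= IH exprS; field.
Qed.

Lemma half_pow_small (e : R) : 0 < e -> exists n, 2^-1 ^+ n <= e.
Proof.
move=> e0; have h : `|2^-1 : R| < 1 by rewrite ger0_norm// invf_lt1// ltr1n.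
have /cvgrPdist_le/(_ e e0)[n _ /(_ n (leqnn n))] := cvg_geometric 1 h.
by rewrite sub0r normrN /geometric/= mul1r ger0_norm ?exprn_ge0// => ?; exists n.
Qed.

(** The points m may lie inside the disc, at a distance from l small compared with |l - 1|. The
    resolvent at m is that at [push J l] times a Neumann series whose ratio is R-bounded by 1/2. Of
    the final constant, one factor 2 bounds the series and the other |m - 1| / |l - 1|. *)
Lemma resolvents_R_bounded : exists B d0, [/\ 0 < B, 0 < d0, d0 <= 1 / 2 & forall (I : finType) (l m : I -> C),
  (forall i, l i != 1) -> (forall i, 1 <= normc (l i)) -> (forall i, normc (l i) <= 4) ->
  (forall i, normc (m i - l i) <= d0 * normc (l i - 1)) -> forall e, 0 < e ->
  exists rr : I -> {poly C}, (forall i, N (1 - ((m i)%:P - 'X) * rr i) <= e) /\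
    forall (A : finType) (r : seq A) (f : A -> I),
    Qb l2 r (fun a => (normc (m (f a) - 1))%:C%C *: rr (f a)) B].
Proof.
have [B B0 HB] := pushed_resolvents_R_bounded.
pose d1 := (2 * B)^-1; have d10 : 0 < d1 by rewrite invr_gt0 mulr_gt0.
have d1B : d1 * B = 2^-1 by rewrite /d1 invfM -mulrA mulVf ?mulr1// gt_eqF.
(* Half of d1 = 1 / (2 B) is spent on the distance from [push J l] to l, where |l| <= 4 turns d1 / 8
   into d1 / 2, and half on that from l to m. *)
have [J HJ] := half_pow_small (divr_gt0 d10 (ltr0Sn R 7)).
pose d0 := Num.min (1 / 2) (d1 / 2).
have d00 : 0 < d0 by rewrite lt_min !divr_gt0.
have d02 : d0 <= 1 / 2 by rewrite ge_min lexx.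
have d0d : d0 <= d1 / 2 by rewrite ge_min lexx orbT.
exists (2 * (B * 2)), d0; split=> //; first by rewrite !mulr_gt0.
move=> I l m ln l1 l4 ml e e0.
have [L [HE HR]] := HB J I l ln l1 l4 (e / 4) (divr_gt0 e0 (ltr0Sn R 3)).
have [n Hn] := half_pow_small (divr_gt0 e0 (ltr0Sn R 1)).
pose dl i := normc (l i - 1); pose s i := res (push J (l i)) L; pose z i := push J (l i) - m i.
pose zc i := z i * ((dl i)^-1)%:C%C; pose w i := z i *: s i.
have dl0 i : 0 < dl i by rewrite /dl normc_gt0// subr_eq0.
have zcE i : z i = zc i * (dl i)%:C%C.
  by rewrite /zc -mulrA -(rmorphM (real_complex R)) mulVf ?rmorph1 ?mulr1// gt_eqF.
have zc1 i : normc (zc i) <= d1.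
  rewrite normcM normc_real ger0_norm ?invr_ge0 ?(ltW (dl0 i))// ler_pdivrMr//.
  have -> : z i = l i * (2^-1 ^+ J * dl i)%:C%C - (m i - l i).
    by rewrite /z /push rmorphD rmorph1 -/(dl i); ring.
  apply: (le_trans (ler_normcD _ _)); rewrite normcN' normcM normc_real ger0_norm ?mulr_ge0 ?exprn_ge0 ?(ltW (dl0 i))//.
  have h : normc (l i) * (2^-1 ^+ J * dl i) <= d1 / 2 * dl i.
    rewrite mulrA ler_wpM2r ?(ltW (dl0 i))//.
    apply: (@le_trans _ _ (4 * (d1 / 8))); last by rewrite le_eqVlt; apply/orP; left; apply/eqP; field.
    by apply: ler_pM; rewrite ?normc_ge0 ?exprn_ge0.
  apply: (le_trans (lerD h (ml i))); rewrite -/(dl i) -mulrDl ler_wpM2r ?(ltW (dl0 i))//.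
  by apply: (le_trans (lerD (lexx _) d0d)); rewrite -splitr.
have wE i : w i = zc i *: ((dl i)%:C%C *: s i) by rewrite scalerA -zcE.
have Qw (A : finType) (r : seq A) (f : A -> I) : Qb l2 r (fun a => w (f a)) 2^-1.
  rewrite -d1B (_ : (fun a => _) = fun a => zc (f a) *: ((dl (f a))%:C%C *: s (f a))); last first.
    by apply/funext => a; rewrite wE.
  by apply: (Qb_scale p1 bT (ltW d10) _ (HR A r f)) => a _; exact: zc1.
have Nw i : N (w i) <= 2^-1 by apply: (Qb_single p1 bT rT (u := w)); [rewrite invr_ge0|exact: (Qw I [:: i] id)].
have Nwk i : N (\sum_(k < n) w i ^+ k) <= 2.
  apply: (le_trans (N_sum NS _ _ _)); apply: (le_trans _ (half_sum n)); apply: ler_sum => k _.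
  by apply: (le_trans (N_pow NS _ _)); apply: lerXn2r; rewrite ?nnegrE ?(N_ge0 NS) ?invr_ge0.
exists (fun i => s i * \sum_(k < n) w i ^+ k); split=> [i|A r f].
  have l0 := normc_unit_ge1 (push_ge1 J (l1 i)).
  have -> : 1 - ((m i)%:P - 'X) * (s i * \sum_(k < n) w i ^+ k) =
     w i ^+ n + ((push J (l i))^-1 ^+ L *: 'X^L) * \sum_(k < n) w i ^+ k.
    rewrite -[w i ^+ n](subrK 1) subrX1 mulrA.
    have -> : ((m i)%:P - 'X) * s i = 1 - (push J (l i))^-1 ^+ L *: 'X^L - w i.
      rewrite -(resE L l0) /w /s -mul_polyC /z polyCB; ring.
    by ring.
  apply: (le_trans (ND NS _ _)); rewrite [leRHS]splitr; apply: lerD.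
    by apply: (le_trans (N_pow NS _ _)); apply: le_trans Hn; apply: lerXn2r; rewrite ?nnegrE ?(N_ge0 NS) ?invr_ge0.
  apply: (le_trans (NM NS _ _)); apply: (le_trans (ler_pM (N_ge0 NS _) (N_ge0 NS _) (HE i) (Nwk i))).
  by rewrite le_eqVlt; apply/orP; left; apply/eqP; field.
rewrite (_ : (fun a => _) = fun a => (normc (m (f a) - 1) / dl (f a))%:C%C *:
    (((dl (f a))%:C%C *: s (f a)) * \sum_(k < n) w (f a) ^+ k)); last first.
  apply/funext => a; rewrite -scalerAl scalerA -(rmorphM (real_complex R)) -mulrA mulVf ?mulr1// gt_eqF//.
apply: (Qb_scale p1 bT) => // [a ar|].
  rewrite normc_real ger0_norm ?divr_ge0 ?normc_ge0// ler_pdivrMr//.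
  have -> : m (f a) - 1 = (m (f a) - l (f a)) + (l (f a) - 1) by ring.
  apply: (le_trans (ler_normcD _ _)); apply: (le_trans (lerD (ml _) (lexx _))).
  rewrite -/(dl (f a)) -[X in _ + X <= _]mul1r -mulrDl ler_wpM2r ?(ltW (dl0 _))//; lra.
apply: (QbM p1 bT); [exact: ltW|exact: HR|].
apply: Qb_le (half_sum n) _; apply: (Qb_sum (u := fun k a => w (f a) ^+ k)) => k _.
by apply: Qb_pow; rewrite ?invr_ge0.
Qed.

End RBoundedness.

(** * The contour *)

Section Contour.
Context {R : realType}.
Notation C := R[i].

Lemma cisX (t : R) j : cis t ^+ j = cis (j%:R * t).
Proof.
elim: j => [|j IH]; first by rewrite expr0 mul0r cis0.
by rewrite exprS IH -cisD; congr cis; rewrite -natr1; ring.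
Qed.

Lemma chord_cis (t : R) : normc (1 - cis (t *+ 2)) = 2 * `|sin t|.
Proof.
apply/eqP; rewrite -(@eqrXn2 _ 2) ?normc_ge0 ?mulr_ge0// exprMn real_normK ?num_real// normc_sqr /=.
have := cos2Dsin2 (t *+ 2); rewrite sin_mulr2n cos_mulr2n => h.
have := cos2Dsin2 t; set c := cos t; set s := sin t => e; apply/eqP.
have -> : c ^+ 2 = 1 - s ^+ 2 by rewrite -e addrK.
rewrite sub0r sqrrN -[c * s *+ 2]mulr_natl !exprMn (_ : c ^+ 2 = 1 - s ^+ 2); last by rewrite -e addrK.
by ring.
Qed.

Lemma normc_dist (a b : C) : `|normc a - normc b| <= normc (a - b).
Proof.
rewrite ler_norml; apply/andP; split; last by rewrite lerBlDr -{1}[a](subrK b); exact: ler_normcD.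
by rewrite lerNl opprB lerBlDr -(normcN' (a - b)) opprB -{1}[b](subrK a); exact: ler_normcD.
Qed.

Lemma sin_le (u : R) : 0 <= u -> sin u <= u.
Proof. by move=> u0; have [c _ ->] := sin_mvt u0; rewrite ler_piMl// cos_le1. Qed.

Lemma sin_ge (u : R) : 0 <= u <= pi / 2 -> u / 8 <= sin u.
Proof.
move=> /andP[u0 u1]; have p2 := @pihalf_lt2 R; have p3 := @pihalf_ge1 R.
have [h|h] := leP u (1 / 2).
  have u1' : 0 <= u <= 1 by rewrite u0/=; lra.
  have /andP[h1 _] := sin_bounds u1'; apply: le_trans h1; nra.
have u1' : 0 <= (1 / 2 : R) <= 1 by apply/andP; split; lra.
have /andP[h1 _] := sin_bounds u1'.
have : sin (1 / 2) < sin u by rewrite ltr_sin// in_itv/=; apply/andP; split; lra.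
by lra.
Qed.

Definition rt n : C := cis (pi *+ 2 / n%:R).
Definition chord n j := normc (1 - rt n ^+ j).

Lemma rtX n j : rt n ^+ j = cis ((j%:R * (pi / n%:R)) *+ 2).
Proof. by rewrite /rt cisX; congr cis; rewrite [X in _ * X]mulrnAl mulrnAr. Qed.

Lemma rt_period n : (0 < n)%N -> rt n ^+ n = 1.
Proof.
move=> n0; rewrite rtX mulrCA mulfV ?pnatr_eq0 -?lt0n// mulr1 /cis cos2pi.
by rewrite sin_mulr2n sinpi mulr0 mul0rn.
Qed.

Lemma normc_rtX n j : normc (rt n ^+ j) = 1.
Proof. by rewrite rtX normc_cis. Qed.

Lemma chordE n j : chord n j = 2 * `|sin (j%:R * (pi / n%:R))|.
Proof. by rewrite /chord rtX chord_cis. Qed.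

Lemma chord_ge0 n j : 0 <= chord n j. Proof. exact: normc_ge0. Qed.

Lemma chord_le2 n j : chord n j <= 2.
Proof. by apply: (le_trans (ler_normcD _ _)); rewrite normcN' normc1 normc_rtX. Qed.

Lemma chord1_le n : (0 < n)%N -> chord n 1 <= 8 / n%:R.
Proof.
move=> n0; have p2 := @pihalf_lt2 R; have p0 := @pi_gt0 R.
have i0 : 0 < n%:R^-1 :> R by rewrite invr_gt0 ltr0n.
have n1 : pi / n%:R <= pi :> R by rewrite ler_pdivrMr ?ltr0n// ler_peMr ?ler1n// ltW.
have h : 0 <= sin (pi / n%:R : R) by apply: sin_ge0_pi; rewrite n1 divr_ge0 ?(ltW p0).
rewrite chordE mul1r.
rewrite ger0_norm//; have := sin_le (divr_ge0 (ltW p0) (ltW (_ : 0 < n%:R))); rewrite ltr0n => /(_ n0).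
have : pi / n%:R <= 4 / n%:R :> R by rewrite ler_wpM2r ?(ltW i0)//; lra.
by lra.
Qed.

Lemma chord_ge_left n j : (j.*2 <= n)%N -> (0 < n)%N -> j%:R / (2 * n%:R) <= chord n j.
Proof.
move=> jn n0; have p2 := @pihalf_ge1 R; rewrite chordE.
have nR : 0 < n%:R :> R by rewrite ltr0n.
have jR : j%:R / n%:R <= 1 / 2 :> R.
  by rewrite ler_pdivrMr// mul1r mulrC ler_pdivlMr// -natrM ler_nat muln2.
have j0 : 0 <= j%:R / n%:R :> R by rewrite divr_ge0.
have e : j%:R * (pi / n%:R) = j%:R / n%:R * pi :> R by rewrite mulrCA mulrC.
have u : (0 <= j%:R * (pi / n%:R) :> R) && (j%:R * (pi / n%:R) <= pi / 2 :> R).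
  rewrite e mulr_ge0 ?pi_ge0//=; have := ler_wpM2r (pi_ge0 R) jR; lra.
rewrite ger0_norm; last first.
  case/andP: u => u1 u2; apply: sin_ge0_pi; rewrite u1/=; apply: (le_trans u2).
  by have := @pi_ge0 R; lra.
have := sin_ge u; rewrite e; have := ler_wpM2l j0 p2; rewrite invfM => h1 h2.
have -> : j%:R * (2^-1 / n%:R) = (j%:R / n%:R) / 2 :> R by field; rewrite gt_eqF.
by set x := j%:R / n%:R in h1 h2 *; set y := sin _ in h2 *; lra.
Qed.

Lemma chord_sym n j : (j <= n)%N -> (0 < n)%N -> chord n (n - j) = chord n j.
Proof.
move=> jn n0; rewrite !chordE; congr (2 * `|_|).
have -> : (n - j)%:R * (pi / n%:R) = - (j%:R * (pi / n%:R)) + pi :> R.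
  by rewrite natrB//; field; rewrite pnatr_eq0 -lt0n.
by rewrite sinDpi sinN opprK.
Qed.

Lemma chord_ge n j : (j <= n)%N -> (0 < n)%N -> j%:R / (2 * n%:R) <= chord n j \/ (n - j)%:R / (2 * n%:R) <= chord n j.
Proof.
move=> jn n0; have [h|h] := leqP j.*2 n; [left|right]; first exact: chord_ge_left.
by rewrite -chord_sym//; apply: chord_ge_left => //; rewrite -!muln2 in h *; lia.
Qed.

Lemma chord_step n j : `|chord n j.+1 - chord n j| <= chord n 1.
Proof.
have e : rt n ^+ j - rt n ^+ j.+1 = rt n ^+ j * (1 - rt n) by rewrite exprSr; ring.
have h : normc (rt n ^+ j - rt n ^+ j.+1) = chord n 1 by rewrite e normcM normc_rtX mul1r /chord expr1.
rewrite -h /chord distrC.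
have -> : rt n ^+ j - rt n ^+ j.+1 = - ((1 - rt n ^+ j) - (1 - rt n ^+ j.+1)) by ring.
by rewrite normcN'; exact: normc_dist.
Qed.

(** A grid: j runs around the curve, and i deforms the circle (i = 0) into the contour zeta (1 - c
    |1 - zeta|) (i = n). With n steps in both directions the mesh is of order 1 / n. *)
Definition node (c : R) n i j : C := rt n ^+ j * (1 - i%:R / n%:R * (c * chord n j))%:C%C.

Lemma node_period c n i : (0 < n)%N -> node c n i n = node c n i 0.
Proof. by move=> n0; rewrite /node /chord rt_period// expr0. Qed.

Section Bounds.
Variables (c : R) (n : nat).
Hypotheses (c0 : 0 < c) (c4 : c <= 1 / 4) (n0 : (0 < n)%N).
Let nR : 0 < n%:R :> R. Proof. by rewrite ltr0n. Qed.
Let c3 : 3 * c <= 1. Proof. by move: c4 => h; lra. Qed.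
Let c1 : c <= 1. Proof. by move: c4 => h; lra. Qed.

Lemma node_shift i j : (i <= n)%N -> 0 <= i%:R / n%:R * (c * chord n j) <= c * chord n j.
Proof.
move=> ni; rewrite mulr_ge0 ?mulr_ge0 ?divr_ge0 ?chord_ge0 ?(ltW c0)//= ler_piMl ?mulr_ge0 ?chord_ge0 ?(ltW c0)//.
by rewrite ler_pdivrMr// mul1r ler_nat.
Qed.

Lemma normc_node i j : (i <= n)%N -> normc (node c n i j) <= 1.
Proof.
move=> /(node_shift j)/andP[h1 h2]; rewrite normcM normc_rtX mul1r normc_real.
have := ler_pM (ltW c0) (chord_ge0 n j) c4 (chord_le2 n j) => h3.
by rewrite ler_norml; apply/andP; split; lra.
Qed.

Lemma node_base j : node c n 0 j = rt n ^+ j.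
Proof. by rewrite /node mul0r mul0r subr0 mulr1. Qed.

Lemma node_near i j : (i <= n)%N -> normc (node c n i j - rt n ^+ j) <= c * chord n j.
Proof.
move=> /(node_shift j)/andP[h1 h2]; rewrite /node.
have -> : rt n ^+ j * (1 - i%:R / n%:R * (c * chord n j))%:C%C - rt n ^+ j = rt n ^+ j * (- (i%:R / n%:R * (c * chord n j)))%:C%C.
  by rewrite rmorphB rmorphN rmorph1; ring.
by rewrite normcM normc_rtX mul1r normc_real normrN ger0_norm.
Qed.

Lemma node_step i j : (i <= n)%N -> normc (node c n i j.+1 - node c n i j) <= 2 * chord n 1.
Proof.
move=> ni; have /andP[h1 h2] := node_shift j ni; have d2 := chord_le2 n j; have d0 := chord_ge0 n j.
have -> : node c n i j.+1 - node c n i j = rt n ^+ j.+1 * (i%:R / n%:R * (c * (chord n j - chord n j.+1)))%:C%C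
    + (rt n ^+ j * (rt n - 1)) * (1 - i%:R / n%:R * (c * chord n j))%:C%C.
  by rewrite /node !(rmorphB, rmorphM, rmorph1) exprSr; ring.
apply: (le_trans (ler_normcD _ _)); rewrite normcM normc_rtX mul1r normc_real (normcM (_ * _)) normcM normc_rtX mul1r normc_real.
have -> : normc (rt n - 1) = chord n 1 by rewrite -normcN' opprB /chord expr1.
rewrite (_ : 2 * chord n 1 = chord n 1 + chord n 1); last by ring.
have k1 : (0 <= i%:R / n%:R :> R) && (i%:R / n%:R <= 1 :> R) by rewrite divr_ge0//= ler_pdivrMr// mul1r ler_nat.
case/andP: k1 => k0 k1; apply: lerD; last first.
  have := ler_pM (ltW c0) d0 c4 d2 => h3.
  by rewrite ler_piMr ?chord_ge0// ler_norml; apply/andP; split; lra.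
rewrite normrM (ger0_norm k0) normrM (ger0_norm (ltW c0)) distrC; have h := chord_step n j.
rewrite mulrA; apply: le_trans h; rewrite ler_piMl// mulr_ile1//; exact: ltW.
Qed.

Lemma node_up i j : (i < n)%N -> normc (node c n i.+1 j - node c n i j) <= c * chord n j / n%:R.
Proof.
move=> ni; have -> : node c n i.+1 j - node c n i j = rt n ^+ j * (- (c * chord n j / n%:R))%:C%C.
  by rewrite /node -natr1 !(rmorphB, rmorphM, rmorphN, rmorphD, rmorph1); ring.
by rewrite normcM normc_rtX mul1r normc_real normrN ger0_norm// !mulr_ge0 ?invr_ge0 ?chord_ge0 ?(ltW c0) ?(ltW nR).
Qed.

(** The mixed second difference gains a factor 1 / n from each direction; the cancellation in
    [cell_term] depends on it. *)
Lemma node_upstep i j : (i < n)%N ->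
  normc ((node c n i.+1 j.+1 - node c n i j.+1) - (node c n i.+1 j - node c n i j)) <= chord n 1 / n%:R.
Proof.
move=> ni; have -> : (node c n i.+1 j.+1 - node c n i j.+1) - (node c n i.+1 j - node c n i j) =
    (rt n ^+ j.+1 * (chord n j - chord n j.+1)%:C%C + (rt n ^+ j * (1 - rt n)) * (chord n j)%:C%C) * (c / n%:R)%:C%C.
  by rewrite /node -natr1 !(rmorphB, rmorphM, rmorphN, rmorphD, rmorph1) !exprSr; ring.
rewrite normcM (normc_real (c / _)) ger0_norm ?divr_ge0 ?(ltW c0) ?(ltW nR)// mulrA ler_wpM2r ?invr_ge0 ?(ltW nR)//.
have h : normc (rt n ^+ j.+1 * (chord n j - chord n j.+1)%:C%C + (rt n ^+ j * (1 - rt n)) * (chord n j)%:C%C) <= 3 * chord n 1.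
  apply: (le_trans (ler_normcD _ _)); rewrite normcM normc_rtX mul1r normc_real (normcM (_ * _)) normcM normc_rtX mul1r normc_real.
  have -> : normc (1 - rt n) = chord n 1 by rewrite /chord expr1.
  rewrite distrC (ger0_norm (chord_ge0 n j)); have := chord_step n j; have := ler_wpM2l (chord_ge0 n 1) (chord_le2 n j); lra.
apply: (le_trans (ler_wpM2r (ltW c0) h)); rewrite mulrAC ler_piMl ?chord_ge0//.
Qed.

Lemma one_sub_node j : normc (1 - node c n n j) <= 2 * chord n j.
Proof.
have -> : 1 - node c n n j = (1 - rt n ^+ j) - (node c n n j - rt n ^+ j) by ring.
apply: (le_trans (ler_normcD _ _)); rewrite normcN' (_ : 2 * _ = chord n j + chord n j); last by ring.
apply: lerD; first exact: lexx.
apply: (le_trans (node_near j (leqnn n))); by rewrite ler_piMl ?chord_ge0.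
Qed.

Lemma chord_le_scaled (sg : R) j : 1 <= sg -> chord n j <= normc (sg%:C%C * rt n ^+ j - 1) /\ sg - 1 <= normc (sg%:C%C * rt n ^+ j - 1).
Proof.
move=> s1; have sg0 : 0 <= sg by lra.
have nz : normc (rt n ^+ j) ^+ 2 = 1 by rewrite normc_rtX expr1n.
split.
  rewrite -(@ler_pXn2r _ 2) ?nnegrE ?normc_ge0//; move: nz; rewrite /chord !normc_sqr.
  case: (rt n ^+ j) => a b /= e; have a1 : a <= 1 by nra.
  have -> : (sg * a - 0 * b - 1) ^+ 2 + (sg * b + 0 * a - 0) ^+ 2 = sg ^+ 2 * (a ^+ 2 + b ^+ 2) - 2 * sg * a + 1 by ring.
  have -> : (1 - a) ^+ 2 + (0 - b) ^+ 2 = 1 - 2 * a + (a ^+ 2 + b ^+ 2) by ring.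
  by rewrite e; nra.
have h := ler_normcD (sg%:C%C * rt n ^+ j - 1) 1; rewrite subrK normcM normc_rtX normc_real normc1 in h.
by move: h; rewrite ger0_norm// mulr1 => h; rewrite lerBlDr.
Qed.

End Bounds.
Lemma normc_exp (x : C) k : normc (x ^+ k) = normc x ^+ k.
Proof. by elim: k => [|k IH]; rewrite ?expr0 ?normc1// !exprS normcM IH. Qed.

Lemma normc_pow_sub1 (x : C) k : normc x <= 3 -> normc (x ^+ k - 1) <= normc (x - 1) * 3 ^+ k.
Proof.
move=> x3; elim: k => [|k IH]; first by rewrite expr0 subrr normc0 mulr1 normc_ge0.
have -> : x ^+ k.+1 - 1 = (x ^+ k - 1) + x ^+ k * (x - 1) by rewrite exprSr; ring.
apply: (le_trans (ler_normcD _ _)); rewrite normcM normc_exp.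
have h : normc x ^+ k <= 3 ^+ k by apply: lerXn2r; rewrite ?nnegrE ?normc_ge0.
have := ler_wpM2r (normc_ge0 (x - 1)) h; have := normc_ge0 (x - 1); have : 0 <= 3 ^+ k :> R by rewrite exprn_ge0.
by rewrite exprS; nra.
Qed.

Definition bump k : {poly C} := (2 ^+ k *: (1 - 'X)) ^+ 6 * ((1 + 'X^(2 ^ k)) ^+ 10 - 1).

Lemma horner_bump k (z : C) : (bump k).[z] = (2 ^+ k * (1 - z)) ^+ 6 * ((1 + z ^+ (2 ^ k)) ^+ 10 - 1).
Proof. by rewrite /bump !(hornerE, horner_exp). Qed.

(** The power 7 outweighs the five factors 1 + v from |1 - lambda|^5 in [bump_admissible] and leaves
    the summable (1 + v)^-2. *)
Lemma expRN_rat (v : R) : 0 <= v -> expR (- v) <= 7 ^+ 7 / (1 + v) ^+ 7.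
Proof.
move=> v0; have e0 := expR_gt0 v; have v1 : 0 < 1 + v by rewrite ltr_pwDl.
rewrite expRN -[7 ^+ 7]invrK -invfM lef_pV2 ?posrE ?mulr_gt0 ?invr_gt0 ?exprn_gt0//.
rewrite -exprVn -exprMn [in leRHS](_ : v = 7%:R * (v / 7)) ?expRM_natl; last by rewrite mulrC divfK.
apply: lerXn2r; rewrite ?nnegrE ?expR_ge0 ?mulr_ge0 ?(ltW v1)//.
by apply: le_trans (expR_ge1Dx _); lra.
Qed.

Lemma decay_sum (b : R) n : 0 <= b -> \sum_(j < n) b / (1 + b * j%:R) ^+ 2 <= 1 + b.
Proof.
move=> b0; have pos (j : nat) : 0 < 1 + b * j%:R by rewrite ltr_pwDl// mulr_ge0.
case: n => [|n]; first by rewrite big_ord0 addr_ge0.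
apply: (@le_trans _ _ (b + 1 - (1 + b * n%:R)^-1)); last by rewrite (addrC b) gerDl oppr_le0 invr_ge0 ltW.
elim: n => [|n IH]; first by rewrite big_ord_recl big_ord0/= mulr0 !addr0 expr1n divr1 invr1; lra.
rewrite big_ord_recr/=; apply: (le_trans (lerD IH (lexx _))); rewrite -subr_ge0.
have e : 1 + b * n.+1%:R = 1 + b * n%:R + b by rewrite -natr1; ring.
have := pos n; have := pos n.+1; rewrite e; set x := 1 + b * n%:R => h1 h2.
have -> : b + 1 - (x + b)^-1 - (b + 1 - x^-1 + b / (x + b) ^+ 2) = b ^+ 2 / (x * (x + b) ^+ 2).
  by field; rewrite !gt_eqF.
by rewrite divr_ge0 ?sqr_ge0 ?mulr_ge0 ?sqr_ge0 ?ltW.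
Qed.

(** The contour meets the point 1 at both ends of the index range 0, ..., n, so decay is measured
    from the nearer end. *)
Lemma two_sided_decay_sum (b : R) n (v : nat -> R) : 0 <= b -> (forall j, (j < n)%N -> b * j%:R <= v j \/ b * (n - j)%:R <= v j) ->
  \sum_(j < n) b / (1 + v j) ^+ 2 <= 2 * (1 + b).
Proof.
move=> b0 H; have pos (j : nat) : 0 < 1 + b * j%:R by rewrite ltr_pwDl// mulr_ge0.
have t0 (j : nat) : 0 <= b / (1 + b * j%:R) ^+ 2 by rewrite divr_ge0// exprn_ge0// ltW.
have mono x y : 0 < 1 + x -> x <= y -> b / (1 + y) ^+ 2 <= b / (1 + x) ^+ 2.
  move=> x0 xy; have y0 : 0 < 1 + y by apply: (lt_le_trans x0); rewrite lerD2l.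
  rewrite ler_wpM2l// lef_pV2 ?posrE ?exprn_gt0//.
  by apply: lerXn2r; rewrite ?nnegrE ?(ltW x0) ?(ltW y0) ?lerD2l.
apply: (@le_trans _ _ (\sum_(j < n) (b / (1 + b * j%:R) ^+ 2 + b / (1 + b * (n - j)%:R) ^+ 2))).
  apply: ler_sum => j _; have [h|h] := H j (ltn_ord j).
    by apply: (le_trans (mono _ _ (pos j) h)); rewrite lerDl t0.
  by apply: (le_trans (mono _ _ (pos (n - j)%N) h)); rewrite lerDr t0.
rewrite big_split/= (_ : 2 * _ = (1 + b) + (1 + b)); last by ring.
apply: lerD; first exact: decay_sum.
rewrite (reindex_inj rev_ord_inj)/=; apply: le_trans (decay_sum n b0); apply: ler_sum => j _.
apply: mono; first exact: pos.
by rewrite ler_wpM2l// ler_nat subKn// ltnW.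
Qed.

(** Riemann sums for the integrability of g / (1 - lambda) over the contour and its slight
    dilations. The majorant v stands for the quotient, which is not defined at the node 1; s0 and n0
    may depend on g, A is meant to be uniform in k. *)
Definition admissible (c A : R) (g : {poly C}) := exists s0 n0, 1 < s0 /\ forall sg n, 1 <= sg -> sg <= s0 -> (n0 <= n)%N -> (0 < n)%N ->
  exists v : nat -> R, [/\ forall j, 0 <= v j,
     forall j, (j < n)%N -> normc g.[sg%:C%C * node c n n j] <= normc (1 - sg%:C%C * node c n n j) * v j
   & \sum_(j < n) v j <= A * n%:R].

Lemma bernoulli_small (x : R) N : 0 <= x -> x * N%:R <= 1 / 2 -> (1 + x) ^+ N <= 2.
Proof.
move=> x0 h; suff : (1 + x) ^+ N * (1 - x * N%:R) <= 1.
  have a0 : 0 <= (1 + x) ^+ N by rewrite exprn_ge0// addr_ge0.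
  have : 1 / 2 <= 1 - x * N%:R by lra.
  by move=> /(ler_wpM2l a0); lra.
elim: N h => [|N IH] h; first by rewrite expr0 mulr0 subr0 mulr1.
have h' : x * N%:R <= 1 / 2 by apply: le_trans h; rewrite ler_wpM2l// ler_nat.
apply: le_trans (IH h'); rewrite exprSr -mulrA ler_wpM2l ?exprn_ge0 ?addr_ge0//.
have -> : x * N.+1%:R = x * N%:R + x by rewrite -natr1; ring.
have : 0 <= x * N%:R by rewrite mulr_ge0.
by set y := x * N%:R => y0; nra.
Qed.

Lemma one_sub_scaled c n j sg : 0 < c -> c <= 1 / 4 -> (0 < n)%N -> 1 <= sg ->
  normc (1 - sg%:C%C * node c n n j) <= 2 * chord n j + (sg - 1).
Proof.
move=> c0 c4 n0 s1; have -> : 1 - sg%:C%C * node c n n j = (1 - node c n n j) - (sg - 1)%:C%C * node c n n j.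
  by rewrite rmorphB rmorph1; ring.
apply: (le_trans (ler_normcD _ _)); rewrite normcN'; apply: lerD; first exact: one_sub_node.
rewrite normcM normc_real ger0_norm ?subr_ge0// ler_piMr ?subr_ge0//; exact: normc_node.
Qed.

(** With y = c 2^k |1 - zeta| one has |u_k| <= 2 e^-y and 2^k |1 - lambda| <= (2 / c) (1 + y), so
    |m_k| / |1 - lambda| is at most a constant times 2^k / (1 + y)^2. Its mean over the contour does
    not depend on k, since the scale 2^-k has length of the same order. *)
Lemma bump_admissible c : 0 < c -> c <= 1 / 4 -> exists2 A, 0 < A & forall k, admissible c A (bump k).
Proof.
move=> c0 c4; pose D : R := 2 * 3 ^+ 10 * (2 / c) ^+ 5 * 7 ^+ 7.
have c2 : 0 < 2 / c by rewrite divr_gt0.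
have D0 : 0 < D := mulr_gt0 (mulr_gt0 (mulr_gt0 (ltr0Sn R 1) (exprn_gt0 10 (ltr0Sn R 2))) (exprn_gt0 5 c2)) (exprn_gt0 7 (ltr0Sn R 6)).
exists (D * (8 / c)); first by rewrite mulr_gt0 ?divr_gt0.
move=> k; pose t : R := 2 ^+ k; have t0 : 0 < t by rewrite exprn_gt0.
have t1 : 1 <= t by rewrite exprn_ege1// ler1n.
have tE : (2 ^ k)%N%:R = t by rewrite natrX.
(* So small a dilation changes lambda^(2^k) by a factor of at most 2, and n >= 2^k resolves the
   scale 2^-k. *)
exists (1 + (2 * t)^-1), (2 ^ k)%N; split; first by rewrite ltrDl invr_gt0 mulr_gt0.
move=> sg n s1 s0 kn n0; have nR : 0 < n%:R :> R by rewrite ltr0n.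
pose y j := c * t * chord n j.
have y0 j : 0 <= y j by rewrite mulr_ge0 ?mulr_ge0 ?chord_ge0 ?(ltW c0) ?(ltW t0).
exists (fun j => D * (t / (1 + y j) ^+ 2)); split=> [j|j jn|].
- by rewrite mulr_ge0 ?(ltW D0)// divr_ge0 ?(ltW t0)// exprn_ge0// addr_ge0.
- set l := sg%:C%C * node c n n j; have d0 := chord_ge0 n j; have d2 := chord_le2 n j.
  have cd : c * chord n j <= 1 / 2 by have := ler_pM (ltW c0) d0 c4 d2; lra.
  have ln : normc l = sg * (1 - c * chord n j).
    rewrite normcM normc_real ger0_norm ?(le_trans _ s1)// normcM normc_rtX mul1r normc_real divff ?gt_eqF// mul1r.
    by rewrite ger0_norm//; lra.
  have u1 : normc (l ^+ (2 ^ k)) <= 2 * expR (- y j).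
    rewrite normc_exp ln exprMn; apply: ler_pM; rewrite ?exprn_ge0//; [lra|lra| |].
      have -> : sg = 1 + (sg - 1) by ring.
      apply: bernoulli_small; rewrite ?subr_ge0// tE.
      apply: (@le_trans _ _ ((2 * t)^-1 * t)); first by rewrite ler_wpM2r ?(ltW t0)//; lra.
      by rewrite le_eqVlt; apply/orP; left; apply/eqP; field; rewrite gt_eqF.
    rewrite (_ : - y j = (2 ^ k)%N%:R * - (c * chord n j)) ?expRM_natl; last by rewrite tE /y; ring.
    apply: lerXn2r; rewrite ?nnegrE ?expR_ge0//; first by lra.
    by apply: le_trans (expR_ge1Dx _).
  have e1 : expR (- y j) <= 1 by rewrite -expR0 ler_expR oppr_le0.
  have u3 : normc (1 + l ^+ (2 ^ k)) <= 3.
    by apply: (le_trans (ler_normcD _ _)); rewrite normc1; lra.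
  have h1 := one_sub_scaled j c0 c4 n0 s1; rewrite -/l in h1.
  have h2 : t * normc (1 - l) <= 2 / c * (1 + y j).
    apply: (le_trans (ler_wpM2l (ltW t0) h1)).
    have -> : 2 / c * (1 + y j) = 2 / c + 2 * t * chord n j by rewrite /y; field; rewrite gt_eqF.
    have : t * (sg - 1) <= 1 / 2.
      apply: (@le_trans _ _ (t * (2 * t)^-1)); first by rewrite ler_wpM2l ?(ltW t0)//; lra.
      by rewrite le_eqVlt; apply/orP; left; apply/eqP; field; rewrite gt_eqF.
    have : 1 <= 2 / c by rewrite ler_pdivlMr//; lra.
    lra.
  rewrite horner_bump normcM normc_exp normcM normc_exp (_ : normc 2 = 2); last first.
    by rewrite (_ : 2 = (2 : R)%:C%C :> C) ?normc_real ?ger0_norm// rmorphMn rmorph1.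
  rewrite -/t; have h3 := normc_pow_sub1 10 u3; rewrite addrAC subrr add0r in h3.
  have h4 : (t * normc (1 - l)) ^+ 5 <= (2 / c * (1 + y j)) ^+ 5.
    have n1 : 0 <= t * normc (1 - l) by rewrite mulr_ge0 ?normc_ge0 ?(ltW t0).
    by apply: lerXn2r => //; rewrite nnegrE; exact: le_trans h2.
  have h5 := expRN_rat (y0 j).
  have h6 : normc ((1 + l ^+ (2 ^ k)) ^+ 10 - 1) <= 2 * (7 ^+ 7 / (1 + y j) ^+ 7) * 3 ^+ 10.
    apply: (le_trans h3); rewrite ler_wpM2r ?exprn_ge0//; apply: (le_trans u1); rewrite ler_wpM2l//.
  have -> : normc (1 - l) * (D * (t / (1 + y j) ^+ 2)) =
     (t * normc (1 - l)) * ((2 / c * (1 + y j)) ^+ 5 * (2 * (7 ^+ 7 / (1 + y j) ^+ 7) * 3 ^+ 10)).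
    by rewrite /D; field; rewrite ?gt_eqF// ltr_pwDl.
  rewrite exprS -mulrA ler_wpM2l ?mulr_ge0 ?normc_ge0 ?(ltW t0)//.
  by apply: ler_pM; rewrite ?normc_ge0 ?exprn_ge0 ?mulr_ge0 ?normc_ge0 ?(ltW t0).
pose b := c * t / (2 * n%:R); have b0 : 0 <= b by rewrite divr_ge0 ?mulr_ge0 ?(ltW c0) ?(ltW t0) ?(ltW nR).
have b1 : b <= 1.
  rewrite ler_pdivrMr ?mulr_gt0// mul1r; have : t <= n%:R by rewrite -tE ler_nat.
  move: c4; clear -t0 c0; nra.
have yb j : (j < n)%N -> b * j%:R <= y j \/ b * (n - j)%:R <= y j.
  move=> jn; have ct : 0 <= c * t by rewrite mulr_ge0 ?ltW.
  have e (m : nat) : b * m%:R = c * t * (m%:R / (2 * n%:R)) by rewrite /b; ring.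
  by have [h|h] := chord_ge (ltnW jn) n0; [left|right]; rewrite e /y ler_wpM2l.
have := two_sided_decay_sum b0 yb => h.
apply: (@le_trans _ _ (D * (2 * n%:R / c * \sum_(j < n) b / (1 + y j) ^+ 2))).
  rewrite -mulr_sumr ler_wpM2l ?(ltW D0)// mulr_sumr; apply: ler_sum => j _.
  rewrite le_eqVlt; apply/orP; left; apply/eqP; rewrite /b; field.
  by rewrite !gt_eqF// ltr_pwDl.
rewrite -(mulrA D) ler_wpM2l ?(ltW D0)//; have : \sum_(j < n) b / (1 + y j) ^+ 2 <= 4 by lra.
move=> /(ler_wpM2l (_ : 0 <= 2 * n%:R / c)); rewrite divr_ge0 ?mulr_ge0 ?(ltW nR) ?(ltW c0)// => /(_ isT).
by rewrite (_ : 2 * n%:R / c * 4 = 8 / c * n%:R)//; ring.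
Qed.

Lemma flat_admissible c : 0 < c -> c <= 1 / 4 -> admissible c (6 ^+ 9) ((1 - 'X) ^+ 10).
Proof.
move=> c0 c4; exists 2, 0%N; split; first by rewrite ltr1n.
move=> sg n s1 s2 _ n0; exists (fun=> 6 ^+ 9); split=> [j|j jn|]; first by rewrite exprn_ge0.
  have -> (l : C) : ((1 - 'X) ^+ 10 : {poly C}).[l] = (1 - l) ^+ 10 by rewrite !(hornerE, horner_exp).
  rewrite normc_exp exprS ler_wpM2l ?normc_ge0//.
  apply: lerXn2r; rewrite ?nnegrE ?normc_ge0//.
  apply: (le_trans (one_sub_scaled j c0 c4 n0 s1)); have := chord_le2 n j; lra.
by rewrite sumr_const card_ord mulr_natr.
Qed.

(** A node is either in the open disc of radius s = sin gamma = 1 - c^2 / 32 or a convex combination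
    of 1 and a point w of that disc. *)
Lemma Stolz_node c : 0 < c -> c <= 1 / 4 -> exists2 gam : R, 0 < gam < pi / 2 & forall n j, (0 < n)%N -> Stolz gam (node c n n j).
Proof.
move=> c0 c4; pose s : R := 1 - c ^+ 2 / 32.
have s0 : 0 < s by rewrite /s; nra.
have s1 : s < 1 by rewrite /s ltrBlDr ltrDl divr_gt0 ?exprn_gt0.
have sin_s : sin (asin s) = s by apply: asinK; rewrite in_itv/=; apply/andP; split; lra.
exists (asin s).
  apply/andP; split; last by apply: asin_ltpi2; apply/andP; split; lra.
  rewrite -ltr_sin ?sin0 ?sin_s// in_itv/= ?asin_geNpi2 ?asin_lepi2//; try (apply/andP; split; lra).
  by have := @pi_gt0 R => h; apply/andP; split; lra.
move=> n j n0 K HK cK _; rewrite sin_s in HK.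
have K1 : K 1 by apply: HK; left.
have Ks z : normc z < s -> K z by move=> h; apply: HK; right.
have d0 := chord_ge0 n j; have d2 := chord_le2 n j; set dd := chord n j in d0 d2.
have nR : 0 < n%:R :> R by rewrite ltr0n.
have zE : node c n n j = rt n ^+ j * (1 - c * dd)%:C%C by rewrite /node divff ?gt_eqF// mul1r.
have cd : c * dd <= 1 / 2 by have := ler_pM (ltW c0) d0 c4 d2; lra.
(* In (1 - t) 1 + t w the relation t c = 8 dd makes the gain 2 t c dd = 16 dd^2, more than all other
   terms of order dd^2; for t > 1 the node itself is in the disc. *)
pose t := 8 * dd / c; have [t1|t1] := ltP 1 t.
  apply: Ks; rewrite zE normcM normc_rtX mul1r normc_real ger0_norm; last by lra.
  by rewrite /s ltrD2l ltrN2; move: t1; rewrite /t ltr_pdivlMr// mul1r => h; nra.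
have [dz|dz] := eqVneq dd 0.
  have : normc (1 - rt n ^+ j) = 0 by exact: dz.
  by move=> /eq0_normc/subr0_eq e; rewrite zE dz mulr0 subr0 mulr1 -e.
have dp : 0 < dd by rewrite lt_neqAle eq_sym dz.
have tp : 0 < t by rewrite divr_gt0 ?mulr_gt0.
pose w := 1 + (node c n n j - 1) * (t^-1)%:C%C.
have -> : node c n n j = (1 - t)%:C%C * 1 + t%:C%C * w.
  rewrite /w mulrDr !mulr1 mulrCA -(rmorphM (real_complex R)) mulfV ?gt_eqF// rmorph1 mulr1 rmorphB rmorph1; ring.
apply: cK => //; last by rewrite (ltW tp).
apply: Ks; have -> : w = ((t - 1)%:C%C + node c n n j) * (t^-1)%:C%C.
  have tt : t%:C%C * (t^-1)%:C%C = 1 by rewrite -(rmorphM (real_complex R)) mulfV ?gt_eqF// rmorph1.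
  by rewrite /w rmorphB rmorph1 -[X in X + _ = _]tt; ring.
rewrite normcM normc_real ger0_norm ?invr_ge0 ?(ltW tp)// ltr_pdivrMr//.
have st0 : 0 <= s * t by rewrite mulr_ge0 // ltW.
rewrite -(@ltr_pXn2r _ 2) ?nnegrE ?normc_ge0//.
have nz : normc (rt n ^+ j) ^+ 2 = 1 by rewrite normc_rtX expr1n.
have nd : normc (1 - rt n ^+ j) ^+ 2 = dd ^+ 2 by [].
have tE : t * c = 8 * dd by rewrite /t divfK ?gt_eqF.
rewrite zE; clear zE; clearbody w t dd; move: nz nd; rewrite !normc_sqr; case: (rt n ^+ j) => a b /= e1 e2.
have -> : (t - 1 + (a * (1 - c * dd) - b * 0)) ^+ 2 + (0 + (a * 0 + b * (1 - c * dd))) ^+ 2 =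
  (t - 1) ^+ 2 + 2 * (t - 1) * (1 - c * dd) * a + (1 - c * dd) ^+ 2 * (a ^+ 2 + b ^+ 2) by ring.
have ae : a = 1 - dd ^+ 2 / 2 by nra.
have -> : (t - 1) ^+ 2 + 2 * (t - 1) * (1 - c * dd) * a + (1 - c * dd) ^+ 2 * (a ^+ 2 + b ^+ 2) =
   (t - c * dd) ^+ 2 + (1 - t) * (1 - c * dd) * dd ^+ 2 by rewrite e1 ae; field.
have h1 : (1 - t) * (1 - c * dd) * dd ^+ 2 <= dd ^+ 2.
  have cd0 : 0 <= c * dd by rewrite mulr_ge0// ltW.
  by rewrite ler_piMl ?sqr_ge0// mulr_ile1 ?subr_ge0//; lra.
apply: (le_lt_trans (lerD (lexx _) h1)).
have h2 : t ^+ 2 - (s * t) ^+ 2 <= 4 * dd ^+ 2.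
  have -> : t ^+ 2 - (s * t) ^+ 2 = (2 - c ^+ 2 / 32) * (t * c) ^+ 2 / 32 by rewrite /s; field.
  by rewrite tE; have := sqr_ge0 (dd * c); have := sqr_ge0 dd; lra.
have h3 : (t - c * dd) ^+ 2 = t ^+ 2 - 2 * (t * c) * dd + (c * dd) ^+ 2 by ring.
have h4 : (c * dd) ^+ 2 <= dd ^+ 2.
  have c1 : c <= 1 by lra.
  by apply: lerXn2r; rewrite ?nnegrE ?mulr_ge0 ?(ltW c0)// ler_piMl.
have d3 : 0 < dd ^+ 2 by rewrite exprn_gt0.
by rewrite h3 tE; lra.
Qed.

End Contour.

(** * A discrete Cauchy formula for approximate resolvents *)

Section Cauchy.
Context {R : realType}.
Notation C := R[i].
Variable N : {poly C} -> R.
Hypothesis NS : alg_seminorm N.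

Lemma le_ND p q a b : N p <= a -> N q <= b -> N (p + q) <= a + b.
Proof. by move=> pa qb; apply: (le_trans (ND NS _ _)); exact: lerD. Qed.

Lemma le_NN p a : N p <= a -> N (- p) <= a.
Proof. by move=> pa; apply: (le_trans (NN NS _)). Qed.

Lemma le_NM p q a b : N p <= a -> N q <= b -> N (p * q) <= a * b.
Proof. by move=> pa qb; apply: (le_trans (NM NS _ _)); apply: ler_pM; rewrite ?(N_ge0 NS). Qed.

Lemma le_NC x q a b : normc x <= a -> N q <= b -> N (x%:P * q) <= a * b.
Proof. by move=> pa qb; rewrite mul_polyC; apply: (le_trans (NZ NS _ _)); apply: ler_pM; rewrite ?(N_ge0 NS) ?normc_ge0. Qed.

Lemma le_Nsum n (f : nat -> {poly C}) a : (forall j, (j < n)%N -> N (f j) <= a) -> N (\sum_(j < n) f j) <= n%:R * a.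
Proof.
move=> H; apply: (le_trans (N_sum NS _ _ _)).
have -> : n%:R * a = \sum_(j < n) a by rewrite sumr_const card_ord mulr_natl.
by apply: ler_sum => j _; exact: H.
Qed.

Section Cell.
Variables (n : nat) (A B : nat -> C) (a b : nat -> {poly C}) (dl M ep : R).
Hypotheses (dl0 : 0 <= dl) (dl1 : dl <= 1) (M1 : 1 <= M) (epdl : ep <= dl ^+ 2).
Hypotheses (An : A n = A 0) (Bn : B n = B 0) (an : a n = a 0).
Hypotheses (aM : forall j, N (a j) <= M) (bM : forall j, N (b j) <= M).
Hypotheses (ea : forall j, N (1 - ((A j)%:P - 'X) * a j) <= ep) (eb : forall j, N (1 - ((B j)%:P - 'X) * b j) <= ep).
Hypotheses (dA : forall j, normc (A j.+1 - A j) <= dl) (dV : forall j, normc (B j - A j) <= dl).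
Hypothesis ddV : forall j, normc ((B j.+1 - A j.+1) - (B j - A j)) <= dl ^+ 2.

Lemma approx_resolvent (x y : C) (u v : {poly C}) : N u <= M -> N v <= M -> N (1 - (x%:P - 'X) * u) <= ep -> N (1 - (y%:P - 'X) * v) <= ep ->
  N (u - v - (y - x)%:P * (u * v)) <= 2 * M * ep.
Proof.
move=> uM vM eu ev; have -> : u - v - (y - x)%:P * (u * v) = u * (1 - (y%:P - 'X) * v) + - (v * (1 - (x%:P - 'X) * u)).
  by rewrite polyCB; ring.
have -> : 2 * M * ep = M * ep + M * ep by ring.
by apply: le_ND; [|apply: le_NN]; exact: le_NM.
Qed.

(* Summation by parts: what remains of the difference of the two Riemann sums on one cell is of third order. *)
Lemma cell_term j : N ((b j - a j) * (A j.+1 - A j)%:P + b j * ((B j.+1 - A j.+1) - (B j - A j))%:P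
  - (a j.+1 * (B j.+1 - A j.+1)%:P - a j * (B j - A j)%:P)) <= 16 * M ^+ 3 * dl ^+ 3.
Proof.
set V := B j - A j; set V' := B j.+1 - A j.+1; set D := A j.+1 - A j.
pose eta := b j - a j - (- V)%:P * (b j * a j); pose th := a j - a j.+1 - D%:P * (a j * a j.+1).
have M0 : 0 <= M by exact: le_trans M1.
have Neta : N eta <= 2 * M * ep.
  by rewrite /eta /V opprB; exact: approx_resolvent.
have Nth : N th <= 2 * M * ep by exact: approx_resolvent.
have nV : normc V <= dl by exact: dV.
have nV' : normc V' <= dl by exact: dV.
have nNV : normc (- V) <= dl by rewrite normcN'.
have nD : normc D <= dl by exact: dA.
have nW : normc (V' - V) <= dl ^+ 2 by exact: ddV.
have -> : (b j - a j) * D%:P + b j * (V' - V)%:P - (a j.+1 * V'%:P - a j * V%:P) =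
  D%:P * (a j * ((V' - V)%:P * a j.+1 + V%:P * (- (th + D%:P * (a j * a j.+1)) + - (eta + (- V)%:P * (b j * a j)))))
  + (- V)%:P * ((V' - V)%:P * (a j * b j)) + (D%:P * eta + (V' - V)%:P * eta) + V'%:P * th.
  by rewrite /eta /th !(polyCB, polyCN); ring.
apply: le_trans (le_ND (le_ND (le_ND
   (le_NC nD (le_NM (aM j) (le_ND (le_NC nW (aM j.+1)) (le_NC nV
      (le_ND (le_NN (le_ND Nth (le_NC nD (le_NM (aM j) (aM j.+1))))) (le_NN (le_ND Neta (le_NC nNV (le_NM (bM j) (aM j))))))))))
   (le_NC nNV (le_NC nW (le_NM (aM j) (bM j))))) (le_ND (le_NC nD Neta) (le_NC nW Neta))) (le_NC nV' Nth)) _.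
have m2 : M ^+ 2 * dl ^+ 3 <= M ^+ 3 * dl ^+ 3 by rewrite ler_wpM2r ?exprn_ge0// ler_weXn2l.
have m1 : M * dl ^+ 3 <= M ^+ 3 * dl ^+ 3 by rewrite ler_wpM2r ?exprn_ge0// -[leLHS]expr1 ler_weXn2l.
have m24 : M ^+ 2 * dl ^+ 4 <= M ^+ 2 * dl ^+ 3 by rewrite ler_wpM2l ?exprn_ge0// ler_wiXn2l.
have m14 : M * dl ^+ 4 <= M * dl ^+ 3 by rewrite ler_wpM2l// ler_wiXn2l.
have h : (4 * M ^+ 2 * dl ^+ 2 + 4 * M * dl + 2 * M * dl ^+ 2) * ep <= (4 * M ^+ 2 * dl ^+ 2 + 4 * M * dl + 2 * M * dl ^+ 2) * dl ^+ 2.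
  by rewrite ler_wpM2l// !addr_ge0 ?mulr_ge0 ?exprn_ge0.
rewrite [leRHS](_ : _ = 4 * (M ^+ 2 * dl ^+ 4) + 4 * (M * dl ^+ 3) + 2 * (M * dl ^+ 4)) in h; last by ring.
rewrite [leLHS](_ : _ = 2 * (M ^+ 2 * dl ^+ 3) + 2 * (M ^+ 3 * dl ^+ 3) + (4 * M ^+ 2 * dl ^+ 2 + 4 * M * dl + 2 * M * dl ^+ 2) * ep); last by ring.
rewrite -(mulrA 16); set X := M ^+ 3 * dl ^+ 3 in m2 m1 *; set Y := M ^+ 2 * dl ^+ 3 in m2 m24 *; set Z := M * dl ^+ 3 in m1 m14 h *.
have X0 : 0 <= X by rewrite mulr_ge0 ?exprn_ge0.
by lra.
Qed.

(** The telescoping part vanishes because both polygons are closed, so only the n third-order terms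
    remain: order n^-2 for neighbouring polygons, which survives the n steps of the deformation. *)
Lemma cell_sum : N (\sum_(j < n) (B j.+1 - B j)%:P * b j - \sum_(j < n) (A j.+1 - A j)%:P * a j) <= n%:R * (16 * M ^+ 3 * dl ^+ 3).
Proof.
have tel : \sum_(j < n) (a j.+1 * (B j.+1 - A j.+1)%:P - a j * (B j - A j)%:P) = 0.
  rewrite -(big_mkord xpredT (fun j => a j.+1 * (B j.+1 - A j.+1)%:P - a j * (B j - A j)%:P)).
  by rewrite (telescope_sumr (fun j => a j * (B j - A j)%:P))// an An Bn subrr.
rewrite -[X in N X]subr0 -[X in _ - X]tel -!sumrB.
pose f j := (b j - a j) * (A j.+1 - A j)%:P + b j * ((B j.+1 - A j.+1) - (B j - A j))%:P - (a j.+1 * (B j.+1 - A j.+1)%:P - a j * (B j - A j)%:P).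
rewrite (eq_bigr (fun j : 'I_n => f j)); last by move=> j _; rewrite /f !polyCB; ring.
by apply: le_Nsum => j _; exact: cell_term.
Qed.

End Cell.

(** A second-order Taylor bound. Summed over a closed polygon the differences of powers telescope,
    so the Riemann sum of lambda^a tends to 0. *)
Lemma power_increment a : exists2 c : R, 0 <= c & forall x y : C, normc x <= 2 -> normc y <= 2 ->
  normc (x ^+ a.+1 - y ^+ a.+1 - a.+1%:R * y ^+ a * (x - y)) <= c * normc (x - y) ^+ 2.
Proof.
elim: a => [|a [c c0 IH]].
  by exists 0 => // x y _ _; rewrite !expr1 expr0 mulr1 mul1r subrr normc0 mul0r.
exists (2 * c + a.+1%:R * 2 ^+ a); first by rewrite addr_ge0 ?mulr_ge0 ?exprn_ge0.
move=> x y x2 y2.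
have -> : x ^+ a.+2 - y ^+ a.+2 - a.+2%:R * y ^+ a.+1 * (x - y) =
   x * (x ^+ a.+1 - y ^+ a.+1 - a.+1%:R * y ^+ a * (x - y)) + (a.+1%:R * y ^+ a) * (x - y) ^+ 2.
  by rewrite -(natr1 a.+1) !exprS; ring.
apply: (le_trans (ler_normcD _ _)); rewrite mulrDl; apply: lerD.
  by rewrite normcM -(mulrA 2); apply: ler_pM; rewrite ?normc_ge0//; exact: IH.
rewrite normcM normc_exp ler_wpM2r ?exprn_ge0 ?normc_ge0// normcM normc_exp.
have -> : normc (a.+1%:R : C) = a.+1%:R.
  by rewrite (_ : a.+1%:R = (a.+1%:R : R)%:C%C) ?normc_real ?ger0_norm// rmorph_nat.
by rewrite ler_wpM2l//; apply: lerXn2r; rewrite ?nnegrE ?normc_ge0.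
Qed.

Lemma root_sum n m : (0 < n)%N -> (0 < m)%N -> (m < n)%N -> \sum_(j < n) (rt n ^+ j) ^+ m = 0 :> C.
Proof.
move=> n0 m0 mn; set w : C := rt n ^+ m.
have w1 : 1 - w != 0.
  have : 0 < chord n m :> R.
    have [h|h] := @chord_ge R n m (ltnW mn) n0; apply: lt_le_trans h; rewrite divr_gt0 ?mulr_gt0 ?ltr0n ?subn_gt0//.
  by rewrite /chord -/w; apply: contraTneq => ->; rewrite normc0 ltxx.
have := subrX1 w n; rewrite {1}/w exprAC rt_period// expr1n subrr => /esym/eqP.
rewrite mulf_eq0 -opprB oppr_eq0 (negPf w1)/= => /eqP h; rewrite -[RHS]h.
by apply: eq_bigr => j _; rewrite /w exprAC.
Qed.

Section Grid.
Variables (c sg M : R).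
Hypotheses (c0 : 0 < c) (c4 : c <= 1 / 4) (sg1 : 1 < sg) (sg2 : sg <= 2) (M1 : 1 <= M).
Let pt n i j : C := sg%:C%C * node c n i j.
Let M0 : 0 <= M. Proof. exact: le_trans M1. Qed.
Let s0 : 0 <= sg. Proof. by rewrite ltW// (lt_trans ltr01). Qed.

(** The accuracy n^-3 is below the square of the mesh, as [cell_sum] requires, and still beats the
    factor n^2 that appears on the circle. M is uniform in n but not in sg. *)
Definition grid_resolvent n (rr : nat -> nat -> {poly C}) := [/\ forall i, rr i n = rr i 0,
  forall i j, (i <= n)%N -> N (rr i j) <= M &
  forall i j, (i <= n)%N -> N (1 - ((sg%:C%C * node c n i j)%:P - 'X) * rr i j) <= n%:R^-1 ^+ 3].

Let big := 16 * M ^+ 3 * 32 ^+ 3.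

Lemma normc_pt n i j : (0 < n)%N -> (i <= n)%N -> normc (pt n i j) <= 2.
Proof.
move=> n0 ni; rewrite normcM normc_real ger0_norm// -[leRHS]mulr1; apply: ler_pM; rewrite ?normc_ge0//.
exact: normc_node.
Qed.

Lemma pt_diff n i j i' j' a : normc (node c n i j - node c n i' j') <= a -> normc (pt n i j - pt n i' j') <= 2 * a.
Proof.
move=> h; rewrite /pt -mulrBr normcM normc_real ger0_norm//; apply: ler_pM; rewrite ?normc_ge0//.
Qed.

Lemma pt_step n i j : (0 < n)%N -> (i <= n)%N -> normc (pt n i j.+1 - pt n i j) <= 32 / n%:R.
Proof.
move=> n0 ni; apply: le_trans (pt_diff (node_step c0 c4 n0 j ni)) _.
have := @chord1_le R n n0; have -> : 32 / n%:R = 4 * (8 / n%:R) :> R by ring.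
lra.
Qed.

Lemma pt_up n i j : (0 < n)%N -> (i < n)%N -> normc (pt n i.+1 j - pt n i j) <= 32 / n%:R.
Proof.
move=> n0 ni; apply: le_trans (pt_diff (node_up c0 n0 j ni)) _.
rewrite mulrA ler_wpM2r ?invr_ge0//; have := @chord_le2 R n j => h.
have := ler_pM (ltW c0) (@chord_ge0 R n j) c4 h; lra.
Qed.

Lemma pt_upstep n i j : (0 < n)%N -> (i < n)%N ->
  normc ((pt n i.+1 j.+1 - pt n i j.+1) - (pt n i.+1 j - pt n i j)) <= (32 / n%:R) ^+ 2.
Proof.
move=> n0 ni; have -> : pt n i.+1 j.+1 - pt n i j.+1 - (pt n i.+1 j - pt n i j) =
  sg%:C%C * ((node c n i.+1 j.+1 - node c n i j.+1) - (node c n i.+1 j - node c n i j)) by rewrite /pt; ring.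
rewrite normcM normc_real ger0_norm//.
apply: le_trans (ler_pM s0 (normc_ge0 _) sg2 (node_upstep c0 c4 n0 j ni)) _.
have h := @chord1_le R n n0; have i0 : 0 <= n%:R^-1 :> R by rewrite invr_ge0.
have := ler_wpM2r i0 h; have : 0 <= n%:R^-1 * n%:R^-1 :> R by rewrite mulr_ge0.
rewrite exprMn expr2 -mulrA -[_ ^+ 2]/(n%:R^-1 * n%:R^-1).
move=> h1 h2; have e : 8 / n%:R / n%:R = 8 * (n%:R^-1 / n%:R) :> R by rewrite -mulrA.
by rewrite e in h2; lra.
Qed.

Lemma homotopy n rr : (32 <= n)%N -> grid_resolvent n rr ->
  N (\sum_(j < n) (pt n n j.+1 - pt n n j)%:P * rr n j - \sum_(j < n) (pt n 0 j.+1 - pt n 0 j)%:P * rr 0 j) <= big / n%:R.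
Proof.
move=> n32 [per rM re]; have n0 : (0 < n)%N by exact: leq_trans n32.
have nR : 0 < n%:R :> R by rewrite ltr0n.
pose I i := \sum_(j < n) (pt n i j.+1 - pt n i j)%:P * rr i j.
have step i : (i < n)%N -> N (I i.+1 - I i) <= n%:R * (16 * M ^+ 3 * (32 / n%:R) ^+ 3).
  move=> ni; have i0 : 0 <= n%:R^-1 :> R by rewrite invr_ge0.
  have i1 : n%:R^-1 <= 1 :> R by rewrite invf_le1// ler1n.
  have d0 : 0 <= 32 / n%:R :> R by rewrite mulr_ge0.
  have d1 : 32 / n%:R <= 1 :> R by rewrite ler_pdivrMr// mul1r ler_nat.
  have ed : n%:R^-1 ^+ 3 <= (32 / n%:R) ^+ 2 :> R.
    by rewrite exprMn exprS ler_wpM2r ?exprn_ge0// (le_trans i1)// exprn_ege1// ler1n.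
  have An : pt n i n = pt n i 0 by rewrite /pt node_period.
  have Bn : pt n i.+1 n = pt n i.+1 0 by rewrite /pt node_period.
  have H := @cell_sum n (pt n i) (pt n i.+1) (rr i) (rr i.+1) _ M _ d0 d1 M1 ed An Bn (per i).
  apply: H => j.
  - exact: rM (ltnW ni).
  - exact: rM.
  - exact: re (ltnW ni).
  - exact: re.
  - exact: pt_step (ltnW ni).
  - exact: pt_up.
  - exact: pt_upstep.
rewrite -/(I n) -/(I 0) -(telescope_sumr _ (leq0n n)) big_mkord.
apply: (le_trans (@le_Nsum n (fun i => I i.+1 - I i) _ step)).
rewrite le_eqVlt; apply/orP; left; apply/eqP; rewrite /big; field; by rewrite gt_eqF.
Qed.

(* On the circle l_j^n = sg^n, so rr_j (sg^n - X^n) is nearly a geometric sum in l_j and X, and summing over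
   the n-th roots of unity only leaves the constant term. *)
Lemma base_circle n rr : (0 < n)%N -> grid_resolvent n rr ->
  N (n%:R - \sum_(j < n) (pt n 0 j)%:P * rr 0 j) <= 2 * M / (sg - 1) + 2.
Proof.
move=> n0 [per rM re]; have nR : 0 < n%:R :> R by rewrite ltr0n.
set S := \sum_(j < n) _; pose G j := \sum_(a < n) (pt n 0 j ^+ (n.-1 - a))%:P * 'X^a : {poly C}.
pose e j := 1 - ((pt n 0 j)%:P - 'X) * rr 0 j.
have ptE j : pt n 0 j = sg%:C%C * rt n ^+ j by rewrite /pt node_base.
have ptn j : pt n 0 j ^+ n = (sg ^+ n)%:C%C.
  by rewrite ptE exprMn exprAC rt_period// expr1n mulr1 rmorphXn.
have GE j : (sg ^+ n)%:C%C%:P - 'X^n = ((pt n 0 j)%:P - 'X) * G j.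
  by rewrite -(ptn j) polyC_exp subrXX; congr (_ * _); apply: eq_bigr => a _; rewrite polyC_exp.
have sumG : \sum_(j < n) (pt n 0 j)%:P * G j = (n%:R * sg ^+ n)%:C%C%:P.
  under eq_bigr do rewrite /G mulr_sumr.
  rewrite exchange_big/= (bigD1 (Ordinal n0))//= [X in _ + X]big1 ?addr0 => [|a an].
    under eq_bigr do rewrite expr0 mulr1 subn0 -polyCM -exprS prednK// ptn.
    by rewrite sumr_const card_ord rmorphM rmorph_nat polyCM polyC_natr mulr_natl.
  have a0 : (0 < a)%N by rewrite lt0n; apply: contra an => /eqP a0; apply/eqP/val_inj.
  have an' : (a <= n.-1)%N by rewrite -ltnS prednK.
  under eq_bigr do rewrite mulrA -polyCM -exprS -subSn// ?prednK// ptE exprMn polyCM -mulrA mulrCA.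
  rewrite -mulr_suml -(raddf_sum (@polyC C)) root_sum ?mul0r// ?subn_gt0// ltn_subrL a0 n0//.
have id_S : (sg ^+ n)%:C%C%:P * (n%:R - S) = - (S * 'X^n) + \sum_(j < n) (pt n 0 j)%:P * (e j * G j).
  have h : \sum_(j < n) (pt n 0 j)%:P * (rr 0 j * ((sg ^+ n)%:C%C%:P - 'X^n)) = \sum_(j < n) ((pt n 0 j)%:P * G j - (pt n 0 j)%:P * (e j * G j)).
    by apply: eq_bigr => j _; rewrite (GE j) /e; ring.
  have h2 : S * ((sg ^+ n)%:C%C%:P - 'X^n) = (n%:R * sg ^+ n)%:C%C%:P - \sum_(j < n) (pt n 0 j)%:P * (e j * G j).
    by rewrite -sumG -sumrB -h /S mulr_suml; apply: eq_bigr => j _; rewrite mulrA.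
  have -> : \sum_(j < n) (pt n 0 j)%:P * (e j * G j) = (n%:R * sg ^+ n)%:C%C%:P - S * ((sg ^+ n)%:C%C%:P - 'X^n) by rewrite h2; ring.
  by rewrite rmorphM rmorph_nat polyCM polyC_natr; ring.
have sgn : 0 < sg ^+ n by rewrite exprn_gt0// (lt_trans ltr01).
have p2 j : normc (pt n 0 j) <= 2 by exact: normc_pt.
have NSum : N S <= n%:R * (2 * M) by apply: (@le_Nsum n (fun j => (pt n 0 j)%:P * rr 0 j)) => j jn; apply: le_NC => //; exact: rM.
have NG j : N (G j) <= n%:R * sg ^+ n.
  apply: (@le_Nsum n (fun a => (pt n 0 j ^+ (n.-1 - a))%:P * 'X^a)) => a an; rewrite -[leRHS]mulr1.
  apply: le_NC; last exact: NX.
  rewrite normc_exp ptE normcM normc_rtX mulr1 normc_real ger0_norm//.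
  by rewrite ler_weXn2l ?(ltW sg1)// (leq_trans (leq_subr _ _))// leq_pred.
have Ne : N (\sum_(j < n) (pt n 0 j)%:P * (e j * G j)) <= n%:R * (2 * (n%:R^-1 ^+ 3 * (n%:R * sg ^+ n))).
  apply: (@le_Nsum n (fun j => (pt n 0 j)%:P * (e j * G j))) => j jn; apply: le_NC => //; apply: le_NM => //; exact: re.
have h : sg ^+ n * N (n%:R - S) <= n%:R * (2 * M) * 1 + n%:R * (2 * (n%:R^-1 ^+ 3 * (n%:R * sg ^+ n))).
  have hE : n%:R - S = ((sg ^+ n)^-1)%:C%C%:P * ((sg ^+ n)%:C%C%:P * (n%:R - S)).
    by rewrite mulrA -polyCM -(rmorphM (real_complex R)) mulVf ?gt_eqF// rmorph1 mul1r.
  have hb := le_ND (le_NN (le_NM NSum (NX NS n))) Ne; rewrite -id_S in hb.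
  have := le_NC (lexx (normc (((sg ^+ n)^-1)%:C%C : C))) hb; rewrite -hE normc_real ger0_norm ?invr_ge0 ?(ltW sgn)//.
  by move=> hh; rewrite -ler_pdivlMl.
have bern : n%:R * (sg - 1) <= sg ^+ n.
  elim: (n) => [|k IH]; first by rewrite mul0r expr0.
  have -> : k.+1%:R * (sg - 1) = k%:R * (sg - 1) + (sg - 1) by rewrite -natr1; ring.
  have -> : sg ^+ k.+1 = sg ^+ k + (sg - 1) * sg ^+ k by rewrite exprS; ring.
  by apply: lerD => //; rewrite ler_peMr ?subr_ge0 ?(ltW sg1)// exprn_ege1// ltW.
have n1 : 1 <= n%:R :> R by rewrite ler1n.
rewrite -(ler_pM2l sgn); apply: (le_trans h).
have s1 : 0 < sg - 1 by rewrite subr_gt0.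
rewrite mulrDr; apply: lerD.
  rewrite mulr1 (_ : sg ^+ n * (2 * M / (sg - 1)) = sg ^+ n * (2 * M) / (sg - 1)) ?ler_pdivlMr//; last by ring.
  by rewrite mulrAC ler_wpM2r// mulr_ge0.
have -> : n%:R * (2 * (n%:R^-1 ^+ 3 * (n%:R * sg ^+ n))) = n%:R^-1 * (sg ^+ n * 2) by field; rewrite gt_eqF.
by rewrite ler_piMl ?mulr_ge0 ?(ltW sgn)// invf_le1.
Qed.

Let bigger := big + 8 * (2 * M / (sg - 1) + 2).

(** On the circle every increment is rt n - 1 times the node, so [base_circle] evaluates the sum.
    The number n (rt n - 1) takes the place of 2 pi i and is divided out later. *)
Lemma winding n rr : (32 <= n)%N -> grid_resolvent n rr ->
  N (\sum_(j < n) (pt n n j.+1 - pt n n j)%:P * rr n j - (n%:R * (rt n - 1))%:P) <= bigger / n%:R.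
Proof.
move=> n32 grr; have n0 : (0 < n)%N by exact: leq_trans n32.
have nR : 0 < n%:R :> R by rewrite ltr0n.
have h1 := homotopy n32 grr; have h2 := base_circle n0 grr.
have e : \sum_(j < n) (pt n 0 j.+1 - pt n 0 j)%:P * rr 0 j = (rt n - 1)%:P * \sum_(j < n) (pt n 0 j)%:P * rr 0 j.
  rewrite mulr_sumr; apply: eq_bigr => j _; rewrite mulrA -polyCM; congr (_%:P * _).
  by rewrite /pt !node_base exprS; ring.
have h3 : normc (- (rt n - 1)) <= 8 / n%:R :> R.
  by rewrite opprB; have := @chord1_le R n n0; rewrite /chord expr1.
have := le_ND h1 (le_NC h3 h2); rewrite e.
set S := \sum_(j < n) (pt n 0 j)%:P * rr 0 j; set S' := \sum_(j < n) _.
have -> : S' - (rt n - 1)%:P * S + (- (rt n - 1))%:P * (n%:R - S) = S' - (n%:R * (rt n - 1))%:P.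
  by rewrite polyCN polyCM polyC_natr; ring.
by have -> : bigger / n%:R = big / n%:R + 8 / n%:R * (2 * M / (sg - 1) + 2) by rewrite /bigger; ring.
Qed.

Lemma power_sum a : exists2 D, 0 <= D & forall n, (32 <= n)%N ->
  normc (\sum_(j < n) (pt n n j.+1 - pt n n j) * pt n n j ^+ a) <= D / n%:R.
Proof.
have [D D0 H] := power_increment a; exists (D * 32 ^+ 2); first by rewrite mulr_ge0 ?exprn_ge0.
move=> n n32; have n0 : (0 < n)%N by exact: leq_trans n32.
have nR : 0 < n%:R :> R by rewrite ltr0n.
have tel : \sum_(j < n) (pt n n j.+1 ^+ a.+1 - pt n n j ^+ a.+1) = 0.
  rewrite -(big_mkord xpredT (fun j => pt n n j.+1 ^+ a.+1 - pt n n j ^+ a.+1)) (telescope_sumr (fun j => pt n n j ^+ a.+1))//.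
  by rewrite /pt node_period// subrr.
have nz : normc (a.+1%:R : C) = a.+1%:R.
  by rewrite (_ : a.+1%:R = (a.+1%:R : R)%:C%C) ?normc_real ?ger0_norm// rmorph_nat.
apply: (@le_trans _ _ (a.+1%:R * normc (\sum_(j < n) (pt n n j.+1 - pt n n j) * pt n n j ^+ a))).
  by rewrite ler_peMl ?normc_ge0// ler1n.
rewrite -nz -normcM -normcN' -[X in normc (- X)]subr0 -[X in _ - X]tel opprB mulr_sumr -sumrB.
apply: (le_trans (normc_sum _ _)); apply: (@le_trans _ _ (\sum_(j < n) D * (32 / n%:R) ^+ 2)).
  apply: ler_sum => j _; rewrite (_ : _ - _ = pt n n j.+1 ^+ a.+1 - pt n n j ^+ a.+1 - a.+1%:R * pt n n j ^+ a * (pt n n j.+1 - pt n n j)); last by ring.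
  apply: le_trans (H _ _ (normc_pt _ n0 (leqnn n)) (normc_pt _ n0 (leqnn n))) _.
  rewrite ler_wpM2l//; apply: lerXn2r; rewrite ?nnegrE ?normc_ge0 ?mulr_ge0 ?invr_ge0//; exact: pt_step.
rewrite sumr_const card_ord -mulr_natr le_eqVlt; apply/orP; left; apply/eqP; field; by rewrite gt_eqF.
Qed.

(** Induction through lambda r = 1 - e + X r, where e is the error of the resolvent: the constant
    contributes a Riemann sum of lambda^a, which is small, and the last term is X times the previous
    case. *)
Lemma cauchy_monomial a : exists2 D, 0 <= D & forall n rr, (32 <= n)%N -> grid_resolvent n rr ->
  N (\sum_(j < n) ((pt n n j.+1 - pt n n j) * pt n n j ^+ a)%:P * rr n j - (n%:R * (rt n - 1))%:P * 'X^a) <= D / n%:R.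
Proof.
elim: a => [|a [D D0 IH]].
  exists bigger => [|n rr n32 grr].
    by rewrite addr_ge0 ?mulr_ge0 ?exprn_ge0 ?addr_ge0 ?mulr_ge0 ?invr_ge0 ?subr_ge0 ?(ltW sg1).
  rewrite expr0 mulr1; under eq_bigr do rewrite expr0 mulr1; exact: winding.
have [E E0 HE] := power_sum a.
exists (E + 32 * 2 ^+ a + D) => [|n rr n32 grr]; first by rewrite !addr_ge0 ?mulr_ge0 ?exprn_ge0.
have n0 : (0 < n)%N by exact: leq_trans n32.
have nR : 0 < n%:R :> R by rewrite ltr0n.
have [per rM re] := grr; pose e j := 1 - ((pt n n j)%:P - 'X) * rr n j.
pose w j := (pt n n j.+1 - pt n n j) * pt n n j ^+ a.
have -> : \sum_(j < n) ((pt n n j.+1 - pt n n j) * pt n n j ^+ a.+1)%:P * rr n j =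
   (\sum_(j < n) w j)%:P - \sum_(j < n) (w j)%:P * e j + 'X * \sum_(j < n) (w j)%:P * rr n j.
  rewrite (raddf_sum (@polyC C)) mulr_sumr -sumrB -big_split/=; apply: eq_bigr => j _.
  by rewrite /e /w exprSr !polyCM; ring.
have -> (u v y : {poly C}) : u - v + 'X * y - (n%:R * (rt n - 1))%:P * 'X^(a.+1) =
  u * 1 - v + 'X * (y - (n%:R * (rt n - 1))%:P * 'X^a) by rewrite exprS; ring.
have -> : (E + 32 * 2 ^+ a + D) / n%:R = E / n%:R + 32 * 2 ^+ a / n%:R + 1 * (D / n%:R) by ring.
apply: le_ND.
  apply: le_ND; first by rewrite -[leRHS]mulr1; apply: le_NC; [exact: HE|exact: (N1 NS)].
  apply: le_NN; apply: (le_trans (@le_Nsum n (fun j => (w j)%:P * e j) (32 / n%:R * 2 ^+ a * n%:R^-1 ^+ 3) _)) => [j jn|].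
    apply: le_NC; last exact: re.
    rewrite normcM normc_exp; apply: ler_pM; rewrite ?exprn_ge0 ?normc_ge0//; first exact: pt_step.
    by apply: lerXn2r; rewrite ?nnegrE ?normc_ge0//; exact: normc_pt.
  have -> (v : R) : n%:R * (32 / n%:R * v * n%:R^-1 ^+ 3) = (n%:R^-1 * n%:R^-1) * (32 * v / n%:R) by field; rewrite gt_eqF.
  have i1 : n%:R^-1 <= 1 :> R by rewrite invf_le1// ler1n.
  by rewrite ler_piMl ?mulr_ge0 ?invr_ge0 ?exprn_ge0// mulr_ile1 ?invr_ge0.
apply: le_NM; last exact: IH.
by rewrite -['X]expr1; exact: NX.
Qed.

Lemma cauchy_formula (h : {poly C}) : exists D, forall n rr, (32 <= n)%N -> grid_resolvent n rr ->
  N (\sum_(j < n) ((pt n n j.+1 - pt n n j) * h.[pt n n j])%:P * rr n j - (n%:R * (rt n - 1))%:P * h) <= D / n%:R.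
Proof.
have /boolp.choice[D HD] : forall a, exists D, forall n rr, (32 <= n)%N -> grid_resolvent n rr ->
  N (\sum_(j < n) ((pt n n j.+1 - pt n n j) * pt n n j ^+ a)%:P * rr n j - (n%:R * (rt n - 1))%:P * 'X^a) <= D / n%:R.
  by move=> a; have [D _ HD] := cauchy_monomial a; exists D.
exists (\sum_(a < size h) normc h`_a * D a) => n rr n32 grr; rewrite mulr_suml.
have -> : (n%:R * (rt n - 1))%:P * h = \sum_(a < size h) (h`_a)%:P * ((n%:R * (rt n - 1))%:P * 'X^a).
  by rewrite -[in LHS](coefK h) poly_def mulr_sumr; apply: eq_bigr => a _; rewrite -mul_polyC mulrCA.
have -> : \sum_(j < n) ((pt n n j.+1 - pt n n j) * h.[pt n n j])%:P * rr n j =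
   \sum_(a < size h) (h`_a)%:P * \sum_(j < n) ((pt n n j.+1 - pt n n j) * pt n n j ^+ a)%:P * rr n j.
  under [RHS]eq_bigr do rewrite mulr_sumr.
  rewrite exchange_big/=; apply: eq_bigr => j _; rewrite horner_coef mulr_sumr (raddf_sum (@polyC C)) mulr_suml.
  by apply: eq_bigr => a _; rewrite [RHS]mulrA -polyCM [in RHS]mulrCA.
rewrite -sumrB; apply: (le_trans (N_sum NS _ _ _)); apply: ler_sum => a _; rewrite -mulrA.
rewrite -mulrBr; apply: le_NC; [exact: lexx|exact: HD].
Qed.

End Grid.
End Cauchy.

(** * Square functions *)

Section Contour.
Context {d : measure_display} {Omega : measurableType d} {R : realType}.
Variable mu : {measure set Omega -> \bar R}.
Variable p : R.
Hypothesis p1 : 1 < p.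
Notation C := R[i].
Notation Lp := (inLp mu p).
Notation cn := (cn mu p).
Notation mn := (mn mu p).
Variable T : (Omega -> C) -> Omega -> C.
Hypothesis aT : analytic_operator mu p T.
Hypothesis rT : contractively_regular mu p T.
Notation N := (opn mu p T).
Notation Qb := (Qb mu p T).

Let bT : bounded_operator_Lp mu p T. Proof. by case: aT. Qed.
Notation NS := (opn_seminorm p1 aT rT).

(** The dilation sg > 1 keeps the contour away from 1 at the price of resolvent norms of order 1 /
    (sg - 1). These enter only the error of the Cauchy formula, which n makes small afterwards,
    whereas the R-bound B depends neither on sg nor on n. *)
Lemma approximate_contour : exists c B, [/\ 0 < c, c <= 1 / 4, 0 < B & forall sg, 1 < sg -> sg <= 2 ->
  forall (hs : seq {poly C}) e, 0 < e -> exists n0, forall n, (n0 <= n)%N -> (0 < n)%N -> exists (rr : 'I_n -> {poly C}) (w : 'I_n -> C),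
  [/\ forall j, normc (w j) <= 64 / n%:R,
    forall h, h \in hs -> N (h - \sum_j (w j * h.[sg%:C%C * node c n n j]) *: rr j) <= e &
    forall (A : finType) (r : seq A) (f : A -> 'I_n),
      Qb l2 r (fun a => (normc (sg%:C%C * node c n n (f a) - 1))%:C%C *: rr (f a)) B]].
Proof.
have [K NK] := opn_analytic p1 aT rT.
have [B [d0 [B0 d00 d02 HB]]] := resolvents_R_bounded p1 aT rT NK.
pose c := d0 / 2; have c0 : 0 < c by rewrite divr_gt0.
have c4 : c <= 1 / 4 by rewrite /c; lra.
exists c, B; split=> // sg sg1 sg2 hs e e0.
pose M := 1 + 2 * B / (sg - 1).
have s1 : 0 < sg - 1 by rewrite subr_gt0.
have M1 : 1 <= M by rewrite lerDl divr_ge0 ?mulr_ge0 ?(ltW B0) ?(ltW s1).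
have /boolp.choice[D HD] : forall h : {poly C}, exists n0, forall n rr, (n0 <= n)%N -> grid_resolvent N c sg M n rr ->
    2 * N (\sum_(j < n) ((sg%:C%C * node c n n j.+1 - sg%:C%C * node c n n j) * h.[sg%:C%C * node c n n j])%:P * rr n j
         - (n%:R * (rt n - 1))%:P * h) <= e.
  move=> h; have [D HD] := cauchy_formula NS c0 c4 sg1 sg2 M1 h.
  exists (maxn 32 (Num.truncn (2 * `|D| / e)).+1) => n rr; rewrite geq_max => /andP[n32 nD] grr.
  have nR : 0 < n%:R :> R by rewrite ltr0n (leq_trans _ n32).
  apply: (le_trans (ler_wpM2l (ler0n R 2) (HD n rr n32 grr))).
  have nD' : (Num.truncn (2 * `|D| / e)).+1%:R <= n%:R :> R by rewrite ler_nat.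
  have := truncnS_gt (2 * `|D| / e) => h1.
  rewrite mulrA ler_pdivrMr//; apply: (@le_trans _ _ (2 * `|D|)); first by rewrite ler_wpM2l// ler_norm.
  by have := ltW (lt_le_trans h1 nD'); rewrite ler_pdivrMr// (mulrC n%:R).
exists (maxn 32 (\max_(h <- hs) D h)) => n; rewrite geq_max => /andP[n32 nD] n0.
have nR : 0 < n%:R :> R by rewrite ltr0n.
case: n n0 n32 nD nR => // n n0 n32 nD nR.
pose l (ji : 'I_n.+1 * 'I_n.+2) : C := sg%:C%C * rt n.+1 ^+ ji.1.
pose m (ji : 'I_n.+1 * 'I_n.+2) : C := sg%:C%C * node c n.+1 ji.2 ji.1.
have sg0 : 0 <= sg by rewrite ltW// (lt_trans ltr01).
have ln ji : normc (l ji) = sg by rewrite normcM normc_rtX normc_real ger0_norm ?mulr1.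
have l1 ji : l ji != 1.
  by apply/negP => /eqP h; move: sg1; rewrite -(ln ji) h normc1 ltxx.
have lge ji : 1 <= normc (l ji) by rewrite ln ltW.
have l4 ji : normc (l ji) <= 4 by rewrite ln (le_trans sg2)// ler_nat.
have ni (i : 'I_n.+2) : (i <= n.+1)%N by rewrite -ltnS.
have ml ji : normc (m ji - l ji) <= d0 * normc (l ji - 1).
  have [h1 _] := chord_le_scaled n.+1 ji.1 (ltW sg1).
  rewrite -mulrBr normcM normc_real ger0_norm//.
  apply: (le_trans (ler_pM sg0 (normc_ge0 _) sg2 (node_near c0 n0 ji.1 (ni ji.2)))).
  have -> : 2 * (c * chord n.+1 ji.1) = d0 * chord n.+1 ji.1 by rewrite /c; field.
  by rewrite ler_wpM2l// ltW.
have i3 : 0 < n.+1%:R^-1 ^+ 3 :> R by rewrite exprn_gt0// invr_gt0.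
have [rr0 [E0 Q0]] := HB _ l m l1 lge l4 ml _ i3.
(* The second index is reduced modulo the number of nodes, which makes the family of resolvents
   periodic by construction. *)
pose mk (i j : nat) : 'I_n.+1 * 'I_n.+2 := (Ordinal (ltn_pmod j n0), inord i).
pose rr i j := rr0 (mk i j).
have mkE i j : (i <= n.+1)%N -> m (mk i j) = sg%:C%C * node c n.+1 i j.
  move=> ii; rewrite /m /node /chord /mk /= inordK ?ltnS//.
  by rewrite (expr_mod _ (@rt_period R n.+1 n0)).
have grr : grid_resolvent N c sg M n.+1 rr.
  split=> [i|i j ii|i j ii]; first by rewrite /rr /mk; congr (rr0 (_, _)); apply/val_inj; rewrite /= modnn mod0n.
    have h := Qb_single p1 bT rT (ltW B0) (Q0 _ [:: mk i j] id).
    have h2 : (sg - 1) / 2 <= normc (m (mk i j) - 1).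
      have [_ h1] := chord_le_scaled n.+1 (mk i j).1 (ltW sg1).
      have h3 := ler_normcD (m (mk i j) - 1) (- (m (mk i j) - l (mk i j))).
      rewrite normcN' (_ : m (mk i j) - 1 - _ = l (mk i j) - 1) in h3; last by ring.
      have := ml (mk i j); have := normc_ge0 (l (mk i j) - 1); rewrite -/(l _) in h1; nra.
    have h4 : 0 < normc (m (mk i j) - 1) by apply: lt_le_trans h2; rewrite divr_gt0.
    have -> : rr i j = ((normc (m (mk i j) - 1))^-1)%:C%C *: ((normc (m (mk i j) - 1))%:C%C *: rr0 (mk i j)).
      by rewrite scalerA -(rmorphM (real_complex R)) mulVf ?gt_eqF// rmorph1 scale1r.
    apply: (le_trans (NZ NS _ _)); rewrite normc_real ger0_norm ?invr_ge0 ?normc_ge0//.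
    apply: (@le_trans _ _ ((2 / (sg - 1)) * B)); last by rewrite /M mulrAC lerDr.
    apply: ler_pM => //; rewrite ?invr_ge0 ?normc_ge0 ?(N_ge0 NS)//.
    by rewrite -[2 / _]invf_div lef_pV2 ?posrE ?divr_gt0.
  by rewrite -(mkE i j ii); exact: E0.
(* A crude lower bound for the substitute of 2 pi; with it the weights are at most 2 times 32 /
   n. *)
have k1 : 1 / 2 <= normc (n.+1%:R * (rt n.+1 - 1) : C).
  have nz : normc (n.+1%:R : C) = n.+1%:R.
    by rewrite (_ : n.+1%:R = (n.+1%:R : R)%:C%C) ?normc_real ?ger0_norm// rmorph_nat.
  rewrite normcM nz.
  have := @chord_ge_left R n.+1 1; rewrite /chord expr1 -normcN' opprB => /(_ (leq_trans (isT : (2 <= 32)%N) n32) n0) h.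
  apply: le_trans (ler_wpM2l (ltW nR) h); rewrite le_eqVlt; apply/orP; left; apply/eqP; field; by rewrite gt_eqF.
set ka := n.+1%:R * (rt n.+1 - 1) : C in k1 *.
have ka0 : ka != 0 by apply: contraTneq k1 => ->; rewrite normc0 -ltNge divr_gt0.
have ki : normc ka^-1 <= 2.
  by rewrite normcV -[leRHS]invrK lef_pV2 ?posrE ?invr_gt0//; lra.
exists (fun j : 'I_n.+1 => rr n.+1 j), (fun j : 'I_n.+1 => ka^-1 * (sg%:C%C * node c n.+1 n.+1 j.+1 - sg%:C%C * node c n.+1 n.+1 j)); split.
- move=> j; rewrite normcM (_ : 64 / _ = 2 * (32 / n.+1%:R)); last by ring.
  by apply: ler_pM; rewrite ?normc_ge0//; exact: (pt_step c0 c4 sg1 sg2).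
- move=> h hhs; have nh : (D h <= n.+1)%N by apply: leq_trans nD; exact: leq_bigmax_seq.
  have := HD h n.+1 rr nh grr; rewrite -/ka; set S := \sum_(j < _) _ => hS.
  have -> : h - \sum_(j < n.+1) (ka^-1 * (sg%:C%C * node c n.+1 n.+1 j.+1 - sg%:C%C * node c n.+1 n.+1 j) * h.[sg%:C%C * node c n.+1 n.+1 j]) *: rr n.+1 j
      = (- ka^-1) *: (S - ka%:P * h).
    rewrite scaleNr scalerBr opprB -mul_polyC mulrA -polyCM mulVf// mul1r; congr (_ - _).
    by rewrite /S scaler_sumr; apply: eq_bigr => j _; rewrite -[in LHS]mulrA mul_polyC scalerA.
  apply: (le_trans (NZ NS _ _)); apply: le_trans hS; rewrite normcN' ler_wpM2r ?(N_ge0 NS)//.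
move=> A r f; have := Q0 A r (fun a => mk n.+1 (f a)).
rewrite (_ : (fun a => _) = fun a => (normc (sg%:C%C * node c n.+1 n.+1 (f a) - 1))%:C%C *: rr n.+1 (f a))//.
by apply/funext => a; rewrite mkE.
Qed.

End Contour.

Section Family.
Context {d : measure_display} {Omega : measurableType d} {R : realType}.
Variable mu : {measure set Omega -> \bar R}.
Variable p : R.
Hypothesis p1 : 1 < p.
Notation C := R[i].
Notation Lp := (inLp mu p).
Notation cn := (cn mu p).
Notation mn := (mn mu p).
Variable T : (Omega -> C) -> Omega -> C.
Hypothesis aT : analytic_operator mu p T.
Hypothesis rT : contractively_regular mu p T.
Notation N := (opn mu p T).
Notation Qb := (Qb mu p T).

Let bT : bounded_operator_Lp mu p T. Proof. by case: aT. Qed.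
Notation NS := (opn_seminorm p1 aT rT).

Lemma mn_dom q q' (A A' : Type) (r : seq A) (r' : seq A') x y S : 0 <= S -> (forall a, Lp (x a)) -> (forall a, Lp (y a)) ->
  (forall w, lnorm q r (x^~ w) <= S * lnorm q' r' (y^~ w)) -> mn q r x <= S * mn q' r' y.
Proof.
move=> S0 Lx Ly H.
have Ls a : Lp (fun w => S%:C%C * y a w) by exact: (inLpZ p1 S%:C%C (Ly a)).1.
rewrite -[S in leRHS](ger0_norm S0) -normc_real -(mnZ p1 q' r' S%:C%C Ly).
have [[mx _] _] := rLp_mixed p1 q r Lx; have [L _] := rLp_mixed p1 q' r' Ls.
apply: (nm_le p1 mx L) => w; rewrite !ger0_norm ?lnorm_ge0// /mixed.
by rewrite lnormZ normc_real ger0_norm//; exact: H.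
Qed.

Lemma sqr_lnorm2 (A : Type) (r : seq A) (f : A -> C) : lnorm l2 r f ^+ 2 = \sum_(a <- r) normc (f a) ^+ 2.
Proof. exact: sqr_enorm. Qed.

Lemma lnorm2_pairs (A A' : Type) (r : seq A) (s : seq A') (f : A * A' -> C) :
  lnorm l2 [seq (k, i) | k <- r, i <- s] f ^+ 2 = \sum_(k <- r) lnorm l2 s (fun i => f (k, i)) ^+ 2.
Proof.
by rewrite /lnorm sqr_enorm big_allpairs; apply: eq_bigr => k _; rewrite sqr_enorm.
Qed.

Lemma weighted_cauchy_schwarz n (W r : 'I_n -> R) : (forall j, 0 <= W j) ->
  (\sum_j W j * r j) ^+ 2 <= (\sum_j W j) * \sum_j W j * r j ^+ 2.
Proof.
move=> W0; have h := cauchy_schwarz (index_enum 'I_n) (fun j => Num.sqrt (W j)) (fun j => Num.sqrt (W j) * r j).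
have h' := cauchy_schwarz (index_enum 'I_n) (fun j => Num.sqrt (W j)) (fun j => - (Num.sqrt (W j) * r j)).
have e : enorm (index_enum 'I_n) (fun j => - (Num.sqrt (W j) * r j)) = enorm (index_enum 'I_n) (fun j => Num.sqrt (W j) * r j).
  by congr Num.sqrt; apply: eq_bigr => j _; rewrite sqrrN.
have E : \sum_j W j * r j = \sum_j Num.sqrt (W j) * (Num.sqrt (W j) * r j).
  by apply: eq_bigr => j _; rewrite mulrA -expr2 sqr_sqrtr.
have E1 : \sum_j W j = enorm (index_enum 'I_n) (fun j => Num.sqrt (W j)) ^+ 2.
  by rewrite sqr_enorm; apply: eq_bigr => j _; rewrite sqr_sqrtr.
have E2 : \sum_j W j * r j ^+ 2 = enorm (index_enum 'I_n) (fun j => Num.sqrt (W j) * r j) ^+ 2.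
  by rewrite sqr_enorm; apply: eq_bigr => j _; rewrite exprMn sqr_sqrtr.
rewrite E1 E2 -exprMn E -[leLHS]real_normK ?num_real//.
apply: lerXn2r; rewrite ?nnegrE ?mulr_ge0 ?enorm_ge0// ler_norml h andbT.
by move: h'; rewrite e; under eq_bigr do rewrite mulrN; rewrite sumrN lerNl.
Qed.

Lemma eventually_small (m : nat) (P : nat -> R -> Prop) :
  (forall k, (k < m)%N -> exists2 s0, 1 < s0 & forall s, 1 < s -> s <= s0 -> P k s) ->
  exists2 s0, 1 < s0 & forall s, 1 < s -> s <= s0 -> forall k, (k < m)%N -> P k s.
Proof.
elim: m => [|m IH] H; first by exists 2 => //; rewrite ltr1n.
have [s1 h1 H1] := IH (fun k km => H k (ltnW km)); have [s2 h2 H2] := H m (ltnSn m).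
exists (Num.min s1 s2) => [|s s0]; first by rewrite lt_min h1.
rewrite le_min => /andP[l1 l2] k; rewrite ltnS leq_eqVlt => /predU1P[->|km]; [exact: H2|exact: H1].
Qed.

Lemma eventually_large (m : nat) (P : nat -> nat -> Prop) :
  (forall k, (k < m)%N -> exists n0, forall n, (n0 <= n)%N -> P k n) ->
  exists n0, forall n, (n0 <= n)%N -> forall k, (k < m)%N -> P k n.
Proof.
elim: m => [|m IH] H; first by exists 0.
have [s1 H1] := IH (fun k km => H k (ltnW km)); have [s2 H2] := H m (ltnSn m).
exists (maxn s1 s2) => s; rewrite geq_max => /andP[l1 l2] k.
by rewrite ltnS leq_eqVlt => /predU1P[->|km]; [exact: H2|exact: H1].
Qed.

(** On the dilated contour this polynomial takes the values of F at the undilated nodes, which lie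
    in the Stolz domain. *)
Definition dilate (s : R) (F : {poly C}) := F \Po ((s^-1)%:C%C *: 'X).

Lemma horner_dilate s F z : s != 0 -> (dilate s F).[s%:C%C * z] = F.[z].
Proof.
move=> s0; rewrite horner_comp hornerZ hornerX mulrA -(rmorphM (real_complex R)) mulVf// rmorph1 mul1r//.
Qed.

Lemma dilate_close F g e : 0 < e -> exists2 s0, 1 < s0 & forall s, 1 < s -> s <= s0 -> N (F * g - dilate s F * g) <= e.
Proof.
move=> e0; pose K := \sum_(a < size F) normc F`_a * a%:R; pose M := 1 + K * N g.
have K0 : 0 <= K by apply: sumr_ge0 => a _; rewrite mulr_ge0 ?normc_ge0.
have M0 : 0 < M by rewrite ltr_pwDl// mulr_ge0 ?(N_ge0 NS).
exists (1 + e / M) => [|s s1 s2]; first by rewrite ltrDl divr_gt0.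
have si : 0 < s by rewrite (lt_trans ltr01).
have x1 : s^-1 <= 1 by rewrite invf_le1// ltW.
have x2 : 1 - s^-1 <= s - 1.
  have -> : s - 1 = (1 - s^-1) + (s - 1) * (1 - s^-1) by field; rewrite gt_eqF.
  by rewrite lerDl mulr_ge0// subr_ge0// ltW.
have pw a : 0 <= 1 - s^-1 ^+ a <= a%:R * (s - 1).
  elim: a => [|a /andP[h1 h2]]; first by rewrite expr0 subrr mul0r lexx.
  have y0 : 0 <= s^-1 ^+ a by rewrite exprn_ge0// invr_ge0 ltW.
  have -> : 1 - s^-1 ^+ a.+1 = (1 - s^-1) + s^-1 * (1 - s^-1 ^+ a) by rewrite exprS; ring.
  have z0 : 0 <= s^-1 by rewrite invr_ge0 ltW.
  rewrite -natr1 mulrDl mul1r (addrC _ (s - 1)); apply/andP; split; first by rewrite addr_ge0 ?subr_ge0 ?mulr_ge0// -subr_ge0.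
  by apply: lerD => //; apply: le_trans h2; rewrite ler_piMl.
rewrite -mulrBl; apply: (@le_trans _ _ ((K * (s - 1)) * N g)); last first.
  rewrite mulrAC; apply: (@le_trans _ _ (M * (e / M))); last by rewrite mulrC divfK ?gt_eqF.
  apply: ler_pM; rewrite ?mulr_ge0 ?(N_ge0 NS) ?subr_ge0 ?(ltW s1)//; first by rewrite /M lerDr.
  by rewrite lerBlDl.
apply: (le_NM NS) => //.
have -> : F - dilate s F = \sum_(a < size F) (F`_a * (1 - s^-1 ^+ a)%:C%C) *: 'X^a.
  have E : F = \sum_(a < size F) F`_a *: 'X^a by rewrite -poly_def coefK.
  rewrite /dilate comp_polyE [X in X - _]E -sumrB; apply: eq_bigr => a _.
  by rewrite exprZn scalerA -scalerBl rmorphB rmorph1 rmorphXn mulrBr mulr1.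
rewrite /K mulr_suml; apply: (le_trans (N_sum NS _ _ _)); apply: ler_sum => a _.
apply: (le_trans (NZ NS _ _)); rewrite -[leRHS]mulr1; apply: ler_pM; rewrite ?normc_ge0 ?(N_ge0 NS) ?(NX NS)//.
rewrite normcM normc_real; have /andP[h1 h2] := pw a.
by rewrite ger0_norm// -mulrA ler_wpM2l ?normc_ge0.
Qed.

Lemma polyT_scaled q (a : C) x : Lp x -> ae_eqC mu (polyT q T (fun w => a * x w)) (fun w => a * polyT q T x w).
Proof.
move=> Lx; rewrite (_ : (fun w => a * x w) = fun w => (a - 1) * x w + x w); last by apply/funext => w; ring.
rewrite (_ : (fun w => a * polyT q T x w) = fun w => (a - 1) * polyT q T x w + polyT q T x w); last by apply/funext => w; ring.
exact: (polyT_lin p1 bT).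
Qed.

Section Bound.
Variables (c B A : R).
Hypotheses (c0 : 0 < c) (c4 : c <= 1 / 4) (B0 : 0 < B) (A0 : 0 <= A).
Hypothesis contour : forall sg, 1 < sg -> sg <= 2 ->
  forall (hs : seq {poly C}) e, 0 < e -> exists n0, forall n, (n0 <= n)%N -> (0 < n)%N -> exists (rr : 'I_n -> {poly C}) (w : 'I_n -> C),
  [/\ forall j, normc (w j) <= 64 / n%:R,
    forall h, h \in hs -> N (h - \sum_j (w j * h.[sg%:C%C * node c n n j]) *: rr j) <= e &
    forall (A : finType) (r : seq A) (f : A -> 'I_n),
      Qb l2 r (fun a => (normc (sg%:C%C * node c n n (f a) - 1))%:C%C *: rr (f a)) B].

(** The values of F are bounded in l^2 over i at each node, so the index i is removed node by node;
    the Cauchy-Schwarz inequality over the contour then separates the weights from the resolvents,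
    to which R-boundedness applies for all pairs (k, j) at once. *)
Lemma contour_sum m q n (F g : nat -> {poly C}) S (y : nat -> Omega -> C) (w l z : 'I_n -> C) (rr : 'I_n -> {poly C}) (v : nat -> nat -> R) :
  0 <= S -> (forall k, Lp (y k)) -> (0 < n)%N -> (forall j, normc (w j) <= 64 / n%:R) ->
  (forall k j, 0 <= v k j) ->
  (forall k (j : 'I_n), (k < m)%N -> normc (g k).[l j] <= normc (1 - l j) * v k j) ->
  (forall k, (k < m)%N -> \sum_(j < n) v k j <= A * n%:R) ->
  (forall j, lnorm l2 (index_iota 0 q) (fun i => (F i).[z j]) <= S) ->
  (forall (A : finType) (r : seq A) (f : A -> 'I_n), Qb l2 r (fun a => (normc (l (f a) - 1))%:C%C *: rr (f a)) B) ->
  mn l2 [seq (k, i) | k <- index_iota 0 m, i <- index_iota 0 q]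
     (fun ki => polyT (\sum_j (w j * ((F ki.2).[z j] * (g ki.1).[l j])) *: rr j) T (y ki.1))
  <= S * (64 * A * B) * mn l2 (index_iota 0 m) y.
Proof.
move=> S0 Ly n0 w64 v0 gv vA FS HQ; pose A' := 64 * A; have A'0 : 0 <= A' by rewrite mulr_ge0.
have nR : 0 < n%:R :> R by rewrite ltr0n.
(* |w_j| |g_k| is at most W k j |1 - lambda_j|, and W k has mass at most 64 A. Its square root goes
   once with the input and once with the output. *)
pose W k (j : 'I_n) := 64 / n%:R * v k j.
have W0 k j : 0 <= W k j by rewrite mulr_ge0// divr_ge0// ltW.
have WA k : (k < m)%N -> \sum_j W k j <= A'.
  move=> km; rewrite -mulr_sumr mulrAC ler_pdivrMr// /A' -mulrA ler_wpM2l//; exact: vA.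
pose r2 := index_enum ('I_m * 'I_n)%type.
pose sW k j : C := (Num.sqrt (W k j))%:C%C.
have nsW k j : normc (sW k j) = Num.sqrt (W k j) by rewrite normc_real ger0_norm// sqrtr_ge0.
pose Y (kj : 'I_m * 'I_n) om := sW kj.1 kj.2 * y kj.1 om.
have LY kj : Lp (Y kj) by exact: (inLpZ p1 _ (Ly _)).1.
pose ro (j : 'I_n) : {poly C} := (normc (l j - 1))%:C%C *: rr j.
pose Z (kj : 'I_m * 'I_n) om := sW kj.1 kj.2 * polyT (ro kj.2) T (y kj.1) om.
have LZ kj : Lp (Z kj) by exact: (inLpZ p1 _ (pT_Lp p1 bT _ (Ly _))).1.
have step3 : mn l2 r2 Y <= Num.sqrt A' * mn l2 (index_iota 0 m) y.
  apply: mn_dom; rewrite ?sqrtr_ge0// => om.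
  rewrite -(ler_pXn2r (n := 2)) ?nnegrE ?mulr_ge0 ?lnorm_ge0 ?sqrtr_ge0// exprMn (sqr_sqrtr A'0) !sqr_lnorm2.
  rewrite -(pair_bigA _ (fun k j => normc (Y (k, j) om) ^+ 2))/= big_mkord mulr_sumr.
  apply: ler_sum => k _; rewrite (eq_bigr (fun j => W k j * normc (y k om) ^+ 2)) => [|j _].
    by rewrite -mulr_suml ler_wpM2r ?sqr_ge0// WA.
  by rewrite normcM nsW exprMn sqr_sqrtr.
(* The same resolvent occurs for every k; this is why the R-bound is stated for families with
   repetitions. *)
have step2 : mn l2 r2 Z <= B * mn l2 r2 Y.
  rewrite (mn_ae p1 l2 r2 LZ (fun kj => pT_Lp p1 bT _ (LY kj)) (fun kj => aeC_sym (polyT_scaled _ _ (Ly _)))).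
  exact: (HQ _ r2 (fun kj => kj.2) Y LY).
have LX ki : Lp (polyT (\sum_j (w j * ((F ki.2).[z j] * (g ki.1).[l j])) *: rr j) T (y ki.1)).
  exact: (pT_Lp p1 bT).
have step1 : mn l2 [seq (k, i) | k <- index_iota 0 m, i <- index_iota 0 q]
     (fun ki => polyT (\sum_j (w j * ((F ki.2).[z j] * (g ki.1).[l j])) *: rr j) T (y ki.1)) <= (S * Num.sqrt A') * mn l2 r2 Z.
  apply: (mn_dom _ LX LZ); first by rewrite mulr_ge0 ?sqrtr_ge0.
  move=> om; rewrite -(ler_pXn2r (n := 2)) ?nnegrE ?mulr_ge0 ?lnorm_ge0 ?sqrtr_ge0// exprMn exprMn (sqr_sqrtr A'0).
  rewrite lnorm2_pairs [in leRHS]sqr_lnorm2 -(pair_bigA _ (fun k j => normc (Z (k, j) om) ^+ 2))/= big_mkord mulr_sumr.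
  apply: ler_sum => k _; pose V j := normc (l j - 1) * normc (polyT (rr j) T (y k) om).
  have V0 j : 0 <= V j by rewrite mulr_ge0 ?normc_ge0.
  rewrite (eq_bigr (fun j => W k j * V j ^+ 2)) => [|j _]; last first.
    by rewrite normcM nsW exprMn sqr_sqrtr// polyTZ normcM normc_real ger0_norm ?normc_ge0.
  have h : lnorm l2 (index_iota 0 q) (fun i => polyT (\sum_j (w j * ((F i).[z j] * (g k).[l j])) *: rr j) T (y k) om)
      <= S * \sum_j W k j * V j.
    rewrite (_ : (fun i => _) = fun i => \sum_j (w j * (g k).[l j] * polyT (rr j) T (y k) om) * (F i).[z j]); last first.
      by apply/funext => i; rewrite polyT_sum; apply: eq_bigr => j _; rewrite polyTZ; ring.
    apply: le_trans (lnorm_sum l2 _ _ _ (fun j i => (F i).[z j])) _; rewrite mulr_sumr; apply: ler_sum => j _.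
    rewrite mulrC; apply: ler_pM; rewrite ?lnorm_ge0 ?normc_ge0//.
    rewrite (normcM (_ * _)) normcM.
    have -> : W k j * V j = (64 / n%:R) * (normc (l j - 1) * v k j) * normc (polyT (rr j) T (y k) om) by rewrite /W /V; ring.
    rewrite ler_wpM2r ?normc_ge0//; apply: ler_pM; rewrite ?normc_ge0//.
    by rewrite -(normcN' (l j - 1)) opprB; exact: gv.
  apply: (@le_trans _ _ ((S * \sum_j W k j * V j) ^+ 2)).
    have sv : 0 <= S * \sum_j W k j * V j by rewrite mulr_ge0// sumr_ge0// => j _; rewrite mulr_ge0.
    by apply: lerXn2r h; rewrite nnegrE; [exact: lnorm_ge0|exact: sv].
  rewrite exprMn -mulrA ler_wpM2l ?sqr_ge0//; apply: (le_trans (weighted_cauchy_schwarz V (W0 k))).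
  by rewrite ler_wpM2r ?WA// sumr_ge0// => j _; rewrite mulr_ge0 ?sqr_ge0.
have sA : 0 <= S * Num.sqrt A' by rewrite mulr_ge0 ?sqrtr_ge0.
apply: (le_trans step1); apply: (le_trans (ler_wpM2l sA step2)).
rewrite mulrA; apply: (le_trans (ler_wpM2l (mulr_ge0 sA (ltW B0)) step3)).
have -> : S * (64 * A * B) = S * Num.sqrt A' * B * Num.sqrt A'.
  by rewrite -/A' -[in LHS](sqr_sqrtr A'0); ring.
by rewrite mulrA.
Qed.

(** Only F is dilated: it is then evaluated at the nodes, where S bounds it, while g is evaluated on
    the dilated contour, as [admissible] provides. The dilation is chosen close to 1 for all k < m
    and i < q, and n after it; the remaining error eta is arbitrary. *)
Lemma family_bound m q (F g : nat -> {poly C}) S (y : nat -> Omega -> C) :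
  (forall k, (k < m)%N -> admissible c A (g k)) -> 0 <= S -> (forall k, Lp (y k)) ->
  (forall n j, (0 < n)%N -> lnorm l2 (index_iota 0 q) (fun i => (F i).[node c n n j]) <= S) ->
  mn l2 [seq (k, i) | k <- index_iota 0 m, i <- index_iota 0 q] (fun ki => polyT (F ki.2 * g ki.1) T (y ki.1))
  <= S * (64 * A * B) * mn l2 (index_iota 0 m) y.
Proof.
move=> ag S0 Ly FS; apply/ler_addgt0Pr => eta eta0.
set lst := [seq (k, i) | k <- index_iota 0 m, i <- index_iota 0 q].
pose D := 1 + \sum_(ki <- lst) 2 * cn (y ki.1).
have D0 : 0 < D by rewrite ltr_pwDl// sumr_ge0// => ki _; rewrite mulr_ge0 ?cn_ge0.
pose e := eta / D; have e0 : 0 < e by rewrite divr_gt0.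
pose P k s := (exists n0, forall n, (n0 <= n)%N -> (0 < n)%N -> exists v : nat -> R, [/\ forall j, 0 <= v j,
     forall j, (j < n)%N -> normc (g k).[s%:C%C * node c n n j] <= normc (1 - s%:C%C * node c n n j) * v j
   & \sum_(j < n) v j <= A * n%:R]) /\ (forall i, (i < q)%N -> N (F i * g k - dilate s (F i) * g k) <= e).
have /eventually_small[s0 s01 H] : forall k, (k < m)%N -> exists2 s0, 1 < s0 & forall s, 1 < s -> s <= s0 -> P k s.
  move=> k km; have [s0 [n0 [s01 Hs]]] := ag k km.
  have [s1 s11 H1] := @eventually_small q (fun i s => N (F i * g k - dilate s (F i) * g k) <= e) (fun i _ => dilate_close _ _ e0).
  exists (Num.min s0 s1) => [|s s2]; first by rewrite lt_min s01.
  rewrite le_min => /andP[l1 l3]; split; last by move=> i iq; exact: H1.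
  by exists n0 => n nn n00; exact: (Hs s n (ltW s2) l1 nn n00).
pose s := Num.min s0 2; have s1 : 1 < s by rewrite lt_min s01 ltr1n.
have ss0 : s <= s0 by rewrite ge_min lexx.
have s2 : s <= 2 by rewrite ge_min lexx orbT.
have sn : s != 0 by rewrite gt_eqF// (lt_trans ltr01).
have {}H k (km : (k < m)%N) := H s s1 ss0 k km.
have [n1 Hn1] := eventually_large (fun k km => (H k km).1).
have [n2 Hn2] := contour s1 s2 [seq dilate s (F ki.2) * g ki.1 | ki <- lst] e0.
pose n := maxn 1 (maxn n1 n2).
have n0 : (0 < n)%N by rewrite leq_max.
have nn1 : (n1 <= n)%N by rewrite !leq_max leqnn !orbT.
have nn2 : (n2 <= n)%N by rewrite !leq_max leqnn !orbT.
have [rr [w [w64 happ HQ]]] := Hn2 n nn2 n0.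
have /boolp.choice[v Hv] : forall k, exists v : nat -> R, (forall j, 0 <= v j) /\ ((k < m)%N ->
   (forall j, (j < n)%N -> normc (g k).[s%:C%C * node c n n j] <= normc (1 - s%:C%C * node c n n j) * v j) /\ \sum_(j < n) v j <= A * n%:R).
  move=> k; have [km|km] := ltnP k m; last by exists (fun=> 0).
  by have [v [h1 h2 h3]] := Hn1 n nn1 k km n0; exists v.
pose u ki := \sum_j (w j * ((F ki.2).[node c n n j] * (g ki.1).[s%:C%C * node c n n j])) *: rr j.
have h1 : mn l2 lst (fun ki => polyT (u ki) T (y ki.1)) <= S * (64 * A * B) * mn l2 (index_iota 0 m) y.
  apply: (contour_sum (v := v) S0 Ly n0 w64) => [k|k j km|k km|j|//]; first exact: (Hv k).1.
  - by have [hv _] := (Hv k).2 km; exact: hv.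
  - by have [_ ->] := (Hv k).2 km.
  - exact: FS.
have E ki : polyT (F ki.2 * g ki.1) T (y ki.1) = fun om => polyT (u ki) T (y ki.1) om + polyT (F ki.2 * g ki.1 - u ki) T (y ki.1) om.
  by apply/funext => om; rewrite -polyTD addrC subrK.
rewrite (_ : (fun ki => _) = fun ki om => polyT (u ki) T (y ki.1) om + polyT (F ki.2 * g ki.1 - u ki) T (y ki.1) om); last first.
  by apply/funext => ki; rewrite E.
have Lu ki : Lp (polyT (u ki) T (y ki.1)) by exact: (pT_Lp p1 bT).
have Lr ki : Lp (polyT (F ki.2 * g ki.1 - u ki) T (y ki.1)) by exact: (pT_Lp p1 bT).
apply: (le_trans (mnD p1 l2 lst Lu Lr)); apply: lerD => //.
apply: (le_trans (rLp_mixed p1 l2 lst Lr).2); apply: (@le_trans _ _ (\sum_(ki <- lst) e * (2 * cn (y ki.1)))).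
  rewrite big_seq [leRHS]big_seq; apply: ler_sum => ki kil.
  apply: (le_trans (opnP p1 bT rT _ (Ly ki.1))); rewrite mulrA ler_wpM2r ?cn_ge0//.
  have [km iq] : (ki.1 < m)%N /\ (ki.2 < q)%N.
    by move: kil => /allpairsP[[k i] [/= ]]; rewrite !mem_index_iota => km iq ->.
  have -> : F ki.2 * g ki.1 - u ki = (F ki.2 * g ki.1 - dilate s (F ki.2) * g ki.1) + (dilate s (F ki.2) * g ki.1 - u ki) by ring.
  rewrite mulr_natr mulr2n; apply: (le_ND NS); first exact: (H _ km).2.
  have := happ (dilate s (F ki.2) * g ki.1) (map_f _ kil).
  rewrite (eq_bigr (fun j => (w j * ((F ki.2).[node c n n j] * (g ki.1).[s%:C%C * node c n n j])) *: rr j))// => j _.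
  by rewrite hornerM horner_dilate.
rewrite -mulr_sumr /e mulrAC ler_pdivrMr// ler_wpM2l ?(ltW eta0)// /D lerDr//.
Qed.

End Bound.

End Family.

(** * Assembly of the finite square function bound *)

Section Assembly.
Context {d : measure_display} {Omega : measurableType d} {R : realType}.
Variable mu : {measure set Omega -> \bar R}.
Variable p : R.
Hypothesis p1 : 1 < p.
Notation C := R[i].
Notation Lp := (inLp mu p).
Notation cn := (cn mu p).
Notation mn := (mn mu p).
Variable T : (Omega -> C) -> Omega -> C.
Hypothesis aT : analytic_operator mu p T.
Hypothesis rT : contractively_regular mu p T.
Notation N := (opn mu p T).

Let bT : bounded_operator_Lp mu p T. Proof. by case: aT. Qed.
Notation NS := (opn_seminorm p1 aT rT).

Lemma square_function : exists2 A, 0 < A & forall m x, Lp x ->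
  mn l2 (index_iota 0 m) (fun k => polyT (Rpoly C k) T x) <= A * cn x.
Proof.
have [A A0 HA] := square_kernel p1; exists (A `^ p^-1); first exact: powR_gt0.
move=> m x Lx.
have := transference p1 bT rT (terms := fun k => [:: (Rpoly C k, tt)]) (ra := [:: tt]) (rb := index_iota 0 m)
  (qi := l2) (qo := l2) (K0 := m.+2) (ltW A0) _ _ (fun _ => Lx).
rewrite (_ : tout _ _ _ = fun k => polyT (Rpoly C k) T x); last first.
  by apply/funext => k; apply/funext => w; rewrite /tout big_seq1.
rewrite mn_seq1; apply => [K f K0K fK|k qa _]; last by rewrite inE => /eqP ->.
rewrite (_ : kout _ _ = fun t k => act (Rpoly C k) (f^~ tt) t); last first.
  by apply/funext => t; apply/funext => k; rewrite /kout big_seq1.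
exact: HA.
Qed.

Lemma dual_square_function : exists2 A, 0 < A & forall m q (x : nat * nat -> Omega -> C), (forall ki, Lp (x ki)) ->
  mn l2 (index_iota 0 q) (fun i w => \sum_(0 <= k < m) polyT (Rpoly C k) T (x (k, i)) w)
  <= A * mn l2 [seq (k, i) | k <- index_iota 0 m, i <- index_iota 0 q] x.
Proof.
have [A A0 HA] := dual_kernel p1; exists (A `^ p^-1); first exact: powR_gt0.
move=> m q x Lx.
have := transference p1 bT rT (terms := fun i : nat => [seq (Rpoly C k, (k, i)) | k <- index_iota 0 m])
  (ra := [seq (k, i) | k <- index_iota 0 m, i <- index_iota 0 q]) (rb := index_iota 0 q)
  (qi := l2) (qo := l2) (K0 := m.+2) (ltW A0) _ _ Lx.
rewrite (_ : tout _ _ _ = fun i w => \sum_(0 <= k < m) polyT (Rpoly C k) T (x (k, i)) w); last first.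
  by apply/funext => k; apply/funext => w; rewrite /tout big_map.
apply => [K f K0K fK|i qa iq /mapP[k km ->]]; last by apply/allpairsP; exists (k, i).
rewrite (_ : kout _ _ = fun t i => \sum_(0 <= k < m) act (Rpoly C k) (f^~ (k, i)) t); last first.
  by apply/funext => t; apply/funext => k; rewrite /kout big_map.
exact: HA.
Qed.

Lemma bump_Rpoly k : Rpoly C k * (bump k : {poly C}) * Rpoly C k = (1 - 'X^(2 ^ k)) ^+ 10 * ((1 + 'X^(2 ^ k)) ^+ 10 - 1).
Proof.
have h : dav C k * (2 ^+ k *: (1 - 'X)) = 1 - 'X^(2 ^ k).
  rewrite /dav -scalerAl -scalerAr scalerA mulVf ?scale1r; last by rewrite expf_neq0// pnatr_eq0.
  by rewrite big_mkord mulrC -opprB mulNr -subrX1 opprB.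
rewrite /Rpoly /bump.
transitivity ((dav C k * (2 ^+ k *: (1 - 'X))) ^+ 6 * (1 - 'X^(2 ^ k)) ^+ 4 * ((1 + 'X^(2 ^ k)) ^+ 10 - 1)).
  rewrite exprMn -[6%N]/(3 + 3)%N -[4%N]/(2 + 2)%N !exprD.
  set u := dav C k ^+ 3; set v := (2 ^+ k *: _) ^+ 3; set z := (1 - _) ^+ 2; set y := _ - 1.
  by clearbody u v z y; ring.
by rewrite h -exprD.
Qed.

(** The factor X^(2^K) is kept visible: multiplied by X - 1 it is small in norm by analyticity. *)
Definition tail10 K : {poly C} := 'X^(2 ^ K) * \sum_(i < 10) (1 - 'X^(2 ^ K)) ^+ i.

Lemma tail10E K : tail10 K = 1 - (1 - 'X^(2 ^ K)) ^+ 10.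
Proof. by rewrite -[RHS]opprB subrX1 /tail10; ring. Qed.

Lemma unit_decomposition K : (1 - 'X) ^+ 10 + \sum_(0 <= k < K) Rpoly C k * bump k * Rpoly C k + tail10 K = 1.
Proof.
rewrite tail10E; elim: K => [|K IH]; first by rewrite big_geq// addr0 expr1 addrC subrK.
rewrite big_nat_recr//= -[RHS]IH bump_Rpoly expnS mulnC exprM.
set z := 'X^(2 ^ K); set s := \sum_(0 <= k < K) _.
have -> : (1 - z ^+ 2) ^+ 10 = (1 - z) ^+ 10 * (1 + z) ^+ 10 by rewrite -exprMn; congr (_ ^+ _); ring.
by set a := (1 - z) ^+ 10; set b := (1 + z) ^+ 10; ring.
Qed.

Lemma N_tail_sum K : N (\sum_(i < 10) (1 - 'X^(2 ^ K)) ^+ i) <= 2 ^+ 10.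
Proof.
have h : N (1 - 'X^(2 ^ K)) <= 2 by apply: le_trans (le_ND NS (N1 NS) (le_NN NS (NX NS _))) _; lra.
apply: (le_trans (N_sum NS _ _ _)); apply: (@le_trans _ _ (\sum_(i < 10) 2 ^+ i)); last first.
  by rewrite !big_ord_recr big_ord0 /=; lra.
apply: ler_sum => i _; apply: (le_trans (N_pow NS _ _)).
by apply: lerXn2r; rewrite ?nnegrE ?(N_ge0 NS).
Qed.

(** The constant is the sum of three contributions: (1 - T)^10 as a family with one member, the
    bumps between the square function and its dual, and 2^10 for the values at 1. None depends on
    the number m of dyadic levels, so m may be chosen after the polynomials. *)
Lemma finite_square_bound : exists c B, [/\ 0 < c, c <= 1 / 4, 1 <= B & forall q (F : nat -> {poly C}) S x, 0 <= S -> Lp x ->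
  (forall n j, (0 < n)%N -> lnorm l2 (index_iota 0 q) (fun i => (F i).[node c n n j]) <= S) ->
  mn l2 (index_iota 0 q) (fun i => polyT (F i) T x) <= B * S * cn x].
Proof.
have [c [B [c0 c4 B0 HC]]] := approximate_contour p1 aT rT.
have [A A0 HA] := bump_admissible c0 c4.
have fA := flat_admissible c0 c4.
have [A1 A10 HS] := square_function; have [A2 A20 HD] := dual_square_function.
have [K NK] := opn_analytic p1 aT rT; have K0 := K_ge0 NS NK.
pose B1 := 64 * 6 ^+ 9 * B; pose B2 := A2 * (64 * A * B) * A1.
have B10 : 0 <= B1 by rewrite !mulr_ge0 ?exprn_ge0// ltW.
have B20 : 0 <= B2 by rewrite !mulr_ge0// ltW.
exists c, (B1 + B2 + 2 ^+ 10); split=> //.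
  by rewrite -[X in X <= _]add0r lerD ?addr_ge0// exprn_ege1// ler1n.
move=> q F S x S0 Lx FS; apply/ler_addgt0Pr => eta eta0.
(* Subtracting the value at 1 produces the factor X - 1 that analyticity needs in the tail. *)
have /boolp.choice[Q HQ] : forall i, exists Q : {poly C}, F i = (F i).[1]%:P + Q * ('X - 1).
  move=> i; have /factor_theorem[Q HQ] : root (F i - (F i).[1]%:P) 1 by rewrite rootE !hornerE subrr.
  by exists Q; rewrite -polyC1 -HQ addrC subrK.
pose D := 1 + \sum_(i <- index_iota 0 q) N (Q i) * (K * 2 ^+ 10) * cn x.
have D0 : 0 < D.
  by rewrite ltr_pwDl// sumr_ge0// => i _; rewrite !mulr_ge0 ?cn_ge0 ?(N_ge0 NS) ?exprn_ge0.
have [m Hm] := half_pow_small (divr_gt0 eta0 D0).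
pose xx (ki : nat * nat) := polyT (F ki.2 * bump ki.1) T (polyT (Rpoly C ki.1) T x).
have LR k : Lp (polyT (Rpoly C k) T x) by exact: (pT_Lp p1 bT).
have Lxx ki : Lp (xx ki) by exact: (pT_Lp p1 bT).
pose t1 i := polyT (F i * (1 - 'X) ^+ 10) T x.
pose t2 i w := \sum_(0 <= k < m) polyT (Rpoly C k * (F i * bump k) * Rpoly C k) T x w.
pose t3 i w := (F i).[1] * polyT (tail10 m) T x w.
pose t4 i := polyT (Q i * ('X - 1) * tail10 m) T x.
have E : (fun i => polyT (F i) T x) = fun i w => t1 i w + t2 i w + t3 i w + t4 i w.
  apply/funext => i; apply/funext => w; rewrite /t1 /t2 /t3 /t4 -polyTZ -polyT_sum -!polyTD.
  congr polyT; rewrite -[LHS]mulr1 -[in LHS](unit_decomposition m) mulrDr mulrDr mulr_sumr -[RHS]addrA; congr (_ + _ + _).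
    by apply: eq_bigr => k _; ring.
  by rewrite {1}(HQ i) mulrDl mul_polyC.
have L1 i : Lp (t1 i) by exact: (pT_Lp p1 bT).
have L2 i : Lp (t2 i) by exact: (inLp_sum p1 (index_iota 0 m) (fun k => pT_Lp p1 bT (Rpoly C k * (F i * bump k) * Rpoly C k) Lx)).1.
have Lt : Lp (polyT (tail10 m) T x) by exact: (pT_Lp p1 bT).
have L3 i : Lp (t3 i) by exact: (inLpZ p1 _ Lt).1.
have L4 i : Lp (t4 i) by exact: (pT_Lp p1 bT).
have L12 i : Lp (fun w => t1 i w + t2 i w) by exact: (inLpD p1 (L1 i) (L2 i)).1.
have L123 i : Lp (fun w => t1 i w + t2 i w + t3 i w) by exact: (inLpD p1 (L12 i) (L3 i)).1.
have M1 : mn l2 (index_iota 0 q) t1 <= S * B1 * cn x.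
  have h := family_bound p1 aT rT (m := 1) (q := q) (F := F) (g := fun=> (1 - 'X) ^+ 10) (S := S) (y := fun=> x)
     B0 (exprn_ge0 9 (ler0n R 6)) HC (fun _ _ => fA) S0 (fun=> Lx) FS.
  rewrite (mn_seq1 _ _ _ 0%N) in h; apply: le_trans h; rewrite -[leRHS]mul1r; apply: (mn_dom p1) => // [ki|w].
    exact: (pT_Lp p1 bT).
  rewrite mul1r -(ler_pXn2r (n := 2)) ?nnegrE ?lnorm_ge0// lnorm2_pairs big_seq1 //.
have M2 : mn l2 (index_iota 0 q) t2 <= S * B2 * cn x.
  have -> : mn l2 (index_iota 0 q) t2 = mn l2 (index_iota 0 q) (fun i w => \sum_(0 <= k < m) polyT (Rpoly C k) T (xx (k, i)) w).
    apply: (mn_ae p1) => // [i|i].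
      exact: (inLp_sum p1 (index_iota 0 m) (fun k => pT_Lp p1 bT (Rpoly C k) (Lxx (k, i)))).1.
    have h k : ae_eqC mu (polyT (Rpoly C k * (F i * bump k) * Rpoly C k) T x) (polyT (Rpoly C k) T (xx (k, i))).
      apply: aeC_trans (polyTM p1 bT _ _ Lx) _; exact: (polyTM p1 bT).
    have := aeC_sum (index_iota 0 m) (fun=> 1) h.
    rewrite (_ : (fun w => _) = t2 i); last by apply/funext => w; apply: eq_bigr => k _; rewrite mul1r.
    rewrite (_ : (fun w => \sum_(i0 <- index_iota 0 m) 1 * _) = fun w => \sum_(0 <= k < m) polyT (Rpoly C k) T (xx (k, i)) w)//.
    by apply/funext => w; apply: eq_bigr => k _; rewrite mul1r.
  apply: (le_trans (HD m q xx Lxx)).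
  have h := family_bound p1 aT rT (m := m) (q := q) (F := F) (g := fun k => bump k) (S := S) (y := fun k => polyT (Rpoly C k) T x)
     B0 (ltW A0) HC (fun k _ => HA k) S0 LR FS.
  apply: (le_trans (ler_wpM2l (ltW A20) h)).
  have sB : 0 <= A2 * (S * (64 * A * B)) by rewrite !mulr_ge0// ltW.
  rewrite mulrA; apply: (le_trans (ler_wpM2l sB (HS m x Lx))).
  by rewrite le_eqVlt; apply/orP; left; apply/eqP; rewrite /B2; ring.
have M3 : mn l2 (index_iota 0 q) t3 <= S * 2 ^+ 10 * cn x.
  have h : cn (polyT (tail10 m) T x) <= 2 ^+ 10 * cn x.
    apply: (le_trans (opnP p1 bT rT _ Lx)); rewrite ler_wpM2r ?cn_ge0// -[leRHS]mul1r.
    apply: (le_NM NS (NX NS _) (N_tail_sum m)).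
  rewrite -mulrA; apply: le_trans (ler_wpM2l S0 h); rewrite -(mn_seq1 mu p l2 tt (fun=> polyT (tail10 m) T x)).
  apply: (mn_dom p1) => // w; rewrite lnorm_seq1 /t3.
  rewrite (_ : (fun a => _) = fun a => polyT (tail10 m) T x w * (F a).[1]); last by apply/funext => a; rewrite mulrC.
  rewrite lnormZ mulrC ler_wpM2r ?normc_ge0//.
  (* The point 1 is a node, so the hypothesis bounds the values F_i(1) as well. *)
  have := FS 1%N 0%N isT; rewrite (_ : node c 1 1 0 = 1)//.
  by rewrite /node /chord expr0 subrr normc0 !mulr0 subr0 mul1r.
have M4 : mn l2 (index_iota 0 q) t4 <= eta.
  apply: (le_trans (rLp_mixed p1 l2 (index_iota 0 q) L4).2).
  apply: (@le_trans _ _ (2^-1 ^+ m * \sum_(i <- index_iota 0 q) N (Q i) * (K * 2 ^+ 10) * cn x)); last first.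
    apply: (@le_trans _ _ (eta / D * D)); last by rewrite divfK ?gt_eqF.
    apply: ler_pM; rewrite ?exprn_ge0//; last by rewrite /D lerDr.
    by rewrite sumr_ge0// => i _; rewrite !mulr_ge0 ?cn_ge0 ?(N_ge0 NS) ?exprn_ge0.
  rewrite mulr_sumr; apply: ler_sum => i _; rewrite mulrA; apply: (le_trans (opnP p1 bT rT _ Lx)); rewrite ler_wpM2r ?cn_ge0//.
  have -> : Q i * ('X - 1) * tail10 m = Q i * (('X^((2 ^ m).+1) - 'X^(2 ^ m)) * \sum_(i < 10) (1 - 'X^(2 ^ m)) ^+ i).
    by rewrite /tail10 exprS; ring.
  have h : N ('X^((2 ^ m).+1) - 'X^(2 ^ m)) <= 2^-1 ^+ m * K.
    have h2 : 0 < 2 ^+ m :> R by rewrite exprn_gt0.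
    have := NK (2 ^ m)%N; rewrite exprVn ler_pdivlMl// => /(le_trans _); apply.
    by rewrite ler_wpM2r ?(N_ge0 NS)// -[X in _ <= X](natr1 (2 ^ m)%N) natrX lerDl.
  have := le_NM NS (lexx (N (Q i))) (le_NM NS h (N_tail_sum m)) => /le_trans; apply.
  by rewrite le_eqVlt; apply/orP; left; apply/eqP; ring.
rewrite E; apply: (le_trans (mnD p1 l2 (index_iota 0 q) L123 L4)); apply: lerD => //.
apply: (le_trans (mnD p1 l2 (index_iota 0 q) L12 L3)); apply: (le_trans (lerD (mnD p1 l2 (index_iota 0 q) L1 L2) M3)).
apply: (le_trans (lerD (lerD M1 M2) (lexx _))).
by rewrite le_eqVlt; apply/orP; left; apply/eqP; ring.
Qed.

End Assembly.

(** * Passage to infinite sums *)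

Section Limit.
Context {d : measure_display} {Omega : measurableType d} {R : realType}.
Variable mu : {measure set Omega -> \bar R}.
Variable p : R.
Hypothesis p1 : 1 < p.
Notation C := R[i].
Notation Lp := (inLp mu p).
Notation mn := (mn mu p).

Let p0 : 0 < p. Proof. exact: lt_trans p1. Qed.

Let sqsum (u : nat -> C) := (\sum_(0 <= n <oo) ((normc (u n)) ^+ 2)%:E)%E.

Lemma le_poweR (r : R) (x y : \bar R) : 0 <= r -> (0 <= x)%E -> (x <= y)%E -> (x `^ r <= y `^ r)%E.
Proof.
move=> r0 x0 xy; apply: gt0_ler_poweR => //; rewrite in_itv/= leey andbT//.
exact: le_trans xy.
Qed.

Lemma sqr_poweR_half (a : R) : 0 <= a -> ((a ^+ 2)%:E `^ (2^-1)%R = a%:E)%E.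
Proof. by move=> a0; rewrite poweR_EFin powR12_sqrt ?sqr_ge0// sqrtr_sqr ger0_norm. Qed.

Lemma nondecreasing_le_limn (u : (\bar R)^nat) n : nondecreasing_seq u -> (u n <= limn u)%E.
Proof.
move=> nd; have /cvg_lim -> // := ereal_nondecreasing_cvgn nd.
by apply: ereal_sup_ubound; exists n.
Qed.

Lemma sqsum_ge q (u : nat -> C) : ((lnorm l2 (index_iota 0 q) u)%:E <= sqsum u `^ (2^-1)%R)%E.
Proof.
have h : (((lnorm l2 (index_iota 0 q) u) ^+ 2)%:E <= sqsum u)%E.
  rewrite sqr_lnorm2 -sumEFin; apply: (@nneseries_lim_ge R (fun n => ((normc (u n)) ^+ 2)%:E) xpredT 0 q) => n _ _.
  by rewrite lee_fin sqr_ge0.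
rewrite -(sqr_poweR_half (lnorm_ge0 _ _ _)); apply: le_poweR => //.
by rewrite lee_fin sqr_ge0.
Qed.

Lemma sqsum_le (u : nat -> C) M : 0 <= M -> (forall q, lnorm l2 (index_iota 0 q) u <= M) -> (sqsum u `^ (2^-1)%R <= M%:E)%E.
Proof.
move=> M0 H; have h : (sqsum u <= (M ^+ 2)%:E)%E.
  apply: lime_le; first by apply: is_cvg_nneseries => n _ _; rewrite lee_fin sqr_ge0.
  apply: nearW => q; rewrite sumEFin lee_fin -sqr_lnorm2; apply: lerXn2r; rewrite ?nnegrE ?lnorm_ge0//.
rewrite -(sqr_poweR_half M0); apply: le_poweR => //.
by apply: nneseries_ge0 => n _ _; rewrite lee_fin sqr_ge0.
Qed.

Lemma Lnorm_sqsum (u : nat -> Omega -> C) D : (forall n, Lp (u n)) -> 0 <= D ->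
  (forall q, mn l2 (index_iota 0 q) u <= D) ->
  (Lnorm mu p%:E (fun w => sqsum (u^~ w) `^ (2^-1)%R) <= D%:E)%E.
Proof.
move=> Lu D0 H; pose m q w := mixed l2 (index_iota 0 q) u w.
have m0 q w : 0 <= m q w by exact: lnorm_ge0.
have nd w : {homo m^~ w : a b / (a <= b)%N >-> a <= b}.
  move=> a b ab; rewrite -(ler_pXn2r (n := 2)) ?nnegrE ?m0// /m /mixed !sqr_lnorm2.
  by rewrite (@big_cat_nat _ _ _ a 0 b)//= lerDl sumr_ge0// => n _; exact: sqr_ge0.
pose h q w := (m q w `^ p)%:E.
have nh w : {homo h^~ w : a b / (a <= b)%N >-> (a <= b)%E}.
  by move=> a b ab; rewrite lee_fin; apply: powR_le; rewrite ?m0 ?(ltW p0) ?nd.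
have mh q : measurable_fun setT (h q).
  have [[mm _] _] := rLp_mixed p1 l2 (index_iota 0 q) Lu.
  apply/measurable_EFinP; have := measurable_power p mm.
  by apply: eq_measurable_fun => w _; rewrite ger0_norm// m0.
have E w : (`| sqsum (u^~ w) `^ (2^-1)%R | `^ p = limn (h^~ w))%E.
  have cv := ereal_nondecreasing_is_cvgn (nh w).
  rewrite gee0_abs ?poweR_ge0//; apply/eqP; rewrite eq_le; apply/andP; split.
    have L0 q : (h q w <= limn (h^~ w))%E by exact: (nondecreasing_le_limn _ (nh w)).
    move: L0; case: (limn (h^~ w)) => [r| |] L0; rewrite ?leey//; last first.
      by have := L0 0%N; rewrite leeNy_eq.
    have r0 : 0 <= r by have := L0 0%N; rewrite lee_fin; apply: le_trans; exact: powR_ge0.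
    have hq q : lnorm l2 (index_iota 0 q) (u^~ w) <= r `^ p^-1.
      by have := L0 q; rewrite lee_fin => /(powR_root p0 (m0 q w) r0).
    have := sqsum_le (powR_ge0 r p^-1) hq => hs.
    have rE : (r%:E = ((r `^ p^-1)%:E) `^ p)%E by rewrite poweR_EFin -powRrM mulVf ?gt_eqF// powRr1.
    by rewrite rE; apply: le_poweR; rewrite ?(ltW p0) ?poweR_ge0.
  apply: lime_le => //; apply: nearW => q.
  rewrite /h -poweR_EFin; apply: le_poweR; rewrite ?(ltW p0)//; first by rewrite lee_fin m0.
  exact: sqsum_ge.
rewrite unlock (eq_integral (fun w => limn (h^~ w))); last by move=> w _; exact: E.
rewrite monotone_convergence//; last by move=> q w _; rewrite lee_fin powR_ge0.
have iE q : (\int[mu]_w h q w = (mn l2 (index_iota 0 q) u `^ p)%:E)%E.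
  rewrite (powR_nm p1 (rLp_mixed p1 l2 (index_iota 0 q) Lu).1).
  by apply: eq_integral => w _; rewrite /h ger0_norm// m0.
have ndi : nondecreasing_seq (fun q => \int[mu]_w h q w)%E.
  by move=> a b ab; apply: ge0_le_integral => // w _; [rewrite lee_fin powR_ge0|exact: nh].
have l1 : (limn (fun q => \int[mu]_w h q w) <= (D `^ p)%:E)%E.
  apply: lime_le.
    exact: ereal_nondecreasing_is_cvgn.
  by apply: nearW => q; rewrite iE lee_fin; apply: powR_le; rewrite ?(ltW p0)// mn_ge0.
have -> : (D%:E = ((D `^ p)%:E) `^ p^-1)%E by rewrite poweR_EFin -powRrM mulfV ?gt_eqF// powRr1.
apply: le_poweR => //; first by rewrite invr_ge0 ltW.
apply: le_trans (nondecreasing_le_limn 0 ndi).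
by apply: integral_ge0 => w _; rewrite lee_fin powR_ge0.
Qed.

End Limit.

(** Abel summation: a factor 1 - r turns (i + 1)^(M+1) into its increments, which are at most (M +
    1) (i + 1)^M, so each induction step contributes a factor M + 1. *)
Lemma geometric_moment {R : realType} (r : R) M q : 0 <= r <= 1 ->
  (1 - r) ^+ M.+1 * \sum_(i < q) i.+1%:R ^+ M * r ^+ i <= (M`!)%:R.
Proof.
move=> /andP[r0 r1]; have s0 : 0 <= 1 - r by rewrite subr_ge0.
have incr N (x : nat) : x.+1%:R ^+ N.+1 - x%:R ^+ N.+1 <= N.+1%:R * x.+1%:R ^+ N :> R.
  elim: N => [|N IH]; first by rewrite !expr1 expr0 mulr1 -natr1 addrAC subrr add0r.
  have h : x%:R ^+ N.+1 <= x.+1%:R ^+ N.+1 :> R by apply: lerXn2r; rewrite ?nnegrE// ler_nat.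
  have -> : x.+1%:R ^+ N.+2 - x%:R ^+ N.+2 = x.+1%:R * (x.+1%:R ^+ N.+1 - x%:R ^+ N.+1) + x%:R ^+ N.+1 :> R.
    by rewrite !(exprS _ N.+1) -(natr1 x); ring.
  have -> : N.+2%:R * x.+1%:R ^+ N.+1 = x.+1%:R * (N.+1%:R * x.+1%:R ^+ N) + x.+1%:R ^+ N.+1 :> R.
    by rewrite -(natr1 N.+1) exprS; ring.
  by apply: lerD => //; rewrite ler_wpM2l.
elim: M => [|M IH].
  rewrite expr1 fact0; under eq_bigr do rewrite expr0 mul1r.
  by rewrite -opprB mulNr -subrX1 opprB gerBl exprn_ge0.
have tel : (1 - r) * \sum_(i < q) i.+1%:R ^+ M.+1 * r ^+ i + q%:R ^+ M.+1 * r ^+ q <= M.+1%:R * \sum_(i < q) i.+1%:R ^+ M * r ^+ i.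
  elim: (q) => [|n IHn]; first by rewrite !big_ord0 !mulr0 expr0n/= mul0r addr0.
  rewrite !big_ord_recr/= [in leRHS]mulrDr.
  have H2 := ler_wpM2r (exprn_ge0 n r0) (incr M n); rewrite mulrBl -(mulrA M.+1%:R) in H2.
  move: IHn H2; rewrite mulrDr (exprS r n); set a := \sum_(i < n) _; set b := \sum_(i < n) _.
  set u := n.+1%:R ^+ M.+1; set v := n%:R ^+ M.+1 * r ^+ n.
  set y := r ^+ n; set z := n.+1%:R ^+ M * y; rewrite -/v => h1 h2.
  have -> : (1 - r) * a + (1 - r) * (u * y) + u * (r * y) = (1 - r) * a + u * y by ring.
  lra.
have h : (1 - r) * \sum_(i < q) i.+1%:R ^+ M.+1 * r ^+ i <= M.+1%:R * \sum_(i < q) i.+1%:R ^+ M * r ^+ i.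
  by apply: le_trans tel; rewrite lerDl mulr_ge0 ?exprn_ge0.
rewrite exprSr -mulrA factS natrM; apply: (le_trans (ler_wpM2l (exprn_ge0 _ s0) h)).
by rewrite mulrCA ler_wpM2l.
Qed.

(** * The two square function estimates *)

Section SquareFunctions.
Context {d : measure_display} {Omega : measurableType d} {R : realType}.
Variable mu : {measure set Omega -> \bar R}.
Variable p : R.
Hypothesis p1 : 1 < p.
Notation C := R[i].
Notation Lp := (inLp mu p).
Notation cn := (cn mu p).
Notation mn := (mn mu p).
Variable T : (Omega -> C) -> Omega -> C.
Hypothesis aT : analytic_operator mu p T.
Variables (c B : R).
Hypotheses (c0 : 0 < c) (c4 : c <= 1 / 4) (B1 : 1 <= B).
Hypothesis bound : forall q (F : nat -> {poly C}) S x, 0 <= S -> Lp x ->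
  (forall n j, (0 < n)%N -> lnorm l2 (index_iota 0 q) (fun i => (F i).[node c n n j]) <= S) ->
  mn l2 (index_iota 0 q) (fun i => polyT (F i) T x) <= B * S * cn x.

Let bT : bounded_operator_Lp mu p T. Proof. by case: aT. Qed.
Let B0 : 0 <= B. Proof. exact: le_trans B1. Qed.

(** The Stolz condition at a node: its modulus is 1 - c |1 - zeta|, while its distance to 1 is at
    most 2 |1 - zeta|. *)
Lemma node_bounds n j : (0 < n)%N -> exists r, [/\ 0 <= r, r <= 1, normc (node c n n j) = r &
  normc (node c n n j - 1) <= 2 / c * (1 - r)].
Proof.
move=> n0; have d0 := @chord_ge0 R n j; have d2 := @chord_le2 R n j.
have nR : 0 < n%:R :> R by rewrite ltr0n.
have cd : c * chord n j <= 1 / 2 by have := ler_pM (ltW c0) d0 c4 d2; lra.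
have cd0 : 0 <= c * chord n j by rewrite mulr_ge0// ltW.
exists (1 - c * chord n j); split; [lra|lra| |].
  rewrite /node divff ?gt_eqF// mul1r normcM normc_rtX mul1r normc_real ger0_norm//; lra.
rewrite -normcN' opprB; apply: (le_trans (one_sub_node c0 c4 n0 j)).
by rewrite subKr mulrA divfK ?gt_eqF.
Qed.

(** At a node the weight (n + 1)^(2m - 1) is exactly what the factor |1 - z|^(2m) <= (2 / c)^(2m) (1
    - |z|)^(2m) can sum, by [geometric_moment] of order 2m - 1. *)
Lemma Ritt_square_function m : (0 < m)%N -> exists Cm : R, forall x, Lp x ->
  (Lnorm mu p%:E (fun w => (\sum_(0 <= n <oo) (((n.+1)%:R ^+ (2 * m - 1)%N) *
      (normc (polyT ('X^n * ('X - 1) ^+ m) T x w)) ^+ 2)%:E) `^ (2^-1)%R) <= Cm%:E * cLnorm mu p x)%E.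
Proof.
case: m => // m _; pose M := (2 * m).+1.
have ME : (2 * m.+1 - 1)%N = M by rewrite mulnS addSn subn1.
pose F n : {poly C} := (Num.sqrt (n.+1%:R ^+ M))%:C%C *: ('X^n * ('X - 1) ^+ m.+1).
pose S := Num.sqrt ((2 / c) ^+ M.+1 * (M`!)%:R).
have K0 : 0 <= (2 / c) ^+ M.+1 by rewrite exprn_ge0// divr_ge0// ltW.
have KM : 0 <= (2 / c) ^+ M.+1 * (M`!)%:R by exact: mulr_ge0.
exists (B * S) => x Lx; rewrite ME (cLnormE p1 Lx) -EFinM.
rewrite (_ : (fun w => _) = fun w => ((\sum_(0 <= n <oo) ((normc (polyT (F n) T x w)) ^+ 2)%:E) `^ (2^-1)%R)%E); last first.
  apply/funext => w; congr (_ `^ _)%E; apply: eq_eseriesr => n _; congr (_%:E).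
  by rewrite polyTZ normcM normc_real ger0_norm ?sqrtr_ge0// exprMn sqr_sqrtr// exprn_ge0.
apply: (Lnorm_sqsum p1) => [n||q]; first exact: (pT_Lp p1 bT).
  by rewrite !mulr_ge0 ?sqrtr_ge0 ?cn_ge0.
apply: bound => //; first exact: sqrtr_ge0.
move=> n j n0; have [r [r0 r1 rz r2]] := node_bounds j n0.
rewrite -(ler_pXn2r (n := 2)) ?nnegrE ?lnorm_ge0 ?sqrtr_ge0// sqr_lnorm2 /S (sqr_sqrtr KM).
have r01 : 0 <= r <= 1 by rewrite r0.
apply: le_trans (ler_wpM2l K0 (geometric_moment M q r01)).
rewrite big_mkord mulrA -exprMn mulr_sumr; apply: ler_sum => i _.
have -> : (F i).[node c n n j] = (Num.sqrt (i.+1%:R ^+ M))%:C%C * (node c n n j ^+ i * (node c n n j - 1) ^+ m.+1).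
  by rewrite /F hornerZ hornerM hornerXn horner_exp !hornerE.
rewrite normcM normc_real ger0_norm ?sqrtr_ge0// (exprMn _ (Num.sqrt _)) sqr_sqrtr ?exprn_ge0//.
rewrite (normcM (_ ^+ i)) !normc_exp rz (exprMn _ (r ^+ i)) -!exprM [leRHS]mulrCA ler_wpM2l ?exprn_ge0//.
rewrite mulrC; apply: ler_pM; rewrite ?exprn_ge0 ?normc_ge0//.
  have -> : (m.+1 * 2 = M.+1)%N by rewrite mulnC mulnS.
  by apply: lerXn2r => //; rewrite nnegrE ?normc_ge0// mulr_ge0 ?subr_ge0// divr_ge0// ltW.
(* r^(2i) <= r^i, so the moment is taken at r itself and not at its square. *)
by rewrite ler_wiXn2l// leq_pmulr.
Qed.

Lemma H_infty_square_function gam : (forall n j, (0 < n)%N -> Stolz gam (node c n n j)) ->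
  forall (F : nat -> {poly C}) x, Lp x ->
  (Lnorm mu p%:E (fun w => (\sum_(1 <= n <oo) ((normc (polyT (F n) T x w)) ^+ 2)%:E) `^ (2^-1)%R)
    <= B%:E * cLnorm mu p x * ereal_sup [set (\sum_(1 <= n <oo) ((normc (F n).[z]) ^+ 2)%:E) `^ (2^-1)%R | z in Stolz gam])%E.
Proof.
(* The sums of the statement start at 1 and those of [bound] at 0; a zero term reconciles them. *)
move=> HS F x Lx; pose F' n : {poly C} := if n is 0 then 0 else F n.
have shift (f g : nat -> \bar R) : g 0%N = 0%E -> (forall n, g n.+1 = f n.+1) -> (\sum_(1 <= n <oo) f n = \sum_(0 <= n <oo) g n)%E.
  move=> g0 fg; congr (limn _); apply/funext => n; case: n => [|n]; first by rewrite !big_geq.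
  rewrite [RHS]big_ltn// g0 add0e; apply: eq_big_nat => -[//|i] _; exact/esym/fg.
rewrite (_ : (fun w => _) = fun w => ((\sum_(0 <= n <oo) ((normc (polyT (F' n) T x w)) ^+ 2)%:E) `^ (2^-1)%R)%E); last first.
  apply/funext => w; congr (_ `^ _)%E; apply: shift => //.
  by rewrite /F' polyT0 normc0 expr0n.
set E := [set _ | _ in _]; rewrite (cLnormE p1 Lx).
have LF n : Lp (polyT (F' n) T x) by exact: (pT_Lp p1 bT).
have zE n j : (0 < n)%N -> ((\sum_(0 <= i <oo) ((normc (F' i).[node c n n j]) ^+ 2)%:E) `^ (2^-1)%R <= ereal_sup E)%E.
  move=> n0; apply: ereal_sup_ubound; exists (node c n n j); first exact: HS.
  by congr (_ `^ _)%E; apply: shift => //; rewrite /F' horner0 normc0 expr0n.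
have sup0 : (0 <= ereal_sup E)%E by apply: le_trans (zE 1%N 0%N isT); exact: poweR_ge0.
have := cn_ge0 mu p x; rewrite le_eqVlt => /predU1P[x0|x0].
  (* For x of norm 0 the right-hand side is 0 even if the supremum is infinite. Any finite S serves
     for each q, here the sum of the moduli of the coefficients, since nodes have modulus at most
     1. *)
  rewrite -x0 mule0 mul0e; apply: (Lnorm_sqsum p1) => // q.
  pose S := \sum_(i < q) \sum_(a < size (F' i)) normc (F' i)`_a.
  have S0 : 0 <= S by apply: sumr_ge0 => i _; apply: sumr_ge0 => a _; exact: normc_ge0.
  have := bound S0 Lx; move=> /(_ q F'); rewrite -x0 mulr0; apply => n j n0.
  apply: (le_trans (lnorm_le1 _ _ _)); rewrite big_mkord; apply: ler_sum => i _.
  rewrite horner_coef; apply: (le_trans (normc_sum _ _)); apply: ler_sum => a _.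
  by rewrite normcM normc_exp ler_piMr ?normc_ge0// exprn_ile1 ?normc_ge0// normc_node.
case: (ereal_sup E) sup0 zE => [s| |//] s0 zE; last first.
  by rewrite gt0_muley ?leey// -EFinM lte_fin mulr_gt0// (lt_le_trans ltr01).
rewrite -!EFinM; apply: (Lnorm_sqsum p1) => // [|q].
  by rewrite !mulr_ge0// cn_ge0.
rewrite mulrAC; apply: bound => // n j n0.
by rewrite -lee_fin; apply: le_trans (zE n j n0); exact: sqsum_ge.
Qed.

End SquareFunctions.

Theorem theorem3p3 (d : measure_display) (Omega : measurableType d)
  (R : realType) (mu : {measure set Omega -> \bar R}) (p : R)
  (T : @cfun d Omega R -> @cfun d Omega R) :
  1 < p -> analytic_operator mu p T -> contractively_regular mu p T ->
  (exists gamma : R, 0 < gamma < pi / 2 /\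
     exists C : R, 1 <= C /\
       forall (F : nat -> {poly R[i]}) (x : @cfun d Omega R), inLp mu p x ->
         (Lnorm mu p%:E
            (fun w => (\sum_(1 <= n <oo) ((normc (polyT (F n) T x w)) ^+ 2)%:E)
                        `^ (2^-1)%R)
          <= C%:E * cLnorm mu p x *
             ereal_sup [set (\sum_(1 <= n <oo) ((normc (F n).[z]) ^+ 2)%:E) `^ (2^-1)%R
                       | z in Stolz gamma])%E)
  /\
  (forall m : nat, (1 <= m)%N ->
     exists Cm : R, forall x : @cfun d Omega R, inLp mu p x ->
       (Lnorm mu p%:E
          (fun w => (\sum_(0 <= n <oo)
                       (((n.+1)%:R ^+ (2 * m - 1)%N) *
                        (normc (polyT ('X^n * ('X - 1) ^+ m) T x w)) ^+ 2)%:E)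
                      `^ (2^-1)%R)
        <= Cm%:E * cLnorm mu p x)%E).
Proof.
move=> p1 aT rT; have [c [B [c0 c4 B1 HB]]] := finite_square_bound p1 aT rT.
split; last by move=> m m1; exact: (Ritt_square_function p1 aT c0 c4 B1 HB).
have [gam gam0 HS] := Stolz_node c0 c4.
by exists gam; split=> //; exists B; split=> // F x Lx; exact: (H_infty_square_function p1 aT c0 c4 B1 HB HS).
Qed.
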